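(* Consider i.i.d. random conductances of law $\nu$ on $[\alpha,\beta]$ on the edges of $\mathbb{Z}^d$, with diffusion matrix $A$, associated homogenized matrix $A_{\mathrm{hom}}$ and modified correctors $\phi_\mu$ as defined in the context. For all $k\ge1$, $\mu>0$ and $L>0$, define the approximation $A_{\mu,k,L}$ of $A_{\mathrm{hom}}$ by $$\xi\cdot A_{\mu,k,L}\xi:=\langle\!\langle(\xi+\nabla\phi_\mu)\cdot A(\xi+\nabla\phi_\mu)\rangle\!\rangle_L+\mu\sum_{i=0}^{k-1}\eta_{k,i}\langle\!\langle\phi_{2^i\mu}^2\rangle\!\rangle_L+\mu\sum_{i=0}^{k-1}\sum_{j>i}^{k-1}\nu_{k,i,j}\langle\!\langle\phi_{2^i\mu}\phi_{2^j\mu}\rangle\!\rangle_L,$$ where the coefficients $\eta_{k,i}$, $\nu_{k,i,j}$ are given in the context, $\langle\!\langle h\rangle\!\rangle_L:=\sum_{x\in\mathbb{Z}^d}h(x)\chi_L(x)$, and $\chi_L$ is an averaging function on $(-L,L)^d$ such that $\sum_{x\in\mathbb{Z}^d}\chi_L(x)=1$ and $\|\nabla\chi_L\|_{L^\infty}\lesssim L^{-d-1}$. Then there exists an exponent $q>0$ depending only on $\alpha,\beta$ such that $$\mathrm{var}\left[A_{\mu,k,L}\right]\lesssim\begin{cases}(L^{-2}+\mu^2)\ln_+^q(\mu^{-1})&\text{if }d=2,\\ L^{-d}+\mu^2L^{-d+2}&\text{if }d>2.\end{cases}$$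
   Context: $d\ge2$ is the dimension and $\beta\ge\alpha>0$. $\lesssim$ stands for $\le$ up to a multiplicative constant which only depends on $d$, $\alpha$ and $\beta$ if not otherwise stated. $\ln_+(x)=\max\{\ln x,1\}$. The bound on $\mathrm{var}[A_{\mu,k,L}]$ is understood as a bound on the variance of $\xi\cdot A_{\mu,k,L}\xi$ for $\xi\in\mathbb{R}^d$ with $|\xi|=1$. Environment: $\mathbb{B}$ is the set of non-oriented nearest-neighbour edges of $\mathbb{Z}^d$, $\Omega=[\alpha,\beta]^{\mathbb{B}}$, $\nu$ is a probability measure on $[\alpha,\beta]$, $\mathbb{P}=\nu^{\otimes\mathbb{B}}$; $\langle\cdot\rangle$ and $\mathrm{var}$ are expectation and variance under $\mathbb{P}$; $\omega_{x,y}=\omega_{y,x}=\omega_e$ for $e=(x,y)$. Shifts: $(\theta_z\omega)_{x,y}=\omega_{x+z,y+z}$. A function $f:\mathbb{Z}^d\times\Omega\to\mathbb{R}$ is stationary if $f(x+z,\omega)=f(x,\theta_z\omega)$ for all $x,z$ and almost every $\omega$. $(\mathbf{e}_1,\dots,\mathbf{e}_d)$ is the canonical basis; $A(x,\omega)=\mathrm{diag}[\omega_{x,x+\mathbf{e}_1},\dots,\omega_{x,x+\mathbf{e}_d}]$. $\nabla u(x)=(u(x+\mathbf{e}_i)-u(x))_i$ and $\nabla^*\cdot F(x)=\sum_i(F_i(x)-F_i(x-\mathbf{e}_i))$. Correctors: for $\mu>0$ and $\xi\in\mathbb{R}^d$, the modified corrector $\phi_\mu\in L^2(\Omega)$ (identified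 with its stationary extension to $\mathbb{Z}^d\times\Omega$) is the unique stationary function solving $\mu\phi_\mu-\nabla^*\cdot A(\xi+\nabla\phi_\mu)=0$ in $\mathbb{Z}^d$ almost surely. $A_{\mathrm{hom}}$ is the symmetric matrix with $\xi\cdot A_{\mathrm{hom}}\xi=\langle(\xi+\nabla\phi)\cdot A(\xi+\nabla\phi)\rangle$, where $\phi$ is the unique measurable function with $\phi(0,\cdot)\equiv0$, $\nabla\phi$ stationary, $\langle\nabla\phi\rangle=0$, and $-\nabla^*\cdot A(\xi+\nabla\phi)=0$ in $\mathbb{Z}^d$ almost surely. Coefficients: $c_1=1$, $c_{k+1}=(2/c_k+1)^{-1}$; $a_{1,0}=1$, $a_{k+1,0}=c_ka_{k,0}$, $a_{k+1,i}=c_ka_{k,i}-2^{1-k}c_ka_{k,i-1}$ for $1\le i\le k-1$, $a_{k+1,k}=-2^{1-k}c_ka_{k,k-1}$; $\eta_{1,0}=0$, $\eta_{k+1,i}=\eta_{k,i}+(2^{k(k-1)+i}-2^{k^2+1})a_{k+1,i}^2$ for $0\le i\le k-1$, $\eta_{k+1,k}=-2^{k^2}a_{k+1,k}^2$; $\nu_{k+1,i,k}=(2^{k(k-1)+i}-3\times2^{k^2})a_{k+1,i}a_{k+1,k}$ for $0\le i\le k-1$, and $\nu_{k+1,i,j}=\nu_{k,i,j}+(2^{k(k-1)}(2^i+2^j)-2^{k^2+2})a_{k+1,i}a_{k+1,j}$ for $0\le i<j\le k-1$. (The numbers $\nu_{k,i,j}$ are unrelated to the measure $\nu$.) *)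

(* Defs.v *)
From HB Require Import structures.
From mathcomp Require Import all_boot all_order all_algebra.
From mathcomp Require Import all_classical all_reals all_analysis.

Set Implicit Arguments.
Unset Strict Implicit.
Unset Printing Implicit Defensive.

Import Order.TTheory GRing.Theory Num.Theory.

Local Open Scope classical_set_scope.
Local Open Scope ring_scope.

Notation lattice d := 'rV[int]_d.

Definition basis_vec d (i : 'I_d) : lattice d := delta_mx 0 i.

(* Each non-oriented nearest-neighbour edge {x, x + e_i} of Z^d is represented
   by its unique pair (x, i). *)
Notation edge d := (lattice d * 'I_d)%type.

Definition itv_type (R : realType) (alpha beta : R) of alpha <= beta :=
  {x : R | alpha <= x <= beta}.

Definition itv_left (R : realType) (alpha beta : R) (ab : alpha <= beta) :
    itv_type ab :=
  exist _ alpha (introT andP (conj (lexx alpha) ab)).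

HB.instance Definition _ (R : realType) (alpha beta : R) (ab : alpha <= beta) :=
  Choice.copy (itv_type ab) {x : R | alpha <= x <= beta}.
HB.instance Definition _ (R : realType) (alpha beta : R) (ab : alpha <= beta) :=
  isPointed.Build (itv_type ab) (itv_left ab).

Definition itv_val (R : realType) (alpha beta : R) (ab : alpha <= beta)
  (x : itv_type ab) : R := sval x.

(* [alpha, beta] with the trace of the Borel sigma-algebra of R. *)
Definition conductance (R : realType) (alpha beta : R) (ab : alpha <= beta) :=
  g_sigma_algebra_preimageType (@itv_val R alpha beta ab).

Definition cylinders d (R : realType) (alpha beta : R) (ab : alpha <= beta) :
    set (set (edge d -> conductance ab)) :=
  [set C | exists (e : edge d) (B : set (conductance ab)),
     measurable B /\ C = [set w | B (w e)]].

Definition environment d (R : realType) (alpha beta : R) (ab : alpha <= beta) :=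
  g_sigma_algebraType (@cylinders d R alpha beta ab).

(* P is the product of copies of nu over all the edges: the finite-dimensional
   rectangles form a pi-system generating the product sigma-algebra, hence
   determine P. *)
Definition is_product_measure d (R : realType) (alpha beta : R)
    (ab : alpha <= beta) (nu : probability (conductance ab) R)
    (P : probability (environment d ab) R) : Prop :=
  forall (s : seq (edge d)) (B : edge d -> set (conductance ab)),
    uniq s -> (forall e, measurable (B e)) ->
    P [set w | forall e, e \in s -> B e (w e)] =
      (\prod_(e <- s) fine (nu (B e)))%:E.

Definition shift d (R : realType) (alpha beta : R) (ab : alpha <= beta)
    (z : lattice d) (w : environment d ab) : environment d ab :=
  fun e => w (e.1 + z, e.2).

Definition stationary d (R : realType) (alpha beta : R) (ab : alpha <= beta)
    (P : probability (environment d ab) R)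
    (f : lattice d -> environment d ab -> R) : Prop :=
  forall x z, \forall w \ae P, f (x + z) w = f x (shift z w).

Definition diffusion d (R : realType) (alpha beta : R) (ab : alpha <= beta)
    (w : environment d ab) (x : lattice d) : 'M[R]_d :=
  diag_mx (\row_i @itv_val R alpha beta ab (w (x, i))).

Definition grad d (R : realType) (u : lattice d -> R) (x : lattice d) :
    'cV[R]_d :=
  \col_i (u (x + basis_vec i) - u x).

Definition bdiv d (R : realType) (F : lattice d -> 'cV[R]_d) (x : lattice d) :
    R :=
  \sum_i (F x i 0 - F (x - basis_vec i) i 0).

Definition dot d (R : realType) (u v : 'cV[R]_d) : R :=
  \sum_i u i 0 * v i 0.

(* The norm that the library puts on matrices is the sup norm. *)
Definition enorm d (R : realType) (v : 'cV[R]_d) : R := Num.sqrt (dot v v).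

Definition is_modified_corrector d (R : realType) (alpha beta : R)
    (ab : alpha <= beta) (P : probability (environment d ab) R)
    (xi : 'cV[R]_d) (mu : R) (phi : lattice d -> environment d ab -> R) :
    Prop :=
  [/\ forall x, phi x \in Lfun P 2%:E,
      stationary P phi
    & \forall w \ae P, forall x,
        mu * phi x w
        - bdiv (fun y => diffusion w y *m (xi + grad (phi ^~ w) y)) x = 0].

(* The indices of the coefficients below start at k = 1; they are set to 0
   outside the range of indices where they are used. *)
Fixpoint coef_c (R : realType) (k : nat) : R :=
  match k with
  | 0 => 0
  | 1 => 1
  | k'.+1 => (2 / coef_c R k' + 1)^-1
  end.

Fixpoint coef_a (R : realType) (k i : nat) : R :=
  match k with
  | 0 => 0
  | 1 => if i == 0%N then 1 else 0
  | k'.+1 =>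
    if i == 0%N then coef_c R k' * coef_a R k' 0
    else if (i < k')%N then
      coef_c R k' * coef_a R k' i
      - 2 ^ (1 - k'%:Z) * coef_c R k' * coef_a R k' i.-1
    else if i == k' then
      - (2 ^ (1 - k'%:Z) * coef_c R k' * coef_a R k' k'.-1)
    else 0
  end.

Fixpoint coef_eta (R : realType) (k i : nat) : R :=
  match k with
  | 0 | 1 => 0
  | k'.+1 =>
    if (i < k')%N then
      coef_eta R k' i
      + (2 ^+ (k' * (k' - 1) + i) - 2 ^+ (k' ^ 2 + 1)) * coef_a R k'.+1 i ^+ 2
    else if i == k' then - (2 ^+ (k' ^ 2) * coef_a R k'.+1 k' ^+ 2)
    else 0
  end.

Fixpoint coef_nu (R : realType) (k i j : nat) : R :=
  match k with
  | 0 | 1 => 0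
  | k'.+1 =>
    if (i < j < k')%N then
      coef_nu R k' i j
      + (2 ^+ (k' * (k' - 1)) * (2 ^+ i + 2 ^+ j) - 2 ^+ (k' ^ 2 + 2))
        * coef_a R k'.+1 i * coef_a R k'.+1 j
    else if (i < k')%N && (j == k') then
      (2 ^+ (k' * (k' - 1) + i) - 3 * 2 ^+ (k' ^ 2))
        * coef_a R k'.+1 i * coef_a R k'.+1 k'
    else 0
  end.

(* K is the multiplicative constant hidden in the bound on the gradient. *)
Definition averaging_function d (R : realType) (K L : R)
    (chi : lattice d -> R) : Prop :=
  [/\ forall x, chi x != 0 -> forall i, - L < (x 0 i)%:~R < L,
      \sum_(x \in [set: lattice d]) chi x = 1
    & forall x, enorm (grad chi x) <= K * L ^- d.+1].

Definition average d (R : realType) (chi h : lattice d -> R) : R :=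
  \sum_(x \in [set: lattice d]) h x * chi x.

(* The quadratic form xi . A_{mu,k,L} xi of the approximation of the homogenized
   matrix in the environment w, where chi is the averaging function chi_L and
   phi m is the corrector with parameter m in direction xi. *)
Definition approx_quad d (R : realType) (alpha beta : R) (ab : alpha <= beta)
    (mu : R) (k : nat) (chi : lattice d -> R) (xi : 'cV[R]_d)
    (phi : R -> lattice d -> environment d ab -> R) (w : environment d ab) :
    R :=
  let v x := xi + grad (phi mu ^~ w) x in
  average chi (fun x => dot (v x) (diffusion w x *m v x))
  + mu * (\sum_(0 <= i < k)
      coef_eta R k i * average chi (fun x => phi (2 ^+ i * mu) x w ^+ 2))
  + mu * (\sum_(0 <= i < k) \sum_(i.+1 <= j < k)
      coef_nu R k i j
      * average chi (fun x => phi (2 ^+ i * mu) x w * phi (2 ^+ j * mu) x w)).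

Definition ln_plus (R : realType) (x : R) : R := Num.max (ln x) 1.

(* Main.v *)
(** On a discrete torus with conductances in a finite set, the averages are functions
    of finitely many independent variables, and Efron--Stein bounds their variance by
    the summed squared effects of resetting a single conductance. These effects are
    expressed by the gradient of the Green function and, after a duality that puts the
    weight [chi] into the source, by the flux of the corrector. In dimension at least
    three, Hardy's inequality gives an algebraic decay of the energy of the Green
    function, which closes moment bounds on the flux and allows one to decouple the
    flux from the dual solution scale by scale. In the plane, hole filling controls the
    flux by the supremum of the corrector, whose moments of order comparable to the
    logarithm of the volume grow like a power of that logarithm.

    The lattice correctors are within any prescribed distance of those of a torus whose
    side is a power of [mu^-1] and [L], by the maximum principle with the barrier
    [\sum_i lamb ^ |x_i|]; so in the plane only logarithms are lost. The coefficients
    [coef_eta] and [coef_nu] are summable uniformly in [k]. *)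

From mathcomp Require Import all_boot all_order all_algebra.
From mathcomp Require Import ring lra zify.

Set Implicit Arguments.
Unset Strict Implicit.
Unset Printing Implicit Defensive.

Import Order.TTheory GRing.Theory Num.Theory.

Local Open Scope ring_scope.

Ltac nonneg := repeat first [ by [] | assumption | exact: sqr_ge0
  | exact: ler0n | exact: normr_ge0 | (apply: ltW; assumption) | apply: mulr_ge0 | apply: addr_ge0
  | apply: exprn_ge0 | apply: divr_ge0 | rewrite invr_ge0
  | match goal with H : forall _, is_true (0 <= _) |- _ => exact: H end
  | (apply: sumr_ge0 => ? _) | exact: ltW ].

(** * Elementary inequalities *)

Lemma eq_leW disp (T : porderType disp) (x y : T) : x = y -> (x <= y)%O.
Proof. by move->. Qed.

Section Elementary.
Variable R : realFieldType.
Implicit Types x y t K : R.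

Lemma tangent_power x t p : 0 <= x -> 0 <= t ->
  t ^+ p.+1 + p.+1%:R * t ^+ p * (x - t) <= x ^+ p.+1.
Proof.
move=> x0 t0; elim: p => [|p IH]; first by rewrite !expr1 expr0; lra.
have := ler_wpM2l x0 IH; rewrite -[x * x ^+ _]exprS; apply: le_trans.
have : 0 <= p.+1%:R * t ^+ p * (x - t) ^+ 2.
  by nonneg.
rewrite -subr_ge0 => h; rewrite -subr_ge0; congr (_ <= _): h.
by rewrite !exprS -[p.+2%:R]natr1; ring.
Qed.

Lemma young_power x y K p : 0 <= x -> 0 <= y -> 0 <= K ->
  K * x * y ^+ p <= y ^+ p.+1 / 4 + (4 * K * x) ^+ p.+1.
Proof.
move=> x0 y0 K0.
have kx : 0 <= K * x by rewrite mulr_ge0.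
have h4 : 0 <= 4 * K * x by rewrite -mulrA mulr_ge0.
have [le|lt] := leP (4 * K * x) y.
  have h : K * x * y ^+ p <= y ^+ p.+1 / 4.
    rewrite ler_pdivlMr // exprS.
    have := ler_wpM2r (exprn_ge0 p y0) le; lra.
  by rewrite (le_trans h) // lerDl exprn_ge0.
have h : K * x * y ^+ p <= (4 * K * x) ^+ p.+1.
  rewrite exprS; apply: ler_pM => //; [by rewrite exprn_ge0| by lra|].
  by rewrite lerXn2r ?nnegrE // ltW.
by rewrite (le_trans h) // lerDr divr_ge0 ?exprn_ge0.
Qed.

Lemma sqrrD_le x y : (x + y) ^+ 2 <= 2 * x ^+ 2 + 2 * y ^+ 2.
Proof. by have := sqr_ge0 (x - y); nra. Qed.

Lemma norm_subXX x y p :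
  `|x ^+ p.+1 - y ^+ p.+1| <=
  p.+1%:R * `|x - y| * (`|x| + `|x - y|) ^+ p.
Proof.
rewrite subrXX normrM [_ * `|x - y|]mulrC -mulrA ler_wpM2l //.
apply: le_trans (ler_norm_sum _ _ _) _.
rewrite mulr_natl -[in leRHS](card_ord p.+1) -sumr_const; apply: ler_sum => i _.
rewrite normrM !normrX /=.
have hx : `|x| <= `|x| + `|x - y| by rewrite lerDl.
have hy : `|y| <= `|x| + `|x - y|.
  by have := ler_normB x (x - y); rewrite opprB addrC subrK.
have h0 : 0 <= `|x| + `|x - y| by rewrite addr_ge0.
have hi : (p - i + i = p)%N by rewrite subnK // -ltnS.
rewrite -[in leRHS]hi exprD.
by apply: ler_pM; rewrite ?exprn_ge0 // lerXn2r ?nnegrE.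
Qed.

Lemma expr_1D_le2 p (x : R) : 0 <= x -> p%:R * x <= 2^-1 -> (1 + x) ^+ p <= 2.
Proof.
move=> x0 px.
have [->|p0] := posnP p; first by rewrite expr0; lra.
have x12 : x <= 2^-1.
  apply: le_trans px; rewrite ler_peMl //.
  by rewrite (_ : 1 = 1%:R) // ler_nat.
have B : 1 - p%:R * x <= (1 - x) ^+ p.
  elim: {p0 px} p => [|p IH]; first by rewrite mul0r subr0 expr0.
  rewrite exprS -natr1.
  have h : 0 <= 1 - x by lra.
  have := ler_wpM2l h IH.
  have : 0 <= p%:R * x * x by rewrite !mulr_ge0 ?ler0n.
  by nra.
have C : (1 + x) ^+ p * (1 - x) ^+ p <= 1.
  rewrite -exprMn exprn_ile1 //; first by rewrite mulr_ge0; lra.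
  by have := sqr_ge0 x; nra.
have D : 0 <= (1 + x) ^+ p by rewrite exprn_ge0; lra.
have := ler_wpM2l D B; nra.
Qed.

Lemma exprD_even_le (z d : R) p : 0 <= z -> 0 <= d ->
  (z + d) ^+ (2 * p) <=
  4 * z ^+ (2 * p) + (3 * p.+1%:R * d) ^+ (2 * p).
Proof.
move=> z0 d0.
have P0 : (0 : R) < 2 * p.+1%:R by rewrite mulr_gt0 ?ltr0n.
have e3 : 0 <= 3 * p.+1%:R * d by rewrite !mulr_ge0 ?ler0n.
have [le|lt] := leP (2 * p.+1%:R * d) z.
  apply: ler_wpDr; first by rewrite exprn_ge0.
  have hd : d <= z / (2 * p.+1%:R) by rewrite ler_pdivlMr // mulrC.
  have hs : (z + d) ^+ p <= 2 * z ^+ p.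
    have -> : 2 * z ^+ p = z ^+ p * 2 by rewrite mulrC.
    apply: le_trans (_ : (z * (1 + (2 * p.+1%:R)^-1)) ^+ p <= _).
      rewrite lerXn2r ?nnegrE //; [by nonneg|by nonneg|by rewrite mulrDr mulr1 lerD2l].
    rewrite exprMn ler_wpM2l ?exprn_ge0 // expr_1D_le2 ?invr_ge0 ?(ltW P0) //.
    rewrite ler_pdivrMr //.
    have : (p%:R : R) <= p.+1%:R by rewrite ler_nat.
    by lra.
  have -> : 4 * z ^+ (2 * p) = (2 * z ^+ p) ^+ 2.
    by rewrite exprMn -exprM mulnC -natrX.
  rewrite mulnC exprM lerXn2r ?nnegrE ?mulr_ge0 ?exprn_ge0 ?addr_ge0 //.
apply: ler_wpDl; first by rewrite mulr_ge0 ?exprn_ge0.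
rewrite lerXn2r ?nnegrE ?addr_ge0 //.
have : (1 : R) <= p.+1%:R by rewrite (_ : 1 = 1%:R) // ler_nat.
by nra.
Qed.

Lemma power_increment_le (z d : R) p :
  (z ^+ p.+1 - (z - d) ^+ p.+1) ^+ 2 <=
  4 * p.+1%:R ^+ 2 * (z ^+ 2) ^+ p * d ^+ 2 +
  (9 * p.+1%:R ^+ 2) ^+ p.+1 * (d ^+ 2) ^+ p.+1.
Proof.
have sqr_norm (x : R) : `|x| ^+ 2 = x ^+ 2 by rewrite real_normK ?num_real.
have lipschitz : (z ^+ p.+1 - (z - d) ^+ p.+1) ^+ 2 <=
    p.+1%:R ^+ 2 * d ^+ 2 * (`|z| + `|d|) ^+ (2 * p).
  rewrite -[leLHS]sqr_norm -[d ^+ 2]sqr_norm mulnC exprM -!exprMn.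
  have := norm_subXX z (z - d) p; rewrite (_ : z - (z - d) = d); last by ring.
  by move=> ?; rewrite lerXn2r ?nnegrE ?mulr_ge0 ?exprn_ge0 ?addr_ge0.
apply: (le_trans lipschitz).
have slope_ge0 : 0 <= p.+1%:R ^+ 2 * d ^+ 2 by nonneg.
apply: le_trans (ler_wpM2l slope_ge0 (exprD_even_le p (normr_ge0 z) (normr_ge0 d))) _.
rewrite mulrDr; apply: lerD; first by rewrite exprM sqr_norm; apply: eq_leW; ring.
have -> : (3 * p.+1%:R * `|d|) ^+ (2 * p) = (9 * p.+1%:R ^+ 2 * d ^+ 2) ^+ p.
  by rewrite exprM; congr (_ ^+ p); rewrite -[d ^+ 2]sqr_norm; ring.
rewrite -[leRHS]exprMn [leRHS]exprS; apply: ler_wpM2r; first by nonneg.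
by lra.
Qed.

Lemma sum_powers_le (I : eqType) (s : seq I) (f : I -> R) p :
  (forall i, 0 <= f i) -> \sum_(i <- s) f i ^+ p.+1 <= (\sum_(i <- s) f i) ^+ p.+1.
Proof.
move=> f0; elim: s => [|i s IH]; first by rewrite !big_nil expr0n.
rewrite !big_cons; set S := \sum_(j <- s) f j.
have S0 : 0 <= S by rewrite sumr_ge0.
apply: le_trans (_ : f i ^+ p.+1 + S ^+ p.+1 <= _); first by rewrite lerD2l.
rewrite [(_ + _) ^+ _]exprS mulrDl.
apply: lerD; rewrite exprS ler_wpM2l ?lerXn2r ?nnegrE ?addr_ge0 ?lerDl ?lerDr //.
Qed.

Lemma quadratic_ge0_discriminant (a b c : R) : 0 <= c ->
  (forall t, 0 <= a + 2 * t * b + t ^+ 2 * c) -> b ^+ 2 <= a * c.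
Proof.
move=> c_ge0 quad_ge0; have [c_eq0|c_neq0] := eqVneq c 0; last first.
  have := quad_ge0 (- b / c).
  have -> : a + 2 * (- b / c) * b + (- b / c) ^+ 2 * c = (a * c - b ^+ 2) / c by field.
  by rewrite pmulr_lge0 ?invr_gt0 ?lt_def ?c_neq0 // subr_ge0.
have [->|b_neq0] := eqVneq b 0; first by rewrite c_eq0 mulr0 expr0n.
have := quad_ge0 (- (a + 1) / (2 * b)); rewrite c_eq0 mulr0 addr0.
have -> : 2 * (- (a + 1) / (2 * b)) * b = - (a + 1) by field.
by lra.
Qed.

Lemma cauchy_schwarz_seq (I : Type) (s : seq I) (P : pred I) (w f g : I -> R) :
  (forall i, 0 <= w i) ->
  (\sum_(i <- s | P i) w i * f i * g i) ^+ 2 <=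
  (\sum_(i <- s | P i) w i * f i ^+ 2) * (\sum_(i <- s | P i) w i * g i ^+ 2).
Proof.
move=> w_ge0; apply: quadratic_ge0_discriminant => [|t].
  by rewrite sumr_ge0 // => i _; rewrite mulr_ge0 ?sqr_ge0.
rewrite !mulr_sumr -!big_split sumr_ge0 //= => i _.
have -> : w i * f i ^+ 2 + 2 * t * (w i * f i * g i) + t ^+ 2 * (w i * g i ^+ 2)
  = w i * (f i + t * g i) ^+ 2 by ring.
by rewrite mulr_ge0 ?sqr_ge0.
Qed.

Lemma weighted_power_sum (I : Type) (s : seq I) (w f : I -> R) p :
  (forall i, 0 <= w i) -> (forall i, 0 <= f i) ->
  (\sum_(i <- s) w i * f i) ^+ p.+1 <=
  (\sum_(i <- s) w i) ^+ p * \sum_(i <- s) w i * f i ^+ p.+1.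
Proof.
move=> w0 f0; set W := \sum_(i <- s) w i; set S := \sum_(i <- s) w i * f i.
have W0 : 0 <= W by rewrite sumr_ge0.
have S0 : 0 <= S by rewrite sumr_ge0 // => i _; rewrite mulr_ge0.
have [W00|Wn] := eqVneq W 0.
  have -> : S = 0.
    rewrite /S; have : all (fun i => w i == 0) s.
      elim: s @W @S W0 W00 S0 => //= i s IH; rewrite !big_cons => _ /eqP.
      rewrite paddr_eq0 ?sumr_ge0 // => /andP[-> /eqP h] _.
      apply: IH => //; first by rewrite h.
      by rewrite sumr_ge0 // => k _; rewrite mulr_ge0.
    elim: (s) => [|i s' IH] /=; first by rewrite big_nil.
    by rewrite big_cons => /andP[/eqP -> /IH ->]; rewrite mul0r addr0.
  rewrite expr0n mulr_ge0 ?exprn_ge0 ?sumr_ge0 // => i _.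
  by rewrite mulr_ge0 ?exprn_ge0.
have Wp : 0 < W by rewrite lt_def Wn.
pose t := S / W.
have t0 : 0 <= t by rewrite divr_ge0.
have h : W * t ^+ p.+1 <= \sum_(i <- s) w i * f i ^+ p.+1.
  have -> : W * t ^+ p.+1 =
      \sum_(i <- s) w i * (t ^+ p.+1 + p.+1%:R * t ^+ p * (f i - t)).
    transitivity (\sum_(i <- s) ((t ^+ p.+1 - p.+1%:R * t ^+ p * t) * w i +
       p.+1%:R * t ^+ p * (w i * f i))); last by apply: eq_bigr => i _; ring.
    rewrite big_split /= -!mulr_sumr -/W -/S.
    have -> : S = t * W by rewrite /t divfK.
    by ring.
  by apply: ler_sum => i _; rewrite ler_wpM2l ?tangent_power.
have -> : S = W * t by rewrite /t mulrC divfK.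
by rewrite exprMn exprSr -mulrA ler_wpM2l ?exprn_ge0.
Qed.

Lemma exprD_le x y p : 0 <= x -> 0 <= y ->
  (x + y) ^+ p <= 2 ^+ p * (x ^+ p + y ^+ p).
Proof.
move=> x0 y0; wlog xy : x y x0 y0 / x <= y.
  move=> H; have [/H|/ltW/H] := leP x y; first exact.
  by rewrite addrC [y ^+ p + _]addrC; exact.
apply: le_trans (_ : (2 * y) ^+ p <= _).
  by rewrite lerXn2r ?nnegrE; nonneg; lra.
rewrite exprMn ler_wpM2l ?exprn_ge0 // lerDr; nonneg.
Qed.

Lemma expr_double x p : `|x| ^+ (2 * p) = x ^+ (2 * p).
Proof. by rewrite !exprM real_normK ?num_real. Qed.

Lemma expr_double_ge0 x p : 0 <= x ^+ (2 * p).
Proof. by rewrite exprM exprn_ge0 ?sqr_ge0. Qed.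

Lemma odd_power_coercive x y p :
  (x - y) ^+ 2 * (x ^+ (2 * p) + y ^+ (2 * p)) <=
  2 * ((x - y) * (x ^+ (2 * p).+1 - y ^+ (2 * p).+1)).
Proof.
rewrite -subr_ge0 [x ^+ _.+1]exprS [y ^+ _.+1]exprS !exprM.
set X := x ^+ 2; set Y := y ^+ 2.
have -> : 2 * ((x - y) * (x * X ^+ p - y * Y ^+ p)) - (x - y) ^+ 2 * (X ^+ p + Y ^+ p)
  = (X - Y) * (X ^+ p - Y ^+ p) by rewrite /X /Y; ring.
have X0 : 0 <= X by rewrite sqr_ge0.
have Y0 : 0 <= Y by rewrite sqr_ge0.
have [XY|/ltW XY] := leP X Y.
  by apply: mulr_le0; rewrite subr_le0 // lerXn2r.
by apply: mulr_ge0; rewrite subr_ge0 // lerXn2r.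
Qed.

Lemma odd_power_lipschitz x y p :
  `|x ^+ (2 * p).+1 - y ^+ (2 * p).+1| <=
  (2 * p).+1%:R * 16 ^+ p * (`|x - y| * (x ^+ (2 * p) + y ^+ (2 * p))).
Proof.
apply: le_trans (norm_subXX _ _ _) _.
rewrite -!mulrA ler_wpM2l ?ler0n // mulrCA ler_wpM2l //.
have n0 : 0 <= `|x - y| by [].
have h1 : `|x| + `|x - y| <= 2 * (`|x| + `|y|).
  by have := ler_normB x y; have := normr_ge0 y; lra.
apply: le_trans (_ : (2 * (`|x| + `|y|)) ^+ (2 * p) <= _).
  by rewrite lerXn2r ?nnegrE; nonneg.
rewrite exprMn.
have -> : (16 : R) ^+ p = 2 ^+ (2 * p) * 2 ^+ (2 * p).
  by rewrite -exprMn exprM; congr (_ ^+ p); rewrite -natrM -natrX.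
rewrite -mulrA ler_wpM2l ?exprn_ge0 //.
by apply: le_trans (exprD_le _ _ _) _ => //; rewrite !expr_double.
Qed.

Lemma even_power_diff x y p :
  (x - y) ^+ (2 * p) <= 4 ^+ p * (x ^+ (2 * p) + y ^+ (2 * p)).
Proof.
rewrite -expr_double; apply: le_trans (_ : (`|x| + `|y|) ^+ (2 * p) <= _).
  by rewrite lerXn2r ?nnegrE ?addr_ge0 // ler_normB.
have -> : (4 : R) ^+ p = 2 ^+ (2 * p).
  by rewrite exprM; congr (_ ^+ p); rewrite -natrX.
by apply: le_trans (exprD_le _ _ _) _ => //; rewrite !expr_double.
Qed.

End Elementary.

(** * Product probabilities on finite sets *)

Section ProductProbability.
Variables (R : realFieldType) (E J : finType) (rho : J -> R) (j0 : J).
Hypotheses (rho_ge0 : forall j, 0 <= rho j) (rho_sum : \sum_j rho j = 1).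
Local Notation cfg := {ffun E -> J}.
Implicit Types (c : cfg) (e : E) (f g V : cfg -> R) (l : seq E).

Definition upd c e j : cfg := [ffun e' => if e' == e then j else c e'].

Definition weight c : R := \prod_e rho (c e).

Definition Ex f : R := \sum_c weight c * f c.

Definition avg1 e f c : R := \sum_j rho j * f (upd c e j).

Definition avg l f : cfg -> R := foldr avg1 f l.

Definition indep e f := forall c j, f (upd c e j) = f c.

Lemma weight_ge0 c : 0 <= weight c.
Proof. by rewrite prodr_ge0. Qed.

Lemma weight_sum : \sum_c weight c = 1.
Proof.
rewrite /weight -(bigA_distr_bigA (fun (e : E) j => rho j)) /=.
by rewrite big1 // => e _.
Qed.

Record is_mean (A : (cfg -> R) -> R) : Prop := IsMean {
  mean1 : A (fun=> 1) = 1;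
  mean_lin : forall t f g, A (fun c => t * f c + g c) = t * A f + A g;
  mean_mono : forall f g, (forall c, f c <= g c) -> A f <= A g }.

Section Mean.
Variables (A : (cfg -> R) -> R) (HA : is_mean A).

Lemma mean_ext f g : f =1 g -> A f = A g.
Proof.
by move=> fg; apply/eqP; rewrite eq_le !(mean_mono HA) // => c; rewrite fg.
Qed.

Lemma mean0 : A (fun=> 0) = 0.
Proof.
have := mean_lin HA (-1) (fun=> 1) (fun=> 1); rewrite (mean1 HA).
rewrite (@mean_ext _ (fun=> 0)); first by move=> ->; ring.
by move=> c; ring.
Qed.

Lemma meanZ t f : A (fun c => t * f c) = t * A f.
Proof.
rewrite -[RHS]addr0 -mean0 -(mean_lin HA); apply: mean_ext => c.
by rewrite addr0.
Qed.

Lemma meanD f g : A (fun c => f c + g c) = A f + A g.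
Proof. by rewrite -[A f]mul1r -(mean_lin HA); apply: mean_ext => c; rewrite mul1r. Qed.

Lemma meanB f g : A (fun c => f c - g c) = A f - A g.
Proof.
rewrite addrC -mulN1r -(mean_lin HA); apply: mean_ext => c; ring.
Qed.

Lemma mean_cst t : A (fun=> t) = t.
Proof.
by rewrite (@mean_ext _ (fun=> t * 1)) ?meanZ ?(mean1 HA) ?mulr1 // => c; rewrite mulr1.
Qed.

Lemma mean_sum (I : Type) (s : seq I) (F : I -> cfg -> R) :
  A (fun c => \sum_(i <- s) F i c) = \sum_(i <- s) A (F i).
Proof.
elim: s => [|i s IH].
  by rewrite big_nil -[RHS]mean0; apply: mean_ext => c; rewrite big_nil.
rewrite big_cons -IH -meanD; apply: mean_ext => c.
by rewrite big_cons.
Qed.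

Lemma mean_ge0 f : (forall c, 0 <= f c) -> 0 <= A f.
Proof. by move=> f0; rewrite -mean0 (mean_mono HA). Qed.

Lemma mean_power f p : (forall c, 0 <= f c) -> A f ^+ p <= A (fun c => f c ^+ p).
Proof.
move=> f0; case: p => [|p]; first by rewrite expr0 mean_cst.
set t := A f; have t0 : 0 <= t by apply: mean_ge0.
apply: le_trans (_ : A (fun c => p.+1%:R * t ^+ p * f c +
  (t ^+ p.+1 - p.+1%:R * t ^+ p * t)) <= _); last first.
  apply: (mean_mono HA) => c; apply: le_trans (tangent_power p (f0 c) t0).
  by apply: eq_leW; ring.
rewrite (mean_lin HA) mean_cst -/t; apply: eq_leW; ring.
Qed.

Lemma mean_cauchy f g :
  A (fun c => f c * g c) ^+ 2 <= A (fun c => f c ^+ 2) * A (fun c => g c ^+ 2).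
Proof.
apply: quadratic_ge0_discriminant => [|t]; first by apply: mean_ge0 => c; exact: sqr_ge0.
rewrite -!meanZ -!meanD; apply: mean_ge0 => c.
have -> : f c ^+ 2 + 2 * t * (f c * g c) + t ^+ 2 * g c ^+ 2 = (f c + t * g c) ^+ 2.
  by ring.
exact: sqr_ge0.
Qed.

Lemma mean_sqr f : A f ^+ 2 <= A (fun c => f c ^+ 2).
Proof.
have := mean_cauchy f (fun=> 1).
rewrite (mean_ext (f := fun c => f c * 1) (g := f)); last by move=> c; rewrite mulr1.
by rewrite [A (fun=> 1 ^+ 2)](_ : _ = 1) ?mulr1 // expr1n (mean1 HA).
Qed.

End Mean.

Lemma Ex_mean : is_mean Ex.
Proof.
split=> [|t f g|f g fg].
- by rewrite /Ex -[RHS]weight_sum; apply: eq_bigr => c _; rewrite mulr1.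
- rewrite /Ex mulr_sumr -big_split; apply: eq_bigr => c _ /=; ring.
- by apply: ler_sum => c _; rewrite ler_wpM2l ?weight_ge0.
Qed.

Lemma avg1_mean e c : is_mean (fun f => avg1 e f c).
Proof.
split=> [|t f g|f g fg].
- by rewrite /avg1 -[RHS]rho_sum; apply: eq_bigr => j _; rewrite mulr1.
- rewrite /avg1 mulr_sumr -big_split; apply: eq_bigr => j _ /=; ring.
- by apply: ler_sum => j _; rewrite ler_wpM2l.
Qed.

Lemma avg_mean l c : is_mean (fun f => avg l f c).
Proof.
elim: l c => [|e l IH] c; first by split.
split=> [|t f g|f g fg] /=.
- rewrite -[RHS](mean1 (avg1_mean e c)); apply: (mean_ext (avg1_mean e c)) => c'.
  exact: mean1 (IH c').
- rewrite -(mean_lin (avg1_mean e c)); apply: (mean_ext (avg1_mean e c)) => c'.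
  exact: mean_lin (IH c') _ _ _.
- apply: (mean_mono (avg1_mean e c)) => c'; exact: mean_mono (IH c') _ _ fg.
Qed.

Lemma upd_same c e j k : upd (upd c e j) e k = upd c e k.
Proof. by apply/ffunP => e'; rewrite !ffunE; case: eqP. Qed.

Lemma upd_id c e : upd c e (c e) = c.
Proof. by apply/ffunP => e'; rewrite !ffunE; case: eqP => [->|]. Qed.

Lemma upd_comm c e e' j k : e != e' ->
  upd (upd c e j) e' k = upd (upd c e' k) e j.
Proof.
move=> ne; apply/ffunP => x; rewrite !ffunE.
by case: eqP => [->|//]; rewrite eq_sym (negPf ne).
Qed.

Lemma weight_upd c e j : weight c * rho j = weight (upd c e j) * rho (c e).
Proof.
rewrite /weight (bigD1 e) //= [X in _ = X * _](bigD1 e) //= ffunE eqxx.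
have -> : \prod_(i | i != e) rho (upd c e j i) = \prod_(i | i != e) rho (c i).
  by apply: eq_bigr => e' ne; rewrite ffunE (negPf ne).
by ring.
Qed.

Lemma Ex_avg1 e f : Ex (avg1 e f) = Ex f.
Proof.
rewrite /Ex /avg1.
transitivity (\sum_(x : cfg * J) weight x.1 * rho x.2 * f (upd x.1 e x.2)).
  rewrite -(pair_big xpredT xpredT
    (fun c j => weight c * rho j * f (upd c e j))) /=.
  by apply: eq_bigr => c _; rewrite mulr_sumr; apply: eq_bigr => j _; rewrite mulrA.
pose s (x : cfg * J) := (upd x.1 e x.2, x.1 e).
have sK : involutive s.
  by move=> [c j]; rewrite /s /= upd_same upd_id ffunE eqxx.
rewrite (reindex_inj (inv_inj sK)) /=.
rewrite -(pair_big xpredT xpredT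
    (fun c j => weight (upd c e j) * rho (c e) * f (upd (upd c e j) e (c e)))) /=.
apply: eq_bigr => c _.
transitivity (\sum_j rho j * (weight c * f c)).
  by apply: eq_bigr => j _; rewrite upd_same upd_id -weight_upd; ring.
by rewrite -mulr_suml rho_sum mul1r.
Qed.

Lemma Ex_avg l f : Ex (avg l f) = Ex f.
Proof. by elim: l f => //= e l IH f; rewrite Ex_avg1. Qed.

Lemma indep_avg1 e f : indep e (avg1 e f).
Proof. by move=> c j; apply: eq_bigr => k _; rewrite upd_same. Qed.

Lemma indep_avg1r e e' f : indep e f -> indep e (avg1 e' f).
Proof.
have [<- _|ne h c j] := eqVneq e e'; first exact: indep_avg1.
by apply: eq_bigr => k _; rewrite upd_comm // h.
Qed.

Lemma indep_avgr e l f : indep e f -> indep e (avg l f).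
Proof. by move=> h; elim: l => //= e' l IH; apply: indep_avg1r. Qed.

Lemma indep_avg e l f : e \in l -> indep e (avg l f).
Proof.
elim: l => //= e' l IH; rewrite inE => /orP[/eqP ->|/IH]; first exact: indep_avg1.
exact: indep_avg1r.
Qed.

Lemma avg1_indepM e f g c : indep e g ->
  avg1 e (fun c => g c * f c) c = g c * avg1 e f c.
Proof.
by move=> h; rewrite /avg1 mulr_sumr; apply: eq_bigr => j _; rewrite h mulrCA.
Qed.

Lemma avg_indepM l f g c : (forall e, e \in l -> indep e g) ->
  avg l (fun c => g c * f c) c = g c * avg l f c.
Proof.
elim: l c => //= e l IH c h; rewrite -avg1_indepM; last by apply: h; rewrite mem_head.
apply: (mean_ext (avg1_mean e c)) => c'; apply: IH => e' e'l.
by apply: h; rewrite inE e'l orbT.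
Qed.

Lemma avg_indep l g c : (forall e, e \in l -> indep e g) -> avg l g c = g c.
Proof.
move=> h; rewrite -[RHS]mulr1 -(mean1 (avg_mean l c)) -avg_indepM //.
by apply: (mean_ext (avg_mean l c)) => c'; rewrite mulr1.
Qed.

Lemma indep_ext f l c c' : (forall e, e \in l -> indep e f) ->
  (forall e, e \notin l -> c e = c' e) -> f c = f c'.
Proof.
elim: l c c' => [|e l IH] c c' h cc'.
  by congr f; apply/ffunP => e; apply: cc'.
rewrite -(h e (mem_head _ _) c (c' e)); apply: IH => [e' e'l|e' e'l].
  by apply: h; rewrite inE e'l orbT.
rewrite ffunE; case: eqP => [->//|/eqP ne].
by apply: cc'; rewrite inE negb_or ne.
Qed.

Lemma avg_enum f c : avg (enum E) f c = Ex f.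
Proof.
rewrite -(Ex_avg (enum E) f) -[LHS](mean_cst Ex_mean).
apply: (mean_ext Ex_mean) => c'; apply: (@indep_ext _ (enum E)) => e.
  by move=> _; apply: indep_avg; rewrite mem_enum.
by rewrite mem_enum.
Qed.

Lemma Ex_indep l f g :
  (forall e, e \notin l -> indep e f) -> (forall e, e \in l -> indep e g) ->
  Ex (fun c => g c * f c) = Ex g * Ex f.
Proof.
move=> hf hg; rewrite -(Ex_avg l).
have cst c : avg l f c = Ex f.
  rewrite -(Ex_avg l f) -[LHS](mean_cst Ex_mean).
  apply: (mean_ext Ex_mean) => c'; apply: (@indep_ext _ (enum E)) => e; last by rewrite mem_enum.
  by have [/indep_avg //|/hf/indep_avgr //] := boolP (e \in l).
rewrite mulrC -(meanZ Ex_mean); apply: (mean_ext Ex_mean) => c.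
by rewrite avg_indepM // cst mulrC.
Qed.

Lemma Ex_reindex (s : E -> E) (s' : E -> E) F : cancel s s' -> cancel s' s ->
  Ex (fun c => F [ffun e => c (s e)]) = Ex F.
Proof.
move=> ss' s's; pose S (c : cfg) : cfg := [ffun e => c (s e)].
have Sinj : injective S.
  move=> c c' /ffunP h; apply/ffunP => e.
  by have := h (s' e); rewrite !ffunE s's.
rewrite /Ex [RHS](reindex_inj Sinj) /=; apply: eq_bigr => c _; congr (_ * _).
rewrite /weight (reindex_inj (can_inj ss')) /=.
by apply: eq_bigr => e _; rewrite ffunE.
Qed.

Lemma avg_bias_variance l f k c : (forall e, e \in l -> indep e k) ->
  avg l (fun c => (f c - k c) ^+ 2) c =
  avg l (fun c => (f c - avg l f c) ^+ 2) c + (avg l f c - k c) ^+ 2.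
Proof.
move=> hk; have HA := avg_mean l c.
pose d c := avg l f c - k c.
have hd e : e \in l -> indep e d.
  by move=> el c' j; rewrite /d (indep_avg _ el) (hk e el).
have hav e : e \in l -> indep e (avg l f) by exact: indep_avg.
rewrite (mean_ext HA (g := fun c => (f c - avg l f c) ^+ 2 +
   (d c * (2 * (f c - avg l f c)) + d c * d c))); last first.
  by move=> c'; rewrite /d; ring.
rewrite (meanD HA) (meanD HA) !(avg_indepM _ _ hd) (avg_indep _ hd) (meanZ HA) (meanB HA).
by rewrite (avg_indep _ hav) subrr mulr0 mulr0 add0r expr2.
Qed.

Lemma avg_reset l f e c : e \notin l ->
  avg l (fun c => f (upd c e j0)) c = avg l f (upd c e j0).
Proof.
elim: l c => //= e' l IH c; rewrite inE negb_or => /andP[ne el].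
rewrite (mean_ext (avg1_mean e' c) (fun c' => IH c' el)).
by apply: eq_bigr => j _; rewrite upd_comm // eq_sym.
Qed.

(** Efron--Stein, conditionally on the coordinates outside [l]; resampling is
    replaced by resetting one coordinate to [j0]. *)
Lemma efron_stein l f c : uniq l ->
  avg l (fun c => (f c - avg l f c) ^+ 2) c <=
  avg l (fun c => \sum_(e <- l) (f c - f (upd c e j0)) ^+ 2) c.
Proof.
elim: l c => [|e l IH] c /=; first by rewrite big_nil subrr expr0n.
move=> /andP[el ul].
set g := avg l f.
have kind e' : e' \in l -> indep e' (avg1 e g).
  by move=> e'l; apply: indep_avg1r; apply: indep_avg.
have HA := avg1_mean e c.
rewrite (mean_ext HA (fun c' => avg_bias_variance f c' kind)) (meanD HA).
rewrite [leRHS](_ : _ = avg1 e (fun c' => avg l (fun c =>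
    (f c - f (upd c e j0)) ^+ 2) c' +
    avg l (fun c => \sum_(e' <- l) (f c - f (upd c e' j0)) ^+ 2) c') c); last first.
  apply: (mean_ext HA) => c'; rewrite -(meanD (avg_mean l c')).
  by apply: (mean_ext (avg_mean l c')) => c''; rewrite big_cons.
rewrite (meanD HA) [leRHS]addrC; apply: lerD.
  by apply: (mean_mono HA) => c'; apply: IH.
have hk e' : e' \in [:: e] -> indep e' (fun c => g (upd c e j0)).
  by rewrite inE => /eqP -> c' j; rewrite upd_same.
have := avg_bias_variance g c hk; rewrite /= => h.
apply: le_trans (_ : avg1 e (fun c => (g c - g (upd c e j0)) ^+ 2) c <= _).
  by rewrite h lerDl sqr_ge0.
apply: (mean_mono HA) => c'; rewrite /g -avg_reset // -(meanB (avg_mean l c')).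
exact: mean_sqr (avg_mean l c') _.
Qed.

Section EfronSteinMoment.
Variables (l : seq E) (f V : cfg -> R) (p : nat).
Hypothesis l_uniq : uniq l.
Hypothesis increments_le : forall c, \sum_(e <- l) (f c - f (upd c e j0)) ^+ 2 <= V c.

Let V_ge0 c : 0 <= V c.
Proof. by apply: le_trans (increments_le c); rewrite sumr_ge0 // => e _; rewrite sqr_ge0. Qed.

Let P : R := p.+1%:R ^+ 2.

Let P_ge1 : 1 <= P.
Proof. by rewrite /P -natrX (ler_nat R 1) expn_gt0. Qed.

Let fluct c := f c - avg l f c.

Let avgV c := avg l V c.

Let avgV_ge0 c : 0 <= avgV c. Proof. exact: mean_ge0 (avg_mean l c) _ V_ge0. Qed.

Lemma fluct_upd e c : e \in l -> fluct (upd c e j0) = fluct c - (f c - f (upd c e j0)).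
Proof. by move=> el; rewrite /fluct (indep_avg f el); ring. Qed.

Lemma fluct_power_increments c :
  \sum_(e <- l) (fluct c ^+ p.+1 - fluct (upd c e j0) ^+ p.+1) ^+ 2 <=
  4 * P * V c * (fluct c ^+ 2) ^+ p + (9 * P * V c) ^+ p.+1.
Proof.
apply: le_trans (_ : \sum_(e <- l) (4 * P * (fluct c ^+ 2) ^+ p * (f c - f (upd c e j0)) ^+ 2
   + (9 * P) ^+ p.+1 * ((f c - f (upd c e j0)) ^+ 2) ^+ p.+1) <= _).
  rewrite big_seq [leRHS]big_seq; apply: ler_sum => e el.
  by rewrite fluct_upd // power_increment_le.
rewrite big_split /= -!mulr_sumr; apply: lerD.
  by rewrite [leRHS]mulrAC ler_wpM2l // /P; nonneg.
rewrite [leRHS]exprMn ler_wpM2l ?exprn_ge0 ?mulr_ge0 ?ler0n //.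
apply: le_trans (sum_powers_le l p (fun e => sqr_ge0 (f c - f (upd c e j0)))) _.
by rewrite lerXn2r ?nnegrE // sumr_ge0 // => e _; rewrite sqr_ge0.
Qed.

Lemma avg_fluct_sqr c : avg l (fun c => fluct c ^+ 2) c <= avgV c.
Proof.
by apply: le_trans (efron_stein _ c l_uniq) _; exact: mean_mono (avg_mean l c) _ _ _.
Qed.

(* The variance of [fluct ^+ p.+1] is bounded by Efron--Stein, its squared mean by
   Cauchy--Schwarz. *)
Lemma avg_fluct_power c : avg l (fun c => (fluct c ^+ 2) ^+ p.+1) c <=
  avg l (fun c => 4 * P * V c * (fluct c ^+ 2) ^+ p + (9 * P * V c) ^+ p.+1
    + avgV c * (fluct c ^+ 2) ^+ p) c.
Proof.
have avgM := avg_mean l c; have avgV_indep e : e \in l -> indep e avgV by exact: indep_avg.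
have cst_indep e : e \in l -> indep e (fun=> 0 : R) by [].
rewrite (mean_ext avgM (g := fun c => (fluct c ^+ p.+1 - 0) ^+ 2)); last first.
  by move=> c'; rewrite subr0 -!exprM mulnC.
rewrite (avg_bias_variance _ c cst_indep) (meanD avgM); apply: lerD.
  apply: le_trans (efron_stein _ c l_uniq) _.
  by apply: (mean_mono avgM) => c'; exact: fluct_power_increments.
rewrite subr0 (mean_ext avgM (g := fun c => fluct c * fluct c ^+ p)); last first.
  by move=> c'; rewrite exprS.
apply: le_trans (mean_cauchy avgM _ _) _; rewrite avg_indepM //; apply: ler_pM.
- by apply: (mean_ge0 avgM) => c'; rewrite sqr_ge0.
- by apply: (mean_ge0 avgM) => c'; rewrite sqr_ge0.
- exact: avg_fluct_sqr.
- by apply: (mean_mono avgM) => c'; rewrite -!exprM mulnC.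
Qed.

Lemma fluct_power_young c :
  4 * P * V c * (fluct c ^+ 2) ^+ p + (9 * P * V c) ^+ p.+1 + avgV c * (fluct c ^+ 2) ^+ p <=
  2^-1 * (fluct c ^+ 2) ^+ p.+1 +
    ((25 * P) ^+ p.+1 * V c ^+ p.+1 + (4 * P) ^+ p.+1 * avgV c ^+ p.+1).
Proof.
have P1 := P_ge1; have v0 := V_ge0 c; have y0 := sqr_ge0 (fluct c).
have P_ge0 : 0 <= P by lra.
have youngV := young_power p v0 y0 (mulr_ge0 (ler0n R 4) P_ge0).
have young_avgV := young_power p (avgV_ge0 c) y0 P_ge0.
have drop_P : avgV c * (fluct c ^+ 2) ^+ p <= P * avgV c * (fluct c ^+ 2) ^+ p.
  by apply: ler_wpM2r; [rewrite exprn_ge0|rewrite ler_peMl].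
have merge : (4 * (4 * P) * V c) ^+ p.+1 + (9 * P * V c) ^+ p.+1 <= (25 * P * V c) ^+ p.+1.
  pose term i := if i == 0%N then 4 * (4 * P) * V c else 9 * P * V c.
  have term_ge0 i : 0 <= term i by rewrite /term; case: ifP => _; nonneg; lra.
  have := sum_powers_le [:: 0%N; 1%N] p term_ge0; rewrite !big_cons !big_nil /= !addr0.
  by rewrite /term /= (_ : _ * V c + _ = 25 * P * V c) //; ring.
by rewrite -!exprMn; move: youngV young_avgV drop_P merge; lra.
Qed.

Lemma efron_stein_const : 2 * (25 * P) ^+ p.+1 + 2 * (4 * P) ^+ p.+1 <= (96 * P) ^+ p.+1.
Proof.
have : 0 <= P by have := P_ge1; lra.
generalize P => Q Q_ge0; rewrite !exprMn !mulrA -mulrDl.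
apply: ler_wpM2r; first exact: exprn_ge0.
have le25 : (25 : R) ^+ p <= 96 ^+ p by rewrite lerXn2r ?nnegrE; lra.
have le4 : (4 : R) ^+ p <= 96 ^+ p by rewrite lerXn2r ?nnegrE; lra.
have : 0 <= (96 : R) ^+ p by exact: exprn_ge0.
by rewrite !exprS; lra.
Qed.

Lemma efron_stein_moment :
  Ex (fun c => (f c - avg l f c) ^+ (2 * p.+1)) <=
  (96 * p.+1%:R ^+ 2) ^+ p.+1 * Ex (fun c => V c ^+ p.+1).
Proof.
rewrite -/P (mean_ext Ex_mean (g := fun c => (fluct c ^+ 2) ^+ p.+1)); last first.
  by move=> c; rewrite exprM.
set Y := Ex _; set EV := Ex (fun c => V c ^+ p.+1).
have absorb : Y <= 2^-1 * Y +
   ((25 * P) ^+ p.+1 * EV + (4 * P) ^+ p.+1 * Ex (fun c => avgV c ^+ p.+1)).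
  rewrite -!(meanZ Ex_mean) -!(meanD Ex_mean).
  apply: le_trans (_ : Ex (avg l (fun c => 4 * P * V c * (fluct c ^+ 2) ^+ p +
     (9 * P * V c) ^+ p.+1 + avgV c * (fluct c ^+ 2) ^+ p)) <= _).
    rewrite /Y -(Ex_avg l); apply: (mean_mono Ex_mean); exact: avg_fluct_power.
  by rewrite Ex_avg; apply: (mean_mono Ex_mean); exact: fluct_power_young.
have jensen : Ex (fun c => avgV c ^+ p.+1) <= EV.
  rewrite /EV -(Ex_avg l (fun c => V c ^+ p.+1)); apply: (mean_mono Ex_mean) => c.
  exact: mean_power (avg_mean l c) _ _ V_ge0.
have EV_ge0 : 0 <= EV by apply: (mean_ge0 Ex_mean) => c; rewrite exprn_ge0.
have P4_ge0 : 0 <= (4 * P) ^+ p.+1 by rewrite exprn_ge0 //; have := P_ge1; lra.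
have := ler_wpM2l P4_ge0 jensen; have := ler_wpM2r EV_ge0 efron_stein_const; lra.
Qed.

End EfronSteinMoment.

End ProductProbability.

(** * Massive elliptic equations on finite graphs *)

Section Graph.
Variables (R : realFieldType) (T E : finType) (src tgt : E -> T).
Implicit Types (u v z f : T -> R) (a b g xi : E -> R) (m : R) (x y : T) (e : E).

Definition grd u e : R := u (tgt e) - u (src e).

(** Weak formulation of [m u - div (a grad u) = f - div g]. *)
Definition weak_sol m a u f g := forall z,
  m * (\sum_x u x * z x) + \sum_e a e * grd u e * grd z e =
  \sum_x f x * z x + \sum_e g e * grd z e.

Definition boundary e x : R := (x == tgt e)%:R - (x == src e)%:R.

Lemma sum_delta y z : \sum_x (x == y)%:R * z x = z y.
Proof.
rewrite (bigD1 y) //= eqxx mul1r big1 ?addr0 // => x /negPf ->.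
by rewrite mul0r.
Qed.

Lemma grd_boundary z e : grd z e = \sum_x boundary e x * z x.
Proof.
rewrite /grd /boundary; under eq_bigr => x _ do rewrite mulrBl.
by rewrite sumrB !sum_delta.
Qed.

Definition stiffness m a x y : R :=
  m * (x == y)%:R + \sum_e a e * boundary e x * boundary e y.

Lemma stiffness_form m a u z :
  \sum_y (\sum_x u x * stiffness m a x y) * z y =
  m * (\sum_x u x * z x) + \sum_e a e * grd u e * grd z e.
Proof.
have h y : \sum_x u x * stiffness m a x y =
    m * u y + \sum_e a e * grd u e * boundary e y.
  under eq_bigr => x _ do rewrite /stiffness mulrDr.
  rewrite big_split /=; congr (_ + _).
    rewrite -(sum_delta y u) mulr_sumr; apply: eq_bigr => x _; ring.
  under eq_bigr => x _ do rewrite mulr_sumr.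
  rewrite exchange_big /=; apply: eq_bigr => e _.
  by rewrite grd_boundary mulr_sumr mulr_suml; apply: eq_bigr => x _; ring.
under eq_bigr => y _ do rewrite h mulrDl.
rewrite big_split /=; congr (_ + _).
  by rewrite mulr_sumr; apply: eq_bigr => y _; ring.
under eq_bigr => y _ do rewrite mulr_suml.
rewrite exchange_big /=; apply: eq_bigr => e _.
by rewrite (grd_boundary z) mulr_sumr; apply: eq_bigr => x _; ring.
Qed.

Definition stiffness_mx m a : 'M[R]_#|T| :=
  \matrix_(i, j) stiffness m a (enum_val i) (enum_val j).

Definition solution m a f g : T -> R := fun x =>
  ((\row_j (f (enum_val j) + \sum_e g e * boundary e (enum_val j)))
    *m invmx (stiffness_mx m a)) 0 (enum_rank x).

Lemma sum_enum_val (F : T -> R) : \sum_x F x = \sum_(i < #|T|) F (enum_val i).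
Proof.
by rewrite (reindex (@enum_val T T)) //=; apply: onW_bij; apply: enum_val_bij.
Qed.

Lemma stiffness_mx_unit m a : 0 < m -> (forall e, 0 <= a e) -> stiffness_mx m a \in unitmx.
Proof.
move=> m0 a0; rewrite -row_free_unit; apply: inj_row_free => v v0.
pose u x := v 0 (enum_rank x).
have uv i : u (enum_val i) = v 0 i by rewrite /u enum_valK.
have energy_eq0 : m * (\sum_x u x * u x) + \sum_e a e * grd u e * grd u e = 0.
  rewrite -stiffness_form sum_enum_val big1 // => j _.
  have -> : \sum_x u x * stiffness m a x (enum_val j) = (v *m stiffness_mx m a) 0 j.
    rewrite mxE sum_enum_val; apply: eq_bigr => i _.
    by rewrite uv !mxE.
  by rewrite v0 mxE mul0r.
have e0 : 0 <= \sum_e a e * grd u e * grd u e.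
  by rewrite sumr_ge0 // => e _; rewrite -mulrA -expr2; nonneg.
have s0 : \sum_x u x * u x <= 0.
  by rewrite -(pmulr_rle0 _ m0); lra.
have u0 x : u x = 0.
  apply/eqP; rewrite -sqrf_eq0 eq_le sqr_ge0 andbT expr2.
  apply: le_trans s0; rewrite (bigD1 x) //= lerDl sumr_ge0 // => y _.
  by rewrite -expr2 sqr_ge0.
by apply/rowP => i; rewrite mxE -uv u0.
Qed.

Lemma solutionP m a f g : 0 < m -> (forall e, 0 <= a e) -> weak_sol m a (solution m a f g) f g.
Proof.
move=> m0 a0 z; rewrite -stiffness_form.
have h y : \sum_x solution m a f g x * stiffness m a x y = f y + \sum_e g e * boundary e y.
  rewrite sum_enum_val -[y](enum_rankK).
  pose b : 'rV[R]_#|T| := \row_j (f (enum_val j) + \sum_e g e * boundary e (enum_val j)).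
  transitivity ((b *m invmx (stiffness_mx m a) *m stiffness_mx m a) 0 (enum_rank y)).
    rewrite [RHS]mxE; apply: eq_bigr => i _; rewrite /solution enum_valK -/b.
    by rewrite [stiffness_mx m a i _]mxE.
  by rewrite mulmxKV ?stiffness_mx_unit // mxE.
under eq_bigr => y _ do rewrite h mulrDl.
rewrite big_split /=; congr (_ + _).
under eq_bigr => y _ do rewrite mulr_suml.
rewrite exchange_big /=; apply: eq_bigr => e _.
by rewrite (grd_boundary z) mulr_sumr; apply: eq_bigr => x _; ring.
Qed.

Lemma grdB u v e : grd (fun x => u x - v x) e = grd u e - grd v e.
Proof. by rewrite /grd; ring. Qed.

Lemma weak_sol_energy m a u f g : weak_sol m a u f g ->
  m * (\sum_x u x ^+ 2) + \sum_e a e * grd u e ^+ 2 =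
  \sum_x f x * u x + \sum_e g e * grd u e.
Proof.
move=> /(_ u) <-; congr (_ * _ + _); apply: eq_bigr => x _; ring.
Qed.

Lemma weak_solB m a u v f f' g g' : weak_sol m a u f g -> weak_sol m a v f' g' ->
  weak_sol m a (fun x => u x - v x) (fun x => f x - f' x) (fun e => g e - g' e).
Proof.
move=> hu hv z; have := hu z; have := hv z.
have -> : \sum_x (u x - v x) * z x = \sum_x u x * z x - \sum_x v x * z x.
  by rewrite -sumrB; apply: eq_bigr => x _; ring.
have -> : \sum_e a e * grd (fun x => u x - v x) e * grd z e =
   \sum_e a e * grd u e * grd z e - \sum_e a e * grd v e * grd z e.
  by rewrite -sumrB; apply: eq_bigr => e _; rewrite grdB; ring.
have -> : \sum_x (f x - f' x) * z x = \sum_x f x * z x - \sum_x f' x * z x.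
  by rewrite -sumrB; apply: eq_bigr => x _; ring.
have -> : \sum_e (g e - g' e) * grd z e = \sum_e g e * grd z e - \sum_e g' e * grd z e.
  by rewrite -sumrB; apply: eq_bigr => e _; ring.
by lra.
Qed.

Lemma weak_sol_ext m a u v f f' g g' : u =1 v -> f =1 f' -> g =1 g' ->
  weak_sol m a u f g -> weak_sol m a v f' g'.
Proof.
move=> uv ff gg h z; have := h z.
under eq_bigr => x _ do rewrite uv.
under [X in _ + X = _ -> _]eq_bigr => e _ do rewrite /grd !uv -/(grd v e).
under [X in _ = X + _ -> _]eq_bigr => x _ do rewrite ff.
by under [X in _ = _ + X -> _]eq_bigr => e _ do rewrite gg.
Qed.

Definition delta y x : R := (x == y)%:R.

Definition green m a y : T -> R := solution m a (delta y) (fun=> 0).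

Section Elliptic.
Variables (al be : R).
Hypotheses (al_gt0 : 0 < al) (al_be : al <= be).

Definition elliptic a := forall e, al <= a e <= be.

Lemma elliptic_ge0 a e : elliptic a -> 0 <= a e.
Proof. by move=> /(_ e) /andP[h _]; apply: le_trans h; apply: ltW. Qed.

Lemma greenP m a y z : 0 < m -> elliptic a ->
  m * (\sum_x green m a y x * z x) +
  \sum_e a e * grd (green m a y) e * grd z e = z y.
Proof.
move=> m0 ea; have a0 e : 0 <= a e by apply: elliptic_ge0.
have := solutionP (delta y) (fun=> 0) m0 a0 z; rewrite -/(green m a y) => ->.
by rewrite sum_delta big1 ?addr0 // => e _; rewrite mul0r.
Qed.

Lemma green_repr m a y u f g : 0 < m -> elliptic a -> weak_sol m a u f g ->
  u y = \sum_x f x * green m a y x + \sum_e g e * grd (green m a y) e.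
Proof.
move=> m0 ea /(_ (green m a y)) <-; rewrite -(greenP y u m0 ea).
congr (_ * _ + _); apply: eq_bigr => x _; ring.
Qed.

Lemma green_energy m a y : 0 < m -> elliptic a ->
  m * (\sum_x green m a y x ^+ 2) + \sum_e a e * grd (green m a y) e ^+ 2 =
  green m a y y.
Proof.
move=> m0 ea; rewrite -[RHS](greenP y _ m0 ea).
congr (_ * _ + _); apply: eq_bigr => x _; ring.
Qed.

Lemma weak_sol_energy_le m a u f g : elliptic a -> weak_sol m a u f g ->
  m * (\sum_x u x ^+ 2) + al * \sum_e grd u e ^+ 2 <=
  \sum_x f x * u x + \sum_e g e * grd u e.
Proof.
move=> ea /weak_sol_energy <-; rewrite lerD2l mulr_sumr; apply: ler_sum => e _.
by apply: ler_wpM2r; [exact: sqr_ge0|have /andP[] := ea e].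
Qed.

Lemma weak_sol_energy_div m a u f g : elliptic a -> weak_sol m a u f g ->
  2 * m * (\sum_x u x ^+ 2) + al * \sum_e grd u e ^+ 2 <=
  2 * \sum_x f x * u x + al^-1 * \sum_e g e ^+ 2.
Proof.
move=> ea h; have {h} := weak_sol_energy_le ea h.
have : \sum_e g e * grd u e <=
    al / 2 * (\sum_e grd u e ^+ 2) + al^-1 / 2 * \sum_e g e ^+ 2.
  rewrite !mulr_sumr -big_split; apply: ler_sum => e _ /=.
  have -> : al / 2 * grd u e ^+ 2 + al^-1 / 2 * g e ^+ 2 =
     g e * grd u e + al / 2 * (grd u e - g e / al) ^+ 2.
    by field; rewrite gt_eqF.
  by rewrite lerDl; nonneg.
by lra.
Qed.

Lemma weak_sol_uniq m a u v f g : 0 < m -> elliptic a ->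
  weak_sol m a u f g -> weak_sol m a v f g -> u =1 v.
Proof.
move=> m0 ea hu hv x; apply/eqP; rewrite -subr_eq0.
rewrite (green_repr x m0 ea (weak_solB hu hv)).
by rewrite !big1 ?addr0 // => ? _; rewrite subrr mul0r.
Qed.

Variable xi : E -> R.

Definition corrector m a : T -> R := solution m a (fun=> 0) (fun e => - (a e * xi e)).

Definition corr_flux m a e : R := xi e + grd (corrector m a) e.

Lemma corrector_test m a z : 0 < m -> elliptic a ->
  m * (\sum_x corrector m a x * z x) + \sum_e a e * corr_flux m a e * grd z e = 0.
Proof.
move=> m0 ea; have a0 e : 0 <= a e by apply: elliptic_ge0.
have := solutionP (fun=> 0) (fun e => - (a e * xi e)) m0 a0 z.
rewrite -/(corrector m a) [X in _ = X + _]big1; last by move=> x _; rewrite mul0r.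
move=> h.
have -> : \sum_e a e * corr_flux m a e * grd z e = \sum_e a e * grd (corrector m a) e * grd z e -
    \sum_e - (a e * xi e) * grd z e.
  by rewrite -sumrB; apply: eq_bigr => e _; rewrite /corr_flux; ring.
by rewrite addrA h add0r subrr.
Qed.

Lemma corrector_char m a u : 0 < m -> elliptic a ->
  (forall z, m * (\sum_x u x * z x) + \sum_e a e * (xi e + grd u e) * grd z e = 0) ->
  u =1 corrector m a.
Proof.
move=> m0 ea h; have a0 e : 0 <= a e by apply: elliptic_ge0.
apply: weak_sol_uniq m0 ea _ (solutionP _ _ m0 a0) => z.
have := h z; rewrite [X in _ -> _ = X + _]big1; last by move=> x _; rewrite mul0r.
have -> : \sum_e a e * (xi e + grd u e) * grd z e = \sum_e a e * grd u e * grd z e -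
    \sum_e - (a e * xi e) * grd z e.
  by rewrite -sumrB; apply: eq_bigr => e _; ring.
by lra.
Qed.

Lemma corrector_diff_sol m a a' : 0 < m -> elliptic a -> elliptic a' ->
  weak_sol m a (fun x => corrector m a' x - corrector m a x) (fun=> 0)
    (fun e => - ((a' e - a e) * corr_flux m a' e)).
Proof.
move=> m0 ea ea' z; have := corrector_test z m0 ea; have := corrector_test z m0 ea'.
under [X in _ -> _ -> m * X + _ = _]eq_bigr => x _ do rewrite mulrBl.
rewrite sumrB [X in _ -> _ -> _ = X + _]big1; last by move=> x _; rewrite mul0r.
have -> : \sum_e a e * grd (fun x => corrector m a' x - corrector m a x) e * grd z e =
  \sum_e a' e * corr_flux m a' e * grd z e - \sum_e a e * corr_flux m a e * grd z e
  + \sum_e - ((a' e - a e) * corr_flux m a' e) * grd z e.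
  rewrite -sumrB -big_split; apply: eq_bigr => e _ /=.
  by rewrite grdB /corr_flux; ring.
by lra.
Qed.

Lemma corrector_diff_repr m a a' y : 0 < m -> elliptic a -> elliptic a' ->
  corrector m a' y - corrector m a y =
  - \sum_e (a' e - a e) * corr_flux m a' e * grd (green m a y) e.
Proof.
move=> m0 ea ea'; rewrite (green_repr y m0 ea (corrector_diff_sol m0 ea ea')).
rewrite big1 ?add0r; last by move=> x _; rewrite mul0r.
by rewrite -sumrN; apply: eq_bigr => e _; rewrite mulNr.
Qed.

Lemma elliptic_diff_sqr a a' e : elliptic a -> elliptic a' -> (a' e - a e) ^+ 2 <= be ^+ 2.
Proof.
move=> /(_ e) /andP[h1 h2] /(_ e) /andP[h3 h4].
have h0 := al_gt0.
have : 0 <= (be - (a' e - a e)) * (be + (a' e - a e)) by apply: mulr_ge0; lra.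
by nra.
Qed.

Lemma sum_off_support (B : {set E}) a a' g : elliptic a -> elliptic a' ->
  (forall e, e \notin B -> a e = a' e) ->
  \sum_e ((a' e - a e) * g e) ^+ 2 <= be ^+ 2 * \sum_(e in B) g e ^+ 2.
Proof.
move=> ea ea' h; rewrite mulr_sumr (bigID (mem B)) /= [X in _ + X]big1; last first.
  by move=> e /h ->; rewrite subrr mul0r expr0n.
rewrite addr0; apply: ler_sum => e _; rewrite exprMn ler_wpM2r ?sqr_ge0 //.
exact: elliptic_diff_sqr.
Qed.

Lemma corrector_diff_energy (B : {set E}) m a a' : 0 < m -> elliptic a -> elliptic a' ->
  (forall e, e \notin B -> a e = a' e) ->
  2 * m * (\sum_x (corrector m a' x - corrector m a x) ^+ 2) +
  al * \sum_e grd (fun x => corrector m a' x - corrector m a x) e ^+ 2 <=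
  be ^+ 2 / al * \sum_(e in B) corr_flux m a' e ^+ 2.
Proof.
move=> m0 ea ea' h.
apply: le_trans (weak_sol_energy_div ea (corrector_diff_sol m0 ea ea')) _.
rewrite big1 ?mulr0 ?add0r; last by move=> x _; rewrite mul0r.
have -> : be ^+ 2 / al * (\sum_(e in B) corr_flux m a' e ^+ 2) =
  al^-1 * (be ^+ 2 * \sum_(e in B) corr_flux m a' e ^+ 2) by ring.
apply: ler_wpM2l; first by rewrite invr_ge0 ltW.
under eq_bigr => e _ do rewrite sqrrN.
exact: sum_off_support.
Qed.

Definition contrast : R := (be / al) ^+ 2.

Lemma contrast_ge1 : 1 <= contrast.
Proof.
have h : 1 <= be / al by rewrite ler_pdivlMr // mul1r.
by rewrite /contrast expr_ge1 //; lra.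
Qed.

Lemma corrector_diff_grad (B : {set E}) m a a' : 0 < m -> elliptic a -> elliptic a' ->
  (forall e, e \notin B -> a e = a' e) ->
  \sum_e grd (fun x => corrector m a' x - corrector m a x) e ^+ 2 <=
  contrast * \sum_(e in B) corr_flux m a' e ^+ 2.
Proof.
move=> m0 ea ea' h; have := corrector_diff_energy m0 ea ea' h.
set Z := \sum_x (_ - _) ^+ 2; set X := \sum_e grd _ e ^+ 2.
set Y := \sum_(e in B) _ => k.
have Z0 : 0 <= Z by rewrite /Z; nonneg.
rewrite -(ler_pM2l al_gt0); apply: le_trans (_ : be ^+ 2 / al * Y <= _).
  have mZ : 0 <= m * Z by nonneg.
  by lra.
rewrite /contrast; apply: eq_leW.
by field; rewrite gt_eqF.
Qed.

Lemma corr_flux_compare (B : {set E}) m a a' : 0 < m -> elliptic a -> elliptic a' ->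
  (forall e, e \notin B -> a e = a' e) ->
  \sum_(e in B) corr_flux m a e ^+ 2 <= 4 * contrast * \sum_(e in B) corr_flux m a' e ^+ 2.
Proof.
move=> m0 ea ea' h; have h1 := corrector_diff_grad m0 ea ea' h.
set X := \sum_(e in B) corr_flux m a' e ^+ 2 in h1 *.
have X0 : 0 <= X by rewrite /X; nonneg.
have : \sum_(e in B) corr_flux m a e ^+ 2 <= 2 * X +
    2 * \sum_e grd (fun x => corrector m a' x - corrector m a x) e ^+ 2.
  rewrite [X in _ + 2 * X](bigID (mem B)) /= mulrDr addrA.
  apply: ler_wpDr; first by nonneg.
  rewrite /X !mulr_sumr -big_split; apply: ler_sum => e _ /=.
  have -> : corr_flux m a e = corr_flux m a' e - grd (fun x => corrector m a' x - corrector m a x) e.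
    by rewrite /corr_flux grdB; ring.
  apply: le_trans (sqrrD_le _ _) _; by rewrite sqrrN.
have := contrast_ge1; nra.
Qed.

Lemma corrector_diff_point (B : {set E}) m a a' y : 0 < m -> elliptic a -> elliptic a' ->
  (forall e, e \notin B -> a e = a' e) ->
  (corrector m a' y - corrector m a y) ^+ 2 <=
  be ^+ 2 * (\sum_(e in B) corr_flux m a' e ^+ 2) *
  \sum_(e in B) grd (green m a y) e ^+ 2.
Proof.
move=> m0 ea ea' h; rewrite corrector_diff_repr // sqrrN.
have -> : \sum_e (a' e - a e) * corr_flux m a' e * grd (green m a y) e =
    \sum_(e in B) 1 * ((a' e - a e) * corr_flux m a' e) * grd (green m a y) e.
  rewrite (bigID (mem B)) /= [X in _ + X]big1 ?addr0; last first.
    by move=> e /h ->; rewrite subrr !mul0r.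
  by apply: eq_bigr => e _; rewrite mul1r.
apply: le_trans (cauchy_schwarz_seq _ _ _ _ (fun=> ler01)) _.
apply: ler_pM; [by nonneg|by nonneg| |by under eq_bigr do rewrite mul1r].
under eq_bigr do rewrite mul1r.
apply: le_trans (sum_off_support (corr_flux m a') ea ea' h).
rewrite [leRHS](bigID (mem B)) /= lerDl; nonneg.
Qed.

Lemma weak_sol_perturb (B : {set E}) m a a' v v' h h' : 0 < m -> elliptic a -> elliptic a' ->
  (forall e, e \notin B -> a e = a' e) ->
  weak_sol m a v h (fun=> 0) -> weak_sol m a' v' h' (fun=> 0) ->
  2 * m * (\sum_x (v x - v' x) ^+ 2) +
  al * \sum_e grd (fun x => v x - v' x) e ^+ 2 <=
  2 * \sum_x (h x - h' x) * (v x - v' x) +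
  be ^+ 2 / al * \sum_(e in B) grd v' e ^+ 2.
Proof.
move=> m0 ea ea' hB hv hv'.
have s : weak_sol m a (fun x => v x - v' x) (fun x => h x - h' x)
    (fun e => (a' e - a e) * grd v' e).
  apply: weak_sol_ext (weak_solB hv (_ : weak_sol m a v' h' (fun e => - ((a' e - a e) * grd v' e)))) => //.
    by move=> e; rewrite sub0r opprK.
  move=> z; have := hv' z.
  rewrite [X in _ = _ + X]big1 ?addr0; last by move=> e _; rewrite mul0r.
  have -> : \sum_e a' e * grd v' e * grd z e = \sum_e a e * grd v' e * grd z e
     - \sum_e - ((a' e - a e) * grd v' e) * grd z e.
    by rewrite -sumrB; apply: eq_bigr => e _; ring.
  by lra.
apply: le_trans (weak_sol_energy_div ea s) _; rewrite lerD2l.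
have -> : be ^+ 2 / al * (\sum_(e in B) grd v' e ^+ 2) =
  al^-1 * (be ^+ 2 * \sum_(e in B) grd v' e ^+ 2) by ring.
apply: ler_wpM2l; first by rewrite invr_ge0 ltW.
exact: sum_off_support.
Qed.

End Elliptic.

End Graph.

Section CorrectorBounds.
Variables (R : realFieldType) (T E : finType) (src tgt : E -> T).
Variables (al be : R) (al_gt0 : 0 < al) (al_be : al <= be).
Variables (xi : E -> R) (xi_le1 : forall e, `|xi e| <= 1).
Variables (m : R) (m_gt0 : 0 < m) (a : E -> R) (ea : elliptic al be a).

Let phi := corrector src tgt xi m a.

Lemma corrector_max (D : R) x :
  (forall x, \sum_e ((tgt e == x)%:R + (src e == x)%:R) <= D) ->
  (forall y, phi y <= phi x) -> phi x <= be * D / m.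
Proof.
move=> hD hx; have := corrector_test src tgt al_gt0 xi (delta R x) m_gt0 ea.
rewrite -/phi.
have -> : \sum_y phi y * delta R x y = phi x.
  by rewrite -[RHS](sum_delta x); apply: eq_bigr => y _; rewrite mulrC.
move=> h; rewrite ler_pdivlMr // mulrC.
have -> : m * phi x = - \sum_e a e * corr_flux src tgt xi m a e * grd src tgt (delta R x) e.
  by apply/eqP; rewrite -subr_eq0 opprK; apply/eqP.
apply: le_trans (_ : be * \sum_e ((tgt e == x)%:R + (src e == x)%:R) <= _); last first.
  by apply: ler_wpM2l => //; have := al_gt0; have := al_be; lra.
rewrite -sumrN mulr_sumr; apply: ler_sum => e _.
have /andP[a1 a2] := ea e; have a0 := al_gt0.
rewrite /corr_flux /grd -/phi /delta.
have := xi_le1 e; rewrite ler_norml => /andP[x1 x2].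
have h1 := hx (src e); have h2 := hx (tgt e).
have [et|nt] := eqVneq (tgt e) x; have [es|ns] := eqVneq (src e) x.
- rewrite subrr mulr0 oppr0; apply: mulr_ge0; last by rewrite addr_ge0.
  by have := al_be; lra.
- rewrite et subr0 addr0 !mulr1.
  have : 0 <= a e * (phi x - phi (src e)) by apply: mulr_ge0; lra.
  by nra.
- rewrite es sub0r add0r mulrN1 opprK mulr1.
  have : 0 <= a e * (phi x - phi (tgt e)) by apply: mulr_ge0; lra.
  by nra.
- by rewrite subr0 addr0 !mulr0 oppr0.
Qed.

Section GradientPower.
Variable p : nat.
Local Notation lip := ((2 * p).+1%:R * 16 ^+ p : R).
Local Notation ends e := (phi (tgt e) ^+ (2 * p) + phi (src e) ^+ (2 * p)).
Local Notation power := (fun x => phi x ^+ (2 * p).+1).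

Let ends_ge0 e : 0 <= ends e. Proof. by rewrite addr_ge0 ?expr_double_ge0. Qed.

Lemma corrector_edge_coercive e :
  al / 4 * (grd src tgt phi e ^+ 2 * ends e) - (be * lip) ^+ 2 / al * ends e <=
  a e * corr_flux src tgt xi m a e * grd src tgt power e.
Proof.
have /andP[al_le le_be] := ea e; have al0 := al_gt0; have S0 := ends_ge0 e.
rewrite /corr_flux -/phi; set g := grd src tgt phi e; set k := grd src tgt _ e.
set S := ends e in S0 *; set C := lip.
have gk_ge : g ^+ 2 * S <= 2 * (g * k) by exact: odd_power_coercive.
have k_le : `|k| <= C * (`|g| * S) by exact: odd_power_lipschitz.
have diffusion_ge : al / 2 * (g ^+ 2 * S) <= a e * g * k.
  have gS_ge0 : 0 <= g ^+ 2 * S by nonneg.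
  have : al * (g * k) <= a e * (g * k) by apply: ler_wpM2r; lra.
  by nra.
have source_ge : - (be * (C * (`|g| * S))) <= a e * xi e * k.
  have : `|a e * xi e * k| <= be * 1 * (C * (`|g| * S)).
    rewrite !normrM ger0_norm; last by lra.
    have a_ge0 : 0 <= a e by lra.
    by apply: ler_pM => //; [exact: mulr_ge0|exact: ler_pM].
  by rewrite mulr1 ler_norml => /andP[].
have young : be * (C * (`|g| * S)) <= al / 4 * (g ^+ 2 * S) + (be * C) ^+ 2 / al * S.
  rewrite -subr_ge0 -[g ^+ 2](real_normK (num_real g)).
  rewrite [X in 0 <= X](_ : _ = S * (al / 4 * (`|g| - 2 * (be * C) / al) ^+ 2)).
    by nonneg; lra.
  by field; lra.
have -> : a e * (xi e + g) * k = a e * xi e * k + a e * g * k by ring.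
by lra.
Qed.

Lemma corrector_power_energy :
  al / 4 * (\sum_e grd src tgt phi e ^+ 2 * ends e) <= (be * lip) ^+ 2 / al * \sum_e ends e.
Proof.
have weak := corrector_test src tgt al_gt0 xi power m_gt0 ea.
rewrite -/phi in weak.
have mass_ge0 : 0 <= m * \sum_x phi x * phi x ^+ (2 * p).+1.
  apply: mulr_ge0; [exact: ltW|apply: sumr_ge0 => x _].
  by rewrite -exprS (_ : (2 * p).+2 = 2 * p.+1)%N ?expr_double_ge0 // mulnS.
have : \sum_e (al / 4 * (grd src tgt phi e ^+ 2 * ends e) - (be * lip) ^+ 2 / al * ends e) <=
    \sum_e a e * corr_flux src tgt xi m a e * grd src tgt power e.
  by apply: ler_sum => e _; exact: corrector_edge_coercive.
by rewrite sumrB -!mulr_sumr; lra.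
Qed.

Lemma corrector_grad_power :
  \sum_e grd src tgt phi e ^+ (2 * p.+1) <=
  4 * 4 ^+ p * (be * ((2 * p).+1%:R * 16 ^+ p) / al) ^+ 2 *
  \sum_(e : E) (phi (tgt e) ^+ (2 * p) + phi (src e) ^+ (2 * p)).
Proof.
apply: le_trans (_ : 4 ^+ p * \sum_e grd src tgt phi e ^+ 2 * ends e <= _).
  rewrite mulr_sumr; apply: ler_sum => e _.
  by rewrite mulnS exprD mulrCA ler_wpM2l ?sqr_ge0 // even_power_diff.
rewrite [4 * _]mulrC -!(mulrA (4 ^+ p)) ler_wpM2l ?exprn_ge0 //.
have al0 := al_gt0; have al4_gt0 : 0 < al / 4 by rewrite divr_gt0.
rewrite -(ler_pM2l al4_gt0); apply: (le_trans corrector_power_energy).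
by apply: eq_leW; field; lra.
Qed.

End GradientPower.

End CorrectorBounds.

(** * The random conductance model on a discrete torus *)

Notation torus d h := {ffun 'I_d -> 'I_(2 * h).+1}.

Section Torus.
Variables (d h : nat).
Local Notation T := (torus d h).
Local Notation E := (T * 'I_d)%type.

Definition stp (i : 'I_d) : T := [ffun k => if k == i then inZp 1 else 0].

Definition tsrc (e : E) : T := e.1.

Definition ttgt (e : E) : T := e.1 + stp e.2.

Lemma sum_shift (R : nmodType) (z : T) (F : T -> R) :
  \sum_(x : T) F (x + z) = \sum_(x : T) F x.
Proof. by rewrite [RHS](reindex_inj (addIr z)). Qed.

Lemma sum_edges (R : nmodType) (F : E -> R) : \sum_e F e = \sum_i \sum_x F (x, i).
Proof.
by rewrite exchange_big pair_big; apply: eq_bigr => -[].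
Qed.

Lemma torus_degree (R : realFieldType) (x : T) :
  \sum_(e : E) ((ttgt e == x)%:R + (tsrc e == x)%:R) = 2 * d%:R :> R.
Proof.
have dl (y : T) : \sum_x (x == y)%:R = 1 :> R.
  by rewrite (bigD1 y) //= eqxx big1 ?addr0 // => z /negPf ->.
rewrite sum_edges (eq_bigr (fun=> 2)); last first.
  move=> i _; rewrite big_split /= /ttgt /tsrc /= dl.
  by rewrite (sum_shift (stp i) (fun y => (y == x)%:R)) dl.
by rewrite sumr_const card_ord mulr_natr.
Qed.

Variables (R : realFieldType) (J : finType) (rho : J -> R) (j0 : J).
Hypotheses (rho_ge0 : forall j, 0 <= rho j) (rho_sum : \sum_j rho j = 1).
Variables (al be : R) (al_gt0 : 0 < al) (al_be : al <= be).
Variables (vl : J -> R) (vl_itv : forall j, al <= vl j <= be).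
Variables (zeta : 'I_d -> R).
Local Notation cfg := {ffun E -> J}.
Local Notation Ex := (Ex (E := E) rho).
Implicit Types (c : cfg) (e : E) (x y z : T) (m : R).

Definition cfield c e : R := vl (c e).

Definition phi m c : T -> R := corrector tsrc ttgt (fun e => zeta e.2) m (cfield c).

Definition flux m c e : R := corr_flux tsrc ttgt (fun e => zeta e.2) m (cfield c) e.

Definition flux2 m c e : R := flux m c e ^+ 2.

Definition tgreen m c y : T -> R := green tsrc ttgt m (cfield c) y.

Definition dgreen m c y e : R := grd tsrc ttgt (tgreen m c y) e ^+ 2.

Lemma cfield_elliptic c : elliptic al be (cfield c).
Proof. by move=> e; apply: vl_itv. Qed.

Lemma flux2_ge0 m c e : 0 <= flux2 m c e.
Proof. exact: sqr_ge0. Qed.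

Lemma dgreen_ge0 m c y e : 0 <= dgreen m c y e.
Proof. exact: sqr_ge0. Qed.

Lemma cfield_upd c e j e' : e' \notin [set e] -> cfield c e' = cfield (upd c e j) e'.
Proof. by rewrite inE /cfield ffunE => /negPf ->. Qed.

Definition shiftc z c : cfg := [ffun e : E => c (e.1 + z, e.2)].

Lemma Ex_shift z (F : cfg -> R) : Ex (fun c => F (shiftc z c)) = Ex F.
Proof.
apply: (@Ex_reindex _ _ _ rho (fun e : E => (e.1 + z, e.2)) (fun e : E => (e.1 - z, e.2)) F).
- by move=> [x i] /=; rewrite addrK.
- by move=> [x i] /=; rewrite subrK.
Qed.

Lemma grd_shift z (u : T -> R) x i :
  grd tsrc ttgt (fun y => u (y + z)) (x, i) = grd tsrc ttgt u (x + z, i).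
Proof. by rewrite /grd /ttgt /tsrc /= addrAC. Qed.

Lemma sum_edges_shift z (F : E -> R) :
  \sum_(e : E) F (e.1 + z, e.2) = \sum_(e : E) F e.
Proof.
by rewrite !sum_edges; apply: eq_bigr => i _; rewrite (sum_shift z (fun x => F (x, i))).
Qed.

Lemma phi_shift m z c x : 0 < m -> phi m (shiftc z c) x = phi m c (x + z).
Proof.
move=> m0; symmetry.
apply: (corrector_char (u := fun x => phi m c (x + z)) al_gt0 m0 (cfield_elliptic _)) => zz.
have := corrector_test tsrc ttgt al_gt0 (fun e => zeta e.2) (fun y => zz (y - z)) m0 (cfield_elliptic c).
congr (_ * _ + _ = _).
  rewrite -(sum_shift z); apply: eq_bigr => y _.
  by rewrite addrK.
rewrite -(sum_edges_shift z); apply: eq_bigr => -[y i] _ /=.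
by rewrite !grd_shift addrK /cfield ffunE.
Qed.

Lemma flux_shift m z c x i : 0 < m -> flux m (shiftc z c) (x, i) = flux m c (x + z, i).
Proof.
move=> m0; rewrite /flux /corr_flux /=; congr (_ + _).
by rewrite -grd_shift /grd -/(phi m _) !phi_shift.
Qed.

Lemma Ex_phi_shift m (g : R -> R) x y : 0 < m ->
  Ex (fun c => g (phi m c x)) = Ex (fun c => g (phi m c y)).
Proof.
move=> m0; rewrite -(Ex_shift (x - y) (fun c => g (phi m c y))).
apply: (mean_ext (Ex_mean _ rho_ge0 rho_sum)) => c.
by rewrite phi_shift // addrC subrK.
Qed.

Lemma Ex_flux_shift m (g : R -> R) x y i : 0 < m ->
  Ex (fun c => g (flux m c (x, i))) = Ex (fun c => g (flux m c (y, i))).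
Proof.
move=> m0; rewrite -(Ex_shift (x - y) (fun c => g (flux m c (y, i)))).
apply: (mean_ext (Ex_mean _ rho_ge0 rho_sum)) => c.
by rewrite flux_shift // addrC subrK.
Qed.

Lemma card_torus_gt0 : (0 : R) < #|{: T}|%:R.
Proof. by rewrite ltr0n; apply/card_gt0P; exists 0. Qed.

Lemma Ex_phi0 m x : 0 < m -> Ex (fun c => phi m c x) = 0.
Proof.
move=> m0; apply: (mulfI (lt0r_neq0 (card_torus_gt0))); rewrite mulr0.
have ExP := Ex_mean E rho_ge0 rho_sum.
rewrite mulr_natl -sumr_const.
rewrite (eq_bigr (fun y => Ex (fun c => phi m c y))); last first.
  by move=> y _; apply: (@Ex_phi_shift m id).
rewrite -(mean_sum ExP) -[RHS](mean0 ExP); apply: (mean_ext ExP) => c.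
have := corrector_test tsrc ttgt al_gt0 (fun e => zeta e.2) (fun=> 1) m0 (cfield_elliptic c).
rewrite [X in _ + X]big1; last by move=> e _; rewrite /grd subrr mulr0.
under eq_bigr do rewrite mulr1.
by rewrite addr0 => /eqP; rewrite mulf_eq0 (gt_eqF m0) /= => /eqP.
Qed.

Hypothesis zeta_le1 : forall i, `|zeta i| <= 1.

Lemma phi_sup m c x : 0 < m -> `|phi m c x| <= be * (2 * d%:R) / m.
Proof.
move=> m0.
have hD y : \sum_(e : E) ((ttgt e == y)%:R + (tsrc e == y)%:R) <= 2 * d%:R :> R.
  by rewrite torus_degree.
have has_max (u : T -> R) : {y | forall z, u z <= u y}.
  case: (@arg_maxP _ R T (0 : T) xpredT u isT) => y _ hy.
  by exists y => z; apply: hy.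
rewrite ler_norml; apply/andP; split.
  have [y hy] := has_max (fun y => - phi m c y).
  have opp_phi : corrector tsrc ttgt (fun e => - zeta e.2) m (cfield c) =1 fun y => - phi m c y.
    move=> z; symmetry; apply: (corrector_char (u := fun y => - phi m c y) al_gt0 m0 (cfield_elliptic c)) => zz.
    have /eqP := corrector_test tsrc ttgt al_gt0 (fun e => zeta e.2) zz m0 (cfield_elliptic c).
    rewrite -oppr_eq0 opprD -mulrN -!sumrN => /eqP h0; rewrite -[RHS]h0.
    congr (_ * _ + _); apply: eq_bigr => t _; rewrite ?mulNr //.
    by rewrite /corr_flux /grd -/(phi m c); ring.
  have := @corrector_max R T E tsrc ttgt al be al_gt0 al_be (fun e => - zeta e.2)
    _ m m0 (cfield c) (cfield_elliptic c) _ y hD.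
  rewrite opp_phi => max_bound; have {max_bound}phi_min : - phi m c y <= be * (2 * d%:R) / m.
    apply: max_bound; first by move=> e; rewrite normrN.
    by move=> z; rewrite !opp_phi.
  by have := hy x; lra.
have [y hy] := has_max (phi m c).
apply: le_trans (hy x) _.
apply: (@corrector_max R T E tsrc ttgt al be al_gt0 al_be (fun e => zeta e.2)
    _ m m0 (cfield c) (cfield_elliptic c) _ y hD) => //.
Qed.

Lemma phi_upd m c e y : 0 < m ->
  (phi m c y - phi m (upd c e j0) y) ^+ 2 <=
  4 * be ^+ 2 * contrast al be * (dgreen m c y e * flux2 m c e).
Proof.
move=> m0; rewrite -sqrrN opprB.
have hB := @cfield_upd c e j0.
have := corrector_diff_point tsrc ttgt al_gt0 (fun e => zeta e.2) y m0 (cfield_elliptic c) (cfield_elliptic _) hB.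
rewrite !big_set1 -/(phi m _) => hh.
apply: (le_trans hh); rewrite -/(dgreen m c y e).
have hB' e' : e' \notin [set e] -> cfield (upd c e j0) e' = cfield c e' by move=> /hB ->.
have := corr_flux_compare tsrc ttgt al_gt0 al_be (fun e => zeta e.2) m0 (cfield_elliptic (upd c e j0)) (cfield_elliptic c) hB'.
rewrite !big_set1 => h2.
have -> : 4 * be ^+ 2 * contrast al be * (dgreen m c y e * flux2 m c e) =
   be ^+ 2 * (4 * contrast al be * flux2 m c e) * dgreen m c y e by ring.
apply: ler_wpM2r; first exact: dgreen_ge0.
by apply: ler_wpM2l; first exact: sqr_ge0.
Qed.

Lemma phi_moment m y p : 0 < m ->
  Ex (fun c => phi m c y ^+ (2 * p.+1)) <=
  (384 * be ^+ 2 * contrast al be * p.+1%:R ^+ 2) ^+ p.+1 *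
  Ex (fun c => (\sum_e dgreen m c y e * flux2 m c e) ^+ p.+1).
Proof.
move=> m0; have ExP := Ex_mean E rho_ge0 rho_sum.
pose K := 4 * be ^+ 2 * contrast al be.
pose V c := K * \sum_e dgreen m c y e * flux2 m c e.
have hV c : \sum_(e <- enum {: E}) (phi m c y - phi m (upd c e j0) y) ^+ 2 <= V c.
  rewrite /V mulr_sumr big_enum /=; apply: ler_sum => e _; exact: phi_upd.
have := efron_stein_moment rho_ge0 rho_sum p (enum_uniq _) hV.
rewrite [X in X <= _ -> _](mean_ext ExP (g := fun c => phi m c y ^+ (2 * p.+1))); last first.
  by move=> c; rewrite avg_enum // Ex_phi0 // subr0.
move=> hh; apply: (le_trans hh).
rewrite (mean_ext ExP (fun c => exprMn _ _ _)) (meanZ ExP) mulrA -exprMn.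
by apply: eq_leW; rewrite /K; congr (_ ^+ _ * _); ring.
Qed.

Lemma flux2_power m c e p : flux2 m c e ^+ p <=
  4 ^+ p * (1 + grd tsrc ttgt (phi m c) e ^+ (2 * p)).
Proof.
rewrite /flux2 -exprM /flux /corr_flux -expr_double.
have x0 : 0 <= `|zeta e.2| by [].
have h1 := zeta_le1 e.2; set g := grd _ _ _ e.
apply: le_trans (_ : (1 + `|g|) ^+ (2 * p) <= _).
  rewrite lerXn2r ?nnegrE; nonneg.
  by apply: le_trans (ler_normD _ _) _; rewrite lerD2r.
have -> : (4 : R) ^+ p = 2 ^+ (2 * p).
  by rewrite exprM; congr (_ ^+ p); rewrite -natrX.
by apply: le_trans (exprD_le _ _ _) _ => //; rewrite expr1n expr_double.
Qed.

Lemma flux2_moment_step m x i p y : 0 < m ->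
  Ex (fun c => flux2 m c (x, i) ^+ p.+1) <=
  4 ^+ p.+1 * (1 + 4 * 4 ^+ p * (be * ((2 * p).+1%:R * 16 ^+ p) / al) ^+ 2 *
    (2 * d%:R) * Ex (fun c => phi m c y ^+ (2 * p))).
Proof.
move=> m0; have ExP := Ex_mean E rho_ge0 rho_sum.
set C := 4 * 4 ^+ p * _ ^+ 2.
have C0 : 0 <= C by rewrite /C; nonneg.
pose g c e := grd tsrc ttgt (phi m c) e ^+ (2 * p.+1).
have g0 c e : 0 <= g c e by exact: expr_double_ge0.
have flux2_le_grad : Ex (fun c => flux2 m c (x, i) ^+ p.+1) <= 4 ^+ p.+1 * (1 + Ex (fun c => g c (x, i))).
  apply: le_trans (_ : Ex (fun c => 4 ^+ p.+1 * (1 + g c (x, i))) <= _).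
    by apply: (mean_mono ExP) => c; apply: flux2_power.
  by rewrite (meanZ ExP) (meanD ExP) (mean_cst ExP).
apply: (le_trans flux2_le_grad); rewrite ler_wpM2l ?exprn_ge0 // lerD2l.
rewrite -(ler_pM2l (card_torus_gt0)).
have -> : #|{: T}|%:R * Ex (fun c => g c (x, i)) = \sum_z Ex (fun c => g c (z, i)).
  rewrite mulr_natl -sumr_const; apply: eq_bigr => z _.
  rewrite (@mean_ext _ _ _ _ ExP _ (fun c => (flux m c (x, i) - zeta i) ^+ (2 * p.+1))); last first.
    by move=> c; rewrite /flux /corr_flux /= addrC addKr.
  rewrite (Ex_flux_shift (fun t => (t - zeta i) ^+ (2 * p.+1)) x z) //.
  by apply: (mean_ext ExP) => c; rewrite /flux /corr_flux /= addrC addKr.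
apply: le_trans (_ : Ex (fun c => \sum_e g c e) <= _).
  rewrite -(mean_sum ExP); apply: (mean_mono ExP) => c.
  rewrite sum_edges (bigD1 i) //= lerDl; nonneg; exact: g0.
apply: le_trans (_ : Ex (fun c => C * \sum_e
    (phi m c (ttgt e) ^+ (2 * p) + phi m c (tsrc e) ^+ (2 * p))) <= _).
  apply: (mean_mono ExP) => c.
  have xl (e : E) : `|zeta e.2| <= 1 by [].
  exact: (corrector_grad_power tsrc ttgt al_gt0 xl m0 (cfield_elliptic c) p).
rewrite (meanZ ExP).
have -> : Ex (fun c => \sum_(e : E) (phi m c (ttgt e) ^+ (2 * p) + phi m c (tsrc e) ^+ (2 * p))) =
   #|{: T}|%:R * (2 * d%:R * Ex (fun c => phi m c y ^+ (2 * p))).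
  rewrite (mean_sum ExP) sum_edges.
  rewrite (eq_bigr (fun=> #|{: T}|%:R * (2 * Ex (fun c => phi m c y ^+ (2 * p))))).
    by rewrite sumr_const card_ord -mulr_natl; ring.
  move=> k _; rewrite mulr_natl -sumr_const; apply: eq_bigr => z _.
  rewrite (meanD ExP) mulr_natl mulr2n.
  by rewrite (Ex_phi_shift (fun t => t ^+ (2 * p)) (ttgt (z, k)) y) //
    (Ex_phi_shift (fun t => t ^+ (2 * p)) (tsrc (z, k)) y).
apply: eq_leW; ring.
Qed.

End Torus.

(** * Hardy's inequality on the torus in dimension at least three *)

Section CenteredLift.
Variables (R : realFieldType) (d h : nat) (h_gt0 : (0 < h)%N).
Local Notation T := (torus d h).
Implicit Types (t : 'I_(2 * h).+1) (x y z : T) (i k : 'I_d).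

Definition clift t : R := if (t <= h)%N then t%:R else t%:R - (2 * h).+1%:R.

Lemma cliftS t : clift (t + inZp 1) =
  if clift t == h%:R then - h%:R else clift t + 1.
Proof.
have hv : (t + inZp 1 : 'I_(2 * h).+1) = (t.+1 %% (2 * h).+1)%N :> nat.
  by rewrite /= [(1 %% _)%N]modn_small ?addn1 //; lia.
have lt := ltn_ord t.
rewrite /clift hv.
have [th|th] := leqP t h.
  rewrite modn_small; last by lia.
  rewrite eqr_nat; case: eqP => [->|ne].
    by rewrite ltnn -!natr1 natrM; ring.
  by rewrite (_ : t < h)%N ?natr1 //; lia.
have -> : (t%:R - (2 * h).+1%:R == h%:R :> R) = false.
  by rewrite subr_eq -natrD eqr_nat; apply/negP => /eqP; lia.
have [e|e] := eqVneq (t : nat) (2 * h)%N.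
  by rewrite e modnn /= -natr1; ring.
rewrite modn_small; last by lia.
by rewrite ifF -?natr1; [ring|lia].
Qed.

Lemma clift_bound t : - h%:R <= clift t <= h%:R.
Proof.
rewrite /clift; have lt := ltn_ord t; case: leqP => th.
  by rewrite ler_nat th andbT (le_trans _ (ler0n _ _)) // oppr_le0 ler0n.
have k1 : (h.+1%:R : R) <= t%:R by rewrite ler_nat.
have k2 : (t%:R : R) <= (2 * h)%:R by rewrite ler_nat.
have k3 : (0 : R) <= h%:R by [].
by move: k1 k2; rewrite -!natr1 natrM; lra.
Qed.

Lemma cliftB t : clift (t - inZp 1) =
  if clift t == - h%:R then h%:R else clift t - 1.
Proof.
have H s : clift s = if clift (s + inZp 1) == - h%:R then h%:R else clift (s + inZp 1) - 1.
  rewrite cliftS; have [e|ne] := eqVneq (clift s) h%:R; first by rewrite eqxx.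
  have := clift_bound s => /andP[lo hi].
  case: eqP => [e|_]; last by ring.
  by lra.
by rewrite H subrK.
Qed.

Lemma clift0 : clift 0 = 0.
Proof. by []. Qed.

Definition ccoord i x : R := clift (x i).

Definition sqnorm x : R := \sum_i ccoord i x ^+ 2.

Lemma sqnorm_ge0 x : 0 <= sqnorm x.
Proof. by rewrite /sqnorm; nonneg. Qed.

Lemma ccoord_le_sqnorm i x : ccoord i x ^+ 2 <= sqnorm x.
Proof. by rewrite /sqnorm (bigD1 i) //= lerDl; nonneg. Qed.

Lemma ccoord_stp i x : ccoord i (x + stp h i) = if ccoord i x == h%:R then - h%:R else ccoord i x + 1.
Proof. by rewrite /ccoord !ffunE eqxx cliftS. Qed.

Lemma ccoord_stpB i x : ccoord i (x - stp h i) = if ccoord i x == - h%:R then h%:R else ccoord i x - 1.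
Proof. by rewrite /ccoord !ffunE eqxx cliftB. Qed.

Lemma ccoord_stp_ne i k x : k != i -> ccoord k (x + stp h i) = ccoord k x.
Proof. by move=> /negPf ki; rewrite /ccoord !ffunE ki addr0. Qed.

Lemma sqnorm_stp i x : sqnorm (x + stp h i) = sqnorm x + (ccoord i (x + stp h i) ^+ 2 - ccoord i x ^+ 2).
Proof.
rewrite /sqnorm (bigD1 i) //= [in RHS](bigD1 i) //=.
rewrite (eq_bigr (fun k => ccoord k x ^+ 2)); first by ring.
by move=> k ki; rewrite ccoord_stp_ne.
Qed.

Lemma sqnorm_stpB i x : sqnorm (x - stp h i) = sqnorm x + (ccoord i (x - stp h i) ^+ 2 - ccoord i x ^+ 2).
Proof. by have := sqnorm_stp i (x - stp h i); rewrite subrK => ->; ring. Qed.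

Lemma sqnorm_stp_diff_sqr i x : (sqnorm (x + stp h i) - sqnorm x) ^+ 2 <= 8 * sqnorm x + 2.
Proof.
rewrite sqnorm_stp addrC addKr ccoord_stp; have := ccoord_le_sqnorm i x.
set c := ccoord i x; case: eqP => [ch|_] c_le.
  by rewrite sqrrN ch subrr expr0n /=; have := sqnorm_ge0 x; lra.
by have := sqr_ge0 (2 * c - 1); nra.
Qed.

(** Wrapping around the torus leaves [sqnorm] unchanged. *)
Lemma sqnorm_stp_le i x : sqnorm (x + stp h i) <= 2 * sqnorm x + 2.
Proof.
rewrite sqnorm_stp ccoord_stp; have := ccoord_le_sqnorm i x; have := sqnorm_ge0 x.
by case: eqP => [->|_]; have := sqr_ge0 (ccoord i x - 1); nra.
Qed.

Lemma sqnorm_stp_ge i x : sqnorm x <= 2 * sqnorm (x + stp h i) + 2.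
Proof.
have := sqnorm_stp i x; have := ccoord_le_sqnorm i (x + stp h i); rewrite ccoord_stp.
have := sqnorm_ge0 x; have := sqnorm_ge0 (x + stp h i).
by case: eqP => [->|_]; have := sqr_ge0 (ccoord i x + 2); nra.
Qed.

End CenteredLift.

Lemma sum_cst_ord (R : realFieldType) d (x : R) : \sum_(i < d) x = d%:R * x.
Proof. by rewrite sumr_const card_ord mulr_natl. Qed.

Section Hardy.
Variables (R : realFieldType) (d h : nat).
Hypotheses (d3 : (3 <= d)%N) (h_gt1 : (1 < h)%N).
Local Notation T := (torus d h).
Implicit Types (x y z : T) (i : 'I_d) (u : T -> R).

Let h_gt0 : (0 < h)%N. Proof. exact: ltnW. Qed.

Local Notation ccoord := (@ccoord R d h).
Local Notation sqnorm := (@sqnorm R d h).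

Definition hweight x : R := (sqnorm x + 16)^-1.

Lemma hweight_gt0 x : 0 < hweight x.
Proof. by rewrite invr_gt0; have := sqnorm_ge0 R x; lra. Qed.

Lemma hweight_stp i x : hweight (x + stp h i) <= 2 * hweight x /\ hweight x <= 2 * hweight (x + stp h i).
Proof.
have n1 := sqnorm_ge0 R x; have n2 := sqnorm_ge0 R (x + stp h i).
have l1 := sqnorm_stp_le R h_gt0 i x; have l2 := sqnorm_stp_ge R h_gt0 i x.
rewrite /hweight; split; rewrite -[2]invrK -invfM lef_pV2 ?posrE; lra.
Qed.

Definition vfield i x : R := ccoord i x * hweight x.

Lemma vfield_sqr i x : vfield i x ^+ 2 <= hweight x.
Proof.
rewrite /vfield exprMn [hweight x ^+ 2]expr2 mulrA ger_pMl ?hweight_gt0 //.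
rewrite /hweight ler_pdivrMr; last by have := sqnorm_ge0 R x; lra.
by have := ccoord_le_sqnorm R i x; lra.
Qed.

Lemma radial_difference_ge (c Q : R) : c ^+ 2 + 16 <= Q ->
  (2 * (Q + 1) - 4 * c ^+ 2) / (Q + 1) ^+ 2 - 16 * c ^+ 2 / (Q + 1) ^+ 3 <=
  (c + 1) / (Q + 2 * c + 1) - (c - 1) / (Q - 2 * c + 1).
Proof.
move=> cQ; have c0 := sqr_ge0 c.
have p1 : 0 < Q + 2 * c + 1 by have := sqr_ge0 (c + 1); nra.
have p2 : 0 < Q - 2 * c + 1 by have := sqr_ge0 (c - 1); nra.
set P := Q + 1; set N := 2 * P - 4 * c ^+ 2.
have P0 : 0 < P by rewrite /P; lra.
set D := P ^+ 2 - 4 * c ^+ 2.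
have -> : (c + 1) / (Q + 2 * c + 1) - (c - 1) / (Q - 2 * c + 1) = N / D.
  have D0 : D = (Q + 2 * c + 1) * (Q - 2 * c + 1) by rewrite /D /P; ring.
  rewrite D0 /N /P; field.
  by apply/andP; split; rewrite gt_eqF.
have DP : P ^+ 2 / 2 <= D by rewrite /D /P; nra.
have D0 : 0 < D by apply: lt_le_trans DP; rewrite divr_gt0 ?exprn_gt0.
have -> : N / P ^+ 2 - 16 * c ^+ 2 / P ^+ 3 = (N * P - 16 * c ^+ 2) / P ^+ 3.
  by field; rewrite gt_eqF.
rewrite ler_pdivrMr ?exprn_gt0 // mulrAC ler_pdivlMr //.
have N1 : - (2 * P) <= N by rewrite /N /P; nra.
have e : N * P ^+ 3 - (N * P - 16 * c ^+ 2) * D =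
   4 * c ^+ 2 * (P * N) + 16 * c ^+ 2 * D by rewrite /D; ring.
rewrite -subr_ge0 e.
have h1 : - (2 * P ^+ 2) <= P * N by have := ler_wpM2l (ltW P0) N1; nra.
have h2 : 0 <= c ^+ 2 * (4 * (P * N) + 16 * D) by apply: mulr_ge0 => //; lra.
by lra.
Qed.

Lemma wrap_ratio_le (t Q H : R) : 2 <= H -> t ^+ 2 + 16 <= Q -> H - 1 <= `|t| ->
  `|t / Q| <= 2 / H.
Proof.
move=> H2 tQ tH; have Q_gt0 : 0 < Q by have := sqr_ge0 t; lra.
rewrite normrM normfV (gtr0_norm Q_gt0) ler_pdivrMr // mulrAC ler_pdivlMr; last by lra.
rewrite -(real_normK (num_real t)) in tQ.
have : 0 <= (`|t| - (H - 1)) * `|t| by apply: mulr_ge0 => //; lra.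
by nra.
Qed.

(* At a coordinate where the torus wraps around, [c ^+ 2 = H ^+ 2] and both values of the
   field are of order [H^-1]. *)
Lemma wrap_difference_ge (c Q H t t' S S' : R) : 2 <= H -> c ^+ 2 = H ^+ 2 -> c ^+ 2 + 16 <= Q ->
  t ^+ 2 + 16 <= S -> t' ^+ 2 + 16 <= S' -> H - 1 <= `|t| -> H - 1 <= `|t'| ->
  (2 * (Q + 1) - 4 * c ^+ 2) / (Q + 1) ^+ 2 - 16 * c ^+ 2 / (Q + 1) ^+ 3 - 8 / H <=
  t / S - t' / S'.
Proof.
move=> H2 cH cQ tS tS' tH tH'.
have := wrap_ratio_le H2 tS tH; have := wrap_ratio_le H2 tS' tH'.
rewrite !ler_norml => /andP[lo' hi'] /andP[lo hi].
have c_ge0 := sqr_ge0 c; have Q1 : 0 < Q + 1 by lra.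
have : 2 / (Q + 1) <= 2 / H.
  have HQ : H <= Q + 1 by rewrite cH in cQ; nra.
  by rewrite ler_pM2l // lef_pV2 ?posrE //; lra.
have : (2 * (Q + 1) - 4 * c ^+ 2) / (Q + 1) ^+ 2 <= 2 / (Q + 1).
  have -> : 2 / (Q + 1) = 2 * (Q + 1) / (Q + 1) ^+ 2 by field; rewrite gt_eqF.
  by rewrite ler_pM2r ?invr_gt0 ?exprn_gt0 //; lra.
have : 0 <= 16 * c ^+ 2 / (Q + 1) ^+ 3 by nonneg.
have -> : 8 / H = 4 * (2 / H) by field; rewrite gt_eqF //; lra.
by lra.
Qed.

Lemma vfield_div_coord i x :
  (2 * (sqnorm x + 17) - 4 * ccoord i x ^+ 2) / (sqnorm x + 17) ^+ 2
   - 16 * ccoord i x ^+ 2 / (sqnorm x + 17) ^+ 3 - 8 / h%:R <=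
  vfield i (x + stp h i) - vfield i (x - stp h i).
Proof.
have H2 : (2 : R) <= h%:R by rewrite (ler_nat R 2).
have c_le := ccoord_le_sqnorm R i x; have sq_ge0 := sqnorm_ge0 R x.
rewrite /vfield /hweight sqnorm_stp // sqnorm_stpB // ccoord_stp // ccoord_stpB //.
set c := ccoord i x in c_le *; set Q := sqnorm x + 16.
have cQ : c ^+ 2 + 16 <= Q by rewrite /Q; lra.
have -> : sqnorm x + 17 = Q + 1 by rewrite /Q; ring.
case: eqP => [ch|_]; case: eqP => [ch'|_]; first by exfalso; lra.
- apply: wrap_difference_ge; rewrite ?ch //.
  + by move: c_le; rewrite ?ch ?sqrrN /Q; lra.
  + by move: c_le; rewrite ?ch ?sqrrN /Q; lra.
  + by move: c_le; rewrite ?ch ?sqrrN /Q; lra.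
  + by rewrite normrN ger0_norm; lra.
  + by rewrite ger0_norm; lra.
- apply: wrap_difference_ge; rewrite ?ch' ?sqrrN //.
  + by move: c_le; rewrite ?ch' ?sqrrN /Q; lra.
  + by move: c_le; rewrite ?ch' ?sqrrN /Q; lra.
  + by move: c_le; rewrite ?ch' ?sqrrN /Q; lra.
  + by rewrite (_ : - h%:R + 1 = - (h%:R - 1)) ?normrN ?ger0_norm; lra.
  + by rewrite ger0_norm; lra.
have -> : sqnorm x + ((c + 1) ^+ 2 - c ^+ 2) + 16 = Q + 2 * c + 1 by rewrite /Q; ring.
have -> : sqnorm x + ((c - 1) ^+ 2 - c ^+ 2) + 16 = Q - 2 * c + 1 by rewrite /Q; ring.
by apply: le_trans (radial_difference_ge cQ); rewrite gerBl; nonneg.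
Qed.

Lemma vfield_div x :
  hweight x / 2 - 8 * d%:R / h%:R <=
  \sum_i (vfield i (x + stp h i) - vfield i (x - stp h i)).
Proof.
apply: le_trans (_ : \sum_i ((2 * (sqnorm x + 17) - 4 * ccoord i x ^+ 2) / (sqnorm x + 17) ^+ 2
   - 16 * ccoord i x ^+ 2 / (sqnorm x + 17) ^+ 3 - 8 / h%:R) <= _); last first.
  by apply: ler_sum => i _; apply: vfield_div_coord.
have n0 := sqnorm_ge0 R x.
set Q := sqnorm x + 17; have Q17 : 17 <= Q by rewrite /Q; lra.
have -> : \sum_i ((2 * Q - 4 * ccoord i x ^+ 2) / Q ^+ 2
   - 16 * ccoord i x ^+ 2 / Q ^+ 3 - 8 / h%:R) =
   (2 * d%:R * Q - 4 * sqnorm x) / Q ^+ 2 - 16 * sqnorm x / Q ^+ 3 - 8 * d%:R / h%:R.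
  rewrite (eq_bigr (fun i => (2 * Q / Q ^+ 2 - 8 / h%:R) +
     (- (4 / Q ^+ 2) - 16 / Q ^+ 3) * ccoord i x ^+ 2)); last by move=> i _; ring.
  rewrite big_split /= sum_cst_ord -mulr_sumr -/(sqnorm x); ring.
rewrite lerD2r.
have D3 : (3 : R) <= d%:R by rewrite (ler_nat R 3).
have Q0 : 0 < Q by lra.
apply: le_trans (_ : (2 * Q) / Q ^+ 2 - 16 * Q / Q ^+ 3 <= _); last first.
  apply: lerB; rewrite ler_pM2r ?invr_gt0 ?exprn_gt0 //; rewrite /Q; nra.
have -> : 2 * Q / Q ^+ 2 - 16 * Q / Q ^+ 3 = (2 * Q - 16) / Q ^+ 2.
  by field; rewrite gt_eqF.
have -> : hweight x / 2 = (2 * (Q - 1))^-1.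
  by rewrite /hweight -invfM /Q; congr (_^-1); ring.
rewrite ler_pdivlMr ?exprn_gt0 // mulrC ler_pdivrMr; last by lra.
nra.
Qed.

Lemma vfield_by_parts u i :
  \sum_x u x ^+ 2 * (vfield i (x + stp h i) - vfield i (x - stp h i)) =
  - \sum_x (vfield i x + vfield i (x + stp h i)) *
      (u (x + stp h i) - u x) * (u (x + stp h i) + u x).
Proof.
transitivity (\sum_x (u x ^+ 2 * vfield i (x + stp h i) + u x ^+ 2 * vfield i x) -
    \sum_x (u x ^+ 2 * vfield i x + u x ^+ 2 * vfield i (x - stp h i))).
  by rewrite -sumrB; apply: eq_bigr => x _; ring.
rewrite -[X in _ - X](sum_shift (stp h i)) -sumrB -sumrN; apply: eq_bigr => x _.
by rewrite addrK; ring.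
Qed.

Lemma vfield_edge_le u i x (b : R) : 0 < b ->
  - ((vfield i x + vfield i (x + stp h i)) * (u (x + stp h i) - u x) * (u (x + stp h i) + u x)) <=
  (8 * b)^-1 * (u x ^+ 2 * hweight x + u (x + stp h i) ^+ 2 * hweight (x + stp h i)) +
  24 * b * (u (x + stp h i) - u x) ^+ 2.
Proof.
move=> b_gt0; set x' := x + stp h i.
have [near near'] := hweight_stp i x; rewrite -/x' in near near'.
have := vfield_sqr i x; have := vfield_sqr i x'.
set F := vfield i x; set F' := vfield i x'; set w := u x; set w' := u x' => F'_le F_le.
set p := hweight x in near near' F_le *; set p' := hweight x' in near near' F'_le *.
set Y := w ^+ 2 * p + w' ^+ 2 * p'.
have product_le : (F + F') ^+ 2 * (w' + w) ^+ 2 <= 12 * Y.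
  have F_sum : (F + F') ^+ 2 <= 2 * (p + p') by have := sqrrD_le F F'; lra.
  have w_sum : (w' + w) ^+ 2 <= 2 * (w ^+ 2 + w' ^+ 2) by have := sqrrD_le w' w; lra.
  have := ler_pM (sqr_ge0 _) (sqr_ge0 _) F_sum w_sum.
  have : w ^+ 2 * p' <= w ^+ 2 * (2 * p) by rewrite ler_wpM2l ?sqr_ge0.
  have : w' ^+ 2 * p <= w' ^+ 2 * (2 * p') by rewrite ler_wpM2l ?sqr_ge0.
  by rewrite /Y; lra.
have young : - ((F + F') * (w' - w) * (w' + w)) <=
   (96 * b)^-1 * ((F + F') ^+ 2 * (w' + w) ^+ 2) + 24 * b * (w' - w) ^+ 2.
  rewrite -subr_ge0 [X in 0 <= X](_ : _ =
    (96 * b)^-1 * ((F + F') * (w' + w) + 48 * b * (w' - w)) ^+ 2); first by nonneg.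
  by field; rewrite gt_eqF.
apply: (le_trans young); rewrite lerD2r.
have b96 : 0 <= (96 * b)^-1 by nonneg.
apply: le_trans (ler_wpM2l b96 product_le) _; apply: eq_leW.
by rewrite -/Y; field; rewrite gt_eqF.
Qed.

Lemma vfield_coord_le u i (b : R) : 0 < b ->
  \sum_x u x ^+ 2 * (vfield i (x + stp h i) - vfield i (x - stp h i)) <=
  (\sum_x u x ^+ 2 * hweight x) / (4 * b) + 24 * b * \sum_(x : T) (u (x + stp h i) - u x) ^+ 2.
Proof.
move=> b_gt0; rewrite vfield_by_parts -sumrN.
apply: le_trans (ler_sum _ (fun x _ => vfield_edge_le u i x b_gt0)) _.
rewrite big_split /= -!mulr_sumr big_split /=.
rewrite (sum_shift (stp h i) (fun x => u x ^+ 2 * hweight x)) lerD2r.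
by apply: eq_leW; field; rewrite gt_eqF.
Qed.

Lemma hardy u :
  \sum_x u x ^+ 2 * hweight x <=
  96 * d%:R * (\sum_e grd (@tsrc d h) (@ttgt d h) u e ^+ 2) +
  32 * d%:R / h%:R * \sum_x u x ^+ 2.
Proof.
have d_gt0 : (0 : R) < d%:R by rewrite ltr0n; lia.
set A := \sum_x u x ^+ 2 * hweight x; set B := \sum_e _; set C := \sum_x _.
have lower : A / 2 - 8 * d%:R / h%:R * C <=
   \sum_x u x ^+ 2 * \sum_i (vfield i (x + stp h i) - vfield i (x - stp h i)).
  rewrite /A /C mulr_suml mulr_sumr -sumrB; apply: ler_sum => x _.
  have := ler_wpM2l (sqr_ge0 (u x)) (vfield_div x).
  by rewrite mulrBr; lra.
have upper : \sum_x u x ^+ 2 * \sum_i (vfield i (x + stp h i) - vfield i (x - stp h i)) <=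
   A / 4 + 24 * d%:R * B.
  under eq_bigr => x _ do rewrite mulr_sumr.
  rewrite exchange_big /=.
  apply: le_trans (ler_sum _ (fun i _ => vfield_coord_le u i d_gt0)) _.
  rewrite big_split /= sum_cst_ord -mulr_sumr /B sum_edges lerD2r -/A.
  by apply: eq_leW; field; rewrite gt_eqF.
have -> : 32 * d%:R / h%:R * C = 4 * (8 * d%:R / h%:R * C) by ring.
by lra.
Qed.

Lemma hardy_center y u :
  \sum_x u x ^+ 2 * hweight (x - y) <=
  96 * d%:R * (\sum_e grd (@tsrc d h) (@ttgt d h) u e ^+ 2) +
  32 * d%:R / h%:R * \sum_x u x ^+ 2.
Proof.
have := hardy (fun x => u (x + y)).
rewrite (sum_shift y (fun x => u x ^+ 2)).
rewrite -(sum_shift y (fun x => u x ^+ 2 * hweight (x - y))).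
under [X in _ -> X <= _]eq_bigr => x _ do rewrite addrK.
rewrite -(sum_edges_shift y (fun e => grd (@tsrc d h) (@ttgt d h) u e ^+ 2)).
rewrite [X in _ <= _ * X + _ -> _](eq_bigr (fun e : T * 'I_d =>
  grd (@tsrc d h) (@ttgt d h) u (e.1 + y, e.2) ^+ 2)) //.
by move=> [x i] _; rewrite grd_shift.
Qed.

End Hardy.

(** * Decay of the Green function in dimension at least three *)

Section Cutoff.
Variable R : realFieldType.

Definition clamp (t : R) : R := if t <= 0 then 0 else if 1 <= t then 1 else t.

Lemma clamp_lip s t : (clamp s - clamp t) ^+ 2 <= (s - t) ^+ 2.
Proof.
wlog st : s t / s <= t.
  move=> H; have [/H//|/ltW/H] := leP s t.
  by rewrite -sqrrN opprB -[leRHS]sqrrN opprB.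
have : 0 <= clamp t - clamp s <= t - s.
  rewrite /clamp; have [s1|s1] := leP s 0; have [t1|t1] := leP t 0;
  have [s2|s2] := leP 1 s; have [t2|t2] := leP 1 t; by apply/andP; split; lra.
move=> /andP[p q]; have -> : (clamp s - clamp t) ^+ 2 = (clamp t - clamp s) ^+ 2 by ring.
have -> : (s - t) ^+ 2 = (t - s) ^+ 2 by ring.
by rewrite lerXn2r ?nnegrE //; lra.
Qed.

Lemma clamp0 t : t <= 0 -> clamp t = 0.
Proof. by rewrite /clamp => ->. Qed.

Lemma clamp1 t : 1 <= t -> clamp t = 1.
Proof. by move=> h; rewrite /clamp h; case: leP => //; lra. Qed.

End Cutoff.

Section LocalEnergy.
Variables (R : realFieldType) (T E : finType) (src tgt : E -> T).

(** [Du D(eta^2 u) = (D(eta u))^2 - u u' (D eta)^2] along each edge. *)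
Lemma cutoff_identity (a : E -> R) (u eta : T -> R) :
  \sum_e a e * grd src tgt u e * grd src tgt (fun x => eta x ^+ 2 * u x) e =
  \sum_e a e * grd src tgt (fun x => eta x * u x) e ^+ 2 -
  \sum_e a e * (u (src e) * u (tgt e) * grd src tgt eta e ^+ 2).
Proof.
by rewrite -sumrB; apply: eq_bigr => e _; rewrite /grd; ring.
Qed.

End LocalEnergy.

Section GreenDecay.
Variables (R : realFieldType) (d h : nat).
Hypotheses (d3 : (3 <= d)%N) (h_gt1 : (1 < h)%N).
Variables (al be : R) (al_gt0 : 0 < al) (al_be : al <= be).
Variables (m : R) (m_gt0 : 0 < m) (m_large : 32 * d%:R <= m * h%:R).
Local Notation T := (torus d h).
Local Notation E := (T * 'I_d)%type.
Local Notation src := (@tsrc d h).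
Local Notation tgt := (@ttgt d h).
Local Notation sqnorm := (@sqnorm R d h).
Local Notation hweight := (@hweight R d h).
Variables (a : E -> R) (ea : elliptic al be a) (y : T).
Implicit Types (x z : T) (u : T -> R) (e : E).

Let h_gt0 : (0 < h)%N. Proof. exact: ltnW. Qed.

Let hR_ge2 : (2 : R) <= h%:R. Proof. by rewrite (ler_nat R 2). Qed.

Let dR_ge3 : (3 : R) <= d%:R. Proof. by rewrite (ler_nat R 3). Qed.

Let a_ge0 e : 0 <= a e.
Proof. by apply: le_trans (ltW al_gt0) _; have /andP[] := ea e. Qed.

Definition energy u := \sum_e a e * grd src tgt u e ^+ 2 + m * \sum_x u x ^+ 2.

Definition coercivity : R := 1 + al^-1.

Lemma coercivity_ge1 : 1 <= coercivity.
Proof. by rewrite /coercivity lerDl invr_ge0 ltW. Qed.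

Lemma energy_grad u : \sum_e grd src tgt u e ^+ 2 + m * \sum_x u x ^+ 2 <= coercivity * energy u.
Proof.
have a0 := al_gt0; have A : al * \sum_e grd src tgt u e ^+ 2 <= \sum_e a e * grd src tgt u e ^+ 2.
  rewrite mulr_sumr; apply: ler_sum => e _; apply: ler_wpM2r; first exact: sqr_ge0.
  by have /andP[] := ea e.
have M0 : 0 <= m * \sum_x u x ^+ 2 by nonneg.
rewrite /coercivity /energy; move: A M0; set X := \sum_e grd _ _ _ _ ^+ 2.
set Y := \sum_e a e * _; set M := m * _ => A M0.
have X0 : 0 <= X by rewrite /X; nonneg.
have i0 : 0 <= al^-1 by rewrite invr_ge0 ltW.
have := ler_wpM2l i0 A; rewrite mulKf ?gt_eqF // => A'.
have : 0 <= al * X by nonneg.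
have : 0 <= al^-1 * M by nonneg.
by rewrite mulrDl !mulrDr !mul1r; lra.
Qed.

Lemma hardy_energy z u : \sum_x u x ^+ 2 * hweight (x - z) <= 96 * d%:R * coercivity * energy u.
Proof.
apply: le_trans (hardy_center d3 h_gt1 z u) _.
apply: le_trans (_ : 96 * d%:R *
    (\sum_e grd src tgt u e ^+ 2 + m * \sum_x u x ^+ 2) <= _); last first.
  by rewrite -[leRHS]mulrA; apply: ler_wpM2l; [nonneg|exact: energy_grad].
rewrite mulrDr lerD2l.
have h0 := hR_ge2; have d0 := dR_ge3.
have : 32 * d%:R / h%:R <= m by rewrite ler_pdivrMr //; lra.
move=> k; set S := \sum_x _; have S0 : 0 <= S by rewrite /S; nonneg.
have k2 := ler_wpM2r S0 k; apply: (le_trans k2).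
have mS : 0 <= m * S by nonneg.
by nra.
Qed.

Let G := green src tgt m a y.

Lemma energy_green : energy G = G y.
Proof. by rewrite /energy addrC (green_energy src tgt al_gt0 y m_gt0 ea). Qed.

Definition green_diag_bound : R := 16 * (96 * d%:R * coercivity).

Lemma green_diag_bound_ge1 : 1 <= green_diag_bound.
Proof. by rewrite /green_diag_bound; have := coercivity_ge1; have := dR_ge3; nra. Qed.

Lemma green_diag : 0 <= G y <= green_diag_bound.
Proof.
have g0 : 0 <= G y.
  rewrite -energy_green /energy; apply: addr_ge0; last by nonneg.
  by apply: sumr_ge0 => e _; apply: mulr_ge0; [exact: a_ge0|exact: sqr_ge0].
rewrite g0 /=.
have := hardy_energy y G; rewrite energy_green.
have : G y ^+ 2 / 16 <= \sum_x G x ^+ 2 * hweight (x - y).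
  rewrite (bigD1 y) //= subrr /hweight.
  have -> : sqnorm 0 = 0.
    by rewrite /sqnorm big1 // => i _; rewrite /ccoord ffunE clift0 expr0n.
  rewrite add0r lerDl; apply: sumr_ge0 => x _; apply: mulr_ge0; first exact: sqr_ge0.
  exact/ltW/hweight_gt0.
move=> /le_trans H /H; rewrite ler_pdivrMr //.
have [->|gn] := eqVneq (G y) 0; first by move=> _; have := green_diag_bound_ge1; lra.
have gp : 0 < G y by rewrite lt_def gn.
rewrite expr2 => k; rewrite -(ler_pM2r gp); apply: (le_trans k).
by rewrite /green_diag_bound; lra.
Qed.

Definition green_density x : R := G x ^+ 2 * hweight (x - y) + \sum_i grd src tgt G (x, i) ^+ 2.

Lemma green_density_ge0 x : 0 <= green_density x.
Proof.
rewrite /green_density; apply: addr_ge0; last by nonneg.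
by apply: mulr_ge0; [exact: sqr_ge0|exact/ltW/hweight_gt0].
Qed.

Definition green_tail k : R := \sum_(x : T | 16 ^+ k <= sqnorm (x - y)) green_density x.

Definition hole_const : R := 97 * 200 * d%:R ^+ 2 * be * coercivity.

Lemma hole_const_ge0 : 0 <= hole_const.
Proof. by rewrite /hole_const; have := coercivity_ge1; have := al_gt0; have := al_be => ? ? ?; nonneg; lra. Qed.

Lemma energy_cutoff (eta : T -> R) : eta y = 0 ->
  energy (fun x => eta x * G x) =
  \sum_e a e * (G (src e) * G (tgt e) * grd src tgt eta e ^+ 2).
Proof.
move=> eta_y; have := greenP src tgt al_gt0 y (fun x => eta x ^+ 2 * G x) m_gt0 ea.
rewrite -/G eta_y expr0n mul0r cutoff_identity /energy.
have -> : \sum_x G x * (eta x ^+ 2 * G x) = \sum_x (eta x * G x) ^+ 2.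
  by apply: eq_bigr => x _; ring.
by lra.
Qed.

Section Annulus.
Variable k : nat.
Local Notation r2 x := (sqnorm (x - y)).

Definition annulus x := (16 ^+ k <= r2 x) && ~~ (16 ^+ k.+3 <= r2 x).

Definition cutoff x : R := clamp ((r2 x - 16 ^+ k.+1) / (15 * 16 ^+ k.+1)).

Let A : R := 16 ^+ k.+1.

Let A_ge16 : 16 <= A.
Proof. by rewrite /A exprS ler_peMr // -natrX (ler_nat R 1) expn_gt0. Qed.

Let annulusE x : annulus x = (A / 16 <= r2 x) && ~~ (256 * A <= r2 x).
Proof.
rewrite /annulus (_ : 16 ^+ k = A / 16) 1?(_ : 16 ^+ k.+3 = 256 * A) //.
  by rewrite /A !exprS; ring.
by rewrite /A exprS; field.
Qed.

Let r2_stp x i : r2 (x + stp h i) <= 2 * r2 x + 2 /\ r2 x <= 2 * r2 (x + stp h i) + 2.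
Proof. by rewrite addrAC; split; [exact: sqnorm_stp_le|exact: sqnorm_stp_ge]. Qed.

Lemma cutoff0 x : r2 x <= A -> cutoff x = 0.
Proof. by have := A_ge16 => ? ?; apply: clamp0; rewrite ler_pdivrMr ?mul0r -/A; lra. Qed.

Lemma cutoff1 x : 16 * A <= r2 x -> cutoff x = 1.
Proof. by have := A_ge16 => ? ?; apply: clamp1; rewrite ler_pdivlMr ?mul1r -/A; lra. Qed.

Lemma cutoff_grad x i : grd src tgt cutoff (x, i) ^+ 2 <=
  if annulus x && annulus (x + stp h i) then 100 * hweight (x - y) else 0.
Proof.
have [far near] := r2_stp x i; have A16 := A_ge16.
have r2_ge0 := sqnorm_ge0 R (x - y); have r2_ge0' := sqnorm_ge0 R (x + stp h i - y).
have w_gt0 := hweight_gt0 R (x - y).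
rewrite /grd /tsrc /ttgt /=; set x' := x + stp h i in far near r2_ge0' *.
have [/andP[in1 in2]|not_in] := boolP ((r2 x <= A) && (r2 x' <= A)).
  by rewrite !cutoff0 // subrr expr0n /=; case: ifP => // _; lra.
have [/andP[out1 out2]|not_out] := boolP ((16 * A <= r2 x) && (16 * A <= r2 x')).
  by rewrite !cutoff1 // subrr expr0n /=; case: ifP => // _; lra.
have [lo lo' hi hi'] : [/\ A / 16 <= r2 x, A / 16 <= r2 x', r2 x <= 34 * A & r2 x' <= 34 * A].
  rewrite !negb_and -!ltNge in not_in not_out.
  by case/orP: not_in => ?; case/orP: not_out => ?; split; lra.
have -> : annulus x && annulus x' by rewrite !annulusE -!ltNge lo lo' /=; apply/andP; split; lra.
apply: le_trans (clamp_lip _ _) _; rewrite -mulrBl exprMn -/A.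
have -> : r2 x' - A - (r2 x - A) = r2 x' - r2 x by ring.
rewrite /hweight exprVn ler_pdivrMr ?exprn_gt0 //; last by lra.
rewrite mulrAC ler_pdivlMr; last by lra.
have diff_le : (r2 x' - r2 x) ^+ 2 <= 300 * A.
  by have := sqnorm_stp_diff_sqr R h_gt0 i (x - y); rewrite /x' addrAC; lra.
apply: le_trans (_ : 300 * A * (50 * A) <= _); last by nra.
by apply: ler_pM => //; [exact: sqr_ge0|lra|lra].
Qed.

Lemma energy_cutoff_le : energy (fun x => cutoff x * G x) <=
  200 * d%:R * be * \sum_(x | annulus x) G x ^+ 2 * hweight (x - y).
Proof.
have A16 := A_ge16; have al0 := al_gt0; have be_ge0 : 0 <= be by have := al_be; lra.
rewrite energy_cutoff; last first.
  by apply: cutoff0; rewrite subrr /sqnorm big1 => [|i _]; [lra|rewrite /ccoord ffunE clift0 expr0n].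
pose density x := if annulus x then G x ^+ 2 * hweight (x - y) else 0.
have edge_le i x : a (x, i) * (G x * G (x + stp h i) * grd src tgt cutoff (x, i) ^+ 2) <=
    100 * be * (density x + density (x + stp h i)).
  have /andP[a_ge a_le] := ea (x, i); have := cutoff_grad x i; have := sqr_ge0 (grd src tgt cutoff (x, i)).
  set D := grd _ _ _ _ ^+ 2; set p := G x; set q := G (x + stp h i).
  have w_gt0 := hweight_gt0 R (x - y); have w_gt0' := hweight_gt0 R (x + stp h i - y).
  have [_ w_near] := hweight_stp R h_gt1 i (x - y); rewrite addrAC in w_near.
  rewrite /density; case: ifP => [/andP[-> ->]|_] D_ge0 D_le; last first.
    have -> : D = 0 by lra.
    by rewrite !mulr0; apply: mulr_ge0; [nonneg|apply: addr_ge0; case: ifP => // _; nonneg].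
  rewrite -/p -/q; set w := hweight (x - y) in w_gt0 w_near D_le *.
  set w' := hweight _ in w_gt0' w_near *.
  apply: le_trans (_ : be * ((p ^+ 2 + q ^+ 2) / 2 * (100 * w)) <= _).
    apply: le_trans (_ : a (x, i) * ((p ^+ 2 + q ^+ 2) / 2 * (100 * w)) <= _); last first.
      by apply: ler_wpM2r => //; nonneg.
    apply: ler_wpM2l; first by lra.
    apply: le_trans (_ : (p ^+ 2 + q ^+ 2) / 2 * D <= _); last by apply: ler_wpM2l => //; nonneg.
    by apply: ler_wpM2r => //; have := sqr_ge0 (p - q); nra.
  rewrite [100 * be]mulrC -[leRHS]mulrA; apply: ler_wpM2l => //.
  have : q ^+ 2 * w <= q ^+ 2 * (2 * w') by apply: ler_wpM2l => //; exact: sqr_ge0.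
  have : 0 <= p ^+ 2 * w by nonneg.
  by lra.
rewrite sum_edges; apply: le_trans (ler_sum _ (fun i _ => ler_sum _ (fun x _ => edge_le i x))) _.
rewrite (eq_bigr (fun=> 200 * be * \sum_(x | annulus x) G x ^+ 2 * hweight (x - y))).
  by rewrite sum_cst_ord; apply: eq_leW; ring.
move=> i _; rewrite -mulr_sumr big_split /= (sum_shift (stp h i) density) /density -big_mkcond /=.
by ring.
Qed.

Lemma green_tail_le_energy :
  green_tail k.+3 <= 97 * d%:R * coercivity * energy (fun x => cutoff x * G x).
Proof.
set w := fun x => _; have A16 := A_ge16; have AE : 16 ^+ k.+3 = 256 * A by rewrite /A !exprS; ring.
have hardy_part : \sum_(x : T | 16 ^+ k.+3 <= r2 x) G x ^+ 2 * hweight (x - y) <=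
    96 * d%:R * coercivity * energy w.
  apply: le_trans (hardy_energy y w); rewrite big_mkcond; apply: ler_sum => x _.
  have w_gt0 := hweight_gt0 R (x - y); case: ifP => [x_far|_]; last by nonneg.
  by rewrite /w cutoff1 ?mul1r //; rewrite AE in x_far; lra.
have grad_part : \sum_(x : T | 16 ^+ k.+3 <= r2 x) \sum_i grd src tgt G (x, i) ^+ 2 <=
    coercivity * energy w.
  apply: le_trans (energy_grad w); apply: ler_wpDr; first by nonneg.
  rewrite [leRHS]sum_edges exchange_big /=; apply: ler_sum => i _.
  rewrite big_mkcond; apply: ler_sum => x _ /=; case: ifP => [x_far|_]; last exact: sqr_ge0.
  rewrite AE in x_far; have [_ near] := r2_stp x i.
  by rewrite /grd /w /tsrc /ttgt /= !cutoff1 ?mul1r //; lra.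
rewrite /green_tail /green_density big_split /=; apply: le_trans (lerD hardy_part grad_part) _.
have : 0 <= coercivity * energy w.
  apply: mulr_ge0; first by have := coercivity_ge1; lra.
  by rewrite /energy; apply: addr_ge0; [apply: sumr_ge0 => e _; rewrite mulr_ge0 ?sqr_ge0|nonneg].
by have := dR_ge3; nra.
Qed.

Lemma annulus_le_tail :
  \sum_(x | annulus x) G x ^+ 2 * hweight (x - y) <= green_tail k - green_tail k.+3.
Proof.
rewrite lerBrDr /green_tail [leRHS](bigID (fun x => 16 ^+ k.+3 <= r2 x)) /= addrC.
apply: lerD; first by apply: ler_sum => x _; rewrite /green_density lerDl; nonneg.
apply: eq_leW; apply: eq_bigl => x; apply/idP/andP => [x_far|[] //]; split=> //.
by apply: le_trans x_far; rewrite ler_weXn2l ?(ler_nat R 1) // !leqW.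
Qed.

Lemma green_tail_hole : green_tail k.+3 <= hole_const * (green_tail k - green_tail k.+3).
Proof.
have coer1 := coercivity_ge1; have be_ge0 : 0 <= be by have := al_gt0; have := al_be; lra.
have coer_ge0 : 0 <= 97 * d%:R * coercivity by apply: mulr_ge0; [nonneg|lra].
apply: (le_trans green_tail_le_energy); apply: le_trans (ler_wpM2l coer_ge0 energy_cutoff_le) _.
have const_ge0 : 0 <= 97 * d%:R * coercivity * (200 * d%:R * be) by nonneg.
have := ler_wpM2l const_ge0 annulus_le_tail; rewrite -!(mulrA (97 * d%:R * coercivity)).
by move=> /le_trans; apply; apply: eq_leW; rewrite /hole_const; ring.
Qed.

End Annulus.

Definition hole_ratio : R := hole_const / (1 + hole_const).

Lemma hole_ratio_itv : 0 <= hole_ratio < 1.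
Proof.
have k := hole_const_ge0; rewrite /hole_ratio; apply/andP; split; first by nonneg; lra.
by rewrite ltr_pdivrMr ?mul1r; lra.
Qed.

Lemma green_density_total : \sum_x green_density x <= 97 * d%:R * coercivity * green_diag_bound.
Proof.
have /andP[g0 g1] := green_diag; have c1 := coercivity_ge1; have D := dR_ge3.
have h1 := hardy_energy y G; have h2 := energy_grad G; rewrite energy_green in h1 h2.
have M0 : 0 <= m * \sum_x G x ^+ 2 by nonneg.
rewrite /green_density big_split /=.
have -> : \sum_(x : T) \sum_i grd src tgt G (x, i) ^+ 2 = \sum_e grd src tgt G e ^+ 2.
  by rewrite [RHS]sum_edges exchange_big.
have h3 : 0 <= coercivity * G y by nonneg; lra.
have h4 : coercivity * G y <= coercivity * green_diag_bound by apply: ler_wpM2l => //; lra.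
have h5 : d%:R * (coercivity * G y) <= d%:R * (coercivity * green_diag_bound) by apply: ler_wpM2l => //; lra.
by nra.
Qed.

Lemma green_tail_decay j : green_tail (3 * j) <= 97 * d%:R * coercivity * green_diag_bound * hole_ratio ^+ j.
Proof.
have k := hole_const_ge0; have /andP[t0 t1] := hole_ratio_itv.
elim: j => [|j IH].
  rewrite muln0 expr0 mulr1; apply: le_trans green_density_total.
  rewrite /green_tail big_mkcond; apply: ler_sum => x _; case: ifP => // _; exact: green_density_ge0.
have := green_tail_hole (3 * j); rewrite (_ : (3 * j).+3 = 3 * j.+1)%N; last by lia.
set X := green_tail _; set Y := green_tail _ => H.
have : X <= hole_ratio * Y by rewrite /hole_ratio mulrAC ler_pdivlMr; lra.
move=> /le_trans; apply; rewrite exprS mulrCA; exact: ler_wpM2l.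
Qed.

Definition green_const : R := 97 * d%:R * coercivity * green_diag_bound.

Lemma green_const_ge1 : 1 <= green_const.
Proof.
rewrite /green_const; have := green_diag_bound_ge1; have := coercivity_ge1; have := dR_ge3 => D c g.
by apply: mulr_ege1 => //; apply: mulr_ege1 => //; lra.
Qed.

Lemma green_grad_tail j :
  \sum_(e : E | 4096 ^+ j <= sqnorm (e.1 - y)) grd src tgt G e ^+ 2 <= green_const * hole_ratio ^+ j.
Proof.
apply: le_trans (green_tail_decay j); rewrite /green_tail.
have -> : (16 : R) ^+ (3 * j) = 4096 ^+ j by rewrite exprM; congr (_ ^+ j); rewrite -natrX.
rewrite big_mkcond sum_edges exchange_big [leRHS]big_mkcond /=; apply: ler_sum => x _.
case: ifP => hx; last by rewrite big1.
rewrite /green_density lerDr; apply: mulr_ge0; [exact: sqr_ge0|exact/ltW/hweight_gt0].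
Qed.

Lemma green_grad_total : \sum_(e : E) grd src tgt G e ^+ 2 <= green_const.
Proof.
apply: le_trans green_density_total; rewrite sum_edges exchange_big /=; apply: ler_sum => x _.
rewrite /green_density lerDr; apply: mulr_ge0; [exact: sqr_ge0|exact/ltW/hweight_gt0].
Qed.

End GreenDecay.

Section Shells.
Variables (R : realFieldType) (d h : nat).
Local Notation T := (torus d h).
Implicit Types (x y : T).
Local Notation sqnorm := (@sqnorm R d h).

Lemma clift_sqr_le (t : 'I_(2 * h).+1) : clift R t ^+ 2 <= (h ^ 2)%:R.
Proof.
have /andP[a b] := clift_bound R t.
have : 0 <= (h%:R - clift R t) * (h%:R + clift R t) by apply: mulr_ge0; lra.
by rewrite natrX; lra.
Qed.

Lemma shell_ex x : exists j, sqnorm x < 4096 ^+ j.+1.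
Proof.
exists (d * h ^ 2)%N.
apply: le_lt_trans (_ : (d * h ^ 2)%:R < _).
  rewrite /sqnorm natrM -sum_cst_ord; apply: ler_sum => i _; exact: clift_sqr_le.
rewrite -natrX ltr_nat; apply: leq_ltn_trans (leqnSn _) _.
by apply: ltn_expl.
Qed.

Definition shell x : nat := ex_minn (shell_ex x).

Lemma shell_lt x : sqnorm x < 4096 ^+ (shell x).+1.
Proof. by rewrite /shell; case: ex_minnP. Qed.

Lemma shell_ge x j : (j < shell x)%N -> 4096 ^+ j.+1 <= sqnorm x.
Proof.
rewrite /shell; case: ex_minnP => k _ hk jk; rewrite leNgt; apply/negP => /hk.
by rewrite leqNgt jk.
Qed.

Lemma shell_leP x j : (0 < j)%N -> (j <= shell x)%N = (4096 ^+ j <= sqnorm x).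
Proof.
case: j => // j _; apply/idP/idP => [/shell_ge //|hj]; rewrite ltnNge.
apply/negP => kj; have := shell_lt x; apply/negP; rewrite -leNgt.
apply: le_trans hj; apply: ler_weXn2l; [exact: (ler_nat R 1 4096)|by []].
Qed.

Lemma shell_bound x : (shell x <= d * h ^ 2)%N.
Proof.
rewrite /shell; case: ex_minnP => k _; apply.
apply: le_lt_trans (_ : (d * h ^ 2)%:R < _).
  rewrite /sqnorm natrM -sum_cst_ord; apply: ler_sum => i _; exact: clift_sqr_le.
rewrite -natrX ltr_nat; apply: leq_ltn_trans (leqnSn _) _.
by apply: ltn_expl.
Qed.

Lemma card_clift n : (#|[pred t : 'I_(2 * h).+1 | (clift R t ^+ 2 < n%:R ^+ 2)%R]| <= 2 * n)%N.
Proof.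
rewrite cardE -(size_map (@nat_of_ord _)).
rewrite (_ : 2 * n = size (iota 0 n ++ iota ((2 * h).+1 - n) n))%N; last first.
  by rewrite size_cat !size_iota; lia.
apply: uniq_leq_size; first by rewrite (map_inj_uniq val_inj) enum_uniq.
move=> k /mapP[t]; rewrite mem_enum inE => ht ->{k}.
have n0 : (0 : R) <= n%:R by [].
have lt := ltn_ord t.
have {ht} : `|clift R t| < n%:R.
  by rewrite -ltr_sqr ?nnegrE // real_normK // num_real.
rewrite mem_cat !mem_iota /= ltr_norml /clift; case: (leqP t h) => th /andP[h1 h2].
  by rewrite ltr_nat in h2; rewrite add0n h2.
apply/orP; right; apply/andP; split; last by lia.
have : ((2 * h).+1%:R : R) < t%:R + n%:R by lra.
by rewrite -natrD ltr_nat; lia.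
Qed.

Lemma card_near n : (#|[pred x : T | (sqnorm x < n%:R ^+ 2)%R]| <= (2 * n) ^ d)%N.
Proof.
apply: leq_trans (_ : #|ffun_on [pred t : 'I_(2 * h).+1 | (clift R t ^+ 2 < n%:R ^+ 2)%R]
   : {pred T}| <= _)%N.
  apply: subset_leq_card; apply/subsetP => x; rewrite inE => hx.
  apply/ffun_onP => i; rewrite inE; apply: le_lt_trans hx.
  exact: (ccoord_le_sqnorm R i x).
have mono (p q k : nat) : (p <= q -> p ^ k <= q ^ k)%N by case: k => // k; rewrite leq_exp2r.
rewrite card_ffun_on card_ord; apply: mono; exact: card_clift.
Qed.

Lemma card_shell j : (#|[pred x : T | shell x == j]| <= (2 * 64 ^ j.+1) ^ d)%N.
Proof.
apply: leq_trans (card_near (64 ^ j.+1)); apply: subset_leq_card.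
apply/subsetP => x; rewrite !inE => /eqP <-; apply: lt_le_trans (shell_lt x) _.
rewrite -natrX -natrX ler_nat -expnM mulnC expnM.
by rewrite leq_exp2r.
Qed.

Lemma geometric_tail (t : R) j n : 0 <= t < 1 ->
  \sum_(i < n | (j <= i)%N) t ^+ i <= t ^+ j / (1 - t).
Proof.
move=> /andP[t0 t1]; rewrite ler_pdivlMr; last by lra.
have : (\sum_(i < n | (j <= i)%N) t ^+ i) * (1 - t) = t ^+ j - t ^+ (maxn j n).
  rewrite big_mkcond; elim: n => [|n IH]; first by rewrite big_ord0 mul0r maxn0 subrr.
  rewrite big_ord_recr /= mulrDl IH; case: leqP => jn.
    rewrite (maxn_idPr (leqW jn)) exprS; ring.
  by rewrite mul0r addr0 (maxn_idPl jn).
by move=> ->; rewrite gerBl exprn_ge0.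
Qed.

Lemma shell_sum (F : nat -> R) : (forall j, 0 <= F j) ->
  \sum_(x : T) F (shell x) <= \sum_(j < (d * h ^ 2).+1) ((2 * 64 ^ j.+1) ^ d)%:R * F j.
Proof.
move=> F0; pose p x : 'I_(d * h ^ 2).+1 := inord (shell x).
rewrite (partition_big p xpredT) //=; apply: ler_sum => j _.
have pE x : (p x == j) = (shell x == j).
  by rewrite /p -val_eqE /= inordK // ltnS shell_bound.
rewrite (eq_bigr (fun=> F j)); last by move=> x; rewrite pE => /eqP ->.
rewrite sumr_const -[X in X <= _]mulr_natl; apply: ler_wpM2r => //; rewrite ler_nat.
apply: leq_trans (card_shell j); apply: subset_leq_card; apply/subsetP => x hx.
by rewrite inE -pE; exact: hx.
Qed.

Lemma shell_count (s : R) y : 0 < s -> 2 * 64 ^+ d <= s ->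
  \sum_(x : T) s ^- (shell (x - y)%R) <= 2 * 128 ^+ d.
Proof.
move=> s0 hs; rewrite (sum_shift (- y) (fun x => s ^- (shell x))).
apply: le_trans (shell_sum (F := fun j => s ^- j) _) _.
  by move=> j; rewrite invr_ge0 exprn_ge0 // ltW.
apply: le_trans (_ : 128 ^+ d * \sum_(j < (d * h ^ 2).+1 | (0 <= j)%N) (2^-1) ^+ j <= _).
  rewrite mulr_sumr; apply: ler_sum => j _.
  rewrite natrX natrM natrX exprMn -exprM mulnC exprM exprS.
  have -> : (128 : R) ^+ d = 2 ^+ d * 64 ^+ d by rewrite -exprMn -natrM.
  rewrite -!mulrA ler_wpM2l ?exprn_ge0 // ler_wpM2l ?exprn_ge0 //.
  rewrite ler_pdivrMr ?exprn_gt0 // -exprMn lerXn2r ?nnegrE ?exprn_ge0 //.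
    by apply: mulr_ge0; [nonneg|exact: ltW].
  by lra.
have := @geometric_tail (2^-1) 0 (d * h ^ 2).+1 _; rewrite expr0 => /(_ _) H.
have -> : 2 * 128 ^+ d = 128 ^+ d * (1 / (1 - 2^-1)) :> R by field.
apply: ler_wpM2l; first by rewrite exprn_ge0.
by apply: H; lra.
Qed.

End Shells.

Section FluxDecomposition.
Variables (R : realFieldType) (d h : nat).
Hypotheses (d3 : (3 <= d)%N) (h_gt1 : (1 < h)%N).
Variables (J : finType) (rho : J -> R) (j0 : J).
Hypotheses (rho_ge0 : forall j, 0 <= rho j) (rho_sum : \sum_j rho j = 1).
Variables (al be : R) (al_gt0 : 0 < al) (al_be : al <= be).
Variables (vl : J -> R) (vl_itv : forall j, al <= vl j <= be).
Local Notation T := (torus d h).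
Local Notation E := (T * 'I_d)%type.
Local Notation cfg := {ffun E -> J}.
Local Notation Ex := (Ex (E := E) rho).
Local Notation shell := (@shell R d h).
Implicit Types (c : cfg) (e : E) (x y z : T) (m : R).

Let ExP : is_mean Ex. Proof. exact: Ex_mean. Qed.

Definition decay_rate : R := (1 + hole_ratio d al be) / 2.

Definition growth_rate : R := (1 + hole_ratio d al be) / (2 * hole_ratio d al be).

Lemma hole_ratio_gt0 : 0 < hole_ratio d al be.
Proof.
have c1 := coercivity_ge1 al_gt0; have a0 := al_gt0; have ab := al_be.
have D : (3 : R) <= d%:R by rewrite (ler_nat R 3).
have K : 0 < hole_const d al be by rewrite /hole_const !mulr_gt0 ?exprn_gt0; lra.
by rewrite /hole_ratio divr_gt0; lra.
Qed.

Lemma decay_rate_itv : 0 < decay_rate < 1.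
Proof. by have := hole_ratio_gt0; have /andP[_] := hole_ratio_itv d al_gt0 al_be; rewrite /decay_rate; lra. Qed.

Lemma growth_rate_gt1 : 1 < growth_rate.
Proof.
have t0 := hole_ratio_gt0; have /andP[_ t1] := hole_ratio_itv d al_gt0 al_be.
by rewrite /growth_rate ltr_pdivlMr; lra.
Qed.

Lemma growth_rateM : growth_rate * hole_ratio d al be = decay_rate.
Proof. by rewrite /growth_rate /decay_rate; field; rewrite gt_eqF ?hole_ratio_gt0. Qed.

Section Deterministic.
Variables (m : R) (m_gt0 : 0 < m) (m_large : 32 * d%:R <= m * h%:R) (c : cfg) (y : T).

Lemma dgreen_le e : dgreen vl m c y e <= green_const d al.
Proof.
apply: le_trans (green_grad_total d3 h_gt1 al_gt0 m_gt0 m_large (cfield_elliptic vl_itv c) y).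
by rewrite (bigD1 e) //= lerDl; nonneg.
Qed.

Lemma dgreen_far j : \sum_(e : E | (j <= shell (e.1 - y)%R)%N) dgreen vl m c y e <=
  green_const d al * hole_ratio d al be ^+ j.
Proof.
have ea := cfield_elliptic vl_itv c.
case: j => [|j].
  by rewrite expr0 mulr1; exact: (green_grad_total d3 h_gt1 al_gt0 m_gt0 m_large ea y).
apply: le_trans (green_grad_tail d3 h_gt1 al_gt0 al_be m_gt0 m_large ea y j.+1).
by apply: eq_leW; apply: eq_bigl => e; rewrite shell_leP.
Qed.

Lemma dgreen_gain_ge0 e : 0 <= dgreen vl m c y e * growth_rate ^+ shell (e.1 - y)%R.
Proof.
apply: mulr_ge0; first exact: dgreen_ge0.
by rewrite exprn_ge0 //; have := growth_rate_gt1; lra.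
Qed.

Lemma dgreen_weighted j (Q : pred E) : (forall e, Q e -> (j <= shell (e.1 - y)%R)%N) ->
  \sum_(e | Q e) dgreen vl m c y e * growth_rate ^+ shell (e.1 - y)%R <=
  green_const d al * (decay_rate ^+ j / (1 - decay_rate)).
Proof.
move=> hQ; have /andP[t0 t1] := decay_rate_itv; have s1 := growth_rate_gt1.
have C1 := green_const_ge1 d3 al_gt0.
apply: le_trans (_ : \sum_(e : E | (j <= shell (e.1 - y)%R)%N)
    dgreen vl m c y e * growth_rate ^+ shell (e.1 - y)%R <= _).
  rewrite big_mkcond [leRHS]big_mkcond; apply: ler_sum => e _.
  by have := dgreen_gain_ge0 e; case: ifP => [/hQ ->//|_]; case: ifP.
pose p (e : E) : 'I_(d * h ^ 2).+1 := inord (shell (e.1 - y)%R).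
have pE e i : (p e == i) = (shell (e.1 - y)%R == i).
  by rewrite /p -val_eqE /= inordK // ltnS shell_bound.
rewrite (partition_big p (fun i : 'I__ => (j <= i)%N)) /=; last first.
  by move=> e; rewrite /p inordK // ltnS shell_bound.
apply: le_trans (_ : \sum_(i < (d * h ^ 2).+1 | (j <= i)%N) green_const d al * decay_rate ^+ i <= _); last first.
  rewrite -mulr_sumr; apply: ler_wpM2l; first by lra.
  by apply: geometric_tail; rewrite t1 ltW.
apply: ler_sum => i ji.
have gain_ge0 : 0 <= growth_rate ^+ i by rewrite exprn_ge0 //; lra.
apply: le_trans (_ : growth_rate ^+ i * \sum_(e : E | (i <= shell (e.1 - y)%R)%N) dgreen vl m c y e <= _).
  rewrite mulr_sumr big_mkcond [leRHS]big_mkcond; apply: ler_sum => e _ /=.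
  have := mulr_ge0 gain_ge0 (dgreen_ge0 vl m c y e).
  rewrite pE; case: ifP => [/andP[_ /eqP ->]|_]; last by case: ifP.
  by rewrite leqnn mulrC.
apply: le_trans (ler_wpM2l gain_ge0 (dgreen_far i)) _.
by rewrite mulrCA -exprMn growth_rateM.
Qed.

Lemma dgreen_power_sum p j (Q : pred E) (Y : E -> R) : (forall e, 0 <= Y e) ->
  (forall e, Q e -> (j <= shell (e.1 - y)%R)%N) ->
  (\sum_(e | Q e) dgreen vl m c y e * Y e) ^+ p.+1 <=
  (green_const d al * (decay_rate ^+ j / (1 - decay_rate))) ^+ p *
  \sum_(e : E) green_const d al * (growth_rate ^+ p) ^- shell (e.1 - y)%R * Y e ^+ p.+1.
Proof.
move=> Y0 hQ; pose K (e : E) := shell (e.1 - y)%R; have /andP[t0 t1] := decay_rate_itv.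
have C1 := green_const_ge1 d3 al_gt0; have g0 : 0 < growth_rate by have := growth_rate_gt1; lra.
pose w e := if Q e then dgreen vl m c y e * growth_rate ^+ K e else 0.
have w0 e : 0 <= w e by rewrite /w; case: ifP => // _; exact: dgreen_gain_ge0.
have f0 e : 0 <= growth_rate ^- K e * Y e.
  by apply: mulr_ge0 => //; rewrite invr_ge0 exprn_ge0 // ltW.
have := weighted_power_sum (index_enum _) p w0 f0.
have -> : \sum_e w e * (growth_rate ^- K e * Y e) = \sum_(e | Q e) dgreen vl m c y e * Y e.
  rewrite [RHS]big_mkcond; apply: eq_bigr => e _; rewrite /w; case: ifP => _; last by rewrite mul0r.
  by rewrite mulrA -(mulrA (dgreen _ _ _ _ _)) mulfV ?mulr1 // expf_neq0 // gt_eqF.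
move=> /le_trans; apply; apply: ler_pM.
- by apply: exprn_ge0; rewrite sumr_ge0.
- by apply: sumr_ge0 => e _; apply: mulr_ge0 => //; rewrite exprn_ge0.
- rewrite lerXn2r ?nnegrE ?sumr_ge0 // -?big_mkcond; last exact: dgreen_weighted.
  by apply: mulr_ge0; [lra|apply: divr_ge0; [rewrite exprn_ge0 // ltW|lra]].
apply: ler_sum => e _; rewrite /w; case: ifP => [_|_]; last first.
  rewrite mul0r; apply: mulr_ge0; last by rewrite exprn_ge0.
  by apply: mulr_ge0; [lra|rewrite invr_ge0 !exprn_ge0 // ltW].
rewrite [(_ * Y e) ^+ _]exprMn mulrA; apply: ler_wpM2r; first by rewrite exprn_ge0.
have -> : dgreen vl m c y e * growth_rate ^+ K e * (growth_rate ^- K e) ^+ p.+1 =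
   dgreen vl m c y e * (growth_rate ^+ p) ^- K e.
  rewrite -mulrA; congr (_ * _); rewrite exprS mulrA mulfV ?mul1r ?expf_neq0 ?gt_eqF //.
  by rewrite exprVn -!exprM mulnC.
by apply: ler_wpM2r; [rewrite invr_ge0 !exprn_ge0 // ltW|exact: dgreen_le].
Qed.

End Deterministic.

Definition green_sum_const p : R := (green_const d al / (1 - decay_rate)) ^+ p * (green_const d al * (d%:R * (2 * 128 ^+ d))).

Lemma green_sum_const_ge0 p : 0 <= green_sum_const p.
Proof.
have /andP[t0 t1] := decay_rate_itv; have C1 := green_const_ge1 d3 al_gt0.
by rewrite /green_sum_const; apply: mulr_ge0; [apply: exprn_ge0; apply: divr_ge0; lra|nonneg; lra].
Qed.

Lemma green_sum m y p j (Q : pred E) (Y : cfg -> E -> R) B : 0 < m ->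
  32 * d%:R <= m * h%:R -> 2 * 64 ^+ d <= growth_rate ^+ p ->
  (forall c e, 0 <= Y c e) -> (forall e, Ex (fun c => Y c e ^+ p.+1) <= B) ->
  (forall e, Q e -> (j <= shell (e.1 - y)%R)%N) ->
  Ex (fun c => (\sum_(e | Q e) dgreen vl m c y e * Y c e) ^+ p.+1) <=
  green_sum_const p * decay_rate ^+ (j * p) * B.
Proof.
move=> m0 m_large p_large Y0 hY hQ; have /andP[t0 t1] := decay_rate_itv.
have C1 := green_const_ge1 d3 al_gt0; have g1 := growth_rate_gt1.
have g0 : 0 < growth_rate by lra.
pose A := green_const d al * (decay_rate ^+ j / (1 - decay_rate)).
have A0 : 0 <= A ^+ p.
  by apply/exprn_ge0/mulr_ge0; [lra|apply: divr_ge0; [rewrite exprn_ge0 // ltW|lra]].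
have B0 : 0 <= B.
  apply: le_trans (hY (0, Ordinal (ltnW (ltnW d3)))); apply: (mean_ge0 ExP) => c.
  by rewrite exprn_ge0.
apply: le_trans (mean_mono ExP (fun c => dgreen_power_sum m0 m_large c p (Y0 c) hQ)) _.
rewrite (meanZ ExP) (mean_sum ExP) -/A.
apply: le_trans (_ : A ^+ p * (\sum_(e : E) green_const d al * (growth_rate ^+ p) ^- shell (e.1 - y)%R * B) <= _).
  apply: ler_wpM2l => //; apply: ler_sum => e _; rewrite (meanZ ExP); apply: ler_wpM2l => //.
  by apply: mulr_ge0; [lra|rewrite invr_ge0 !exprn_ge0 // ltW].
rewrite -mulr_suml -mulr_sumr sum_edges /=.
have count : \sum_(i < d) \sum_(x : T) (growth_rate ^+ p) ^- shell (x - y)%R <= d%:R * (2 * 128 ^+ d).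
  by rewrite -sum_cst_ord; apply: ler_sum => i _; apply: shell_count => //; rewrite exprn_gt0.
have -> : green_sum_const p * decay_rate ^+ (j * p) * B =
    A ^+ p * (green_const d al * (d%:R * (2 * 128 ^+ d)) * B).
  by rewrite /green_sum_const exprM /A !exprMn; ring.
apply: ler_wpM2l => //; apply: ler_wpM2r => //; apply: ler_wpM2l => //; lra.
Qed.

Variables (zeta : 'I_d -> R) (zeta_le1 : forall i, `|zeta i| <= 1).

Definition phi_by_flux p : R := (384 * be ^+ 2 * contrast al be * p.+1%:R ^+ 2) ^+ p.+1 * green_sum_const p.

Definition flux_by_phi p : R := 4 ^+ p.+1 * (1 + 4 * 4 ^+ p *
  (be * ((2 * p).+1%:R * 16 ^+ p) / al) ^+ 2 * (2 * d%:R)).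

Definition phi_moment_const p : R := 2 * (phi_by_flux p * flux_by_phi p + 1) * (1 + (2 * (phi_by_flux p * flux_by_phi p + 1)) ^+ p).

Definition flux_moment_const p : R := flux_by_phi p * (1 + phi_moment_const p).

Lemma power_interp (t K : R) p : 0 <= t -> 1 <= K -> t ^+ p <= t ^+ p.+1 / K + K ^+ p.
Proof.
move=> t0 K1; have [t_le|t_le] := leP t K.
  apply: ler_wpDl; first by nonneg; lra.
  by rewrite lerXn2r ?nnegrE //; lra.
apply: ler_wpDr; first by rewrite exprn_ge0; lra.
rewrite ler_pdivlMr; last by lra.
rewrite exprS mulrC; apply: ler_wpM2r; [by rewrite exprn_ge0|exact: ltW].
Qed.

Lemma moment_closure (A z Z : R) p : 0 <= A -> 0 <= Z -> Z <= A * (1 + z) ->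
  (forall K, 1 <= K -> z <= Z / K + K ^+ p) ->
  let M := 2 * (A + 1) * (1 + (2 * (A + 1)) ^+ p) in Z <= M /\ z <= M.
Proof.
move=> A0 Z0 Zz interp /=; set K := 2 * (A + 1); set Kp := K ^+ p.
have K2 : 2 <= K by rewrite /K; lra.
have zK : z <= Z / K + Kp by apply: interp; lra.
have Kp0 : 0 <= Kp by rewrite exprn_ge0 //; lra.
have half : A * (Z / K) <= Z / 2.
  by rewrite mulrA ler_pdivrMr; [rewrite /K; nra|lra].
have ZM : Z <= K * (1 + Kp).
  have : A * z <= A * (Z / K + Kp) by apply: ler_wpM2l.
  have : 2 * (A * Kp) <= K * Kp by rewrite mulrA; apply: ler_wpM2r => //; rewrite /K; lra.
  by move: Zz half; rewrite !mulrDr !mulr1 /K; lra.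
split=> //; apply: (le_trans zK).
have : Z / K <= 1 + Kp by rewrite ler_pdivrMr; [move: ZM|]; lra.
have : 2 * (1 + Kp) <= K * (1 + Kp) by apply: ler_wpM2r => //; lra.
by lra.
Qed.

Lemma phi_by_flux_ge0 p : 0 <= phi_by_flux p.
Proof.
have al0 := al_gt0; have c1 := contrast_ge1 al_gt0 al_be.
by apply: mulr_ge0; [apply: exprn_ge0; nonneg; lra|exact: green_sum_const_ge0].
Qed.

Lemma flux_by_phi_ge1 p : 1 <= flux_by_phi p.
Proof.
have al0 := al_gt0; have be0 : 0 <= be by have := al_be; lra.
rewrite /flux_by_phi; apply: mulr_ege1; first by rewrite -natrX (ler_nat R 1) expn_gt0.
by rewrite lerDl; nonneg.
Qed.

(* The moment of order [2 * p] of the corrector controls that of order [2 * p.+1] of the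
   flux, hence that of the corrector, and interpolation closes the loop. *)
Lemma phi_flux_moments m p : 0 < m -> 32 * d%:R <= m * h%:R -> 2 * 64 ^+ d <= growth_rate ^+ p ->
  (forall y, Ex (fun c => phi vl zeta m c y ^+ (2 * p.+1)) <= phi_moment_const p) /\
  (forall e, Ex (fun c => flux2 vl zeta m c e ^+ p.+1) <= flux_moment_const p).
Proof.
move=> m0 m_large p_large; have A0 := phi_by_flux_ge0 p; have B_ge1 := flux_by_phi_ge1 p.
pose z := Ex (fun c => phi vl zeta m c (0 : T) ^+ (2 * p)).
pose Z := Ex (fun c => phi vl zeta m c (0 : T) ^+ (2 * p.+1)).
have Z0 : 0 <= Z by apply: (mean_ge0 ExP) => c; exact: expr_double_ge0.
have flux_le e : Ex (fun c => flux2 vl zeta m c e ^+ p.+1) <= flux_by_phi p * (1 + z).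
  case: e => x i.
  apply: le_trans (flux2_moment_step rho_ge0 rho_sum al_gt0 vl_itv zeta_le1 x i p 0 m0) _.
  have z0 : 0 <= z by apply: (mean_ge0 ExP) => c; exact: expr_double_ge0.
  rewrite /flux_by_phi -/z -[leRHS]mulrA; apply: ler_wpM2l; first by rewrite exprn_ge0.
  set C := _ * (2 * d%:R); have C0 : 0 <= C by rewrite /C; nonneg.
  by move: C0 z0; clearbody C z => C0 z0; nra.
have phi_le : Z <= phi_by_flux p * flux_by_phi p * (1 + z).
  apply: le_trans (phi_moment j0 rho_ge0 rho_sum al_gt0 al_be vl_itv zeta 0 p m0) _.
  rewrite -[leRHS]mulrA /phi_by_flux -[leRHS]mulrA; apply: ler_wpM2l.
    by have c1 := contrast_ge1 al_gt0 al_be; apply: exprn_ge0; nonneg; lra.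
  have := @green_sum m 0 p 0 xpredT (fun c e => flux2 vl zeta m c e) _ m0 m_large p_large
     (fun c e => flux2_ge0 _ _ _ _ _) flux_le (fun e _ => leq0n _).
  by rewrite mul0n expr0 mulr1.
have interp K : 1 <= K -> z <= Z / K + K ^+ p.
  move=> K1; rewrite -(mean_cst ExP (K ^+ p)) mulrC -(meanZ ExP) -(meanD ExP).
  apply: (mean_mono ExP) => c; rewrite !exprM mulrC.
  by apply: power_interp => //; exact: sqr_ge0.
have [Z_le z_le] := moment_closure (mulr_ge0 A0 (le_trans ler01 B_ge1)) Z0 phi_le interp.
split=> [y|e].
  by rewrite (Ex_phi_shift rho_ge0 rho_sum al_gt0 vl_itv zeta (fun t => t ^+ (2 * p.+1)) y 0 m0).
by apply: (le_trans (flux_le e)); rewrite /flux_moment_const ler_wpM2l ?lerD2l //; lra.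
Qed.

(** * Multiscale decomposition of the flux *)

Local Notation avg := (avg rho).
Local Notation flux := (flux vl zeta).
Local Notation flux2 := (flux2 vl zeta).
Local Notation phi := (phi vl zeta).
Local Notation tau := decay_rate.
Implicit Types j : nat.

Let h_gt0 : (0 < h)%N. Proof. exact: ltnW. Qed.

Let be_ge0 : 0 <= be. Proof. by have := al_gt0; have := al_be; lra. Qed.


Definition box j e : {set E} := [set e' : E | (shell (e'.1 - e.1)%R < j)%N].

Definition box_size j : R := d%:R * (2 * 64 ^+ j) ^+ d.

Lemma box_size_ge0 j : 0 <= box_size j.
Proof. by rewrite /box_size; nonneg. Qed.

Lemma near_count j : \sum_(x : T | (shell x < j)%N) 1 <= (2 * 64 ^+ j) ^+ d :> R.
Proof.
rewrite sumr_const -natrX -natrM -natrX ler_nat.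
apply: leq_trans (card_near R d h (64 ^ j)); apply: subset_leq_card.
apply/subsetP => x hx; rewrite inE; apply: lt_le_trans (shell_lt R x) _.
rewrite -natrX -natrX ler_nat -expnM mulnC (expnM 64 2) leq_exp2l //.
Qed.

Lemma box_count j e : \sum_(e' in box j e) 1 <= box_size j.
Proof.
rewrite big_mkcond sum_edges /box_size -sum_cst_ord; apply: ler_sum => i _.
apply: le_trans (near_count j); rewrite [leRHS]big_mkcond.
rewrite -(sum_shift (- e.1) (fun x => if (shell x < j)%N then 1 else 0)).
by apply: ler_sum => x _; rewrite inE.
Qed.

Lemma box_count_rev j e' : \sum_(e : E | e' \in box j e) 1 <= box_size j.
Proof.
rewrite big_mkcond sum_edges /box_size -sum_cst_ord; apply: ler_sum => i _.
apply: le_trans (near_count j); rewrite [leRHS]big_mkcond.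
have inj : injective (fun x : T => e'.1 - x) by move=> x y /addrI /oppr_inj.
rewrite [leRHS](reindex_inj inj).
by apply: ler_sum => x _; rewrite inE.
Qed.

Lemma shell_tgt j e e' : e' \notin box j e -> (j.-1 <= shell (e'.1 - ttgt e)%R)%N.
Proof.
rewrite inE -leqNgt; case: j => [|[|j]] //= hk; rewrite shell_leP //.
rewrite shell_leP // in hk; rewrite /ttgt opprD addrA.
have := sqnorm_stp_le R h_gt0 e.2 (e'.1 - e.1 - stp h e.2); rewrite subrK.
have : (1 : R) <= 4096 ^+ j.+1 by rewrite -natrX (ler_nat R 1) expn_gt0.
by move: hk; rewrite exprS; lra.
Qed.

Lemma fluxE m c e : flux m c e = zeta e.2 + (phi m c (ttgt e) - phi m c (tsrc e)).
Proof. by []. Qed.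

Definition dgreen_ends m c e e' : R := dgreen vl m c (ttgt e) e' + dgreen vl m c (tsrc e) e'.

Definition flux_upd_const : R := 8 * be ^+ 2 * contrast al be.

Lemma flux_upd_const_ge0 : 0 <= flux_upd_const.
Proof. by rewrite /flux_upd_const; nonneg; exact: be_ge0. Qed.

Lemma flux_upd m c e e' : 0 < m ->
  (flux m c e - flux m (upd c e' j0) e) ^+ 2 <= flux_upd_const * (dgreen_ends m c e e' * flux2 m c e').
Proof.
move=> m0; rewrite !fluxE.
have h1 := phi_upd j0 al_gt0 al_be vl_itv zeta c e' (ttgt e) m0.
have h2 := phi_upd j0 al_gt0 al_be vl_itv zeta c e' (tsrc e) m0.
set X := phi m c (ttgt e) - _ in h1; set Y := phi m c (tsrc e) - _ in h2.
have -> : zeta e.2 + (phi m c (ttgt e) - phi m c (tsrc e)) -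
  (zeta e.2 + (phi m (upd c e' j0) (ttgt e) - phi m (upd c e' j0) (tsrc e))) = X - Y.
  by rewrite /X /Y; ring.
apply: le_trans (sqrrD_le _ _) _; rewrite sqrrN /flux_upd_const /dgreen_ends.
by move: h1 h2; lra.
Qed.

Definition local_flux m j e c : R := avg (enum (~: box j e)) (fun c => flux m c e) c.

Definition flux_incr m j e c : R := local_flux m j.+1 e c - local_flux m j e c.

Let tau_gt0 : 0 < tau. Proof. by have /andP[] := decay_rate_itv. Qed.

Let tau_lt1 : tau < 1. Proof. by have /andP[] := decay_rate_itv. Qed.

Definition local_flux_const p : R := (96 * p.+1%:R ^+ 2) ^+ p.+1 *
  ((2 * flux_upd_const) ^+ p.+1 * (2 * (green_sum_const p * flux_moment_const p))).

Lemma flux_moment_const_ge0 p : 0 <= flux_moment_const p.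
Proof.
have A0 := phi_by_flux_ge0 p; have B_ge1 := flux_by_phi_ge1 p.
have AB : 0 <= phi_by_flux p * flux_by_phi p by apply: mulr_ge0 => //; lra.
by rewrite /flux_moment_const /phi_moment_const; nonneg; lra.
Qed.

Lemma local_flux_const_ge0 p : 0 <= local_flux_const p.
Proof.
have := flux_upd_const_ge0; have := green_sum_const_ge0 p; have := flux_moment_const_ge0 p => w g f.
by rewrite /local_flux_const; nonneg.
Qed.

Section Moments.
Variables (m : R) (p : nat).
Hypotheses (m0 : 0 < m) (m_large : 32 * d%:R <= m * h%:R).
Hypothesis p_large : 2 * 64 ^+ d <= growth_rate ^+ p.

Lemma local_flux_moment j e :
  Ex (fun c => (flux m c e - local_flux m j e c) ^+ (2 * p.+1)) <= local_flux_const p * tau ^+ (j.-1 * p).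
Proof.
pose S y c := \sum_(e' : E | e' \notin box j e) dgreen vl m c y e' * flux2 m c e'.
have S0 y c : 0 <= S y c.
  by apply: sumr_ge0 => e' _; apply: mulr_ge0; [exact: dgreen_ge0|exact: flux2_ge0].
pose V c := flux_upd_const * (S (ttgt e) c + S (tsrc e) c).
have hV c : \sum_(e' <- enum (~: box j e)) (flux m c e - flux m (upd c e' j0) e) ^+ 2 <= V c.
  rewrite big_enum /= /V /S -big_split mulr_sumr /=.
  rewrite (eq_bigl (fun e' => e' \notin box j e)); last by move=> e'; rewrite inE.
  apply: ler_sum => e' _; apply: le_trans (flux_upd c e e' m0) _.
  by rewrite /dgreen_ends mulrDl.
apply: le_trans (efron_stein_moment rho_ge0 rho_sum p (enum_uniq _) hV) _.
rewrite /local_flux_const -[leRHS]mulrA; apply: ler_wpM2l; first by nonneg.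
have MW := phi_flux_moments m0 m_large p_large.
have tp : tau ^+ (j * p) <= tau ^+ (j.-1 * p).
  by apply: ler_wiXn2l; [exact: ltW|exact: ltW|rewrite leq_mul2r leq_pred orbT].
have M0 := flux_moment_const_ge0 p; have G0 := green_sum_const_ge0 p.
have g1 : Ex (fun c => S (ttgt e) c ^+ p.+1) <=
    green_sum_const p * tau ^+ (j.-1 * p) * flux_moment_const p.
  apply: green_sum => //; [by move=> c e'; exact: flux2_ge0|exact: MW.2|].
  by move=> e'; exact: shell_tgt.
have g2 : Ex (fun c => S (tsrc e) c ^+ p.+1) <=
    green_sum_const p * tau ^+ (j.-1 * p) * flux_moment_const p.
  apply: le_trans (_ : green_sum_const p * tau ^+ (j * p) * flux_moment_const p <= _); last first.
    by apply: ler_wpM2r => //; apply: ler_wpM2l.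
  apply: green_sum => //; [by move=> c e'; exact: flux2_ge0|exact: MW.2|].
  by move=> e'; rewrite inE -leqNgt.
apply: le_trans (_ : Ex (fun c => (2 * flux_upd_const) ^+ p.+1 *
    (S (ttgt e) c ^+ p.+1 + S (tsrc e) c ^+ p.+1)) <= _).
  apply: (mean_mono ExP) => c; rewrite /V [2 * flux_upd_const]mulrC exprMn [(flux_upd_const * 2) ^+ _]exprMn.
  rewrite -[leRHS]mulrA; apply: ler_wpM2l; first by rewrite exprn_ge0 ?flux_upd_const_ge0.
  by apply: exprD_le.
rewrite (meanZ ExP) (meanD ExP) -mulrA; apply: ler_wpM2l.
  by rewrite exprn_ge0 // mulr_ge0 ?flux_upd_const_ge0.
by move: g1 g2; lra.
Qed.

Lemma flux_incr_moment j e :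
  Ex (fun c => flux_incr m j e c ^+ (2 * p.+1)) <= 4 ^+ p.+1 * (2 * local_flux_const p) * tau ^+ (j.-1 * p).
Proof.
have h1 := local_flux_moment j e; have h2 := local_flux_moment j.+1 e.
have tp : tau ^+ (j * p) <= tau ^+ (j.-1 * p).
  by apply: ler_wiXn2l; [exact: ltW|exact: ltW|rewrite leq_mul2r leq_pred orbT].
have C0 := local_flux_const_ge0 p.
have {}h2 := le_trans h2 (ler_wpM2l C0 tp).
apply: le_trans (_ : Ex (fun c => 4 ^+ p.+1 * ((flux m c e - local_flux m j e c) ^+ (2 * p.+1) +
   (flux m c e - local_flux m j.+1 e c) ^+ (2 * p.+1))) <= _).
  apply: (mean_mono ExP) => c.
  apply: le_trans (even_power_diff _ _ _).
  by apply: eq_leW; rewrite /flux_incr; congr (_ ^+ _); ring.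
rewrite (meanZ ExP) (meanD ExP) -mulrA; apply: ler_wpM2l; first by nonneg.
by lra.
Qed.

End Moments.

Lemma flux_incr_indep m j e e' : e' \notin box j.+1 e -> indep e' (flux_incr m j e).
Proof.
move=> h1.
have h2 : e' \notin box j e by apply: contra h1; rewrite !inE => /leqW.
move=> c k; rewrite /flux_incr /local_flux.
by rewrite (indep_avg rho _ (_ : e' \in enum (~: box j.+1 e)))
  ?(indep_avg rho _ (_ : e' \in enum (~: box j e))) // mem_enum inE.
Qed.

Definition nshells : nat := (d * h ^ 2).+1.

Lemma flux_telescope m c e : 0 < m ->
  flux m c e = zeta e.2 + \sum_(j < nshells) flux_incr m j e c.
Proof.
move=> m0.
have q0 : local_flux m 0 e c = zeta e.2.
  rewrite /local_flux (_ : enum (~: box 0 e) = enum {: E}); last first.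
    by apply: eq_enum => e'; rewrite !inE.
  rewrite avg_enum // (mean_ext ExP (g := fun c => zeta e.2 + (phi m c (ttgt e) - phi m c (tsrc e)))) //.
  rewrite (meanD ExP) (mean_cst ExP) (meanB ExP).
  rewrite !(Ex_phi0 rho_ge0 rho_sum al_gt0 vl_itv zeta _ m0); lra.
have q1 : local_flux m nshells e c = flux m c e.
  rewrite /local_flux (_ : enum (~: box nshells e) = [::]) //.
  apply/eqP; rewrite -size_eq0 -cardE cards_eq0; apply/eqP/setP => e'.
  by rewrite !inE ltnS shell_bound.
rewrite -q1 -q0 (eq_bigr (fun j : 'I_nshells => local_flux m j.+1 e c - local_flux m j e c)) //.
rewrite -(big_mkord xpredT (fun j => local_flux m j.+1 e c - local_flux m j e c)).
by rewrite telescope_sumr // addrC subrK.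
Qed.

Definition flux_rate : R := (1 + tau) / 2.

Let flux_rate_gt0 : 0 < flux_rate. Proof. by rewrite /flux_rate; have := tau_gt0; lra. Qed.

Let flux_rate_lt1 : flux_rate < 1. Proof. by rewrite /flux_rate; have := tau_lt1; lra. Qed.

Definition flux_part s m j e c : R := flux_rate ^- (j * (2 * s).+1) * flux_incr m j e c ^+ (2 * s.+1).

Lemma flux_part_ge0 s m j e c : 0 <= flux_part s m j e c.
Proof.
apply: mulr_ge0; first by rewrite invr_ge0 exprn_ge0 // ltW.
exact: expr_double_ge0.
Qed.

Lemma flux_part_indep s m j e e' : e' \notin box j.+1 e -> indep e' (flux_part s m j e).
Proof. by move=> hb c k; rewrite /flux_part (flux_incr_indep m hb). Qed.

Definition flux_part_mean : R := 2 + 2 / (1 - flux_rate) ^+ 2.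

Lemma geometric_cauchy_schwarz (r : R) n (g : nat -> R) : 0 < r < 1 ->
  (\sum_(j < n) g j) ^+ 2 <= (1 - r)^-1 * \sum_(j < n) r ^- j * g j ^+ 2.
Proof.
move=> /andP[r0 r1]; have r_neq0 j : r ^+ j != 0 by rewrite expf_neq0 // gt_eqF.
have := cauchy_schwarz_seq (index_enum _) xpredT (fun=> 1)
  (fun j : 'I_n => r ^- j * g j) (fun j : 'I_n => exprn_ge0 j (ltW r0)).
have -> : \sum_(j < n) r ^+ j * 1 * (r ^- j * g j) = \sum_(j < n) g j.
  by apply: eq_bigr => j _; rewrite mulr1 mulrA mulfV ?mul1r.
move=> /le_trans; apply.
have -> : \sum_(j < n) r ^+ j * (r ^- j * g j) ^+ 2 = \sum_(j < n) r ^- j * g j ^+ 2.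
  by apply: eq_bigr => j _; have := r_neq0 j; set u := r ^+ j => un; rewrite exprMn; field.
apply: ler_wpM2r.
  by apply: sumr_ge0 => j _; apply: mulr_ge0; [rewrite invr_ge0 exprn_ge0 // ltW|exact: sqr_ge0].
under eq_bigr do rewrite expr1n mulr1.
by have := @geometric_tail R r 0 n; rewrite expr0 div1r; apply; rewrite r1 ltW.
Qed.

Lemma excess_power (u x : R) s : 0 < u -> 0 <= x ->
  u^-1 * x <= u + u^-1 * (u ^- (2 * s) * x ^+ s) * x.
Proof.
move=> u0 x0; have [xu|xu] := leP x (u ^+ 2).
  apply: le_trans (_ : u <= _); first by rewrite ler_pdivrMl // -expr2.
  by rewrite lerDl; apply: mulr_ge0 => //; nonneg.
apply: ler_wpDl; first exact: ltW.
apply: ler_wpM2r => //; rewrite ler_peMr ?invr_ge0 ?(ltW u0) //.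
rewrite mulrC exprM ler_pdivlMr ?exprn_gt0 // mul1r.
by rewrite lerXn2r ?nnegrE ?sqr_ge0 // ltW.
Qed.

Lemma flux2_decomp s m c e : 0 < m ->
  flux2 m c e <= flux_part_mean + 2 / (1 - flux_rate) * \sum_(j < nshells) flux_part s m j e c.
Proof.
move=> m0; rewrite /flux2 (flux_telescope c e m0).
have r0 := flux_rate_gt0; have r1 := flux_rate_lt1.
apply: le_trans (sqrrD_le _ _) _.
have zeta_sqr : zeta e.2 ^+ 2 <= 1.
  by rewrite -(real_normK (num_real _)) expr_le1.
have split : \sum_(j < nshells) flux_rate ^- j * flux_incr m j e c ^+ 2 <=
    (1 - flux_rate)^-1 + \sum_(j < nshells) flux_part s m j e c.
  have geo : \sum_(j < nshells) flux_rate ^+ j <= (1 - flux_rate)^-1.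
    have := @geometric_tail R flux_rate 0 nshells; rewrite expr0 div1r; apply.
    by rewrite r1 ltW.
  apply: le_trans (lerD geo (lexx _)); rewrite -big_split; apply: ler_sum => j _ /=.
  have u0 : 0 < flux_rate ^+ j by rewrite exprn_gt0.
  apply: le_trans (excess_power s u0 (sqr_ge0 (flux_incr m j e c))) _; rewrite lerD2l; apply: eq_leW.
  set x := flux_incr m j e c; rewrite /flux_part -/x [flux_rate ^+ (j * _)]exprM; set u := flux_rate ^+ j.
  by rewrite [u ^+ _.+1]exprS invfM [x ^+ (2 * _)]exprM [x ^+ 2 ^+ _.+1]exprS; ring.
have series : (\sum_(j < nshells) flux_incr m j e c) ^+ 2 <=
    (1 - flux_rate)^-1 * ((1 - flux_rate)^-1 + \sum_(j < nshells) flux_part s m j e c).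
  have rate_itv : 0 < flux_rate < 1 by rewrite r0.
  apply: le_trans (geometric_cauchy_schwarz _ (fun j => flux_incr m j e c) rate_itv) _.
  by apply: ler_wpM2l split; rewrite invr_ge0; lra.
rewrite /flux_part_mean -exprVn; move: series; set w := (1 - flux_rate)^-1.
by rewrite mulrDr; lra.
Qed.

Definition part_ratio p : R := (tau / flux_rate ^+ 2) ^+ p.+1 / tau.

Definition part_const p : R := 4 ^+ p.+1 * (2 * local_flux_const p) * tau ^- p.

Lemma flux_part_moment s t p m j e : 0 < m -> 32 * d%:R <= m * h%:R ->
  2 * 64 ^+ d <= growth_rate ^+ p -> (s.+1 * t = p.+1)%N ->
  Ex (fun c => flux_part s m j e c ^+ t) <= part_const p * part_ratio p ^+ j.
Proof.
move=> m0 m_large p_large st; have f0 := flux_rate_gt0; have f1 := flux_rate_lt1; have t0 := tau_gt0; have t1 := tau_lt1.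
have C0 := local_flux_const_ge0 p.
rewrite (mean_ext ExP (g := fun c => (flux_rate ^- (j * (2 * s).+1)) ^+ t * flux_incr m j e c ^+ (2 * p.+1))); last first.
  by move=> c; rewrite /flux_part exprMn -exprM -mulnA st.
rewrite (meanZ ExP).
have i1 : 1 <= flux_rate^-1 by rewrite invf_ge1 // ltW.
apply: le_trans (_ : (flux_rate^-1) ^+ (j * (2 * p.+1)) * (4 ^+ p.+1 * (2 * local_flux_const p) * tau ^+ (j.-1 * p)) <= _).
  apply: ler_pM.
  - by rewrite exprn_ge0 // invr_ge0 exprn_ge0 // ltW.
  - by apply: (mean_ge0 ExP) => c; exact: expr_double_ge0.
  - rewrite -exprVn -exprM; apply: ler_weXn2l => //.
    by rewrite -mulnA leq_mul2l -st mulnA leq_mul2r; apply/orP; right; apply/orP; right; rewrite mulnS !addSn add0n leqnSn.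
  - exact: flux_incr_moment.
rewrite /part_const; set K := 4 ^+ p.+1 * _.
have K0 : 0 <= K by rewrite /K; nonneg.
have tj : tau ^+ (j.-1 * p) <= tau ^- p * tau ^+ (j * p).
  case: j => [|j] /=.
    rewrite !mul0n expr0 mulr1 invf_ge1 ?exprn_gt0 // exprn_ile1 //; exact: ltW.
  by rewrite mulSn exprD mulKf // expf_neq0 // gt_eqF.
apply: le_trans (_ : flux_rate^-1 ^+ (j * (2 * p.+1)) * (K * (tau ^- p * tau ^+ (j * p))) <= _).
  by apply: ler_wpM2l; [rewrite exprn_ge0 // invr_ge0 ltW|apply: ler_wpM2l].
apply: eq_leW.
have -> : part_ratio p = flux_rate^-1 ^+ (2 * p.+1) * tau ^+ p.
  rewrite /part_ratio exprMn -exprVn -exprM exprS.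
  by field; rewrite gt_eqF.
by rewrite [(_ * tau ^+ p) ^+ j]exprMn -!exprM [(2 * p.+1 * j)%N]mulnC [(p * j)%N]mulnC; ring.
Qed.

End FluxDecomposition.

(** * Energy weighted by the squared flux, by decoupling *)

Definition poincare (R : realFieldType) (T E : finType) (src tgt : E -> T) (Lam : {set T}) (Ga m : R) : Prop :=
  forall u : T -> R, \sum_(x in Lam) u x ^+ 2 <= Ga * (\sum_e grd src tgt u e ^+ 2 + m * \sum_x u x ^+ 2).

Section LocalizedSource.
Variables (R : realFieldType) (T E : finType) (src tgt : E -> T).
Variables (al be : R) (al_gt0 : 0 < al) (al_be : al <= be).
Variables (m Ga : R) (m_gt0 : 0 < m) (Ga_gt0 : 0 < Ga) (Lam : {set T}).
Local Notation grd := (grd src tgt).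
Hypothesis Ga_poincare : poincare src tgt Lam Ga m.

Definition ellmin : R := al / (1 + al).

Lemma ellmin_itv : 0 < ellmin <= 1 /\ ellmin <= al.
Proof.
have a0 := al_gt0; have p : 0 < 1 + al by lra.
rewrite /ellmin; split; last by rewrite ler_pdivrMr //; nra.
by rewrite divr_gt0 //= ler_pdivrMr // mul1r; lra.
Qed.

Lemma localized_source (u f : T -> R) (X : R) : (forall x, x \notin Lam -> f x = 0) ->
  2 * m * (\sum_x u x ^+ 2) + al * (\sum_e grd u e ^+ 2) <= 2 * (\sum_x f x * u x) + X ->
  \sum_e grd u e ^+ 2 + m * (\sum_x u x ^+ 2) <=
  4 / ellmin ^+ 2 * Ga * (\sum_(x in Lam) f x ^+ 2) + 2 / ellmin * X.
Proof.
move=> hf hu; have [/andP[c0 c1] ca] := ellmin_itv.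
set D := \sum_e grd u e ^+ 2 in hu *; set M := \sum_x u x ^+ 2 in hu *.
set F := \sum_(x in Lam) f x ^+ 2.
have D0 : 0 <= D by rewrite /D; nonneg.
have M0 : 0 <= m * M by rewrite /M; nonneg.
have y : 2 * (\sum_x f x * u x) <= 2 * Ga / ellmin * F + ellmin / (2 * Ga) * (Ga * (D + m * M)).
  apply: le_trans (_ : 2 * Ga / ellmin * F + ellmin / (2 * Ga) * \sum_(x in Lam) u x ^+ 2 <= _); last first.
    by rewrite lerD2l; apply: ler_wpM2l; [nonneg|exact: Ga_poincare].
  have -> : \sum_x f x * u x = \sum_(x in Lam) f x * u x.
    by rewrite (bigID (mem Lam)) /= [X in _ + X]big1 ?addr0 // => x /hf ->; rewrite mul0r.
  rewrite /F !mulr_sumr -big_split; apply: ler_sum => x _ /=.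
  have -> : 2 * Ga / ellmin * f x ^+ 2 + ellmin / (2 * Ga) * u x ^+ 2 =
    2 * (f x * u x) + ellmin / (2 * Ga) * (u x - 2 * Ga / ellmin * f x) ^+ 2.
    by field; rewrite !gt_eqF.
  by rewrite lerDl; nonneg.
have e1 : ellmin / (2 * Ga) * (Ga * (D + m * M)) = ellmin / 2 * (D + m * M) by field; rewrite gt_eqF.
rewrite e1 in y.
have l1 : ellmin * (D + m * M) <= 2 * m * M + al * D.
  have : ellmin * D <= al * D by apply: ler_wpM2r.
  have : ellmin * (m * M) <= 1 * (m * M) by apply: ler_wpM2r.
  by lra.
have fin : ellmin / 2 * (D + m * M) <= 2 * Ga / ellmin * F + X by lra.
have -> : D + m * M = 2 / ellmin * (ellmin / 2 * (D + m * M)) by field; rewrite gt_eqF.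
have -> : 4 / ellmin ^+ 2 * Ga * F + 2 / ellmin * X = 2 / ellmin * (2 * Ga / ellmin * F + X).
  by field; rewrite gt_eqF.
by apply: ler_wpM2l fin; nonneg.
Qed.

Lemma localized_energy a u f : elliptic al be a -> weak_sol src tgt m a u f (fun=> 0) ->
  (forall x, x \notin Lam -> f x = 0) ->
  \sum_e grd u e ^+ 2 + m * (\sum_x u x ^+ 2) <= 4 / ellmin ^+ 2 * Ga * \sum_(x in Lam) f x ^+ 2.
Proof.
move=> ea su hf; have := weak_sol_energy_div al_gt0 ea su.
have -> : \sum_(e : E) (0 : R) ^+ 2 = 0 by rewrite big1 // => e _; rewrite expr0n.
rewrite mulr0 => H.
by have := localized_source hf H; rewrite mulr0 addr0.
Qed.

Definition box_energy_const : R := 2 + 8 / ellmin ^+ 2 + 4 / ellmin * (be ^+ 2 / al).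

Lemma box_energy_const_ge1 : 1 <= box_energy_const.
Proof.
have [/andP[c0 c1] ca] := ellmin_itv; rewrite /box_energy_const.
have h1 : 0 <= 8 / ellmin ^+ 2 by nonneg.
have h2 : 0 <= 4 / ellmin * (be ^+ 2 / al) by nonneg.
by lra.
Qed.

Lemma box_energy (B : {set E}) a a' v v' f f' : elliptic al be a -> elliptic al be a' ->
  (forall e, e \notin B -> a e = a' e) ->
  weak_sol src tgt m a v f (fun=> 0) -> weak_sol src tgt m a' v' f' (fun=> 0) ->
  (forall x, x \notin Lam -> f x = 0) -> (forall x, x \notin Lam -> f' x = 0) ->
  \sum_(e in B) grd v e ^+ 2 <=
  box_energy_const * (\sum_(e in B) grd v' e ^+ 2 + Ga * \sum_(x in Lam) (f x - f' x) ^+ 2).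
Proof.
move=> ea ea' hB sv sv' hf hf'; have [/andP[c0 c1] ca] := ellmin_itv.
have := weak_sol_perturb al_gt0 m_gt0 ea ea' hB sv sv' => H.
have hff x : x \notin Lam -> f x - f' x = 0 by move=> hx; rewrite hf ?hf' ?subrr.
have := localized_source hff H.
set D := \sum_e _; set M := m * _; set F := \sum_(x in Lam) _; set G := \sum_(e in B) grd v' e ^+ 2.
have M0 : 0 <= M by rewrite /M; nonneg.
have F0 : 0 <= F by rewrite /F; nonneg.
have G0 : 0 <= G by rewrite /G; nonneg.
move=> k.
have s : \sum_(e in B) grd v e ^+ 2 <= 2 * G + 2 * D.
  rewrite /D [X in _ + 2 * X](bigID (mem B)) /= mulrDr addrA.
  apply: ler_wpDr; first by nonneg.
  rewrite /G !mulr_sumr -big_split; apply: ler_sum => e _ /=.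
  have -> : grd v e = grd v' e + grd (fun x => v x - v' x) e by rewrite grdB; ring.
  exact: sqrrD_le.
rewrite /box_energy_const.
have GF : 0 <= Ga * F by nonneg.
have h1 : 0 <= 8 / ellmin ^+ 2 by nonneg.
have h2 : 0 <= 4 / ellmin * (be ^+ 2 / al) by nonneg.
have p1 := mulr_ge0 h1 G0; have p2 := mulr_ge0 h2 GF.
rewrite [leRHS](_ : _ = 2 * G + 2 * (Ga * F) + 8 / ellmin ^+ 2 * G + 8 / ellmin ^+ 2 * (Ga * F) +
   4 / ellmin * (be ^+ 2 / al) * G + 4 / ellmin * (be ^+ 2 / al) * (Ga * F)); last by ring.
have k' : 2 * D <= 8 / ellmin ^+ 2 * (Ga * F) + 4 / ellmin * (be ^+ 2 / al) * G.
  apply: le_trans (_ : 2 * (4 / ellmin ^+ 2 * Ga * F + 2 / ellmin * (be ^+ 2 / al * G)) <= _).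
    by apply: ler_wpM2l => //; lra.
  by apply: eq_leW; ring.
by lra.
Qed.

End LocalizedSource.

Section WeightedEnergy.
Variables (R : realFieldType) (d h : nat).
Variables (J : finType) (rho : J -> R) (j0 : J).
Hypotheses (rho_ge0 : forall j, 0 <= rho j) (rho_sum : \sum_j rho j = 1).
Variables (al be : R) (al_gt0 : 0 < al) (al_be : al <= be).
Variables (vl : J -> R) (vl_itv : forall j, al <= vl j <= be).
Local Notation T := (torus d h).
Local Notation E := (T * 'I_d)%type.
Local Notation cfg := {ffun E -> J}.
Local Notation Ex := (Ex (E := E) rho).
Local Notation box := (@box R d h).
Local Notation src := (@tsrc d h).
Local Notation tgt := (@ttgt d h).
Local Notation grd := (grd src tgt).
Implicit Types (c : cfg) (e : E) (x y z : T) (j : nat) (B : {set E}).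

Let ExP : is_mean Ex. Proof. exact: Ex_mean. Qed.

Definition reset B c : cfg := [ffun e => if e \in B then j0 else c e].

Lemma reset_upd B c e k : e \in B -> reset B (upd c e k) = reset B c.
Proof.
move=> eB; apply/ffunP => e'; rewrite !ffunE; case: ifP => // e'B.
by case: eqP => // ee; rewrite ee eB in e'B.
Qed.

Lemma cfield_reset B c e : e \notin B -> cfield vl c e = cfield vl (reset B c) e.
Proof. by move=> /negPf eB; rewrite /cfield ffunE eB. Qed.

Variables (m Ga : R) (m_gt0 : 0 < m) (Ga_gt0 : 0 < Ga) (Lam : {set T}).
Hypothesis Ga_poincare : poincare src tgt Lam Ga m.
Variables (hh : cfg -> T -> R).
Hypothesis hh_supp : forall c x, x \notin Lam -> hh c x = 0.

Definition dual_sol c : T -> R := solution src tgt m (cfield vl c) (hh c) (fun=> 0).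

Lemma dual_solP c : weak_sol src tgt m (cfield vl c) (dual_sol c) (hh c) (fun=> 0).
Proof.
by apply: solutionP => // e; apply: le_trans (ltW al_gt0) _; have /andP[] := vl_itv (c e).
Qed.

Definition reset_diff B c : R := \sum_(y in Lam) (hh c y - hh (reset B c) y) ^+ 2.

Lemma reset_diff_ge0 B c : 0 <= reset_diff B c.
Proof. by rewrite /reset_diff; nonneg. Qed.

Local Notation K3 := (box_energy_const al be).

Let K3_ge1 : 1 <= K3. Proof. exact: box_energy_const_ge1. Qed.

Lemma box_energy_reset B c :
  \sum_(e in B) grd (dual_sol c) e ^+ 2 <=
  K3 * (\sum_(e in B) grd (dual_sol (reset B c)) e ^+ 2 + Ga * reset_diff B c).
Proof.
apply: (box_energy al_gt0 m_gt0 Ga_gt0 Ga_poincare (cfield_elliptic vl_itv c) (cfield_elliptic vl_itv (reset B c)))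
  => //; [by move=> e; exact: cfield_reset|exact: dual_solP|exact: dual_solP|exact: hh_supp|exact: hh_supp].
Qed.

Lemma box_energy_reset_rev B c :
  \sum_(e in B) grd (dual_sol (reset B c)) e ^+ 2 <=
  K3 * (\sum_(e in B) grd (dual_sol c) e ^+ 2 + Ga * reset_diff B c).
Proof.
have -> : reset_diff B c = \sum_(y in Lam) (hh (reset B c) y - hh c y) ^+ 2.
  by apply: eq_bigr => y _; ring.
apply: (box_energy al_gt0 m_gt0 Ga_gt0 Ga_poincare (cfield_elliptic vl_itv (reset B c)) (cfield_elliptic vl_itv c))
  => //; [by move=> e he; rewrite -cfield_reset|exact: dual_solP|exact: dual_solP|exact: hh_supp|exact: hh_supp].
Qed.

Lemma decoupled_energy B (b : cfg -> R) e : e \in B -> (forall c, 0 <= b c) ->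
  (forall e', e' \notin B -> indep e' b) ->
  Ex (fun c => b c * grd (dual_sol c) e ^+ 2) <=
  K3 ^+ 2 * (Ex b * Ex (fun c => \sum_(e in B) grd (dual_sol c) e ^+ 2) +
    Ga * Ex (fun c => (b c + Ex b) * reset_diff B c)).
Proof.
move=> eB b0 bi; have K0 : 0 <= K3 by have := K3_ge1; lra.
have Eb0 : 0 <= Ex b by apply: (mean_ge0 ExP).
pose F c := \sum_(e in B) grd (dual_sol c) e ^+ 2.
have F0 c : 0 <= F c by rewrite /F; nonneg.
have s1 : Ex (fun c => b c * grd (dual_sol c) e ^+ 2) <=
   K3 * (Ex (fun c => F (reset B c) * b c) + Ga * Ex (fun c => b c * reset_diff B c)).
  rewrite -(meanZ ExP Ga) -(meanD ExP) -(meanZ ExP); apply: (mean_mono ExP) => c.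
  apply: le_trans (_ : b c * F c <= _).
    apply: ler_wpM2l => //; rewrite /F (bigD1 e) //= lerDl; nonneg.
  apply: le_trans (ler_wpM2l (b0 c) (box_energy_reset B c)) _.
  by rewrite -/(F (reset B c)); apply: eq_leW; ring.
have ind : Ex (fun c => F (reset B c) * b c) = Ex (fun c => F (reset B c)) * Ex b.
  apply: (Ex_indep rho_ge0 rho_sum (l := enum B)).
    by move=> e'; rewrite mem_enum => /bi.
  by move=> e'; rewrite mem_enum => e'B c k; rewrite reset_upd.
have s2 : Ex (fun c => F (reset B c)) <= K3 * (Ex F + Ga * Ex (reset_diff B)).
  rewrite -(meanZ ExP Ga) -(meanD ExP) -(meanZ ExP); apply: (mean_mono ExP) => c.
  exact: box_energy_reset_rev.
have -> : Ex (fun c => (b c + Ex b) * reset_diff B c) = Ex (fun c => b c * reset_diff B c) + Ex b * Ex (reset_diff B).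
  rewrite -(meanZ ExP) -(meanD ExP); apply: (mean_ext ExP) => c; ring.
apply: (le_trans s1); rewrite ind.
set X := Ex (fun c => F (reset B c)) in s2 *; set Y := Ex (fun c => b c * reset_diff B c).
set Z := Ex (reset_diff B) in s2 *; rewrite -/F; set W := Ex F in s2 *; set bb := Ex b in Eb0 *.
have Y0 : 0 <= Y by apply: (mean_ge0 ExP) => c; apply: mulr_ge0 => //; exact: reset_diff_ge0.
have q1 : X * bb <= K3 * (W + Ga * Z) * bb by apply: ler_wpM2r.
have q2 : Ga * Y <= K3 * (Ga * Y) by rewrite ler_peMl //; nonneg.
rewrite expr2 -mulrA; apply: ler_wpM2l => //.
by move: q1 q2; lra.
Qed.

Hypothesis d_gt0 : (0 < d)%N.
Variables (Th KS KW : R) (P : nat).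
Variables (ker : T -> cfg -> E -> R) (w : cfg -> E -> R).
Hypotheses (ker_ge0 : forall y c e, 0 <= ker y c e) (w_ge0 : forall c e, 0 <= w c e).
Hypotheses (KS_ge0 : 0 <= KS) (KW_ge0 : 0 <= KW).
Hypothesis hh_reset : forall B c y, y \in Lam ->
  (hh c y - hh (reset B c) y) ^+ 2 <=
  Th ^+ 2 * ((\sum_(e in B) ker y c e) * \sum_(e in B) w c e).
Hypothesis ker_sum : forall y (Y : cfg -> E -> R) M, y \in Lam ->
  (forall c e, 0 <= Y c e) -> (forall e, Ex (fun c => Y c e ^+ P.+1) <= M) ->
  Ex (fun c => (\sum_e ker y c e * Y c e) ^+ P.+1) <= KS * M.
Hypothesis w_moment : forall e, Ex (fun c => w c e ^+ (2 * P.+1)) <= KW.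
Variables (bt : nat -> E -> cfg -> R) (bC del : R).
Hypotheses (bt_ge0 : forall j e c, 0 <= bt j e c) (bC_ge0 : 0 <= bC).
Hypothesis bt_local : forall j e e', e' \notin box j.+1 e -> indep e' (bt j e).
Hypothesis bt_moment : forall j e, Ex (fun c => bt j e c ^+ (2 * P.+1)) <= bC * del ^+ j.

Let mul2S : ((2 * P).+2 = 2 * P.+1)%N. Proof. by rewrite mulnS. Qed.

Definition scale_growth : R := 64 ^+ d.

Definition scale_decay : R := (2 * scale_growth ^+ 2) ^+ P.+1.

Hypothesis del_small : 0 <= del /\ del * scale_decay ^+ 2 <= 1.

Let scale_growth_ge1 : 1 <= scale_growth. Proof. by rewrite /scale_growth -natrX (ler_nat R 1) expn_gt0. Qed.

Let scale_decay_gt0 : 0 < scale_decay.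
Proof. by rewrite /scale_decay exprn_gt0 // mulr_gt0 // exprn_gt0 //; have := scale_growth_ge1; lra. Qed.

Lemma box_size_powers j : box_size R d j.+1 = box_size R d 1 * scale_growth ^+ j.
Proof.
rewrite /box_size /scale_growth -exprM [(d * j)%N]mulnC exprM -mulrA -exprMn; congr (_ * _ ^+ _).
by rewrite expr1 exprS; ring.
Qed.

Let box_size1_gt0 : 0 < box_size R d 1.
Proof.
by rewrite /box_size; apply: mulr_gt0; rewrite ?ltr0n // exprn_gt0 // mulr_gt0 // exprn_gt0.
Qed.

Lemma split_power (t l : R) p : 0 <= t -> 0 < l -> t <= l + t ^+ p.+1 / l ^+ p.
Proof.
move=> t0 l0; have [tl|tl] := leP t l; first by apply: ler_wpDr => //; nonneg.
apply: ler_wpDl; first exact: ltW.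
rewrite ler_pdivlMr ?exprn_gt0 // exprS; apply: ler_wpM2l => //.
by rewrite lerXn2r ?nnegrE ?(ltW l0) // ltW.
Qed.

Lemma bt_mean j e : Ex (bt j e) <= (1 + bC) * (2 * scale_growth) ^- j.
Proof.
have [d0 d1] := del_small; have n := scale_growth_ge1.
set l := (2 * scale_growth) ^- j.
have l0 : 0 < l by rewrite invr_gt0 exprn_gt0; lra.
apply: le_trans (_ : Ex (fun c => l + l ^- (2 * P).+1 * bt j e c ^+ (2 * P.+1)) <= _).
  apply: (mean_mono ExP) => c; have := split_power (2 * P).+1 (bt_ge0 j e c) l0.
  by rewrite mul2S [_ / _]mulrC.
rewrite (meanD ExP) (mean_cst ExP) (meanZ ExP) mulrDl mul1r lerD2l.
rewrite mulrC ler_pdivrMr ?exprn_gt0 //; apply: le_trans (bt_moment j e) _.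
rewrite -mulrA; apply: ler_wpM2l => //.
rewrite -exprS mul2S /l exprVn -exprM mulnC exprM -exprVn.
rewrite lerXn2r ?nnegrE //; first by rewrite invr_ge0 exprn_ge0; lra.
rewrite -[leRHS]div1r ler_pdivlMr; last by rewrite exprn_gt0; lra.
apply: le_trans d1; apply: ler_wpM2l => //.
rewrite [leRHS](_ : _ = (2 * scale_growth ^+ 2) ^+ (2 * P.+1)); last by rewrite /scale_decay -exprM mulnC.
rewrite lerXn2r ?nnegrE; [by []|by lra|by have := scale_growth_ge1; nra|].
by apply: ler_wpM2l => //; rewrite expr2 ler_peMl; lra.
Qed.

Lemma card_power (I : finType) (Q : pred I) (f : I -> R) (N : R) p :
  (forall i, 0 <= f i) -> \sum_(i | Q i) 1 <= N ->
  (\sum_(i | Q i) f i) ^+ p.+1 <= N ^+ p * \sum_(i | Q i) f i ^+ p.+1.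
Proof.
move=> f0 hN; have w0 i : 0 <= (if Q i then 1 else 0 : R) by case: ifP.
have sumQ (g : I -> R) : \sum_i (if Q i then 1 else 0) * g i = \sum_(i | Q i) g i.
  by rewrite [RHS]big_mkcond; apply: eq_bigr => i _; case: ifP; rewrite ?mul1r ?mul0r.
have := weighted_power_sum (index_enum I) p w0 f0; rewrite !sumQ -big_mkcond /=.
move=> /le_trans; apply; apply: ler_wpM2r; first by apply: sumr_ge0 => i _; rewrite exprn_ge0.
have s0 : 0 <= \sum_(i | Q i) 1 :> R by apply: sumr_ge0.
by rewrite lerXn2r ?nnegrE //; apply: le_trans hN.
Qed.

Lemma Ex_sum_cond (I : finType) (Q : pred I) (F : I -> cfg -> R) :
  Ex (fun c => \sum_(i | Q i) F i c) = \sum_(i | Q i) Ex (F i).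
Proof.
rewrite -[RHS]big_filter -(mean_sum ExP); apply: (mean_ext ExP) => c.
by rewrite big_filter.
Qed.

Definition bt_plus_mean j e c : R := bt j e c + Ex (bt j e).

Lemma bt_plus_mean_ge0 j e c : 0 <= bt_plus_mean j e c.
Proof. by rewrite /bt_plus_mean addr_ge0 //; apply: (mean_ge0 ExP). Qed.

Lemma bt_plus_mean_moment j e : Ex (fun c => bt_plus_mean j e c ^+ (2 * P.+1)) <=
  2 ^+ (2 * P.+1) * (2 * (bC * del ^+ j)).
Proof.
set q := (2 * P.+1)%N; have B0 : 0 <= Ex (bt j e) by apply: (mean_ge0 ExP).
apply: le_trans (_ : Ex (fun c => 2 ^+ q * (bt j e c ^+ q + Ex (bt j e) ^+ q)) <= _).
  by apply: (mean_mono ExP) => c; apply: exprD_le.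
rewrite (meanZ ExP) (meanD ExP) (mean_cst ExP); apply: ler_wpM2l; first by rewrite exprn_ge0.
have := bt_moment j e; rewrite -/q.
by have := mean_power ExP q (bt_ge0 j e); lra.
Qed.

Definition mixed_const : R := 2 ^+ (2 * P.+1) * bC + KW.

Lemma mixed_moment j e e' :
  Ex (fun c => (bt_plus_mean j e c * w c e') ^+ P.+1) <= mixed_const * scale_decay ^- j.
Proof.
have [d0 d1] := del_small.
set l := scale_decay ^- j; have l0 : 0 < l by rewrite invr_gt0 exprn_gt0.
apply: le_trans (_ : Ex (fun c => l^-1 / 2 * bt_plus_mean j e c ^+ (2 * P.+1) +
    l / 2 * w c e' ^+ (2 * P.+1)) <= _).
  apply: (mean_mono ExP) => c; rewrite exprMn ![(2 * _)%N]mulnC !exprM.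
  set X := _ ^+ P.+1; set Y := _ ^+ P.+1.
  have -> : l^-1 / 2 * X ^+ 2 + l / 2 * Y ^+ 2 = X * Y + l^-1 / 2 * (X - l * Y) ^+ 2.
    by field; rewrite gt_eqF.
  by rewrite lerDl; nonneg.
rewrite (meanD ExP) !(meanZ ExP) /mixed_const mulrDl; apply: lerD.
  have i0 : 0 <= l^-1 / 2 by nonneg.
  apply: le_trans (ler_wpM2l i0 (bt_plus_mean_moment j e)) _.
  have -> : l^-1 / 2 * (2 ^+ (2 * P.+1) * (2 * (bC * del ^+ j))) =
     2 ^+ (2 * P.+1) * bC * (del ^+ j / l) by field; rewrite gt_eqF.
  apply: ler_wpM2l; first by nonneg.
  rewrite ler_pdivrMr // -expr2 /l -exprVn -exprM mulnC exprM lerXn2r ?nnegrE //.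
    by rewrite exprn_ge0 // invr_ge0 ltW.
  by rewrite exprVn -[leRHS]mul1r ler_pdivlMr; [exact: d1|rewrite exprn_gt0].
have := w_moment e'; set W' := Ex _ => hw.
have W0 : 0 <= W' by apply: (mean_ge0 ExP) => c; rewrite exprn_ge0.
by rewrite -mulrA mulrC mulrAC; have := ler_wpM2r (ltW l0) hw; nra.
Qed.

Definition smeared_weight j c e' : R :=
  \sum_(e : E | e' \in box j.+1 e) bt_plus_mean j e c * \sum_(e'' in box j.+1 e) w c e''.

Lemma smeared_weight_ge0 j c e' : 0 <= smeared_weight j c e'.
Proof.
by apply: sumr_ge0 => e _; apply: mulr_ge0; [exact: bt_plus_mean_ge0|apply: sumr_ge0].
Qed.

Lemma box_size_scale_decay j : box_size R d j.+1 ^+ (2 * P.+1) * scale_decay ^- j =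
  box_size R d 1 ^+ (2 * P.+1) * 2 ^- (j * P.+1).
Proof.
have powers (x : R) : x ^+ 2 ^+ (P.+1 * j) = x ^+ j ^+ (2 * P.+1).
  by rewrite -!exprM; congr (_ ^+ _); rewrite mulnA mulnC.
rewrite box_size_powers [(_ * scale_growth ^+ j) ^+ _]exprMn -mulrA /scale_decay -exprM [(2 * _) ^+ _]exprMn powers [(j * _)%N]mulnC invfM.
by congr (_ * _); rewrite mulrCA mulfV ?mulr1 // !expf_neq0 // gt_eqF //.
Qed.

Lemma smeared_weight_power j c e' : smeared_weight j c e' ^+ P.+1 <=
  box_size R d j.+1 ^+ P * \sum_(e : E | e' \in box j.+1 e) box_size R d j.+1 ^+ P *
    \sum_(e'' in box j.+1 e) (bt_plus_mean j e c * w c e'') ^+ P.+1.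
Proof.
have N0 := box_size_ge0 R d j.+1.
apply: le_trans (card_power (N := box_size R d j.+1) P _ _) _.
- by move=> e; apply: mulr_ge0; [exact: bt_plus_mean_ge0|apply: sumr_ge0].
- exact: box_count_rev.
apply: ler_wpM2l; first by rewrite exprn_ge0.
apply: ler_sum => e _; rewrite [X in X ^+ _]mulr_sumr; apply: card_power; last exact: box_count.
by move=> e''; apply: mulr_ge0 => //; exact: bt_plus_mean_ge0.
Qed.

Lemma smeared_weight_moment j e' : Ex (fun c => smeared_weight j c e' ^+ P.+1) <=
  box_size R d 1 ^+ (2 * P.+1) * mixed_const * 2 ^- (j * P.+1).
Proof.
apply: le_trans (mean_mono ExP (fun c => smeared_weight_power j c e')) _.
set N := box_size R d j.+1; have N0 : 0 <= N by exact: box_size_ge0.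
set M := mixed_const * scale_decay ^- j.
have M0 : 0 <= M by rewrite /M /mixed_const; nonneg.
have NM0 : 0 <= N ^+ P * (N * M) by nonneg.
rewrite (meanZ ExP); apply: le_trans (_ : N ^+ P * (N ^+ P * (N * M) * N) <= _).
  apply: ler_wpM2l; first by rewrite exprn_ge0.
  apply: le_trans (ler_wpM2l NM0 (box_count_rev R j.+1 e')).
  rewrite Ex_sum_cond mulr_sumr; apply: ler_sum => e _; rewrite mulr1 (meanZ ExP).
  apply: ler_wpM2l; first by rewrite exprn_ge0.
  apply: le_trans (ler_wpM2r M0 (box_count R j.+1 e)).
  rewrite Ex_sum_cond mulr_suml; apply: ler_sum => e'' _; rewrite mul1r.
  exact: mixed_moment.
apply: eq_leW; transitivity (N ^+ (2 * P.+1) * scale_decay ^- j * mixed_const).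
  by rewrite mulnC exprM expr2 exprS /M; ring.
by rewrite box_size_scale_decay mulrAC.
Qed.

Definition reset_const : R := 1 + KS * (box_size R d 1 ^+ (2 * P.+1) * mixed_const).

Lemma ker_smeared_weight j y : y \in Lam ->
  Ex (fun c => \sum_e ker y c e * smeared_weight j c e) <= reset_const * 2 ^- j.
Proof.
move=> yL; have M0 : 0 <= mixed_const by rewrite /mixed_const; nonneg.
set l : R := 2 ^- j; have l0 : 0 < l by rewrite invr_gt0 exprn_gt0.
pose Z c := \sum_e ker y c e * smeared_weight j c e.
have Z0 c : 0 <= Z c by apply: sumr_ge0 => e _; apply: mulr_ge0 => //; exact: smeared_weight_ge0.
apply: le_trans (_ : Ex (fun c => l + l ^- P * Z c ^+ P.+1) <= _).
  apply: (mean_mono ExP) => c; have := split_power P (Z0 c) l0.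
  by rewrite [_ / _]mulrC.
rewrite (meanD ExP) (mean_cst ExP) (meanZ ExP) /reset_const mulrDl mul1r lerD2l.
have := ker_sum yL (fun c e => smeared_weight_ge0 j c e) (smeared_weight_moment j).
move=> ks; rewrite [l ^- P * _]mulrC ler_pdivrMr ?exprn_gt0 //; apply: (le_trans ks).
rewrite -!mulrA -!exprS /l exprVn -exprM lexx //.
Qed.

Definition energy_const : R := K3 ^+ 2 * (1 + bC) * (box_size R d 1).

Definition source_const : R := K3 ^+ 2 * reset_const.

Lemma mem_box_self j e : e \in box j.+1 e.
Proof.
rewrite inE subrr /shell; case: ex_minnP => k _ min_k; rewrite ltnS.
apply: leq_trans (min_k 0%N _) _ => //.
by rewrite /sqnorm big1 ?expr1 // => i _; rewrite /ccoord ffunE clift0 expr0n.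
Qed.

Lemma sum_box_le j (F : E -> R) : (forall e, 0 <= F e) ->
  \sum_e \sum_(e' in box j e) F e' <= box_size R d j * \sum_e F e.
Proof.
move=> F0; under eq_bigr do rewrite big_mkcond.
rewrite exchange_big mulr_sumr; apply: ler_sum => e' _ /=.
apply: le_trans (ler_wpM2r (F0 e') (box_count_rev R j e')).
by rewrite -big_mkcond mulr_suml; apply: ler_sum => e _; rewrite mul1r.
Qed.

Lemma sum_reset_diff j :
  \sum_e Ex (fun c => bt_plus_mean j e c * reset_diff (box j.+1 e) c) <=
  Th ^+ 2 * #|Lam|%:R * (reset_const * 2 ^- j).
Proof.
rewrite -(mean_sum ExP).
apply: le_trans (_ : Ex (fun c => Th ^+ 2 * \sum_(y in Lam) \sum_e ker y c e * smeared_weight j c e) <= _).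
  apply: (mean_mono ExP) => c; rewrite /reset_diff mulr_sumr.
  under eq_bigr => e _ do rewrite mulr_sumr.
  rewrite exchange_big /=; apply: ler_sum => y yL.
  have -> : \sum_e' ker y c e' * smeared_weight j c e' =
    \sum_e bt_plus_mean j e c * ((\sum_(e' in box j.+1 e) ker y c e') * \sum_(e'' in box j.+1 e) w c e'').
    rewrite /smeared_weight; under eq_bigr => e' _ do rewrite big_mkcond mulr_sumr.
    rewrite exchange_big /=; apply: eq_bigr => e _.
    rewrite mulr_suml mulr_sumr [RHS]big_mkcond; apply: eq_bigr => e' _.
    by case: ifP => _; rewrite ?mulr0 //; ring.
  rewrite mulr_sumr; apply: ler_sum => e _; rewrite [leRHS]mulrCA.
  by apply: ler_wpM2l; [exact: bt_plus_mean_ge0|exact: hh_reset].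
rewrite (meanZ ExP) -mulrA; apply: ler_wpM2l; first exact: sqr_ge0.
rewrite Ex_sum_cond mulr_natl -sumr_const; apply: ler_sum => y.
exact: ker_smeared_weight.
Qed.

Lemma bt_mean_box_size j : (1 + bC) * (2 * scale_growth) ^- j * box_size R d j.+1 =
  (1 + bC) * box_size R d 1 * 2 ^- j.
Proof.
have growth_ge1 := scale_growth_ge1.
have growth_neq0 : scale_growth ^+ j != 0 by rewrite expf_neq0 // gt_eqF //; lra.
have two_neq0 : 2 ^+ j != 0 :> R by rewrite expf_neq0 ?pnatr_eq0.
rewrite box_size_powers [(2 * scale_growth) ^+ j]exprMn.
move: growth_neq0 two_neq0; set a := scale_growth ^+ j; set b := 2 ^+ j => a_neq0 b_neq0.
by field; rewrite a_neq0 b_neq0.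
Qed.

Lemma scale_energy j :
  \sum_e Ex (fun c => bt j e c * grd (dual_sol c) e ^+ 2) <=
  (energy_const * Ex (fun c => \sum_e grd (dual_sol c) e ^+ 2) +
    source_const * (Ga * (Th ^+ 2 * #|Lam|%:R))) * 2 ^- j.
Proof.
pose V := Ex (fun c => \sum_e grd (dual_sol c) e ^+ 2).
pose Vbox e := Ex (fun c => \sum_(e' in box j.+1 e) grd (dual_sol c) e' ^+ 2).
pose D e := Ex (fun c => bt_plus_mean j e c * reset_diff (box j.+1 e) c).
have bt_ge0' : 0 <= (1 + bC) * (2 * scale_growth) ^- j.
  by rewrite mulr_ge0 ?addr_ge0 // invr_ge0 exprn_ge0 // mulr_ge0 // (le_trans ler01) ?scale_growth_ge1.
apply: le_trans (_ : \sum_e K3 ^+ 2 *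
    ((1 + bC) * (2 * scale_growth) ^- j * Vbox e + Ga * D e) <= _).
  apply: ler_sum => e _.
  apply: le_trans (decoupled_energy (mem_box_self j e) (bt_ge0 j e) (@bt_local j e)) _.
  apply: ler_wpM2l; first exact: sqr_ge0.
  by rewrite lerD2r; apply: ler_wpM2r; [apply: (mean_ge0 ExP) => c; nonneg|exact: bt_mean].
rewrite -mulr_sumr big_split /= -!mulr_sumr.
have box_part : \sum_e Vbox e <= box_size R d j.+1 * V.
  rewrite /Vbox /V -(mean_sum ExP) -(meanZ ExP); apply: (mean_mono ExP) => c.
  by apply: sum_box_le => e; exact: sqr_ge0.
have := ler_wpM2l bt_ge0' box_part; rewrite [X in _ <= X]mulrA bt_mean_box_size => {}box_part.
have reset_part := ler_wpM2l (ltW Ga_gt0) (sum_reset_diff j).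
apply: le_trans (ler_wpM2l (sqr_ge0 _) (lerD box_part reset_part)) _.
by apply: eq_leW; rewrite /energy_const /source_const -/V; ring.
Qed.

Variables (Wf : cfg -> E -> R) (J0 : nat) (c0 c1 : R).
Hypotheses (c0_ge0 : 0 <= c0) (c1_ge0 : 0 <= c1).
Hypothesis W_decomp : forall c e, Wf c e <= c0 + c1 * \sum_(j < J0) bt j e c.

Definition weighted_const : R := c0 + 2 * c1 * (energy_const + source_const).

Lemma weighted_energy :
  Ex (fun c => \sum_e Wf c e * grd (dual_sol c) e ^+ 2) <=
  weighted_const * (Ex (fun c => \sum_e grd (dual_sol c) e ^+ 2) + Ga * (Th ^+ 2 * #|Lam|%:R)).
Proof.
set V := Ex (fun c => \sum_e grd (dual_sol c) e ^+ 2); set Q := Ga * _.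
have V0 : 0 <= V by apply: (mean_ge0 ExP) => c; nonneg.
have Q0 : 0 <= Q by rewrite /Q; nonneg.
have M0 : 0 <= mixed_const by rewrite /mixed_const; nonneg.
have tK0 : 0 <= energy_const by rewrite /energy_const; nonneg; exact: box_size_ge0.
have tE0 : 0 <= source_const by rewrite /source_const /reset_const; nonneg; exact: box_size_ge0.
apply: le_trans (_ : Ex (fun c => c0 * (\sum_e grd (dual_sol c) e ^+ 2) +
   c1 * \sum_(j < J0) \sum_e bt j e c * grd (dual_sol c) e ^+ 2) <= _).
  apply: (mean_mono ExP) => c; rewrite exchange_big /= !mulr_sumr -big_split /=.
  apply: ler_sum => e _; apply: le_trans (ler_wpM2r (sqr_ge0 _) (W_decomp c e)) _.
  by rewrite mulrDl -mulrA mulr_suml.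
rewrite (meanD ExP) !(meanZ ExP) [X in _ + c1 * X](mean_sum ExP) -/V.
have s : \sum_(j < J0) Ex (fun c => \sum_e bt j e c * grd (dual_sol c) e ^+ 2) <= 2 * (energy_const * V + source_const * Q).
  apply: le_trans (_ : \sum_(j < J0) (energy_const * V + source_const * Q) * 2^-1 ^+ j <= _).
    apply: ler_sum => j _; rewrite (mean_sum ExP) exprVn; exact: scale_energy.
  rewrite -mulr_sumr mulrC; apply: ler_wpM2r; first by nonneg.
  have := @geometric_tail R (2^-1) 0 J0; rewrite expr0.
  have -> : 1 / (1 - 2^-1) = 2 :> R by field.
  by apply; lra.
have := ler_wpM2l c1_ge0 s; rewrite /weighted_const.
have p1 := mulr_ge0 c1_ge0 (mulr_ge0 tK0 Q0).
have p2 := mulr_ge0 c1_ge0 (mulr_ge0 tE0 V0).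
have p3 := mulr_ge0 c0_ge0 Q0.
by nra.
Qed.

End WeightedEnergy.

(** * Poincare inequalities and hole filling for planar arrays *)

Section Arrays.
Variable R : realFieldType.
Implicit Types (U V : nat -> nat -> R) (f : nat -> R) (a b n r s t K L : nat).

Lemma sum_nat_ge0 f a b : (forall i, 0 <= f i) -> 0 <= \sum_(a <= i < b) f i.
Proof. by move=> f0; apply: sumr_ge0. Qed.

Lemma sum_nat_sub f a b a' b' : (forall i, 0 <= f i) -> (a' <= a)%N -> (b <= b')%N ->
  \sum_(a <= i < b) f i <= \sum_(a' <= i < b') f i.
Proof.
move=> f0 aa bb; have [ab|ba] := leqP a b; last first.
  by rewrite big_geq ?sum_nat_ge0 // ltnW.
rewrite (@big_cat_nat _ _ _ a a' b') //=; last exact: leq_trans bb.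
rewrite (@big_cat_nat _ _ _ b a b') //=.
have := sum_nat_ge0 a' a f0; have := sum_nat_ge0 b b' f0; lra.
Qed.

Lemma sum_sub_range f a r n : (a + r <= n)%N -> (forall s, 0 <= f s) ->
  \sum_(s < r) f (a + s)%N <= \sum_(s < n) f s.
Proof.
move=> an f0; rewrite -(big_mkord xpredT (fun s => f (a + s)%N)) -(big_mkord xpredT f).
apply: le_trans (sum_nat_sub f0 (leq0n a) an); apply: eq_leW.
by rewrite -{2}[a]add0n big_addn addKn; apply: eq_bigr => s _; rewrite addnC.
Qed.

Lemma path_sqr_nat f a b s : (a <= s <= b)%N ->
  (f s - f a) ^+ 2 <= (b - a)%:R * \sum_(a <= r < b) (f r.+1 - f r) ^+ 2.
Proof.
move=> /andP[as_ sb].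
have -> : f s - f a = \sum_(a <= r < s) 1 * 1 * (f r.+1 - f r).
  rewrite (eq_bigr (fun r => f r.+1 - f r)); last by move=> r _; rewrite !mul1r.
  by rewrite telescope_sumr.
apply: le_trans (cauchy_schwarz_seq _ _ _ _ (fun=> ler01)) _.
apply: ler_pM.
- by apply: sumr_ge0 => i _; rewrite mul1r sqr_ge0.
- by apply: sumr_ge0 => i _; rewrite mul1r sqr_ge0.
- rewrite (eq_bigr (fun=> 1)); last by move=> i _; rewrite expr1n mul1r.
  by rewrite big_const_nat iter_addr addr0 ler_nat leq_sub2r.
rewrite (eq_bigr (fun r => (f r.+1 - f r) ^+ 2)); last by move=> r _; rewrite mul1r.
by apply: sum_nat_sub => // i; exact: sqr_ge0.
Qed.

Lemma path_sqr f n s s' : (s < n)%N -> (s' < n)%N ->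
  (f s - f s') ^+ 2 <= n%:R * \sum_(r < n) (f r.+1 - f r) ^+ 2.
Proof.
wlog ss : s s' / (s' <= s)%N.
  move=> H sn s'n; have [/H|/ltnW/H] := leqP s' s; first exact.
  by move=> /(_ s'n sn); rewrite -sqrrN opprB.
move=> sn s'n; apply: le_trans (path_sqr_nat f (_ : s' <= s <= s)%N) _; first by rewrite ss leqnn.
have incr_ge0 r : 0 <= (f r.+1 - f r) ^+ 2 by exact: sqr_ge0.
apply: ler_pM => //; [exact: sum_nat_ge0|by rewrite ler_nat; lia|].
by rewrite -(big_mkord xpredT (fun r => (f r.+1 - f r) ^+ 2)); apply: sum_nat_sub => //; exact: ltnW.
Qed.

Definition hdiff U s t : R := U s.+1 t - U s t.

Definition vdiff U s t : R := U s t.+1 - U s t.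

Definition diff_sqr U s t : R := hdiff U s t ^+ 2 + vdiff U s t ^+ 2.

Definition array_energy U n n' : R := \sum_(s < n) \sum_(t < n') diff_sqr U s t.

Definition shift_array U a b s t : R := U (a + s)%N (b + t)%N.

Lemma diff_sqr_ge0 U s t : 0 <= diff_sqr U s t.
Proof. by rewrite /diff_sqr; nonneg. Qed.

Lemma array_energy_ge0 U n n' : 0 <= array_energy U n n'.
Proof. by rewrite /array_energy; nonneg; exact: diff_sqr_ge0. Qed.

Lemma diff_sqr_shift U a b s t : diff_sqr (shift_array U a b) s t = diff_sqr U (a + s) (b + t).
Proof. by rewrite /diff_sqr /hdiff /vdiff /shift_array !addnS. Qed.

Lemma pair_sqr U n n' s t s' t' : (s < n)%N -> (s' < n)%N -> (t < n')%N -> (t' < n')%N ->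
  (U s t - U s' t') ^+ 2 <=
  2 * n%:R * (\sum_(r < n) hdiff U r t ^+ 2) + 2 * n'%:R * \sum_(r < n') vdiff U s' r ^+ 2.
Proof.
move=> sn s'n tn t'n.
have -> : U s t - U s' t' = (U s t - U s' t) + (U s' t - U s' t') by ring.
apply: le_trans (sqrrD_le _ _) _.
have h1 := @path_sqr (U^~ t) n s s' sn s'n.
have h2 := @path_sqr (U s') n' t t' tn t'n.
by rewrite -!mulrA; apply: lerD; apply: ler_wpM2l.
Qed.

Definition block_avg U a b r : R := (r%:R ^+ 2)^-1 * \sum_(s < r) \sum_(t < r) U (a + s)%N (b + t)%N.

Lemma sum_sub_array (F : nat -> nat -> R) a b r r' n n' : (a + r <= n)%N -> (b + r' <= n')%N ->
  (forall s t, 0 <= F s t) ->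
  \sum_(s < r) \sum_(t < r') F (a + s)%N (b + t)%N <= \sum_(s < n) \sum_(t < n') F s t.
Proof.
move=> an bn F0; apply: le_trans (sum_sub_range (f := fun s => \sum_(t < n') F s t) an _).
  by apply: ler_sum => s _; apply: (sum_sub_range (f := F (a + s)%N)).
by move=> s; apply: sumr_ge0.
Qed.

Lemma mean_sqr_diff (I I' : finType) (f : I -> R) (g : I' -> R) :
  (0 < #|I|)%N -> (0 < #|I'|)%N ->
  (#|I|%:R^-1 * (\sum_i f i) - #|I'|%:R^-1 * (\sum_i g i)) ^+ 2 <=
  (#|I|%:R * #|I'|%:R)^-1 * \sum_i \sum_i' (f i - g i') ^+ 2.
Proof.
move=> I0 I0'.
have p : (0 : R) < #|I|%:R by rewrite ltr0n.
have p' : (0 : R) < #|I'|%:R by rewrite ltr0n.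
set X := _ - _.
have -> : X = (#|I|%:R * #|I'|%:R)^-1 * \sum_i \sum_i' (f i - g i').
  under [in RHS]eq_bigr => i _ do rewrite sumrB sumr_const.
  rewrite sumrB sumr_const sumrMnl -[X in X - _]mulr_natr -[X in _ - X]mulr_natl /X.
  by field; rewrite !gt_eqF.
rewrite exprMn expr2 -mulrA; apply: ler_wpM2l; first by rewrite invr_ge0; nonneg.
rewrite ler_pdivrMl; last by rewrite mulr_gt0.
rewrite !pair_big /=.
have := cauchy_schwarz_seq (index_enum _) xpredT (fun=> 1)
  (fun x : I * I' => f x.1 - g x.2) (fun=> ler01).
rewrite (eq_bigr (fun x : I * I' => f x.1 - g x.2)); last by move=> x _; rewrite !mul1r.
rewrite [X in X * _](eq_bigr (fun=> 1)); last by move=> x _; rewrite expr1n mul1r.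
rewrite [X in _ * X](eq_bigr (fun x : I * I' => (f x.1 - g x.2) ^+ 2)); last first.
  by move=> x _; rewrite mul1r.
by rewrite sumr_const card_prod natrM.
Qed.

Lemma sum_hdiff_block U n n' b r : (b + r <= n')%N ->
  \sum_(x : 'I_r * 'I_r) \sum_(q < n) hdiff U q (b + x.2)%N ^+ 2 <= r%:R * array_energy U n n'.
Proof.
move=> bn; pose H t := \sum_(q < n) hdiff U q t ^+ 2.
have H0 t : 0 <= H t by rewrite /H; nonneg.
rewrite -(pair_big xpredT xpredT (fun s t : 'I_r => H (b + t)%N)) /= sum_cst_ord.
apply: ler_wpM2l => //; apply: le_trans (sum_sub_range bn H0) _.
rewrite /H exchange_big /array_energy.
by apply: ler_sum => s _; apply: ler_sum => t _; rewrite /diff_sqr lerDl sqr_ge0.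
Qed.

Lemma sum_vdiff_block U n n' a r : (a + r <= n)%N ->
  \sum_(x : 'I_r * 'I_r) \sum_(q < n') vdiff U (a + x.1)%N q ^+ 2 <= r%:R * array_energy U n n'.
Proof.
move=> an; pose V s := \sum_(q < n') vdiff U s q ^+ 2.
have V0 s : 0 <= V s by rewrite /V; nonneg.
rewrite -(pair_big xpredT xpredT (fun s t : 'I_r => V (a + s)%N)) /=.
under eq_bigr => s _ do rewrite sum_cst_ord.
rewrite -mulr_sumr; apply: ler_wpM2l => //; apply: le_trans (sum_sub_range an V0) _.
by apply: ler_sum => s _; apply: ler_sum => t _; rewrite /diff_sqr lerDr sqr_ge0.
Qed.

Lemma sum_split (I I' : finType) (f : I -> R) (g : I' -> R) :
  \sum_i \sum_i' (f i + g i') = #|I'|%:R * (\sum_i f i) + #|I|%:R * \sum_i' g i'.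
Proof.
under eq_bigr => i _ do rewrite big_split /= sumr_const.
by rewrite big_split /= sumr_const sumrMnl !mulr_natl.
Qed.

Lemma block_avg_diff U n n' a b r a' b' r' : (0 < r)%N -> (0 < r')%N ->
  (a + r <= n)%N -> (b + r <= n')%N -> (a' + r' <= n)%N -> (b' + r' <= n')%N ->
  (block_avg U a b r - block_avg U a' b' r') ^+ 2 <=
  (2 * n%:R / r%:R + 2 * n'%:R / r'%:R) * array_energy U n n'.
Proof.
move=> r0 r0' an bn an' bn'.
have rR : (0 : R) < r%:R by rewrite ltr0n.
have rR' : (0 : R) < r'%:R by rewrite ltr0n.
have card_block k : #|{: 'I_k * 'I_k}| = (k ^ 2)%N by rewrite card_prod !card_ord.
have := @mean_sqr_diff ('I_r * 'I_r)%type ('I_r' * 'I_r')%type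
  (fun x => U (a + x.1)%N (b + x.2)%N) (fun x => U (a' + x.1)%N (b' + x.2)%N).
rewrite !card_block !expn_gt0 r0 r0' /= => /(_ isT isT).
rewrite -(pair_big xpredT xpredT (fun s t : 'I_r => U (a + s)%N (b + t)%N)) /=.
rewrite -(pair_big xpredT xpredT (fun s t : 'I_r' => U (a' + s)%N (b' + t)%N)) /=.
rewrite !natrX -/(block_avg U a b r) -/(block_avg U a' b' r') => /le_trans; apply.
apply: le_trans (_ : (r%:R ^+ 2 * r'%:R ^+ 2)^-1 * (\sum_(x : 'I_r * 'I_r) \sum_(x' : 'I_r' * 'I_r')
   (2 * n%:R * (\sum_(q < n) hdiff U q (b + x.2)%N ^+ 2) +
    2 * n'%:R * \sum_(q < n') vdiff U (a' + x'.1)%N q ^+ 2)) <= _).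
  apply: ler_wpM2l; first by rewrite invr_ge0; nonneg.
  apply: ler_sum => -[s t] _; apply: ler_sum => -[s' t'] _ /=.
  by apply: pair_sqr; have := ltn_ord s; have := ltn_ord t; have := ltn_ord s'; have := ltn_ord t'; lia.
rewrite sum_split !card_block -!mulr_sumr !natrX.
have -> : (2 * n%:R / r%:R + 2 * n'%:R / r'%:R) * array_energy U n n' =
  (r%:R ^+ 2 * r'%:R ^+ 2)^-1 * (r'%:R ^+ 2 * (2 * n%:R * (r%:R * array_energy U n n')) +
    r%:R ^+ 2 * (2 * n'%:R * (r'%:R * array_energy U n n'))).
  by field; rewrite !gt_eqF.
apply: ler_wpM2l; first by rewrite invr_ge0; nonneg.
apply: lerD; apply: ler_wpM2l; rewrite ?sqr_ge0 //; apply: ler_wpM2l; rewrite ?mulr_ge0 ?ler0n //.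
  exact: sum_hdiff_block.
exact: sum_vdiff_block.
Qed.

Lemma array_energy_sub U a b r r' n n' : (a + r <= n)%N -> (b + r' <= n')%N ->
  array_energy (shift_array U a b) r r' <= array_energy U n n'.
Proof.
move=> an bn; apply: le_trans (sum_sub_array (F := diff_sqr U) an bn (diff_sqr_ge0 U)).
by apply: ler_sum => s _; apply: ler_sum => t _; rewrite diff_sqr_shift.
Qed.

Lemma block_avg_sqr U n :
  block_avg U 0 0 (2 ^ n) ^+ 2 <= (4 ^+ n)^-1 * \sum_(s < 2 ^ n) \sum_(t < 2 ^ n) U s t ^+ 2.
Proof.
have card_block : #|{: 'I_(2 ^ n) * 'I_(2 ^ n)}| = (2 ^ n * 2 ^ n)%N by rewrite card_prod !card_ord.
have := @mean_sqr_diff ('I_(2 ^ n) * 'I_(2 ^ n))%type 'I_1 (fun x => U x.1 x.2) (fun=> 0).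
rewrite card_block card_ord muln_gt0 expn_gt0 /= => /(_ isT isT).
rewrite big_ord1 mulr0 subr0 mulr1.
rewrite -(pair_big xpredT xpredT (fun s t : 'I_(2 ^ n) => U s t)) /=.
under [X in _ <= _ * X]eq_bigr => x _ do rewrite big_ord1 subr0.
rewrite -(pair_big xpredT xpredT (fun s t : 'I_(2 ^ n) => U s t ^+ 2)) /=.
have -> : ((2 ^ n * 2 ^ n)%:R : R) = 4 ^+ n by rewrite -expnMn natrX.
by rewrite /block_avg (_ : (2 ^ n)%:R ^+ 2 = 4 ^+ n) // natrX -exprM mulnC exprM -natrX.
Qed.

Lemma dyadic_block_avg_diff U n i : (i < n)%N ->
  (block_avg U 0 0 (2 ^ i) - block_avg U 0 0 (2 ^ i.+1)) ^+ 2 <=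
  6 * array_energy U (2 ^ n) (2 ^ n).
Proof.
move=> i_n; have pow_gt0 k : (0 < 2 ^ k)%N by rewrite expn_gt0.
have le2 : (2 ^ i <= 2 ^ i.+1)%N by rewrite leq_exp2l.
have := @block_avg_diff U (2 ^ i.+1) (2 ^ i.+1) 0 0 (2 ^ i) 0 0 (2 ^ i.+1) (pow_gt0 _) (pow_gt0 _).
rewrite !add0n => /(_ le2 le2 (leqnn _) (leqnn _)) /le_trans; apply.
have pow_neq0 : (2 ^ i)%:R != 0 :> R by rewrite pnatr_eq0 -lt0n.
have -> : 2 * (2 ^ i.+1)%:R / (2 ^ i)%:R + 2 * (2 ^ i.+1)%:R / (2 ^ i.+1)%:R = 6 :> R.
  by rewrite expnS natrM; field.
apply: ler_wpM2l; first exact: ler0n.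
have sub : (2 ^ i.+1 <= 2 ^ n)%N by rewrite leq_exp2l.
by have := @array_energy_sub U 0 0 (2 ^ i.+1) (2 ^ i.+1) (2 ^ n) (2 ^ n); rewrite !add0n => /(_ sub sub).
Qed.

(* Telescoping over the averages on dyadic squares. *)
Lemma array_sup U n :
  U 0%N 0%N ^+ 2 <= n.+1%:R * (6 * n%:R * array_energy U (2 ^ n) (2 ^ n) +
    (4 ^+ n)^-1 * \sum_(s < 2 ^ n) \sum_(t < 2 ^ n) U s t ^+ 2).
Proof.
pose A k := block_avg U 0 0 (2 ^ k).
pose g (i : 'I_n.+1) := if (i : nat) == n then A n else A i - A i.+1.
have telescope : U 0%N 0%N = \sum_i 1 * 1 * g i.
  have -> : U 0%N 0%N = A 0%N by rewrite /A /block_avg expn0 !big_ord1 expr1n invr1 mul1r.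
  rewrite big_ord_recr /= /g /= eqxx !mul1r.
  have -> : \sum_(i < n) 1 * (if (i : nat) == n then A n else A i - A i.+1) =
    - \sum_(i < n) (A i.+1 - A i).
    rewrite -sumrN; apply: eq_bigr => i _; rewrite ?mul1r.
    by rewrite (ltn_eqF (ltn_ord i)); ring.
  by rewrite -(big_mkord xpredT (fun i => A i.+1 - A i)) telescope_sumr //; ring.
rewrite telescope; apply: le_trans (cauchy_schwarz_seq _ _ _ _ (fun=> ler01)) _.
rewrite [X in X * _](eq_bigr (fun=> 1)); last by move=> i _; rewrite expr1n mul1r.
rewrite sum_cst_ord mulr1; apply: ler_wpM2l; first by nonneg.
rewrite big_ord_recr /= /g /= eqxx mul1r; apply: lerD; last exact: block_avg_sqr.
rewrite [6 * _]mulrC -mulrA -sum_cst_ord.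
by apply: ler_sum => i _; rewrite mul1r (ltn_eqF (ltn_ord i)) dyadic_block_avg_diff.
Qed.

End Arrays.

Ltac nlia := repeat match goal with
  | H : ?P |- _ => lazymatch type of P with Prop => lazymatch P with
    | is_true (leq _ _) => fail
    | is_true (andb (leq _ _) (leq _ _)) => fail
    | @eq nat _ _ => fail
    | _ => clear H end end end; lia.

(** * Hole filling in the plane *)

Section Holes.
Variable R : realFieldType.
Implicit Types (U A F : nat -> nat -> R) (f g : nat -> R) (a b n r s t : nat) (c : R).

Lemma abel_sum f g a b : (0 < a)%N -> (a <= b)%N ->
  \sum_(a <= s < b.+1) (f s - f s.-1) * g s =
  f b * g b - f a.-1 * g a - \sum_(a <= s < b) f s * (g s.+1 - g s).
Proof.
move=> a0; elim: b => [|b IH] ab; first by nlia.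
have [ab'|] := leqP a b; last first.
  move=> ba; have -> : a = b.+1 by nlia.
  by rewrite big_nat1 big_geq //=; ring.
by rewrite big_nat_recr //= (IH ab') [in RHS]big_nat_recr //=; ring.
Qed.

Definition half_sum F a b : R := \sum_(a <= s < b) \sum_(a <= t < b.+1) F s t.

Lemma half_sum_ring F a b : (forall s t, 0 <= F s t) -> (0 < a)%N -> (a <= b)%N ->
  half_sum F a b + \sum_(a <= t < b.+1) (F b t + F a.-1 t) +
  \sum_(a.-1 <= s < b.+1) (F s a.-1 + F s b.+1) <= half_sum F a.-1 b.+1.
Proof.
move=> F0; case: a => // a _ ab /=; rewrite /half_sum.
have -> : \sum_(a <= s < b.+1) \sum_(a <= t < b.+2) F s t =
  \sum_(a <= s < b.+1) \sum_(a.+1 <= t < b.+1) F s t + \sum_(a <= s < b.+1) (F s a + F s b.+1).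
  rewrite -big_split; apply: eq_bigr => s _ /=.
  by rewrite big_ltn ?ltnS 1?ltnW // 1?big_nat_recr //= 1?ltnW //; ring.
rewrite lerD2r (@big_ltn _ _ _ a b.+1) 1?ltnW // [X in _ <= _ + X]big_nat_recr //= big_split /=; lra.
Qed.

Definition transp U : nat -> nat -> R := fun s t => U t s.

Definition hdiff_sqr U : nat -> nat -> R := fun s t => hdiff U s t ^+ 2.

Definition square_energy U a b : R := half_sum (hdiff_sqr U) a b + half_sum (hdiff_sqr (transp U)) a b.

Lemma hdiff_sqr_ge0 U s t : 0 <= hdiff_sqr U s t. Proof. exact: sqr_ge0. Qed.
Hint Resolve hdiff_sqr_ge0 : core.

Lemma square_energy_ge0 U a b : 0 <= square_energy U a b.
Proof. by rewrite /square_energy /half_sum; apply: addr_ge0; apply: sum_nat_ge0 => s; apply: sum_nat_ge0. Qed.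

Lemma square_energy_sub U a b a' b' : (a' <= a)%N -> (b <= b')%N -> square_energy U a b <= square_energy U a' b'.
Proof.
move=> aa bb; rewrite /square_energy /half_sum; apply: lerD.
  apply: le_trans (_ : \sum_(a <= s < b) \sum_(a' <= t < b'.+1) hdiff_sqr U s t <= _).
    by apply: ler_sum => s _; apply: sum_nat_sub.
  by apply: sum_nat_sub => // s; apply: sum_nat_ge0.
apply: le_trans (_ : \sum_(a <= s < b) \sum_(a' <= t < b'.+1) hdiff_sqr (transp U) s t <= _).
  by apply: ler_sum => s _; apply: sum_nat_sub.
by apply: sum_nat_sub => // s; apply: sum_nat_ge0.
Qed.

Definition crossing U a b : R := \sum_(a <= t < b.+1) (hdiff_sqr U b t + hdiff_sqr U a.-1 t).

Definition loop U a b : R := \sum_(a <= s < b) (hdiff_sqr U s a + hdiff_sqr U s b).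

Definition sides_sqr U c a b : R := \sum_(a <= t < b.+1) ((U b t - c) ^+ 2 + (U a t - c) ^+ 2).

Lemma loop_ge0 U a b : 0 <= loop U a b.
Proof. by apply: sum_nat_ge0 => s; rewrite addr_ge0. Qed.

Lemma crossing_ge0 U a b : 0 <= crossing U a b.
Proof. by apply: sum_nat_ge0 => s; rewrite addr_ge0. Qed.

Lemma square_energy_ring U a b : (0 < a)%N -> (a <= b)%N ->
  square_energy U a b + (crossing U a b + crossing (transp U) a b) + (loop U a.-1 b.+1 + loop (transp U) a.-1 b.+1)
  <= square_energy U a.-1 b.+1.
Proof.
move=> a0 ab; have := half_sum_ring (hdiff_sqr_ge0 U) a0 ab; have := half_sum_ring (hdiff_sqr_ge0 (transp U)) a0 ab.
by rewrite /square_energy /crossing /loop; lra.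
Qed.

Lemma sides_sqr_loop U a b : (a <= b)%N ->
  sides_sqr U (U a a) a b <= (b.+1 - a)%:R * (4 * (b - a)%:R * (loop U a b + loop (transp U) a b)).
Proof.
move=> ab; rewrite /sides_sqr.
have b0 : 0 <= (b - a)%:R :> R by [].
have l0 := loop_ge0 U a b; have l0' := loop_ge0 (transp U) a b.
have sa V : \sum_(a <= q < b) hdiff_sqr V q a <= loop V a b.
  by apply: ler_sum => q _; rewrite lerDl.
have sb V : \sum_(a <= q < b) hdiff_sqr V q b <= loop V a b.
  by apply: ler_sum => q _; rewrite lerDr.
apply: le_trans (_ : \sum_(a <= t < b.+1) 4 * (b - a)%:R * (loop U a b + loop (transp U) a b) <= _); last first.
  by rewrite big_const_nat iter_addr addr0 -[leLHS]mulr_natl.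
rewrite big_nat_cond [leRHS]big_nat_cond; apply: ler_sum => t; rewrite andbT ltnS => tb.
have h1 : (U a t - U a a) ^+ 2 <= (b - a)%:R * (\sum_(a <= q < b) hdiff_sqr (transp U) q a).
  exact: (path_sqr_nat (U a) tb).
have h2 : (U b t - U b a) ^+ 2 <= (b - a)%:R * (\sum_(a <= q < b) hdiff_sqr (transp U) q b).
  exact: (path_sqr_nat (U b) tb).
have h3 : (U b a - U a a) ^+ 2 <= (b - a)%:R * (\sum_(a <= q < b) hdiff_sqr U q a).
  by apply: (@path_sqr_nat _ (U^~ a) a b b); rewrite leqnn ab.
have h4 := sqrrD_le (U b t - U b a) (U b a - U a a).
rewrite addrA subrK in h4.
have t1 := le_trans h1 (ler_wpM2l b0 (sa (transp U))).
have t2 := le_trans h2 (ler_wpM2l b0 (sb (transp U))).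
have t3 := le_trans h3 (ler_wpM2l b0 (sa U)).
have g1 : 0 <= (b - a)%:R * loop U a b by nonneg.
have g2 : 0 <= (b - a)%:R * loop (transp U) a b by nonneg.
by rewrite -[leRHS]mulrA mulrDr; lra.
Qed.

Variables (al be : R).
Hypotheses (al_gt0 : 0 < al) (al_be : al <= be).

Lemma crossing_product_le (x p g lam : R) : 0 < lam -> al <= x <= be ->
  `|x * p * g| <= lam * p ^+ 2 + be ^+ 2 / lam * g ^+ 2.
Proof.
move=> lam0 /andP[x_ge x_le]; have al0 := al_gt0.
have x_sqr : x ^+ 2 <= be ^+ 2 by rewrite lerXn2r ?nnegrE; lra.
apply: le_trans (_ : lam * p ^+ 2 + x ^+ 2 / lam * g ^+ 2 <= _); last first.
  rewrite lerD2l; apply: ler_wpM2r; first exact: sqr_ge0.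
  by apply: ler_wpM2r => //; rewrite invr_ge0 ltW.
have young (sg : R) : sg ^+ 2 = 1 -> sg * (x * p * g) <= lam * p ^+ 2 + x ^+ 2 / lam * g ^+ 2.
  move=> sg1; have : 0 <= (lam * p - sg * (x * g)) ^+ 2 / lam by rewrite divr_ge0 ?sqr_ge0 ?ltW.
  have -> : (lam * p - sg * (x * g)) ^+ 2 / lam =
      lam * p ^+ 2 - 2 * (sg * (x * p * g)) + sg ^+ 2 * (x ^+ 2 / lam * g ^+ 2).
    by field; rewrite gt_eqF.
  rewrite sg1 mul1r => ?; have : 0 <= lam * p ^+ 2 by rewrite mulr_ge0 ?sqr_ge0 ?ltW.
  have : 0 <= x ^+ 2 / lam * g ^+ 2 by rewrite mulr_ge0 ?divr_ge0 ?sqr_ge0 ?ltW.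
  by lra.
rewrite ler_norml; apply/andP; split; last by rewrite -[_ * g]mul1r young ?expr1n.
by rewrite lerNl -mulN1r young ?sqrrN ?expr1n.
Qed.

Lemma half_energy A U c a b (lam : R) : (0 < a)%N -> (a <= b)%N -> 0 < lam ->
  (forall s t, al <= A s t <= be) ->
  al * half_sum (hdiff_sqr U) a b + \sum_(a <= s < b.+1) \sum_(a <= t < b.+1)
    (A s t * hdiff U s t - A s.-1 t * hdiff U s.-1 t) * (U s t - c) <=
  lam * crossing U a b + be ^+ 2 / lam * sides_sqr U c a b.
Proof.
move=> a0 ab lam0 Ab; rewrite exchange_big /=.
under [X in _ + X]eq_bigr => t _.
  rewrite (@abel_sum (fun s => A s t * hdiff U s t) (fun s => U s t - c)) //; over.
rewrite sumrB.
have inner : al * half_sum (hdiff_sqr U) a b <=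
  \sum_(a <= t < b.+1) \sum_(a <= s < b) A s t * hdiff U s t * (U s.+1 t - c - (U s t - c)).
  rewrite /half_sum mulr_sumr exchange_big /=; apply: ler_sum => s _.
  rewrite mulr_sumr; apply: ler_sum => t _.
  have -> : U s.+1 t - c - (U s t - c) = hdiff U s t by rewrite /hdiff; ring.
  by rewrite -mulrA -expr2; apply: ler_wpM2r; [exact: sqr_ge0|case/andP: (Ab s t)].
suff : \sum_(a <= t < b.+1) (A b t * hdiff U b t * (U b t - c) - A a.-1 t * hdiff U a.-1 t * (U a t - c)) <=
  lam * crossing U a b + be ^+ 2 / lam * sides_sqr U c a b by lra.
rewrite /crossing /sides_sqr !mulr_sumr -big_split /=; apply: ler_sum => t _.
have := crossing_product_le (hdiff U b t) (U b t - c) lam0 (Ab b t).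
have := crossing_product_le (hdiff U a.-1 t) (U a t - c) lam0 (Ab a.-1 t).
rewrite !ler_norml /hdiff_sqr => /andP[lower _] /andP[_ upper].
by apply: le_trans (lerB upper lower) _; rewrite opprK !mulrDr addrACA.
Qed.

Variables (m S : R) (ph U A A' : nat -> nat -> R) (n : nat).
Hypotheses (m_gt0 : 0 < m) (S_ge0 : 0 <= S).
Hypotheses (A_itv : forall s t, al <= A s t <= be) (A_itv' : forall s t, al <= A' s t <= be).
Hypothesis equation : forall s t, (0 < s < 2 * n)%N -> (0 < t < 2 * n)%N ->
  m * ph s t = (A s t * hdiff U s t - A s.-1 t * hdiff U s.-1 t) +
    (A' t s * hdiff (transp U) t s - A' t.-1 s * hdiff (transp U) t.-1 s).
Hypothesis ph_le : forall s t, (s <= 2 * n)%N -> (t <= 2 * n)%N -> `|ph s t| <= S.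
Hypothesis osc_le : forall s t s' t', (s <= 2 * n)%N -> (t <= 2 * n)%N -> (s' <= 2 * n)%N -> (t' <= 2 * n)%N ->
  `|U s t - U s' t'| <= S.

Definition mass_err : R := m * (2 * n).+1%:R ^+ 2 * S ^+ 2.

Lemma square_inequality a b (lam : R) s0 t0 : (0 < a)%N -> (a <= b)%N -> (b < 2 * n)%N -> 0 < lam ->
  (s0 <= 2 * n)%N -> (t0 <= 2 * n)%N ->
  al * square_energy U a b <= lam * (crossing U a b + crossing (transp U) a b) +
    be ^+ 2 / lam * (sides_sqr U (U s0 t0) a b + sides_sqr (transp U) (U s0 t0) a b) + mass_err.
Proof.
move=> a0 ab bn l0 sn tn; set c := U s0 t0.
have h1 := half_energy U c a0 ab l0 A_itv.
have h2 := half_energy (transp U) c a0 ab l0 A_itv'.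
rewrite [X in _ + X <= _]exchange_big /= in h2.
have -> : al * square_energy U a b = al * half_sum (hdiff_sqr U) a b + al * half_sum (hdiff_sqr (transp U)) a b by rewrite /square_energy mulrDr.
have m0 : 0 <= m by rewrite ltW.
suff : `|\sum_(a <= s < b.+1) \sum_(a <= t < b.+1) m * ph s t * (U s t - c)| <= mass_err.
  rewrite ler_norml => /andP[q1 q2].
  suff e : \sum_(a <= s < b.+1) \sum_(a <= t < b.+1) m * ph s t * (U s t - c) =
   \sum_(a <= s < b.+1) \sum_(a <= t < b.+1)
    (A s t * hdiff U s t - A s.-1 t * hdiff U s.-1 t) * (U s t - c) +
   \sum_(a <= s < b.+1) \sum_(a <= t < b.+1)
    (A' t s * hdiff (transp U) t s - A' t.-1 s * hdiff (transp U) t.-1 s) * (transp U t s - c).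
    by rewrite e in q1; rewrite !mulrDr; lra.
  rewrite -big_split /= big_nat_cond [RHS]big_nat_cond; apply: eq_bigr => s; rewrite andbT => /andP[s1 s2].
  rewrite -big_split /= big_nat_cond [RHS]big_nat_cond; apply: eq_bigr => t; rewrite andbT => /andP[t1 t2].
  rewrite -mulrDl equation //; first by apply/andP; split; nlia.
  by apply/andP; split; nlia.
have cst (x : R) : 0 <= x -> \sum_(a <= s < b.+1) x <= (2 * n).+1%:R * x.
  move=> x0; rewrite big_const_nat iter_addr addr0 -[leLHS]mulr_natl.
  by apply: ler_wpM2r => //; rewrite ler_nat; nlia.
apply: le_trans (ler_norm_sum _ _ _) _.
apply: le_trans (_ : \sum_(a <= s < b.+1) (2 * n).+1%:R * (m * S ^+ 2) <= _); last first.
  by apply: le_trans (cst _ _) _; [nonneg|rewrite /mass_err; apply: eq_leW; ring].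
rewrite big_nat_cond [leRHS]big_nat_cond; apply: ler_sum => s; rewrite andbT => /andP[s1 s2].
apply: le_trans (ler_norm_sum _ _ _) _; apply: le_trans (cst _ _); last by nonneg.
rewrite big_nat_cond [leRHS]big_nat_cond; apply: ler_sum => t; rewrite andbT => /andP[t1 t2].
rewrite !normrM ger0_norm // -mulrA; apply: ler_wpM2l => //; rewrite expr2.
by apply: ler_pM => //; [apply: ph_le; nlia|apply: osc_le => //; nlia].
Qed.

Definition energy_in r : R := square_energy U (n - r) (n + r).

Lemma energy_in_ge0 r : 0 <= energy_in r. Proof. exact: square_energy_ge0. Qed.

Lemma energy_in_mono r r' : (r <= r')%N -> energy_in r <= energy_in r'.
Proof. by move=> rr; apply: square_energy_sub; nlia. Qed.

Lemma energy_in_ring r : (r < n)%N ->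
  energy_in r + (crossing U (n - r) (n + r) + crossing (transp U) (n - r) (n + r)) +
  (loop U (n - r.+1) (n + r.+1) + loop (transp U) (n - r.+1) (n + r.+1)) <= energy_in r.+1.
Proof.
move=> rn; have := @square_energy_ring U (n - r) (n + r).
by rewrite /energy_in addnS subnS; apply; nlia.
Qed.

Lemma n_sub r : (n - r <= n + r)%N. Proof. nlia. Qed.

Lemma n_sub2 r : (n - r <= 2 * n)%N. Proof. nlia. Qed.

Lemma n_add r : (r < n)%N -> (n + r < 2 * n)%N. Proof. nlia. Qed.

Lemma n_dbl : (n <= 2 * n)%N. Proof. nlia. Qed.

Lemma sides_sqr_le_loop r : (0 < r < n)%N ->
  sides_sqr U (U (n - r)%N (n - r)%N) (n - r) (n + r) +
    sides_sqr (transp U) (U (n - r)%N (n - r)%N) (n - r) (n + r) <=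
  8 * (2 * r).+1%:R ^+ 2 * (loop U (n - r) (n + r) + loop (transp U) (n - r) (n + r)).
Proof.
move=> /andP[r0 rn]; have ab := n_sub r.
have side : ((n + r).+1 - (n - r) = (2 * r).+1)%N by nlia.
have side' : (n + r - (n - r) = 2 * r)%N by nlia.
have := sides_sqr_loop U ab; have := sides_sqr_loop (transp U) ab; rewrite side side'.
have L0 : 0 <= loop U (n - r) (n + r) + loop (transp U) (n - r) (n + r).
  by rewrite addr_ge0 // loop_ge0.
rewrite [loop (transp U) _ _ + _]addrC; move: L0.
set L := loop U _ _ + _; set w := (2 * r).+1%:R => L0.
have : w * (4 * (2 * r)%:R * L) <= w * (4 * w * L).
  by apply: ler_wpM2l => //; apply: ler_wpM2r => //; apply: ler_wpM2l => //; rewrite ler_nat.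
by rewrite expr2; lra.
Qed.

Lemma crossing_loop_le r : (0 < r < n)%N ->
  (crossing U (n - r) (n + r) + crossing (transp U) (n - r) (n + r)) +
    (loop U (n - r) (n + r) + loop (transp U) (n - r) (n + r)) <=
  energy_in r.+1 - energy_in r.-1.
Proof.
move=> /andP[r0 rn]; have := energy_in_ring rn; have := @energy_in_ring r.-1.
rewrite prednK // => /(_ (ltnW rn)).
have := crossing_ge0 U (n - r.-1) (n + r.-1); have := crossing_ge0 (transp U) (n - r.-1) (n + r.-1).
have := loop_ge0 U (n - r.+1) (n + r.+1); have := loop_ge0 (transp U) (n - r.+1) (n + r.+1).
by lra.
Qed.

Lemma center_le_energy_in : (0 < n)%N ->
  hdiff_sqr U n n <= energy_in 1 /\ hdiff_sqr (transp U) n n <= energy_in 1.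
Proof.
move=> n_gt0; have half_ge0 (V : nat -> nat -> R) : 0 <= half_sum (hdiff_sqr V) (n - 1) (n + 1).
  by apply: sum_nat_ge0 => s; apply: sum_nat_ge0 => t; exact: hdiff_sqr_ge0.
have center_le (V : nat -> nat -> R) : hdiff_sqr V n n <= half_sum (hdiff_sqr V) (n - 1) (n + 1).
  apply: le_trans (_ : \sum_(n - 1 <= t < (n + 1).+1) hdiff_sqr V n t <= _).
    have := @sum_nat_sub _ (hdiff_sqr V n) n n.+1 (n - 1) (n + 1).+1 (hdiff_sqr_ge0 V n).
    by rewrite big_nat1; apply; nlia.
  have := @sum_nat_sub _ (fun s => \sum_(n - 1 <= t < (n + 1).+1) hdiff_sqr V s t) n n.+1 (n - 1) (n + 1).
  rewrite big_nat1; apply; [|nlia|nlia].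
  by move=> s; apply: sum_nat_ge0 => t; exact: hdiff_sqr_ge0.
rewrite /energy_in /square_energy.
have := center_le U; have := center_le (transp U); have := half_ge0 U; have := half_ge0 (transp U).
by split; lra.
Qed.

Lemma hole_inequality r : (0 < r < n)%N ->
  al * energy_in r <= 8 * be * (2 * r).+1%:R * (energy_in r.+1 - energy_in r.-1) + mass_err.
Proof.
move=> rn; have be0 : 0 < be by have := al_gt0; have := al_be; lra.
have [r_gt0 r_lt] := andP rn.
have w0 : 0 < (2 * r).+1%:R :> R by rewrite ltr0n.
have lam0 : 0 < be * (2 * r).+1%:R by rewrite mulr_gt0.
have := @square_inequality (n - r) (n + r) _ (n - r) (n - r) _ (n_sub r) (n_add r_lt) lam0
  (n_sub2 r) (n_sub2 r).
rewrite subn_gt0 -/(energy_in r) => /(_ r_lt) /le_trans; apply; rewrite lerD2r.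
have := sides_sqr_le_loop rn; have := crossing_loop_le rn.
have : 0 <= crossing U (n - r) (n + r) + crossing (transp U) (n - r) (n + r).
  by rewrite addr_ge0 // crossing_ge0.
set C := crossing U _ _ + _; set L := loop U _ _ + _; set Sd := sides_sqr U _ _ _ + _.
move: w0 lam0; move: (2 * r).+1%:R => w w0 lam0 C0 ring_le sides_le.
have weight_ge0 : 0 <= be ^+ 2 / (be * w) by rewrite divr_ge0 ?sqr_ge0 ?ltW.
have := ler_wpM2l weight_ge0 sides_le.
have -> : be ^+ 2 / (be * w) * (8 * w ^+ 2 * L) = 8 * (be * w) * L by field; rewrite !gt_eqF.
have := ler_wpM2l (ltW lam0) ring_le; have := mulr_ge0 (ltW lam0) C0.
by rewrite -mulrA -[8 * _ * w]mulrA; lra.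
Qed.

Lemma caccioppoli r (lam : R) : (0 < r < n)%N -> 0 < lam ->
  al * energy_in r <= lam * (energy_in r.+1 - energy_in r) + 4 * (be ^+ 2 / lam * ((2 * r).+1%:R * S ^+ 2)) + mass_err.
Proof.
move=> /andP[r0 rn] l0; have := @square_inequality (n - r) (n + r) lam n n.
move=> H; apply: le_trans (H _ _ _ l0 _ _) _; rewrite ?subn_gt0 ?n_sub ?n_dbl ?n_add //; rewrite lerD2r; clear H.
have bs V : (forall s t, (s <= 2 * n)%N -> (t <= 2 * n)%N -> `|V s t - U n n| <= S) ->
    sides_sqr V (U n n) (n - r) (n + r) <= 2 * ((2 * r).+1%:R * S ^+ 2).
  move=> HV; apply: le_trans (_ : \sum_(n - r <= t < (n + r).+1) 2 * S ^+ 2 <= _).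
    rewrite /sides_sqr big_nat_cond [leRHS]big_nat_cond; apply: ler_sum => t; rewrite andbT => /andP[t1 t2].
    have sq x : `|x| <= S -> x ^+ 2 <= S ^+ 2.
      by move=> xS; rewrite -[x ^+ 2]real_normK ?num_real // ler_pXn2r ?nnegrE //; nonneg.
    have tn : (t <= 2 * n)%N by rewrite -ltnS (leq_trans t2) // ltnW // ltnS n_add.
    have p1 := sq _ (HV _ t (n_sub2 r) tn); have p2 := sq _ (HV _ t (ltnW (n_add rn)) tn).
    lra.
  rewrite big_const_nat iter_addr addr0 -[leLHS]mulr_natl.
  have -> : ((n + r).+1 - (n - r) = (2 * r).+1)%N by nlia.
  by rewrite mulrCA.
have b1 := bs U (fun s t sn tn => osc_le sn tn n_dbl n_dbl).
have b2 := bs (transp U) (fun s t sn tn => osc_le tn sn n_dbl n_dbl).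
apply: lerD.
  apply: ler_wpM2l; first exact: ltW.
  have := energy_in_ring rn; have := loop_ge0 U (n - r.+1) (n + r.+1); have := loop_ge0 (transp U) (n - r.+1) (n + r.+1).
  by lra.
have bl : 0 <= be ^+ 2 / lam by rewrite divr_ge0 ?sqr_ge0 ?ltW.
have := ler_wpM2l bl (lerD b1 b2); move: (be ^+ 2 / lam) => z; lra.
Qed.

Definition hole_theta : R := 64 * be / (64 * be + al).

Lemma hole_theta_itv : 0 < hole_theta < 1.
Proof.
have a1 := al_gt0; have a2 := al_be.
have p : 0 < 64 * be + al by lra.
by rewrite /hole_theta divr_gt0 ?ltr_pdivrMr //=; lra.
Qed.

Lemma energy_in_sum (F : nat -> R) r0 : (0 < r0)%N -> (2 * r0 <= n)%N ->
  (forall r, (r0 <= r < 2 * r0)%N -> al * energy_in r <= F r) ->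
  r0%:R * (al * energy_in r0) <= \sum_(r0 <= r < 2 * r0) F r.
Proof.
move=> r1 rn H.
apply: le_trans (_ : \sum_(r0 <= r < 2 * r0) al * energy_in r0 <= _).
  rewrite big_const_nat iter_addr addr0 -[leRHS]mulr_natl.
  by rewrite mul2n -addnn addnK.
rewrite big_nat_cond [leRHS]big_nat_cond; apply: ler_sum => r; rewrite andbT => rr.
apply: le_trans (H r rr); apply: ler_wpM2l; first exact: ltW.
by apply: energy_in_mono; case/andP: rr.
Qed.

Lemma mass_err_ge0 : 0 <= mass_err.
Proof. by have m0 := m_gt0; rewrite /mass_err; nonneg. Qed.

Lemma telescope_sumr2 f a b : (0 < a)%N -> (a <= b)%N ->
  \sum_(a <= r < b) (f r.+1 - f r.-1) = f b + f b.-1 - f a - f a.-1.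
Proof.
move=> a0 ab; rewrite (@telescope_sumr_eq _ a b (fun r => f r + f r.-1)) //=; first by ring.
by move=> r _ /=; ring.
Qed.

Lemma hole_sum r0 : (0 < r0)%N -> (2 * r0 <= n)%N ->
  al * energy_in r0 <= 32 * be * (2 * (energy_in (2 * r0) - energy_in r0.-1)) + mass_err.
Proof.
move=> r0_gt0 r0_le; have be0 : 0 <= be by have := al_gt0; have := al_be; lra.
have r0R : 0 < r0%:R :> R by rewrite ltr0n.
have := @energy_in_sum (fun r => 32 * be * r0%:R * (energy_in r.+1 - energy_in r.-1) + mass_err) r0.
move=> /(_ r0_gt0 r0_le _); rewrite big_split /= -mulr_sumr telescope_sumr2 //; last by nlia.
rewrite big_const_nat iter_addr addr0 (_ : 2 * r0 - r0 = r0)%N; last by nlia.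
rewrite -[X in _ + X]mulr_natl => sum_le.
have [mono1 mono2] : energy_in r0.-1 <= energy_in r0 /\ energy_in (2 * r0).-1 <= energy_in (2 * r0).
  by split; apply: energy_in_mono; nlia.
rewrite -(ler_pM2l r0R); apply: le_trans (sum_le _) _ => [r /andP[r_ge r_lt]|].
  have rn : (0 < r < n)%N by nlia.
  apply: le_trans (hole_inequality rn) _; rewrite lerD2r; apply: ler_wpM2r.
    by rewrite subr_ge0; apply: energy_in_mono; nlia.
  have : (2 * r).+1%:R <= (4 * r0)%:R :> R by rewrite ler_nat; nlia.
  by rewrite natrM => /(ler_wpM2l be0); lra.
rewrite [leRHS]mulrDr lerD2r.
have gap_le : energy_in (2 * r0) + energy_in (2 * r0).-1 - energy_in r0 - energy_in r0.-1 <=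
    2 * (energy_in (2 * r0) - energy_in r0.-1) by lra.
have coef_ge0 : 0 <= 32 * be * r0%:R by rewrite !mulr_ge0.
by apply: le_trans (ler_wpM2l coef_ge0 gap_le) _; apply: eq_leW; ring.
Qed.

Lemma hole_step r0 : (0 < r0)%N -> (4 * r0 <= n)%N ->
  energy_in r0 <= hole_theta * energy_in (4 * r0) + mass_err / al.
Proof.
move=> r0_gt0 r0_le; have al0 := al_gt0; have be_ge := al_be.
have := @hole_sum (2 * r0) (ltac:(nlia)) (ltac:(nlia)); rewrite mulnA.
have [mono1 mono2] : energy_in r0 <= energy_in (2 * r0).-1 /\ energy_in r0 <= energy_in (2 * r0).
  by split; apply: energy_in_mono; nlia.
move=> sum_le; have p : 0 < 64 * be + al by lra.
have {sum_le} : al * energy_in r0 <= 64 * be * (energy_in (4 * r0) - energy_in r0) + mass_err.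
  have := ler_wpM2l (ltW al0) mono2.
  by have be0 : 0 <= be; [lra|have := ler_wpM2l be0 mono1; lra].
move=> hole; have : energy_in r0 <= (64 * be * energy_in (4 * r0) + mass_err) / (64 * be + al).
  by rewrite ler_pdivlMr; lra.
move=> /le_trans; apply; rewrite mulrDl /hole_theta [64 * be / _ * _]mulrAC lerD2l.
by apply: ler_wpM2l; [exact: mass_err_ge0|rewrite lef_pV2 ?posrE; lra].
Qed.

Definition cacc_const : R := 2 ^+ 12 * be ^+ 2 / al ^+ 2.

Lemma cacc_step r0 : (0 < r0)%N -> (4 * r0 <= n)%N ->
  energy_in r0 <= 256^-1 * energy_in (4 * r0) + (cacc_const * S ^+ 2 + mass_err / al).
Proof.
move=> r1 rn; have a1 := al_gt0; have a2 := al_be.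
have q0 := mass_err_ge0.
have RR : 0 < r0%:R :> R by rewrite ltr0n.
pose lam := al * r0%:R / 255.
have l0 : 0 < lam by rewrite /lam; apply: divr_gt0 => //; rewrite mulr_gt0.
have eM := energy_in_mono (ltac:(nlia) : (2 * r0 <= 4 * r0)%N).
have e0 := energy_in_ge0 r0.
have S0 : 0 <= S ^+ 2 by exact: sqr_ge0.
have : r0%:R * (al * energy_in r0) <= \sum_(r0 <= r < 2 * r0)
    (lam * (energy_in r.+1 - energy_in r) + (4 * (be ^+ 2 / lam * (4 * r0%:R * S ^+ 2)) + mass_err)).
  apply: energy_in_sum => //; first by nlia.
  move=> r /andP[rr1 rr2]; have rr : (0 < r < n)%N by nlia.
  apply: le_trans (caccioppoli rr l0) _; rewrite -addrA lerD2l lerD2r; apply: ler_wpM2l => //.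
  apply: ler_wpM2l; first by rewrite divr_ge0 ?sqr_ge0 ?ltW.
  apply: ler_wpM2r => //; rewrite -natrM ler_nat; nlia.
rewrite big_split /= -mulr_sumr telescope_sumr; last by nlia.
rewrite big_const_nat iter_addr addr0 -[X in _ + X]mulr_natl.
have -> : (2 * r0 - r0 = r0)%N by nlia.
have -> : 4 * (be ^+ 2 / lam * (4 * r0%:R * S ^+ 2)) = 4080 * (be ^+ 2 / al * S ^+ 2).
  by rewrite /lam; field; rewrite !gt_eqF.
move=> h.
have {h} : al * energy_in r0 <= al / 255 * (energy_in (4 * r0) - energy_in r0) + (4080 * (be ^+ 2 / al * S ^+ 2) + mass_err).
  have : r0%:R * (al * energy_in r0) <= r0%:R * (al / 255 * (energy_in (4 * r0) - energy_in r0) + (4080 * (be ^+ 2 / al * S ^+ 2) + mass_err)).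
    apply: le_trans h _; rewrite [leRHS]mulrDr lerD2r /lam.
    have t : energy_in (2 * r0) - energy_in r0 <= energy_in (4 * r0) - energy_in r0 by lra.
    have c : 0 <= al * r0%:R / 255 by exact: ltW.
    by have := ler_wpM2l c t; lra.
  by rewrite ler_pM2l.
have -> : 4080 * (be ^+ 2 / al * S ^+ 2) + mass_err = al * (4080 / 4096 * (cacc_const * S ^+ 2) + mass_err / al).
  by rewrite /cacc_const; field; rewrite !gt_eqF.
have x0 : 0 <= cacc_const * S ^+ 2 by rewrite /cacc_const; apply: mulr_ge0 => //; apply: divr_ge0; nonneg.
have y0 : 0 <= mass_err / al by apply: divr_ge0 => //; exact: ltW.
have -> : al * energy_in r0 <= al / 255 * (energy_in (4 * r0) - energy_in r0) + al * (4080 / 4096 * (cacc_const * S ^+ 2) + mass_err / al) =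
  (al * energy_in r0 <= al * ((energy_in (4 * r0) - energy_in r0) / 255 + (4080 / 4096 * (cacc_const * S ^+ 2) + mass_err / al))) :> bool.
  by congr (_ <= _); ring.
rewrite ler_pM2l //; lra.
Qed.

Lemma energy_in_total r : (r <= n)%N -> energy_in r <= 2 * ((2 * n).+1%:R ^+ 2 * S ^+ 2).
Proof.
move=> rn; rewrite /energy_in /square_energy.
have H V : (forall s t, (s < 2 * n)%N -> (t <= 2 * n)%N -> `|V s.+1 t - V s t| <= S) ->
   half_sum (hdiff_sqr V) (n - r) (n + r) <= (2 * n).+1%:R ^+ 2 * S ^+ 2.
  move=> HV.
  have cst (x : R) a b : 0 <= x -> (b - a <= (2 * n).+1)%N -> \sum_(a <= s < b) x <= (2 * n).+1%:R * x.
    move=> x0 bn; rewrite big_const_nat iter_addr addr0 -[leLHS]mulr_natl.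
    by apply: ler_wpM2r => //; rewrite ler_nat.
  apply: le_trans (_ : \sum_(n - r <= s < n + r) (2 * n).+1%:R * S ^+ 2 <= _); last first.
    by rewrite [X in _ <= X * _]expr2 -mulrA; apply: cst; [nonneg|nlia].
  rewrite /half_sum big_nat_cond [leRHS]big_nat_cond; apply: ler_sum => s; rewrite andbT => /andP[s1 s2].
  apply: le_trans (cst _ (n - r)%N (n + r).+1 _ _); [|nonneg|nlia].
  rewrite big_nat_cond [leRHS]big_nat_cond; apply: ler_sum => t; rewrite andbT => /andP[t1 t2].
  rewrite /hdiff_sqr /hdiff -real_normK ?num_real // ler_pXn2r ?nnegrE //; apply: HV; nlia.
have h1 := H U (fun s t sn tn => osc_le sn tn (ltnW sn) tn).
have h2 := H (transp U) (fun s t sn tn => osc_le tn sn tn (ltnW sn)).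
lra.
Qed.

Lemma scale_iter (kk Q : R) j i : 0 <= kk < 1 -> 0 <= Q -> (4 ^ (j + i) <= n)%N ->
  (forall r, (0 < r)%N -> (4 * r <= n)%N -> energy_in r <= kk * energy_in (4 * r) + Q) ->
  energy_in (4 ^ j) <= kk ^+ i * energy_in (4 ^ (j + i)) + Q / (1 - kk).
Proof.
move=> /andP[k0 k1] Q0 + H; have k2 : 0 < 1 - kk by lra.
elim: i j => [|i IH] j ji.
  by rewrite expr0 mul1r addn0 lerDl divr_ge0 // ltW.
have ji' : (4 ^ (j.+1 + i) <= n)%N by rewrite addSnnS.
have j4 : (4 * 4 ^ j <= n)%N.
  by rewrite -expnS; apply: leq_trans ji'; rewrite leq_exp2l // leq_addr.
apply: le_trans (H _ _ j4) _; first by rewrite expn_gt0.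
have h := ler_wpM2l k0 (IH _ ji'); rewrite -expnS; rewrite addSnnS [leRHS]mulrDr mulrA -exprS in h.
have -> : Q / (1 - kk) = kk * (Q / (1 - kk)) + Q by field; rewrite gt_eqF.
lra.
Qed.

Definition hole_filling_const : R := 1 + 2 * cacc_const + (2 + (1 - hole_theta)^-1) / al.

Lemma hole_filling_const_ge0 : 0 <= hole_filling_const.
Proof.
have a1 := al_gt0; have /andP[t0 t1] := hole_theta_itv.
have h : 0 <= cacc_const by rewrite /cacc_const; apply: divr_ge0; nonneg.
have : 0 <= (2 + (1 - hole_theta)^-1) / al.
  by apply: divr_ge0; [apply: addr_ge0; rewrite // invr_ge0; lra|exact: ltW].
by rewrite /hole_filling_const; lra.
Qed.

Lemma cacc_const_ge0 : 0 <= cacc_const.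
Proof. by have al0 := al_gt0; rewrite /cacc_const; apply: divr_ge0; nonneg. Qed.

Lemma diameter_sqr_le i : n = (16 ^ i)%N -> (2 * n).+1%:R ^+ 2 <= 9 * 256 ^+ i :> R.
Proof.
move=> nE; have n_gt0 : (0 < n)%N by rewrite nE expn_gt0.
apply: le_trans (_ : (3 * n)%:R ^+ 2 <= _); first by rewrite ler_pXn2r ?nnegrE // ler_nat; nlia.
rewrite natrM exprMn nE natrX -exprM mulnC exprM.
by apply: eq_leW; congr (_ * _); rewrite -?natrX.
Qed.

Lemma caccioppoli_iter i : n = (16 ^ i)%N ->
  energy_in (4 ^ i) <= 18 * S ^+ 2 + 256 / 255 * (cacc_const * S ^+ 2 + mass_err / al).
Proof.
move=> nE; have al0 := al_gt0; have S0 : 0 <= S ^+ 2 by exact: sqr_ge0.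
have n4 : n = (4 ^ (i + i))%N by rewrite nE addnn -mul2n expnM.
have ratio : 0 <= (256^-1 : R) < 1 by lra.
have err_ge0 : 0 <= cacc_const * S ^+ 2 + mass_err / al.
  apply: addr_ge0; first exact: mulr_ge0 cacc_const_ge0 S0.
  exact: divr_ge0 mass_err_ge0 (ltW al0).
apply: le_trans (scale_iter ratio err_ge0 (eq_leq (esym n4)) cacc_step) _.
apply: lerD; last by rewrite ler_pdivrMr; lra.
apply: le_trans (ler_wpM2l _ (energy_in_total (eq_leq (esym n4)))) _; first by apply: exprn_ge0; lra.
rewrite exprVn ler_pdivrMl ?exprn_gt0 //.
by have := ler_wpM2r S0 (diameter_sqr_le nE); lra.
Qed.

Lemma hole_filling_arith (x y z q Q c K : R) : 0 <= x <= 1 -> 0 <= y -> 0 <= z -> 0 <= Q ->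
  0 <= c -> 0 <= K -> q <= 9 * y * z ->
  x * (18 * z + 256 / 255 * (c * z + Q)) + (K * q - 2 * Q) <=
  (1 + 2 * c + K) * ((18 * x + 9 * y) * z).
Proof.
move=> /andP[x0 x1] y0 z0 Q0 c0 K0 q_le.
have := ler_wpM2r Q0 x1; have := ler_wpM2l K0 q_le.
have := mulr_ge0 c0 (mulr_ge0 x0 z0); have := mulr_ge0 c0 (mulr_ge0 y0 z0).
have := mulr_ge0 K0 (mulr_ge0 x0 z0); have := mulr_ge0 x0 z0; have := mulr_ge0 y0 z0.
by lra.
Qed.

Lemma hole_filling i : n = (16 ^ i)%N ->
  energy_in 1 <= hole_filling_const * ((18 * hole_theta ^+ i + 9 * (m * 256 ^+ i)) * S ^+ 2).
Proof.
move=> nE; have al0 := ltW al_gt0; have /andP[t0 t1] := hole_theta_itv.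
have m0 := ltW m_gt0; have S0 := sqr_ge0 S.
have theta_itv : 0 <= hole_theta < 1 by rewrite ltW.
have err_ge0 : 0 <= mass_err / al by exact: divr_ge0 mass_err_ge0 al0.
have n4 : n = (4 ^ (i + i))%N by rewrite nE addnn -mul2n expnM.
have i4 : (4 ^ (0 + i) <= n)%N by rewrite n4 leq_exp2l // leq_addl.
have := scale_iter theta_itv err_ge0 i4 hole_step; rewrite expn0 add0n => /le_trans; apply.
have pow_itv : 0 <= hole_theta ^+ i <= 1 by rewrite exprn_ge0 ?exprn_ile1 ?ltW.
have [pow_ge0 _] := andP pow_itv.
apply: le_trans (lerD (ler_wpM2l pow_ge0 (caccioppoli_iter nE)) (lexx _)) _.
have mass_le : mass_err <= 9 * (m * 256 ^+ i) * S ^+ 2.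
  rewrite /mass_err; apply: ler_wpM2r => //.
  by have := ler_wpM2l m0 (diameter_sqr_le nE); lra.
have y0 : 0 <= m * 256 ^+ i by rewrite mulr_ge0 ?exprn_ge0.
have K0 : 0 <= (2 + (1 - hole_theta)^-1) / al.
  by apply: divr_ge0 => //; apply: addr_ge0; rewrite // invr_ge0; lra.
apply: le_trans (hole_filling_arith pow_itv y0 S0 err_ge0 cacc_const_ge0 K0 mass_le).
by rewrite lerD2l; apply: eq_leW; ring.
Qed.

End Holes.

(** * Correctors on the planar torus *)

Section PointEquation.
Variables (R : realFieldType) (d h : nat) (J : finType).
Variables (al be : R) (al_gt0 : 0 < al) (al_be : al <= be).
Variables (vl : J -> R) (vl_itv : forall j, al <= vl j <= be) (zeta : 'I_d -> R).
Local Notation T := (torus d h).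
Local Notation E := (T * 'I_d)%type.

Lemma sum_edges_delta (F : E -> R) (x : T) :
  \sum_(e : E) F e * grd (@tsrc d h) (@ttgt d h) (delta R x) e =
  \sum_i (F (x - stp h i, i) - F (x, i)).
Proof.
rewrite sum_edges; apply: eq_bigr => i _.
under eq_bigr => y _ do rewrite /grd /ttgt /tsrc /delta /= mulrBr.
rewrite sumrB; congr (_ - _).
  rewrite (bigD1 (x - stp h i)) //= subrK eqxx mulr1 big1 ?addr0 // => y yx.
  have -> : (y + stp h i == x) = false by rewrite -(inj_eq (subIr (stp h i))) addrK (negPf yx).
  by rewrite mulr0.
rewrite (bigD1 x) //= eqxx mulr1 big1 ?addr0 // => y yx.
by rewrite (negPf yx) mulr0.
Qed.

Lemma phi_point m (c : {ffun E -> J}) (x : T) : 0 < m ->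
  m * phi vl zeta m c x = \sum_i (cfield vl c (x, i) * flux vl zeta m c (x, i) -
    cfield vl c (x - stp h i, i) * flux vl zeta m c (x - stp h i, i)).
Proof.
move=> m0.
have := corrector_test (@tsrc d h) (@ttgt d h) al_gt0 (fun e => zeta e.2) (delta R x) m0 (cfield_elliptic vl_itv c).
rewrite sum_edges_delta.
rewrite (eq_bigr (fun y => (y == x)%:R * phi vl zeta m c y)); last first.
  by move=> y _; rewrite /delta mulrC.
rewrite sum_delta => /eqP; rewrite addr_eq0 => /eqP ->; rewrite -sumrN.
by apply: eq_bigr => i _; rewrite opprB.
Qed.

End PointEquation.

Lemma log2_bounds k : (0 < k)%N -> (k <= 2 ^ up_log 2 k <= 2 * k)%N.
Proof.
move=> k0; rewrite up_logP //=; have [k1|k1] := leqP k 1.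
  have -> : up_log 2 k = 0%N by apply/eqP; rewrite up_log_eq0 k1 orbT.
  by rewrite expn0 muln_gt0.
have log_gt0 : (0 < up_log 2 k)%N by rewrite up_log_gt0.
by rewrite -(prednK log_gt0) expnS leq_mul2l ltnW ?up_log_gtn.
Qed.

Section Plane.
Variables (R : realFieldType) (h : nat) (J : finType) (rho : J -> R) (j0 : J).
Hypotheses (rho_ge0 : forall j, 0 <= rho j) (rho_sum : \sum_j rho j = 1).
Variables (al be : R) (al_gt0 : 0 < al) (al_be : al <= be).
Variables (vl : J -> R) (vl_itv : forall j, al <= vl j <= be).
Local Notation T := (torus 2 h).
Local Notation E := (T * 'I_2)%type.
Local Notation cfg := {ffun E -> J}.
Local Notation Ex := (Ex (E := E) rho).
Local Notation grd := (grd (@tsrc 2 h) (@ttgt 2 h)).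
Implicit Types (c : cfg) (e : E) (x y z : T) (m : R).
Local Notation st0 := (stp h (ord0 : 'I_2)).
Local Notation st1 := (stp h (lift ord0 ord0 : 'I_2)).

Definition chart y s t : T := y + st0 *+ s + st1 *+ t.

Lemma chart_h y s t : chart y s.+1 t = chart y s t + st0.
Proof. by rewrite /chart mulrSr -!addrA; do 2 congr (_ + _); rewrite addrC. Qed.

Lemma chart_v y s t : chart y s t.+1 = chart y s t + st1.
Proof. by rewrite /chart mulrSr !addrA. Qed.

Lemma chart_inj y (n : nat) : (n <= (2 * h).+1)%N ->
  injective (fun st : 'I_n * 'I_n => chart y st.1 st.2).
Proof.
move=> nh [s t] [s' t'] /=.
have ev (k : 'I_2) a b : chart y a b k = y k + (st0 k *+ a + st1 k *+ b).
  by rewrite /chart !ffunE addrA !(ffunMnE, ffunE).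
have Zp (a b : nat) : (a < n)%N -> (b < n)%N -> (inZp a : 'I_(2 * h).+1) = inZp b -> a = b.
  move=> an bn /(congr1 val) /=; rewrite !modn_small //; exact: leq_trans nh.
have in1 a : (inZp 1 : 'I_(2 * h).+1) *+ a = inZp a.
  by rewrite Zp_mulrn; apply: val_inj; rewrite /= modnMml mul1n.
move=> /ffunP pe; have := pe ord0; have := pe (lift ord0 ord0).
rewrite !ev !ffunE /= !mul0rn !add0r !addr0 !in1 => /addrI e1 /addrI e2.
by congr (_, _); apply: val_inj => /=; [apply: Zp e2|apply: Zp e1].
Qed.

Lemma sum_chart_le y n (F : T -> R) : (n <= (2 * h).+1)%N -> (forall x, 0 <= F x) ->
  \sum_(s < n) \sum_(t < n) F (chart y s t) <= \sum_x F x.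
Proof.
move=> nh F0; rewrite pair_big /=.
pose f (st : 'I_n * 'I_n) := chart y st.1 st.2.
have -> : \sum_(st : 'I_n * 'I_n) F (chart y st.1 st.2) = \sum_(x in f @: [set: 'I_n * 'I_n]) F x.
  rewrite big_imset /=; last by move=> a b _ _; exact: chart_inj.
  by apply: eq_bigl => st; rewrite inE.
by rewrite [leRHS](bigID (mem (f @: [set: 'I_n * 'I_n]))) /= lerDl sumr_ge0.
Qed.

Lemma plane_sup n (u : T -> R) m y : (2 ^ n <= (2 * h).+1)%N -> (4 ^+ n)^-1 <= m ->
  u y ^+ 2 <= 6 * n.+1%:R ^+ 2 * (\sum_e grd u e ^+ 2 + m * \sum_x u x ^+ 2).
Proof.
move=> nh nm; set D := \sum_e _; set M := \sum_x _.
have := @array_sup _ (fun s t => u (chart y s t)) n.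
rewrite (_ : chart y 0 0 = y); last by rewrite /chart !mulr0n !addr0.
have energy_le : array_energy (fun s t => u (chart y s t)) (2 ^ n) (2 ^ n) <= D.
  rewrite /D sum_edges exchange_big /=.
  apply: le_trans (sum_chart_le y nh (F := fun x => \sum_i grd u (x, i) ^+ 2) _); last first.
    by move=> x; nonneg.
  rewrite /array_energy; apply: ler_sum => s _; apply: ler_sum => t _.
  by rewrite /diff_sqr /hdiff /vdiff chart_h chart_v !big_ord_recl big_ord0 addr0.
have mass_le : (4 ^+ n)^-1 * (\sum_(s < 2 ^ n) \sum_(t < 2 ^ n) u (chart y s t) ^+ 2) <= m * M.
  apply: ler_pM => //; [by rewrite invr_ge0 exprn_ge0|by nonneg|].
  by apply: sum_chart_le => // x; exact: sqr_ge0.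
move=> /le_trans; apply.
rewrite [leRHS](_ : _ = n.+1%:R * (6 * n.+1%:R * D + 6 * n.+1%:R * (m * M))); last by ring.
have D0 : 0 <= D by rewrite /D; nonneg.
have M0 : 0 <= m * M by rewrite mulr_ge0 /M ?(le_trans _ nm) ?invr_ge0 ?exprn_ge0 //; nonneg.
have n_le : n%:R <= n.+1%:R :> R by rewrite ler_nat.
have n_ge1 : 1 <= n.+1%:R :> R by rewrite ler1n.
apply: ler_wpM2l; first by nonneg.
have : 6 * n%:R * array_energy (fun s t => u (chart y s t)) (2 ^ n) (2 ^ n) <= 6 * n.+1%:R * D.
  by apply: ler_pM => //; [by nonneg|exact: array_energy_ge0|lra].
have : 1 * (m * M) <= 6 * n.+1%:R * (m * M) by apply: ler_wpM2r => //; lra.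
by lra.
Qed.

Definition plane_green n : R := 6 * n.+1%:R ^+ 2 * coercivity al / al.

Lemma plane_green_ge0 n : 0 <= plane_green n.
Proof.
have a0 := al_gt0; rewrite /plane_green /coercivity; apply: divr_ge0; last exact: ltW.
by apply: mulr_ge0; [nonneg|apply: addr_ge0; rewrite // invr_ge0 ltW].
Qed.

Lemma sum_dgreen_plane n m c y : 0 < m -> (2 ^ n <= (2 * h).+1)%N -> (4 ^+ n)^-1 <= m ->
  \sum_e dgreen vl m c y e <= plane_green n.
Proof.
move=> m0 nh nm; have a0 := al_gt0.
set G := tgreen vl m c y.
have green_en := green_energy (@tsrc 2 h) (@ttgt 2 h) al_gt0 y m0 (cfield_elliptic vl_itv c).
rewrite -/(tgreen vl m c y) -/G in green_en.
have s1 : al * (\sum_e grd G e ^+ 2) <= \sum_e cfield vl c e * grd G e ^+ 2.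
  rewrite mulr_sumr; apply: ler_sum => e _; apply: ler_wpM2r; first exact: sqr_ge0.
  by case/andP: (cfield_elliptic vl_itv c e).
have u0 : 0 <= m * \sum_x G x ^+ 2 by nonneg.
have g0 : 0 <= \sum_e grd G e ^+ 2 by nonneg.
have Gy0 : 0 <= G y by have := mulr_ge0 (ltW a0) g0; lra.
have s2 : \sum_e grd G e ^+ 2 <= al^-1 * G y by rewrite ler_pdivlMl //; lra.
have := @plane_sup n G m y nh nm => h1.
have {h1} h1 : G y ^+ 2 <= 6 * n.+1%:R ^+ 2 * (coercivity al * G y).
  apply: le_trans h1 _; apply: ler_wpM2l; first by nonneg.
  rewrite /coercivity mulrDl mul1r addrC; apply: lerD => //.
  by have := mulr_ge0 (ltW a0) g0; lra.
have Gy : G y <= 6 * n.+1%:R ^+ 2 * coercivity al.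
  move: Gy0; rewrite le_eqVlt => /orP[/eqP <-|Gp].
    by apply: mulr_ge0; [nonneg|apply: addr_ge0; rewrite // invr_ge0 ltW].
  by rewrite -(ler_pM2r Gp) -[leRHS]mulrA -expr2.
apply: le_trans s2 _; rewrite mulrC /plane_green; apply: ler_wpM2r => //; rewrite invr_ge0; exact: ltW.
Qed.

Variables (zeta : 'I_2 -> R) (zeta_le1 : forall i, `|zeta i| <= 1).
Local Notation phi := (phi vl zeta).
Local Notation flux := (flux vl zeta).
Local Notation flux2 := (flux2 vl zeta).

Section HoleChart.
Variables (m : R) (c : cfg) (y : T).
Hypothesis m_gt0 : 0 < m.

Definition potential s t : R :=
  phi m c (chart y s t) + zeta ord0 * s%:R + zeta (lift ord0 ord0) * t%:R.

Lemma hdiff_potential s t : hdiff potential s t = flux m c (chart y s t, ord0).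
Proof.
by rewrite /hdiff /potential /flux /corr_flux /grd /ttgt /tsrc /= chart_h -/(phi m c) -natr1; ring.
Qed.

Lemma vdiff_potential s t :
  hdiff (transp potential) t s = flux m c (chart y s t, lift ord0 ord0).
Proof.
rewrite /hdiff /transp /potential /flux /corr_flux /grd /ttgt /tsrc /= chart_v -/(phi m c) -natr1.
by ring.
Qed.

(* The chart need not be injective: the equation is local, so hole filling is applied to
   the periodic extension. *)
Lemma potential_equation s t : (0 < s)%N -> (0 < t)%N ->
  let A s t := cfield vl c (chart y s t, ord0) in
  let A' t s := cfield vl c (chart y s t, lift ord0 ord0) in
  m * phi m c (chart y s t) =
    (A s t * hdiff potential s t - A s.-1 t * hdiff potential s.-1 t) +
    (A' t s * hdiff (transp potential) t s - A' t.-1 s * hdiff (transp potential) t.-1 s).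
Proof.
move=> s0 t0 /=; rewrite (phi_point al_gt0 vl_itv) // !big_ord_recl big_ord0 addr0.
have left : chart y s.-1 t = chart y s t - st0 by rewrite -[in RHS](prednK s0) chart_h addrK.
have below : chart y s t.-1 = chart y s t - st1 by rewrite -[in RHS](prednK t0) chart_v addrK.
by rewrite !hdiff_potential !vdiff_potential left below.
Qed.

Lemma potential_osc M n s t s' t' : (forall x, `|phi m c x| <= M) ->
  (s <= 2 * n)%N -> (t <= 2 * n)%N -> (s' <= 2 * n)%N -> (t' <= 2 * n)%N ->
  `|potential s t - potential s' t'| <= 2 * M + 4 * n%:R.
Proof.
move=> phi_le sn tn sn' tn'.
have slope k a b : (a <= 2 * n)%N -> (b <= 2 * n)%N -> `|zeta k * (a%:R - b%:R)| <= 2 * n%:R.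
  rewrite -!(ler_nat R) natrM normrM => an bn; have a0 := ler0n R a; have b0 := ler0n R b.
  rewrite -[leRHS]mul1r; apply: ler_pM => //.
  by rewrite ler_norml; apply/andP; split; lra.
have -> : potential s t - potential s' t' = (phi m c (chart y s t) - phi m c (chart y s' t')) +
  zeta ord0 * (s%:R - s'%:R) + zeta (lift ord0 ord0) * (t%:R - t'%:R) by rewrite /potential; ring.
have := slope ord0 _ _ sn sn'; have := slope (lift ord0 ord0) _ _ tn tn'.
have := phi_le (chart y s t); have := phi_le (chart y s' t').
rewrite !ler_norml => /andP[? ?] /andP[? ?] /andP[? ?] /andP[? ?].
by apply/andP; split; lra.
Qed.

End HoleChart.

Lemma flux2_hole m c e M i : 0 < m -> (forall x, `|phi m c x| <= M) ->
  flux2 m c e <= hole_filling_const al be *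
    ((18 * hole_theta al be ^+ i + 9 * (m * 256 ^+ i)) * (8 * (M ^+ 2 + 4 * 256 ^+ i))).
Proof.
move=> m0 phi_le; case: e => y k; pose n := (16 ^ i)%N.
pose y' := y - st0 *+ n - st1 *+ n.
have yE : chart y' n n = y by rewrite /chart /y' addrAC subrK subrK.
have M0 : 0 <= M by apply: le_trans (phi_le 0).
have n0 : 0 <= n%:R :> R by [].
pose S := 2 * M + 4 * n%:R; have S0 : 0 <= S by rewrite /S; lra.
have phi_le_S s t : (s <= 2 * n)%N -> (t <= 2 * n)%N -> `|phi m c (chart y' s t)| <= S.
  by move=> _ _; apply: le_trans (phi_le _) _; rewrite /S; lra.
have equation s t (sn : (0 < s < 2 * n)%N) (tn : (0 < t < 2 * n)%N) :=
  potential_equation c y' m0 (proj1 (andP sn)) (proj1 (andP tn)).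
have osc s t s' t' := @potential_osc m c y' M n s t s' t' phi_le.
have filling := hole_filling al_gt0 al_be m0 S0 (fun s t => cfield_elliptic vl_itv c _)
  (fun t s => cfield_elliptic vl_itv c _) equation phi_le_S osc (i := i) (erefl _).
apply: le_trans (le_trans filling _).
  have k2 : k = ord0 \/ k = lift ord0 ord0.
    by case: k => -[|[|//]] kk; [left|right]; apply: val_inj.
  have := @center_le_energy_in _ (potential m c y') n.
  rewrite expn_gt0 /hdiff_sqr hdiff_potential vdiff_potential yE => /(_ isT) [center center'].
  by rewrite /flux2; case: k2 => ->.
apply: ler_wpM2l; first exact: hole_filling_const_ge0.
apply: ler_wpM2l.
  have /andP[t0 _] := hole_theta_itv al_gt0 al_be; have theta_ge0 := ltW t0; by nonneg.
apply: le_trans (sqrrD_le _ _) _.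
have -> : 256 ^+ i = n%:R ^+ 2 :> R.
  have -> : 256 = 16 ^+ 2 :> R by ring.
  by rewrite /n natrX exprAC.
by rewrite !exprMn; lra.
Qed.

Definition sup_phi m c : R := \big[Num.max/0]_x `|phi m c x|.

Lemma sup_phi_ge0 m c : 0 <= sup_phi m c.
Proof. by rewrite /sup_phi; elim/big_ind: _ => // x y x0 y0; rewrite le_max x0. Qed.

Lemma phi_le_sup_phi m c x : `|phi m c x| <= sup_phi m c.
Proof. exact: (le_bigmax 0 (fun x => `|phi m c x|)). Qed.

Lemma sup_phi_power m c p : sup_phi m c ^+ (2 * p.+1) <= \sum_x phi m c x ^+ (2 * p.+1).
Proof.
have s0 : 0 <= \sum_x phi m c x ^+ (2 * p.+1) by apply: sumr_ge0 => x _; exact: expr_double_ge0.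
rewrite /sup_phi; elim/big_ind: _ => //.
- by rewrite expr0n muln_eq0.
- by move=> x y; case: (leP x y).
move=> x _; rewrite expr_double (bigD1 x) //= lerDl.
by apply: sumr_ge0 => y _; exact: expr_double_ge0.
Qed.

Lemma sup_phi_le m c : 0 < m -> sup_phi m c <= 4 * be / m.
Proof.
move=> m0; have b0 : 0 <= 4 * be / m.
  by apply: divr_ge0; [have a0 := al_gt0; have a1 := al_be; lra|exact: ltW].
rewrite /sup_phi; elim/big_ind: _ => // [x y x0 y0|x _]; first by rewrite ge_max x0.
by apply: le_trans (phi_sup al_gt0 al_be vl_itv zeta_le1 c x m0) _; rewrite -natrM [be * _]mulrC.
Qed.

Definition feedback_const : R := 2 ^+ 20 * be ^+ 2 * contrast al be * (coercivity al / al) * hole_filling_const al be.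

Lemma feedback_const_ge0 : 0 <= feedback_const.
Proof.
have a0 := al_gt0; have k0 := contrast_ge1 al_gt0 al_be; have h0 := hole_filling_const_ge0 al_gt0 al_be.
rewrite /feedback_const /coercivity; have : 0 <= (1 + al^-1) / al.
  by apply: divr_ge0; [apply: addr_ge0; rewrite // invr_ge0 ltW|exact: ltW].
by move=> c0; nonneg; lra.
Qed.

(* [r] is the number of hole-filling steps that halve the energy: it alone determines
   the exponent of the logarithm. *)
Variables (r Ac : nat).
Hypotheses (r_half : hole_theta al be ^+ r <= 2^-1) (Ac_ge : feedback_const * 512 <= Ac%:R) (Ac_be : 4 * be <= Ac%:R).
Hypothesis Ac_gt0 : (0 < Ac)%N.

Definition sup_bound N : R := 4 * ((2 * (Ac * N ^ 4))%:R ^+ (8 * r + 2)) ^+ 2.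

Lemma sup_bound_ge1 N : (0 < N)%N -> 1 <= sup_bound N.
Proof.
move=> N_gt0; rewrite /sup_bound; have h1 : 1 <= ((2 * (Ac * N ^ 4))%:R : R).
  by rewrite ler1n muln_gt0 muln_gt0 Ac_gt0 /= expn_gt0 N_gt0.
have : 1 <= ((2 * (Ac * N ^ 4))%:R ^+ (8 * r + 2)) ^+ 2 :> R by rewrite !exprn_ege1.
lra.
Qed.

Section SupMoments.
Variables (N n : nat) (m : R).
Hypotheses (m_gt0 : 0 < m) (nh : (2 ^ n <= (2 * h).+1)%N) (nm : (4 ^+ n)^-1 <= m).
Hypotheses (TN : (#|{: T}| <= 2 ^ N)%N) (nN : (n < N)%N).

Let ExP : is_mean Ex. Proof. exact: Ex_mean. Qed.

Let theta_ge0 i : 0 <= hole_theta al be ^+ i.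
Proof. by rewrite exprn_ge0 // ltW //; case/andP: (hole_theta_itv al_gt0 al_be). Qed.

Definition hole_gain i : R :=
  hole_filling_const al be * ((18 * hole_theta al be ^+ i + 9 * (m * 256 ^+ i)) * 8).

Lemma hole_gain_ge0 i : 0 <= hole_gain i.
Proof.
have c0 := hole_filling_const_ge0 al_gt0 al_be; have t0 := theta_ge0 i; have m0 := ltW m_gt0.
by rewrite /hole_gain; nonneg.
Qed.

Lemma flux2_le_sup_phi c e i : flux2 m c e <= hole_gain i * (sup_phi m c ^+ 2 + 4 * 256 ^+ i).
Proof.
apply: le_trans (flux2_hole e i m_gt0 (phi_le_sup_phi m c)) _.
by apply: eq_leW; rewrite /hole_gain; ring.
Qed.

Lemma green_flux_le_sup_phi c y i : \sum_e dgreen vl m c y e * flux2 m c e <=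
  plane_green n * hole_gain i * (sup_phi m c ^+ 2 + 4 * 256 ^+ i).
Proof.
rewrite -[leRHS]mulrA; apply: le_trans (ler_wpM2r _ (sum_dgreen_plane c y m_gt0 nh nm)).
  by rewrite mulr_suml; apply: ler_sum => e _; rewrite ler_wpM2l ?dgreen_ge0 ?flux2_le_sup_phi.
by rewrite mulr_ge0 ?hole_gain_ge0 // addr_ge0 ?sqr_ge0 ?mulr_ge0 ?exprn_ge0.
Qed.

Definition feedback p i : R :=
  384 * be ^+ 2 * contrast al be * p.+1%:R ^+ 2 * (plane_green n * hole_gain i).

Lemma feedback_ge0 p i : 0 <= feedback p i.
Proof.
have c1 := contrast_ge1 al_gt0 al_be; have g0 := plane_green_ge0 n; have b0 := hole_gain_ge0 i.
by rewrite /feedback; nonneg; lra.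
Qed.

Lemma phi_moment_le_sup_phi y p i : Ex (fun c => phi m c y ^+ (2 * p.+1)) <=
  feedback p i ^+ p.+1 * (2 ^+ p.+1 *
    (Ex (fun c => (sup_phi m c ^+ 2) ^+ p.+1) + (4 * 256 ^+ i) ^+ p.+1)).
Proof.
have Y0 : 0 <= 4 * 256 ^+ i :> R by nonneg.
have c1 := contrast_ge1 al_gt0 al_be; have gain0 : 0 <= plane_green n * hole_gain i.
  by rewrite mulr_ge0 ?plane_green_ge0 ?hole_gain_ge0.
apply: le_trans (phi_moment j0 rho_ge0 rho_sum al_gt0 al_be vl_itv zeta y p m_gt0) _.
rewrite /feedback [(_ * (plane_green n * _)) ^+ _]exprMn -[leRHS]mulrA.
apply: ler_wpM2l; first by rewrite exprn_ge0 //; nonneg; lra.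
rewrite -(mean_cst ExP ((4 * 256 ^+ i) ^+ p.+1)) -(meanD ExP) -!(meanZ ExP).
apply: (mean_mono ExP) => c.
apply: le_trans (_ : (plane_green n * hole_gain i * (sup_phi m c ^+ 2 + 4 * 256 ^+ i)) ^+ p.+1 <= _).
  rewrite ler_pXn2r ?nnegrE ?green_flux_le_sup_phi //.
    by apply: sumr_ge0 => e _; apply: mulr_ge0; [exact: dgreen_ge0|exact: flux2_ge0].
  by rewrite mulr_ge0 // addr_ge0 ?sqr_ge0.
rewrite exprMn; apply: ler_wpM2l; first exact: exprn_ge0.
exact: exprD_le (sqr_ge0 _) Y0.
Qed.

Lemma feedback_le p i : 2 * feedback p i <=
  feedback_const * (p.+1%:R ^+ 2 * n.+1%:R ^+ 2) * (hole_theta al be ^+ i + m * 256 ^+ i).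
Proof.
set Z := be ^+ 2 * contrast al be * (coercivity al / al) * hole_filling_const al be *
  (p.+1%:R ^+ 2 * n.+1%:R ^+ 2).
have coer_ge0 : 0 <= coercivity al / al.
  by rewrite divr_ge0 ?(ltW al_gt0) // (le_trans ler01) ?coercivity_ge1.
have Z0 : 0 <= 2 ^+ 11 * Z.
  have c1 := contrast_ge1 al_gt0 al_be; have c0 := hole_filling_const_ge0 al_gt0 al_be.
  by rewrite /Z; nonneg; lra.
have -> : 2 * feedback p i = 2 ^+ 11 * Z * (18 * (18 * hole_theta al be ^+ i + 9 * (m * 256 ^+ i))).
  by rewrite /feedback /hole_gain /plane_green /Z; ring.
rewrite [leRHS](_ : _ = 2 ^+ 11 * Z * (512 * (hole_theta al be ^+ i + m * 256 ^+ i))).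
  apply: ler_wpM2l => //; have m256 : 0 <= m * 256 ^+ i by rewrite mulr_ge0 ?exprn_ge0 // ltW.
  by have := theta_ge0 i; move: m256; move: (m * 256 ^+ i) => w w0; lra.
by rewrite /feedback_const /Z; ring.
Qed.

(* The factor [2 ^ N] lost in bounding the supremum by a sum over the torus is absorbed by
   the moment of order [p.+1 >= N]. *)
Lemma plane_moment i p : (N <= p.+1)%N ->
  feedback_const * (p.+1%:R ^+ 2 * n.+1%:R ^+ 2) * (hole_theta al be ^+ i + m * 256 ^+ i) <= 4^-1 ->
  Ex (fun c => (sup_phi m c ^+ 2) ^+ p.+1) <= (4 * 256 ^+ i) ^+ p.+1.
Proof.
move=> Np small; set X := Ex _; set Yp := _ ^+ p.+1.
have Yp0 : 0 <= Yp by rewrite exprn_ge0 // mulr_ge0 ?exprn_ge0.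
have X0 : 0 <= X by apply: (mean_ge0 ExP) => c; rewrite exprn_ge0 ?sqr_ge0.
have F0 := feedback_ge0 p i.
have sup_le : X <= 2 ^+ p.+1 * (feedback p i ^+ p.+1 * (2 ^+ p.+1 * (X + Yp))).
  apply: le_trans (_ : Ex (fun c => \sum_x phi m c x ^+ (2 * p.+1)) <= _).
    by apply: (mean_mono ExP) => c; rewrite -exprM; exact: sup_phi_power.
  rewrite (mean_sum ExP); apply: le_trans (ler_sum _ (fun x _ => phi_moment_le_sup_phi x p i)) _.
  rewrite sumr_const -[leLHS]mulr_natl -/X -/Yp; apply: ler_wpM2r; first by nonneg.
  by rewrite -natrX ler_nat (leq_trans TN) // leq_exp2l.
have half : (4 * feedback p i) ^+ p.+1 <= 2^-1.
  have F4 : 0 <= 4 * feedback p i <= 2^-1.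
    by rewrite mulr_ge0 //=; have := feedback_le p i; lra.
  have /andP[F4_ge0 F4_le] := F4.
  rewrite exprS -[leRHS]mulr1; apply: ler_pM => //; first exact: exprn_ge0.
  by rewrite exprn_ile1 //; lra.
have : X <= 2^-1 * (X + Yp).
  apply: le_trans (ler_wpM2r _ half); last exact: addr_ge0.
  apply: le_trans sup_le _; apply: eq_leW; rewrite [(4 * _) ^+ _]exprMn.
  by rewrite (_ : 4 = 2 * 2 :> R) ?[(2 * 2) ^+ _]exprMn; ring.
by lra.
Qed.

Let N_gt0 : (0 < N)%N. Proof. exact: leq_trans nN. Qed.

Let x : nat := Ac * N ^ 4.

Let x_gt0 : (0 < x)%N. Proof. by rewrite muln_gt0 Ac_gt0 expn_gt0 N_gt0. Qed.

Let s : nat := up_log 2 x.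

Let xR_ge1 : 1 <= x%:R :> R. Proof. by rewrite ler1n. Qed.

Let pow_s : x%:R <= (2 ^+ s : R) <= 2 * x%:R.
Proof. by have := log2_bounds x_gt0; rewrite -!(ler_nat R) natrM natrX. Qed.

Lemma theta_pow : hole_theta al be ^+ (r * s) <= x%:R^-1.
Proof.
have /andP[x_le _] := pow_s; apply: le_trans (_ : (2 ^+ s)^-1 <= _); last first.
  by rewrite lef_pV2 ?posrE ?exprn_gt0 ?ltr0n.
by rewrite exprM -exprVn; apply: lerXn2r; rewrite ?nnegrE ?theta_ge0 ?invr_ge0.
Qed.

Lemma pow256_le : 256 ^+ (r * s) <= (2 * x%:R) ^+ (8 * r) :> R.
Proof.
have -> : 256 ^+ (r * s) = (2 ^+ s) ^+ (8 * r) :> R.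
  rewrite (_ : 256 = 2 ^+ 8 :> R); last by rewrite -natrX.
  by rewrite -!exprM; congr (_ ^+ _); nlia.
by have /andP[_ s_le] := pow_s; rewrite lerXn2r ?nnegrE ?exprn_ge0 ?mulr_ge0.
Qed.

Lemma sup_boundE : sup_bound N = 4 * ((2 * x%:R) ^+ (8 * r) * (2 * x%:R) ^+ 2) ^+ 2.
Proof. by rewrite /sup_bound -/x natrM exprD. Qed.

Lemma sup_phi_moment_small_mass p : p.+1 = (8 * N)%N -> m * 256 ^+ (r * s) <= x%:R^-1 ->
  Ex (fun c => (sup_phi m c ^+ 2) ^+ p.+1) <= sup_bound N ^+ p.+1.
Proof.
move=> pN mass_le; have m0 := ltW m_gt0; have x1 := xR_ge1.
have const_le : feedback_const * (p.+1%:R ^+ 2 * n.+1%:R ^+ 2) <= x%:R / 8.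
  apply: le_trans (_ : feedback_const * (64 * N%:R ^+ 4) <= _).
    apply: ler_wpM2l; first exact: feedback_const_ge0.
    have -> : 64 * N%:R ^+ 4 = (8 * N%:R) ^+ 2 * N%:R ^+ 2 :> R by ring.
    rewrite pN natrM; apply: ler_wpM2l; first by nonneg.
    by rewrite ler_pXn2r ?nnegrE // ler_nat.
  have N4 : 0 <= N%:R ^+ 4 :> R by nonneg.
  by rewrite /x natrM natrX; have := ler_wpM2r N4 Ac_ge; lra.
apply: le_trans (_ : (4 * 256 ^+ (r * s)) ^+ p.+1 <= _).
  apply: plane_moment; first by rewrite pN; clear; lia.
  apply: le_trans (_ : x%:R / 8 * (x%:R^-1 + x%:R^-1) <= _); last first.
    by rewrite -mulr2n mulrnAr mulrAC mulfV ?gt_eqF //; lra.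
  apply: ler_pM => //; last exact: lerD theta_pow mass_le.
    by rewrite mulr_ge0 ?feedback_const_ge0 // mulr_ge0 ?sqr_ge0.
  by rewrite addr_ge0 ?theta_ge0 // mulr_ge0 ?exprn_ge0.
have B_ge1 := sup_bound_ge1 N_gt0.
apply: lerXn2r; rewrite ?nnegrE; [by nonneg|by lra|].
have u1 : 1 <= (2 * x%:R) ^+ (8 * r) :> R by rewrite exprn_ege1 //; lra.
have v1 : 1 <= (2 * x%:R) ^+ 2 :> R by rewrite exprn_ege1 //; lra.
rewrite sup_boundE; apply: ler_wpM2l => //; apply: le_trans pow256_le _.
by move: u1 v1; move: (_ ^+ (8 * r)) (_ ^+ 2) => u v u1 v1; have : 1 <= u * v; nra.
Qed.

Lemma sup_phi_large_mass c : x%:R^-1 < m * 256 ^+ (r * s) -> sup_phi m c ^+ 2 <= sup_bound N.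
Proof.
move=> mass_gt; have be0 : 0 <= 4 * be by have := al_gt0; have := al_be; lra.
have x1 := xR_ge1; have pow_ge0 : 0 <= 256 ^+ (r * s) :> R by exact: exprn_ge0.
have inv_le : m^-1 <= x%:R * 256 ^+ (r * s).
  rewrite -[m^-1]mulr1 ler_pdivrMl // mulrCA -ler_pdivrMl ?mulr1 ?(ltW mass_gt) //.
  by rewrite (lt_le_trans ltr01).
have be_le : 4 * be <= x%:R.
  by apply: le_trans Ac_be _; rewrite ler_nat leq_pmulr // expn_gt0 N_gt0.
have sup_le : sup_phi m c <= (2 * x%:R) ^+ (8 * r) * (2 * x%:R) ^+ 2.
  apply: le_trans (sup_phi_le c m_gt0) _; apply: le_trans (ler_wpM2l be0 inv_le) _.
  rewrite mulrA [leRHS]mulrC; apply: ler_pM => //; [by rewrite mulr_ge0|by nra|exact: pow256_le].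
rewrite sup_boundE; set B := _ * _ in sup_le *.
have : sup_phi m c ^+ 2 <= B ^+ 2.
  by rewrite lerXn2r ?nnegrE ?sup_phi_ge0 // (le_trans (sup_phi_ge0 m c)).
by have := sqr_ge0 B; lra.
Qed.

Lemma sup_phi_moment p : p.+1 = (8 * N)%N ->
  Ex (fun c => (sup_phi m c ^+ 2) ^+ p.+1) <= sup_bound N ^+ p.+1.
Proof.
move=> pN; have [mass_le|mass_gt] := lerP (m * 256 ^+ (r * s)) x%:R^-1.
  exact: sup_phi_moment_small_mass.
rewrite -[leRHS](mean_cst ExP (sup_bound N ^+ p.+1)); apply: (mean_mono ExP) => c.
rewrite ler_pXn2r ?nnegrE ?sqr_ge0 ?(sup_phi_large_mass c mass_gt) //.
by have := sup_bound_ge1 N_gt0; lra.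
Qed.

Lemma sup_phi_moment_low k : (0 < k)%N -> (k %| 8)%N ->
  Ex (fun c => (sup_phi m c ^+ 2) ^+ k) <= sup_bound N ^+ k.
Proof.
move=> k0 /dvdnP[l l8].
have lN_gt0 : (0 < l * N)%N by rewrite muln_gt0 N_gt0 andbT; case: (l) l8.
have B_ge1 := sup_bound_ge1 N_gt0.
have power_ge0 c : 0 <= (sup_phi m c ^+ 2) ^+ k by rewrite exprn_ge0 ?sqr_ge0.
rewrite -(@ler_pXn2r _ (l * N)%N) ?nnegrE //; [|exact: (mean_ge0 ExP)|by rewrite exprn_ge0 //; lra].
apply: le_trans (mean_power ExP _ power_ge0) _.
have N8 : ((8 * N).-1.+1 = 8 * N)%N by rewrite prednK // muln_gt0 N_gt0.
have kl : (8 * N = k * (l * N))%N by rewrite l8 mulnCA mulnA.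
have := sup_phi_moment N8; rewrite N8 kl exprM => moment; apply: le_trans moment.
by apply: (mean_mono ExP) => c; rewrite -[leLHS]exprM.
Qed.

End SupMoments.

End Plane.

(** * Effect of one conductance on the averages *)

Lemma sqr3_le (R : realFieldType) (x y z : R) : (x + y + z) ^+ 2 <= 3 * (x ^+ 2 + y ^+ 2 + z ^+ 2).
Proof. have := sqr_ge0 (x - y); have := sqr_ge0 (x - z); have := sqr_ge0 (y - z); nra. Qed.

Section OneEdge.
Variables (R : realFieldType) (T E : finType) (src tgt : E -> T).
Variables (al be : R) (al_gt0 : 0 < al) (al_be : al <= be) (xi : E -> R).
Variables (a a' : E -> R) (ea : elliptic al be a) (ea' : elliptic al be a') (e0 : E).
Hypothesis off : forall e, e \notin [set e0] -> a e = a' e.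
Local Notation grd := (grd src tgt).
Local Notation weak_sol := (weak_sol src tgt).
Local Notation corrector := (corrector src tgt xi).
Local Notation corr_flux := (corr_flux src tgt xi).
Local Notation green := (green src tgt).
Implicit Types (m : R) (x y : T) (e : E).

Definition cdiff m x : R := corrector m a' x - corrector m a x.

Lemma corr_flux_cdiff m e : corr_flux m a' e = corr_flux m a e + grd (cdiff m) e.
Proof. by rewrite /corr_flux /grd /cdiff; ring. Qed.

Lemma sum_one (F : E -> R) : \sum_e (a' e - a e) * F e = (a' e0 - a e0) * F e0.
Proof.
rewrite (bigD1 e0) //= big1 ?addr0 // => e ee; rewrite off ?subrr ?mul0r //.
by rewrite inE.
Qed.

Lemma test_cdiff m h v : 0 < m -> weak_sol m a v h (fun=> 0) ->
  \sum_x h x * cdiff m x = - ((a' e0 - a e0) * corr_flux m a' e0 * grd v e0).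
Proof.
move=> m0 sv; have := sv (cdiff m); rewrite [X in _ = _ + X]big1 ?addr0; last by move=> e _; rewrite mul0r.
move=> <-; have := corrector_diff_sol src tgt al_gt0 xi m0 ea ea' v.
rewrite [X in _ = X + _]big1 ?add0r; last by move=> x _; rewrite mul0r.
under [X in _ = X -> _]eq_bigr => e _ do rewrite mulNr -mulrA.
rewrite sumrN (sum_one (fun e => corr_flux m a' e * grd v e)) -mulrA => <-.
by congr (_ * _ + _); apply: eq_bigr => x _; rewrite /cdiff /corrector; ring.
Qed.

Lemma delta_sqr : (a' e0 - a e0) ^+ 2 <= be ^+ 2.
Proof. exact: (elliptic_diff_sqr al_gt0 e0 ea ea'). Qed.

Let be_ge0 : 0 <= be. Proof. by rewrite ltW // (lt_le_trans al_gt0). Qed.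

Definition flux_const : R := 4 * contrast al be.

Definition response_const : R := coercivity al * (be ^+ 2 / al).

Lemma flux_const_ge1 : 1 <= flux_const.
Proof. by have := contrast_ge1 al_gt0 al_be; rewrite /flux_const; lra. Qed.

Lemma response_const_ge0 : 0 <= response_const.
Proof.
have a0 := ltW al_gt0; rewrite /response_const /coercivity.
by apply: mulr_ge0; [apply: addr_ge0; rewrite // invr_ge0|apply: divr_ge0; nonneg].
Qed.

Lemma corr_flux_new m : 0 < m -> corr_flux m a' e0 ^+ 2 <= flux_const * corr_flux m a e0 ^+ 2.
Proof.
move=> m0; have := corr_flux_compare src tgt al_gt0 al_be xi m0 ea' ea (B := [set e0]).
rewrite !big_set1; apply => e ee; exact/esym/off.
Qed.

Lemma corr_flux_new_sqr m : 0 < m ->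
  (corr_flux m a' e0 ^+ 2) ^+ 2 <= flux_const ^+ 2 * (corr_flux m a e0 ^+ 2) ^+ 2.
Proof.
move=> m0; have k1 := flux_const_ge1; have p0 : 0 <= corr_flux m a e0 ^+ 2 by exact: sqr_ge0.
by rewrite -exprMn ler_pXn2r ?nnegrE ?corr_flux_new //; [exact: sqr_ge0|apply: mulr_ge0; lra].
Qed.

Lemma defect_sqr m t : 0 < m -> ((a' e0 - a e0) * corr_flux m a' e0 * t) ^+ 2 <=
  be ^+ 2 * flux_const ^+ 2 * (corr_flux m a e0 ^+ 2 * t ^+ 2).
Proof.
move=> m0; rewrite [leLHS]exprMn mulrA; apply: ler_wpM2r; first exact: sqr_ge0.
rewrite [leLHS]exprMn -mulrA; apply: ler_pM; rewrite ?sqr_ge0 //; first exact: delta_sqr.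
apply: le_trans (corr_flux_new m0) _; apply: ler_wpM2r; first exact: sqr_ge0.
by have := flux_const_ge1; rewrite expr2; nra.
Qed.

Lemma cdiff_sqr m y : 0 < m ->
  cdiff m y ^+ 2 <= be ^+ 2 * corr_flux m a' e0 ^+ 2 * grd (green m a y) e0 ^+ 2.
Proof.
by move=> m0; have := corrector_diff_point src tgt al_gt0 xi y m0 ea ea' off; rewrite !big_set1.
Qed.

Lemma cdiff_grad m : 0 < m -> \sum_e grd (cdiff m) e ^+ 2 <= contrast al be * corr_flux m a' e0 ^+ 2.
Proof.
by move=> m0; have := corrector_diff_grad src tgt al_gt0 xi m0 ea ea' off; rewrite !big_set1.
Qed.

Lemma cdiff_energy m : 0 < m -> \sum_e grd (cdiff m) e ^+ 2 + m * \sum_x cdiff m x ^+ 2 <=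
  response_const * corr_flux m a' e0 ^+ 2.
Proof.
move=> m0; have := corrector_diff_energy src tgt al_gt0 xi m0 ea ea' off; rewrite !big_set1 -/(cdiff m).
rewrite /response_const /coercivity; have a0 := al_gt0.
have : 0 <= m * (\sum_x cdiff m x ^+ 2) by nonneg.
have : 0 <= \sum_e grd (cdiff m) e ^+ 2 by nonneg.
rewrite /cdiff; move: (\sum_e _) (\sum_x _) => D S D0 S0 h.
set X := be ^+ 2 / al * _ in h.
have -> : (1 + al^-1) * (be ^+ 2 / al) * corr_flux m a' e0 ^+ 2 = X + al^-1 * X by rewrite /X; ring.
have h1 : S <= al^-1 * X by rewrite ler_pdivlMl //; lra.
have h2 : m * D <= X by have := mulr_ge0 (ltW a0) D0; lra.
by rewrite addrC; exact: lerD.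
Qed.

Definition var_const : R :=
  3 * be ^+ 2 * flux_const ^+ 2 * (4 + 2 * be ^+ 2 * contrast al be + response_const).

Lemma var_const_ge0 : 0 <= var_const.
Proof.
have z0 := response_const_ge0; have k0 := le_trans ler01 (contrast_ge1 al_gt0 al_be).
by rewrite /var_const; nonneg.
Qed.

Lemma sqr_sum3_le_var (x y z A B C : R) : 0 <= A -> 0 <= B -> 0 <= C ->
  x ^+ 2 <= be ^+ 2 * flux_const ^+ 2 * A -> y ^+ 2 <= 4 * (be ^+ 2 * flux_const ^+ 2 * B) ->
  z ^+ 2 <= be ^+ 2 * flux_const ^+ 2 * (2 * be ^+ 2 * contrast al be + response_const) * C ->
  (x + y + z) ^+ 2 <= var_const * (A + B + C).
Proof.
move=> A0 B0 C0 xA yB zC; apply: le_trans (sqr3_le _ _ _) _.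
have z0 := response_const_ge0; have k0 := le_trans ler01 (contrast_ge1 al_gt0 al_be).
rewrite /var_const -[3 * _ * _]mulrA; move: xA yB zC.
have : 0 <= 2 * be ^+ 2 * contrast al be + response_const by nonneg.
have : 0 <= be ^+ 2 * flux_const ^+ 2 by nonneg.
rewrite -[4 + _ + _]addrA; move: (be ^+ 2 * _) (_ + response_const) => w s w0 s0.
have A1 := mulr_ge0 w0 A0; have B_ge1 := mulr_ge0 w0 B0; have C1 := mulr_ge0 w0 C0.
have := mulr_ge0 s0 A1; have := mulr_ge0 s0 B_ge1.
by move: (x ^+ 2) (y ^+ 2) (z ^+ 2) => x2 y2 z2; lra.
Qed.

Variables (chi : T -> R) (X0 : R) (Lam : {set T}).
Hypotheses (chi_le : forall x, `|chi x| <= X0) (chi_supp : forall x, x \notin Lam -> chi x = 0).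

Definition quad_energy m (b : E -> R) : R := \sum_e chi (src e) * (b e * corr_flux m b e ^+ 2).

Definition energy_src m y : R := m * chi y * corrector m a y +
  \sum_(e | tgt e == y) grd chi e * (a e * corr_flux m a e).

Lemma energy_diff m v : 0 < m -> weak_sol m a v (energy_src m) (fun=> 0) ->
  quad_energy m a' - quad_energy m a = chi (src e0) * ((a' e0 - a e0) * corr_flux m a' e0 ^+ 2) +
    2 * ((a' e0 - a e0) * corr_flux m a' e0 * grd v e0) +
    \sum_e chi (src e) * (a e * grd (cdiff m) e ^+ 2).
Proof.
move=> m0 sv.
have dualE := test_cdiff m0 sv.
have correctorE := corrector_test src tgt al_gt0 xi (fun x => chi x * cdiff m x) m0 ea.
have srcE : \sum_x energy_src m x * cdiff m x = m * (\sum_x corrector m a x * (chi x * cdiff m x)) +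
    \sum_e a e * corr_flux m a e * (grd chi e * cdiff m (tgt e)).
  rewrite mulr_sumr (partition_big tgt xpredT) //= -big_split; apply: eq_bigr => x _ /=.
  rewrite /energy_src mulrDl mulr_suml; congr (_ + _); first by ring.
  by apply: eq_bigr => e /eqP ->; ring.
have productE : \sum_e a e * corr_flux m a e * grd (fun x => chi x * cdiff m x) e =
   \sum_e chi (src e) * (a e * corr_flux m a e * grd (cdiff m) e) +
   \sum_e a e * corr_flux m a e * (grd chi e * cdiff m (tgt e)).
  by rewrite -big_split; apply: eq_bigr => e _ /=; rewrite /grd; ring.
have -> : quad_energy m a' - quad_energy m a = \sum_e (a' e - a e) * (chi (src e) * corr_flux m a' e ^+ 2) +
   2 * (\sum_e chi (src e) * (a e * corr_flux m a e * grd (cdiff m) e)) +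
   \sum_e chi (src e) * (a e * grd (cdiff m) e ^+ 2).
  rewrite /quad_energy -sumrB mulr_sumr -!big_split; apply: eq_bigr => e _ /=.
  by rewrite corr_flux_cdiff; ring.
by rewrite sum_one; lra.
Qed.

Lemma sum_src_supp (F : E -> R) : \sum_e chi (src e) * F e = \sum_(e | src e \in Lam) chi (src e) * F e.
Proof.
rewrite [RHS]big_mkcond; apply: eq_bigr => e _; case: ifPn => // /chi_supp ->.
by rewrite mul0r.
Qed.

Let X0_ge0 (x : T) : 0 <= X0. Proof. exact: le_trans (chi_le x). Qed.

Lemma chi_sqr x : chi x ^+ 2 <= X0 ^+ 2.
Proof.
by rewrite -[_ ^+ 2]real_normK ?num_real // ler_pXn2r ?nnegrE //; exact: X0_ge0 x.
Qed.

Definition edge_green_sum m : R := \sum_(e | src e \in Lam)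
  (grd (green m a (tgt e)) e0 ^+ 2 + grd (green m a (src e)) e0 ^+ 2).

Lemma edge_green_sum_ge0 m : 0 <= edge_green_sum m.
Proof. by rewrite /edge_green_sum; nonneg. Qed.

Lemma local_energy_le m : 0 < m -> \sum_(e | src e \in Lam) grd (cdiff m) e ^+ 2 <=
  2 * be ^+ 2 * corr_flux m a' e0 ^+ 2 * edge_green_sum m.
Proof.
move=> m0; rewrite mulr_sumr; apply: ler_sum => e _.
have := cdiff_sqr (tgt e) m0; have := cdiff_sqr (src e) m0.
have := sqrrD_le (cdiff m (tgt e)) (- cdiff m (src e)); rewrite sqrrN -/(grd (cdiff m) e).
by rewrite -[2 * be ^+ 2 * _]mulrA; move: (be ^+ 2 * corr_flux m a' e0 ^+ 2) => z; lra.
Qed.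

Lemma energy_quad m : 0 < m -> (\sum_e chi (src e) * (a e * grd (cdiff m) e ^+ 2)) ^+ 2 <=
  be ^+ 2 * flux_const ^+ 2 * (2 * be ^+ 2 * contrast al be) *
  (X0 ^+ 2 * ((corr_flux m a e0 ^+ 2) ^+ 2 * edge_green_sum m)).
Proof.
move=> m0; rewrite sum_src_supp.
set Q := \sum_(e | src e \in Lam) grd (cdiff m) e ^+ 2.
have k0 := le_trans ler01 (contrast_ge1 al_gt0 al_be); have g0 := edge_green_sum_ge0 m.
have Q0 : 0 <= Q by rewrite /Q; nonneg.
have absQ : `|\sum_(e | src e \in Lam) chi (src e) * (a e * grd (cdiff m) e ^+ 2)| <= X0 * be * Q.
  apply: le_trans (ler_norm_sum _ _ _) _; rewrite mulr_sumr; apply: ler_sum => e _.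
  have /andP[ale ebe] := ea e; have ge : 0 <= a e by apply: le_trans ale; exact: ltW.
  rewrite normrM normrM (ger0_norm ge) (ger0_norm (sqr_ge0 (grd (cdiff m) e))) -mulrA.
  apply: ler_pM => //; first by apply: mulr_ge0 => //; exact: sqr_ge0.
  by apply: ler_wpM2r => //; exact: sqr_ge0.
have Q_le : Q <= contrast al be * corr_flux m a' e0 ^+ 2.
  apply: le_trans (cdiff_grad m0).
  by rewrite /Q [leRHS](bigID (fun e => src e \in Lam)) /= lerDl; nonneg.
rewrite -[leLHS]real_normK ?num_real //.
apply: le_trans (_ : (X0 * be * Q) ^+ 2 <= _).
  by rewrite ler_pXn2r ?nnegrE //; exact: le_trans absQ.
rewrite exprMn [Q ^+ 2]expr2.
apply: le_trans (ler_wpM2l (sqr_ge0 _) (ler_pM Q0 Q0 Q_le (local_energy_le m0))) _.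
have w0 : 0 <= 2 * be ^+ 4 * contrast al be * X0 ^+ 2 * edge_green_sum m.
  by have b0 := be_ge0; nonneg.
have := ler_wpM2l w0 (corr_flux_new_sqr m0); move: (corr_flux m a' e0) (corr_flux m a e0) => p' p le_p.
by apply: le_trans (le_trans _ le_p) _; apply: eq_leW; ring.
Qed.

Lemma energy_diff_sqr m v : 0 < m -> weak_sol m a v (energy_src m) (fun=> 0) ->
  (quad_energy m a' - quad_energy m a) ^+ 2 <= var_const * (chi (src e0) ^+ 2 * (corr_flux m a e0 ^+ 2) ^+ 2 +
    corr_flux m a e0 ^+ 2 * grd v e0 ^+ 2 + X0 ^+ 2 * ((corr_flux m a e0 ^+ 2) ^+ 2 * edge_green_sum m)).
Proof.
move=> m0 sv; rewrite (energy_diff m0 sv); have g0 := edge_green_sum_ge0 m.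
have k0 := le_trans ler01 (contrast_ge1 al_gt0 al_be); have z0 := response_const_ge0.
apply: sqr_sum3_le_var; try by nonneg.
- rewrite exprMn [leRHS]mulrCA; apply: ler_wpM2l; first exact: sqr_ge0.
  rewrite [leLHS]exprMn -[leRHS]mulrA; apply: ler_pM; rewrite ?sqr_ge0 ?corr_flux_new_sqr //; exact: delta_sqr.
- rewrite exprMn (_ : 2 ^+ 2 = 4); last by ring.
  by apply: ler_wpM2l => //; exact: defect_sqr.
apply: le_trans (energy_quad m0) _; apply: ler_wpM2r; first by nonneg.
by apply: ler_wpM2l; [nonneg|rewrite lerDl].
Qed.

Variables (m1 m2 Ga : R) (m1_gt0 : 0 < m1) (m2_gt0 : 0 < m2) (Ga_ge0 : 0 <= Ga).
Hypotheses (hGa1 : poincare src tgt Lam Ga m1) (hGa2 : poincare src tgt Lam Ga m2).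

Definition quad_product (b : E -> R) : R := \sum_x chi x * (corrector m1 b x * corrector m2 b x).

Definition vertex_green_sum m : R := \sum_(y in Lam) grd (green m a y) e0 ^+ 2.

Lemma product_quad m : 0 < m -> poincare src tgt Lam Ga m -> (\sum_(x in Lam) cdiff m x ^+ 2) ^+ 2 <=
  be ^+ 2 * flux_const ^+ 2 * response_const * (Ga * ((corr_flux m a e0 ^+ 2) ^+ 2 * vertex_green_sum m)).
Proof.
move=> m0 hG; rewrite expr2.
have energy_le : \sum_(x in Lam) cdiff m x ^+ 2 <= Ga * (response_const * corr_flux m a' e0 ^+ 2).
  by apply: le_trans (hG _) _; apply: ler_wpM2l => //; exact: cdiff_energy.
have green_le : \sum_(x in Lam) cdiff m x ^+ 2 <= be ^+ 2 * corr_flux m a' e0 ^+ 2 * vertex_green_sum m.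
  by rewrite /vertex_green_sum mulr_sumr; apply: ler_sum => x _; exact: cdiff_sqr.
have s0 : 0 <= \sum_(x in Lam) cdiff m x ^+ 2 by nonneg.
apply: le_trans (ler_pM s0 s0 energy_le green_le) _.
have z0 := response_const_ge0; have g0 : 0 <= vertex_green_sum m by rewrite /vertex_green_sum; nonneg.
have w0 : 0 <= be ^+ 2 * response_const * Ga * vertex_green_sum m by nonneg.
have := ler_wpM2l w0 (corr_flux_new_sqr m0); move: (corr_flux m a' e0) (corr_flux m a e0) => p' p le_p.
by apply: le_trans (le_trans _ le_p) _; apply: eq_leW; ring.
Qed.

Local Notation product_term m := ((corr_flux m a e0 ^+ 2) ^+ 2 * vertex_green_sum m).

Lemma product_cross : (\sum_x chi x * (cdiff m1 x * cdiff m2 x)) ^+ 2 <=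
  be ^+ 2 * flux_const ^+ 2 * response_const * (X0 ^+ 2 * Ga * (product_term m1 + product_term m2)).
Proof.
have -> : \sum_x chi x * (cdiff m1 x * cdiff m2 x) = \sum_(x in Lam) 1 * cdiff m1 x * (chi x * cdiff m2 x).
  rewrite [RHS]big_mkcond; apply: eq_bigr => x _; case: ifPn => [_|/chi_supp ->]; first by ring.
  by rewrite mul0r.
apply: le_trans (cauchy_schwarz_seq _ _ _ _ (fun=> ler01)) _.
apply: le_trans (_ : (\sum_(x in Lam) cdiff m1 x ^+ 2) * (X0 ^+ 2 * \sum_(x in Lam) cdiff m2 x ^+ 2) <= _).
  apply: ler_pM; try by apply: sumr_ge0 => x _; rewrite mul1r sqr_ge0.
    by apply: ler_sum => x _; rewrite mul1r.
  rewrite mulr_sumr; apply: ler_sum => x _; rewrite mul1r exprMn; apply: ler_wpM2r; first exact: sqr_ge0.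
  exact: chi_sqr.
rewrite mulrCA -[X0 ^+ 2 * Ga * _]mulrA [leRHS]mulrCA; apply: ler_wpM2l; first exact: sqr_ge0.
have := product_quad m1_gt0 hGa1; have := product_quad m2_gt0 hGa2.
rewrite !mulrDr; move: (\sum_(x in Lam) _) (\sum_(x in Lam) _) => x y.
move: (_ * _ * (Ga * _)) (_ * _ * (Ga * _)) => p q.
by have := sqr_ge0 x; have := sqr_ge0 y; have := sqr_ge0 (x - y); lra.
Qed.

Lemma product_diff_sqr v1 v2 : weak_sol m1 a v1 (fun x => chi x * corrector m2 a x) (fun=> 0) ->
  weak_sol m2 a v2 (fun x => chi x * corrector m1 a x) (fun=> 0) ->
  (quad_product a' - quad_product a) ^+ 2 <= var_const *
    (corr_flux m1 a e0 ^+ 2 * grd v1 e0 ^+ 2 + corr_flux m2 a e0 ^+ 2 * grd v2 e0 ^+ 2 +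
     X0 ^+ 2 * Ga * (product_term m1 + product_term m2)).
Proof.
move=> sv1 sv2.
have -> : quad_product a' - quad_product a = \sum_x chi x * corrector m2 a x * cdiff m1 x +
   \sum_x chi x * corrector m1 a x * cdiff m2 x + \sum_x chi x * (cdiff m1 x * cdiff m2 x).
  by rewrite /quad_product -sumrB -!big_split; apply: eq_bigr => x _ /=; rewrite /cdiff; ring.
rewrite (test_cdiff m1_gt0 sv1) (test_cdiff m2_gt0 sv2).
have k0 := le_trans ler01 (contrast_ge1 al_gt0 al_be); have z0 := response_const_ge0.
have g0 m : 0 <= vertex_green_sum m by rewrite /vertex_green_sum; nonneg.
have t0 m : 0 <= product_term m by apply: mulr_ge0; rewrite // sqr_ge0.
have c0 : 0 <= X0 ^+ 2 * Ga * (product_term m1 + product_term m2).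
  by apply: mulr_ge0; [nonneg|exact: addr_ge0].
apply: sqr_sum3_le_var; rewrite ?sqrrN ?defect_sqr //; try by nonneg.
  by apply: le_trans (defect_sqr _ m2_gt0) _; rewrite ler_peMl ?ler1n //; nonneg.
apply: le_trans product_cross _; apply: ler_wpM2r => //; apply: ler_wpM2l; first by nonneg.
by rewrite lerDr; nonneg.
Qed.

End OneEdge.

(** * Variance of the spatial averages on the torus *)

Lemma sqr_sum_ord (R : realFieldType) (n : nat) (f : 'I_n -> R) :
  (\sum_i f i) ^+ 2 <= n%:R * \sum_i f i ^+ 2.
Proof.
have := cauchy_schwarz_seq (index_enum 'I_n) xpredT (fun=> 1) f (fun=> ler01).
rewrite (eq_bigr f); last by move=> i _; rewrite !mul1r.
rewrite [X in _ <= X * _](eq_bigr (fun=> 1)); last by move=> i _; rewrite expr1n mul1r.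
rewrite [X in _ <= _ * X](eq_bigr (fun i => f i ^+ 2)); last by move=> i _; rewrite mul1r.
by rewrite sum_cst_ord mulr1.
Qed.

Section TorusVariance.
Variables (R : realFieldType) (d h : nat) (J : finType) (rho : J -> R) (j0 : J).
Hypotheses (rho_ge0 : forall j, 0 <= rho j) (rho_sum : \sum_j rho j = 1).
Variables (al be : R) (al_gt0 : 0 < al) (al_be : al <= be).
Variables (vl : J -> R) (vl_itv : forall j, al <= vl j <= be).
Variables (zeta : 'I_d -> R).
Local Notation T := (torus d h).
Local Notation E := (T * 'I_d)%type.
Local Notation cfg := {ffun E -> J}.
Local Notation Ex := (Ex (E := E) rho).
Local Notation grd := (grd (@tsrc d h) (@ttgt d h)).
Local Notation phi := (phi vl zeta).
Local Notation flux := (flux vl zeta).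
Local Notation flux2 := (flux2 vl zeta).
Local Notation dgreen := (dgreen vl).
Implicit Types (c : cfg) (e : E) (x y z : T) (m : R).

Definition Var (f : cfg -> R) : R := Ex (fun c => (f c - Ex f) ^+ 2).

Lemma Var_le f : Var f <= \sum_e Ex (fun c => (f (upd c e j0) - f c) ^+ 2).
Proof.
have ExP := Ex_mean E rho_ge0 rho_sum.
have c0 : cfg := [ffun=> j0].
have := efron_stein j0 rho_ge0 rho_sum f c0 (enum_uniq (mem (predT : pred E))).
rewrite !(avg_enum rho_ge0 rho_sum) => h1.
rewrite -(mean_sum ExP) /Var; apply: le_trans (le_trans _ h1) _.
  by apply: (mean_mono ExP) => c; rewrite (avg_enum rho_ge0 rho_sum).
apply: (mean_mono ExP) => c; rewrite big_enum /=; apply: ler_sum => e _.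
by rewrite -sqrrN opprB.
Qed.

Lemma sum_in_edges (F : E -> R) y : \sum_(e | ttgt e == y) F e = \sum_i F (y - stp h i, i).
Proof.
rewrite big_mkcond sum_edges; apply: eq_bigr => i _; rewrite (bigD1 (y - stp h i)) //=.
rewrite {1}/ttgt /= subrK eqxx big1 ?addr0 // => x xy.
case: eqP => // tx; case/eqP: xy; by rewrite -tx /ttgt /= addrK.
Qed.

Lemma card_out_edges (Lam : {set T}) (K : R) :
  \sum_(e : E | e.1 \in Lam) K = d%:R * #|Lam|%:R * K.
Proof.
rewrite big_mkcond sum_edges.
under eq_bigr => i _ do rewrite -big_mkcond sumr_const.
by rewrite sumr_const card_ord -[LHS]mulr_natl -[X in _ * X]mulr_natl mulrA.
Qed.

Definition dual_src m (A : T -> R) (B : E -> R) c y : R :=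
  A y * phi m c y + \sum_(e | ttgt e == y) B e * (cfield vl c e * flux m c e).

Definition dual_term m (hh : cfg -> T -> R) : R :=
  Ex (fun c => \sum_e flux2 m c e * grd (dual_sol vl m hh c) e ^+ 2).

Section Averages.
Variables (chi : T -> R) (X0 : R) (Lam : {set T}).
Hypotheses (chi_le : forall x, `|chi x| <= X0) (chi_supp : forall x, x \notin Lam -> chi x = 0).

Definition avg_energy m c : R := \sum_(e : E) chi e.1 * (cfield vl c e * flux2 m c e).

Definition avg_product m1 m2 c : R := \sum_x chi x * (phi m1 c x * phi m2 c x).

Lemma Var_energy m k1 k2 : 0 < m ->
  (forall e, Ex (fun c => flux2 m c e ^+ 2) <= k1) ->
  (forall y, Ex (fun c => \sum_e flux2 m c e ^+ 2 * dgreen m c y e) <= k2) ->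
  Var (avg_energy m) <= var_const al be * (X0 ^+ 2 * (d%:R * #|Lam|%:R * (k1 + 2 * k2)) +
    dual_term m (dual_src m (fun x => m * chi x) (grd chi))).
Proof.
move=> m0 h1 h2; apply: le_trans (Var_le _) _.
have ExP := Ex_mean E rho_ge0 rho_sum.
have a0 := al_gt0.
set hh := dual_src _ _ _.
pose G c e := \sum_(e' : E | e'.1 \in Lam) (dgreen m c (ttgt e') e + dgreen m c (tsrc e') e).
apply: le_trans (_ : \sum_e Ex (fun c => var_const al be * (chi e.1 ^+ 2 * flux2 m c e ^+ 2 +
    flux2 m c e * grd (dual_sol vl m hh c) e ^+ 2 + X0 ^+ 2 * (flux2 m c e ^+ 2 * G c e))) <= _).
  apply: ler_sum => e _; apply: (mean_mono ExP) => c.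
  have sv := dual_solP al_gt0 vl_itv m0 hh c.
  exact: (energy_diff_sqr al_gt0 al_be (cfield_elliptic vl_itv c) (cfield_elliptic vl_itv (upd c e j0))
    (cfield_upd vl c j0 (e := e)) chi_le chi_supp m0 sv).
rewrite -(mean_sum ExP).
have -> : Ex (fun c => \sum_e var_const al be * (chi e.1 ^+ 2 * flux2 m c e ^+ 2 +
    flux2 m c e * grd (dual_sol vl m hh c) e ^+ 2 + X0 ^+ 2 * (flux2 m c e ^+ 2 * G c e))) =
  var_const al be * (\sum_e chi e.1 ^+ 2 * Ex (fun c => flux2 m c e ^+ 2) + dual_term m hh +
   X0 ^+ 2 * Ex (fun c => \sum_e flux2 m c e ^+ 2 * G c e)).
  rewrite -(meanZ ExP) /dual_term.
  under [in RHS]eq_bigr => e _ do rewrite -(meanZ ExP).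
  rewrite -(mean_sum ExP) -!(meanD ExP) -(meanZ ExP); apply: (mean_ext ExP) => c.
  by rewrite -mulr_sumr !big_split /= mulr_sumr.
apply: ler_wpM2l; first exact: var_const_ge0.
rewrite -addrA [X in _ <= X]addrC addrCA; apply: lerD => //.
rewrite [k1 + _]addrC; rewrite mulrDr mulrDr addrC; apply: lerD.
  apply: ler_wpM2l; first exact: sqr_ge0.
  rewrite (mean_ext ExP (g := fun c => \sum_(e' : E | e'.1 \in Lam)
     ((\sum_e flux2 m c e ^+ 2 * dgreen m c (ttgt e') e) + \sum_e flux2 m c e ^+ 2 * dgreen m c (tsrc e') e))); last first.
    move=> c; rewrite /G; under eq_bigr => e _ do rewrite mulr_sumr.
    rewrite exchange_big; apply: eq_bigr => e' _ /=.
    by rewrite -big_split; apply: eq_bigr => e _; rewrite mulrDr.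
  rewrite (Ex_sum_cond rho_ge0 rho_sum) -(card_out_edges Lam (2 * k2)); apply: ler_sum => e _.
  by rewrite (meanD ExP) mulr_natl mulr2n; apply: lerD; exact: h2.
rewrite -(card_out_edges Lam k1) mulr_sumr [leRHS]big_mkcond; apply: ler_sum => e _.
case: ifPn => [eL|/chi_supp ->]; last by rewrite expr0n mul0r.
apply: ler_pM; [exact: sqr_ge0|by apply: (mean_ge0 ExP) => c; exact: sqr_ge0| |exact: h1].
exact: chi_sqr chi_le _.
Qed.

Variables (m1 m2 Ga : R) (m1_gt0 : 0 < m1) (m2_gt0 : 0 < m2) (Ga_ge0 : 0 <= Ga).
Hypothesis hGa1 : poincare (@tsrc d h) (@ttgt d h) Lam Ga m1.
Hypothesis hGa2 : poincare (@tsrc d h) (@ttgt d h) Lam Ga m2.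

Lemma Var_product k2 :
  (forall y, Ex (fun c => \sum_e flux2 m1 c e ^+ 2 * dgreen m1 c y e) <= k2) ->
  (forall y, Ex (fun c => \sum_e flux2 m2 c e ^+ 2 * dgreen m2 c y e) <= k2) ->
  Var (avg_product m1 m2) <= var_const al be * (dual_term m1 (dual_src m2 chi (fun=> 0)) + dual_term m2 (dual_src m1 chi (fun=> 0)) +
    X0 ^+ 2 * Ga * (2 * (#|Lam|%:R * k2))).
Proof.
move=> h1 h2; apply: le_trans (Var_le _) _.
have ExP := Ex_mean E rho_ge0 rho_sum.
have hs0 m c x : dual_src m chi (fun=> 0) c x = chi x * phi m c x.
  by rewrite /dual_src big1 ?addr0 // => e _; rewrite mul0r.
pose V1 c := dual_sol vl m1 (dual_src m2 chi (fun=> 0)) c.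
pose V2 c := dual_sol vl m2 (dual_src m1 chi (fun=> 0)) c.
pose G m c e := \sum_(y in Lam) dgreen m c y e.
apply: le_trans (_ : \sum_e Ex (fun c => var_const al be * (flux2 m1 c e * grd (V1 c) e ^+ 2 +
    flux2 m2 c e * grd (V2 c) e ^+ 2 + X0 ^+ 2 * Ga * (flux2 m1 c e ^+ 2 * G m1 c e + flux2 m2 c e ^+ 2 * G m2 c e))) <= _).
  apply: ler_sum => e _; apply: (mean_mono ExP) => c.
  have s1 := dual_solP al_gt0 vl_itv m1_gt0 (dual_src m2 chi (fun=> 0)) c.
  have s2 := dual_solP al_gt0 vl_itv m2_gt0 (dual_src m1 chi (fun=> 0)) c.
  have s1' : weak_sol (@tsrc d h) (@ttgt d h) m1 (cfield vl c) (V1 c) (fun x => chi x * phi m2 c x) (fun=> 0).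
    by move=> z; rewrite s1; congr (_ + _); apply: eq_bigr => x _; rewrite hs0.
  have s2' : weak_sol (@tsrc d h) (@ttgt d h) m2 (cfield vl c) (V2 c) (fun x => chi x * phi m1 c x) (fun=> 0).
    by move=> z; rewrite s2; congr (_ + _); apply: eq_bigr => x _; rewrite hs0.
  exact: (product_diff_sqr al_gt0 al_be (cfield_elliptic vl_itv c) (cfield_elliptic vl_itv (upd c e j0))
    (cfield_upd vl c j0 (e := e)) chi_le chi_supp m1_gt0 m2_gt0 Ga_ge0 hGa1 hGa2 s1' s2').
rewrite -(mean_sum ExP).
have -> : Ex (fun c => \sum_e var_const al be * (flux2 m1 c e * grd (V1 c) e ^+ 2 +
    flux2 m2 c e * grd (V2 c) e ^+ 2 + X0 ^+ 2 * Ga * (flux2 m1 c e ^+ 2 * G m1 c e + flux2 m2 c e ^+ 2 * G m2 c e))) =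
  var_const al be * (dual_term m1 (dual_src m2 chi (fun=> 0)) + dual_term m2 (dual_src m1 chi (fun=> 0)) +
   X0 ^+ 2 * Ga * (Ex (fun c => \sum_e flux2 m1 c e ^+ 2 * G m1 c e) +
     Ex (fun c => \sum_e flux2 m2 c e ^+ 2 * G m2 c e))).
  rewrite /dual_term -!(meanD ExP) -(meanZ ExP) -(meanD ExP) -(meanZ ExP); apply: (mean_ext ExP) => c.
  by rewrite -mulr_sumr !big_split /= -mulr_sumr big_split.
apply: ler_wpM2l; first exact: var_const_ge0.
rewrite lerD2l; apply: ler_wpM2l; first by apply: mulr_ge0 => //; exact: sqr_ge0.
have gs m : (forall y, Ex (fun c => \sum_e flux2 m c e ^+ 2 * dgreen m c y e) <= k2) ->
    Ex (fun c => \sum_e flux2 m c e ^+ 2 * G m c e) <= #|Lam|%:R * k2.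
  move=> H; rewrite (mean_ext ExP (g := fun c => \sum_(y in Lam) \sum_e flux2 m c e ^+ 2 * dgreen m c y e)); last first.
    by move=> c; rewrite /G exchange_big; apply: eq_bigr => e _; rewrite mulr_sumr.
  rewrite (Ex_sum_cond rho_ge0 rho_sum); apply: le_trans (ler_sum _ (fun y _ => H y)) _.
  by rewrite sumr_const -[leLHS]mulr_natl.
by rewrite mulr_natl mulr2n; apply: lerD; exact: gs.
Qed.

End Averages.

Section Sources.
Hypothesis d_gt0 : (0 < d)%N.
Variables (A : T -> R) (B : E -> R) (XA XB : R) (Lam : {set T}).
Hypotheses (A_le : forall x, `|A x| <= XA) (B_le : forall e, `|B e| <= XB).
Hypotheses (A_supp : forall x, x \notin Lam -> A x = 0)
  (B_supp : forall e, ttgt e \notin Lam -> B e = 0).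

Let be_ge0 : 0 <= be. Proof. by rewrite ltW // (lt_le_trans al_gt0). Qed.

Let XA_ge0 : 0 <= XA. Proof. exact: le_trans (A_le 0). Qed.

Let XB_ge0 : 0 <= XB.
Proof. by case: d d_gt0 B B_le => // n _ b bl; exact: le_trans (bl (0, ord0)). Qed.

Definition in_edge (y : T) (i : 'I_d) : E := (y - stp h i, i).

Lemma dual_srcE m c y : dual_src m A B c y =
  A y * phi m c y + \sum_i B (in_edge y i) * (cfield vl c (in_edge y i) * flux m c (in_edge y i)).
Proof. by rewrite /dual_src sum_in_edges. Qed.

Lemma dual_src_supp m c x : x \notin Lam -> dual_src m A B c x = 0.
Proof.
move=> xL; rewrite dual_srcE A_supp // mul0r add0r big1 // => i _.
by rewrite B_supp ?mul0r // /ttgt /in_edge /= subrK.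
Qed.

Lemma cfield_itv c e : 0 <= cfield vl c e <= be.
Proof. by have /andP[l1 ->] := vl_itv (c e); rewrite andbT; apply: le_trans (ltW al_gt0) l1. Qed.

Lemma dual_src_sqr m c y : dual_src m A B c y ^+ 2 <=
  2 * (XA + XB) ^+ 2 * (phi m c y ^+ 2 + be ^+ 2 * (d%:R * \sum_i flux2 m c (in_edge y i))).
Proof.
rewrite dual_srcE; apply: le_trans (sqrrD_le _ _) _.
have sA : A y ^+ 2 <= (XA + XB) ^+ 2.
  rewrite -[A y ^+ 2]real_normK ?num_real // ler_pXn2r ?nnegrE ?addr_ge0 //.
  by apply: le_trans (A_le _) _; rewrite lerDl.
have sB e : B e ^+ 2 <= (XA + XB) ^+ 2.
  rewrite -[B e ^+ 2]real_normK ?num_real // ler_pXn2r ?nnegrE ?addr_ge0 //.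
  by apply: le_trans (B_le _) _; rewrite lerDr.
have h1 : (A y * phi m c y) ^+ 2 <= (XA + XB) ^+ 2 * phi m c y ^+ 2.
  by rewrite exprMn; apply: ler_wpM2r => //; exact: sqr_ge0.
have h2 : (\sum_i B (in_edge y i) * (cfield vl c (in_edge y i) * flux m c (in_edge y i))) ^+ 2 <=
  (XA + XB) ^+ 2 * (be ^+ 2 * (d%:R * \sum_i flux2 m c (in_edge y i))).
  apply: le_trans (sqr_sum_ord _) _.
  rewrite [X in _ <= _ * X]mulrCA [leRHS]mulrCA; apply: ler_wpM2l => //.
  rewrite !mulr_sumr; apply: ler_sum => i _.
  rewrite exprMn exprMn; apply: ler_pM; rewrite ?sqr_ge0 //.
    by apply: mulr_ge0; exact: sqr_ge0.
  apply: ler_wpM2r; first exact: sqr_ge0.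
  by have /andP[l1 l2] := cfield_itv c (in_edge y i); rewrite ler_pXn2r ?nnegrE.
lra.
Qed.

Definition src_kernel m y c e : R :=
  dgreen m c y e + \sum_i dgreen m c (y - stp h i) e + \sum_i (e == in_edge y i)%:R.

Lemma src_kernel_ge0 m y c e : 0 <= src_kernel m y c e.
Proof. by rewrite /src_kernel; nonneg; exact: dgreen_ge0. Qed.

Definition src_const : R := 3 * be ^+ 2 * (d%:R * (1 + d%:R * be) ^+ 2) * (4 * contrast al be).

Lemma src_const_ge0 : 0 <= src_const.
Proof. by have k := contrast_ge1 al_gt0 al_be; rewrite /src_const; nonneg; lra. Qed.

Section SourceReset.
Variables (m : R) (m_gt0 : 0 < m) (S : {set E}) (c : cfg).
Local Notation c' := (reset j0 S c).
Local Notation F := (\sum_(e in S) flux2 m c' e).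
Local Notation G x := (\sum_(e in S) dgreen m c x e).

Definition phi_reset_diff x : R := phi m c' x - phi m c x.

Definition field_defect e : R := (cfield vl c e - cfield vl c' e) * flux m c' e.

Let off e : e \notin S -> cfield vl c e = cfield vl c' e.
Proof. exact: cfield_reset. Qed.

Let F_ge0 : 0 <= F. Proof. by apply: sumr_ge0 => e _; exact: flux2_ge0. Qed.

Let G_ge0 x : 0 <= G x. Proof. by apply: sumr_ge0 => e _; exact: dgreen_ge0. Qed.

Lemma phi_reset_diff_sqr x : phi_reset_diff x ^+ 2 <= be ^+ 2 * F * G x.
Proof.
exact: (corrector_diff_point (@tsrc d h) (@ttgt d h) al_gt0 (fun e => zeta e.2) x m_gt0
  (cfield_elliptic vl_itv c) (cfield_elliptic vl_itv c') off).
Qed.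

Lemma flux_reset_le : F <= 4 * contrast al be * \sum_(e in S) flux2 m c e.
Proof.
apply: (corr_flux_compare (@tsrc d h) (@ttgt d h) al_gt0 al_be (fun e => zeta e.2) m_gt0
  (cfield_elliptic vl_itv c') (cfield_elliptic vl_itv c)) => e eS.
exact/esym/off.
Qed.

Lemma field_defect_sqr e : field_defect e ^+ 2 <= be ^+ 2 * F * (e \in S)%:R.
Proof.
rewrite /field_defect; case: (boolP (e \in S)) => eS; last by rewrite off // subrr mul0r expr0n mulr0.
rewrite mulr1 exprMn; apply: ler_pM; rewrite ?sqr_ge0 //.
  have /andP[? ?] := cfield_itv c e; have /andP[? ?] := cfield_itv c' e.
  rewrite -[leLHS]real_normK ?num_real // ler_pXn2r ?nnegrE // ler_norml; apply/andP; split; lra.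
by rewrite (bigD1 e) //= lerDl; apply: sumr_ge0 => i _; exact: flux2_ge0.
Qed.

Lemma dual_src_diffE y : dual_src m A B c y - dual_src m A B c' y =
  - A y * phi_reset_diff y + \sum_i B (in_edge y i) *
    (cfield vl c (in_edge y i) * (phi_reset_diff (y - stp h i) - phi_reset_diff y) + field_defect (in_edge y i)).
Proof.
set Z := \sum_i _; have -> : Z = \sum_i B (in_edge y i) * (cfield vl c (in_edge y i) * flux m c (in_edge y i)) -
    \sum_i B (in_edge y i) * (cfield vl c' (in_edge y i) * flux m c' (in_edge y i)).
  rewrite -sumrB; apply: eq_bigr => i _; rewrite /field_defect.
  have -> : flux m c' (in_edge y i) = flux m c (in_edge y i) + (phi_reset_diff y - phi_reset_diff (y - stp h i)).
    by rewrite /flux /corr_flux /grd /ttgt /tsrc /in_edge /= subrK -/(phi m c) -/(phi m c') /phi_reset_diff; ring.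
  ring.
by rewrite !dual_srcE /phi_reset_diff; ring.
Qed.

Lemma dual_src_diff_le y : `|dual_src m A B c y - dual_src m A B c' y| <= (XA + XB) *
  ((1 + d%:R * be) * `|phi_reset_diff y| + be * (\sum_i `|phi_reset_diff (y - stp h i)|) +
   \sum_i `|field_defect (in_edge y i)|).
Proof.
rewrite dual_src_diffE; apply: le_trans (ler_normD _ _) _; set u := phi_reset_diff.
have -> : (XA + XB) * ((1 + d%:R * be) * `|u y| + be * (\sum_i `|u (y - stp h i)|) +
    \sum_i `|field_defect (in_edge y i)|) = (XA + XB) * `|u y| +
  (XA + XB) * (\sum_i (be * (`|u (y - stp h i)| + `|u y|) + `|field_defect (in_edge y i)|)).
  by rewrite big_split /= -mulr_sumr big_split /= sum_cst_ord; ring.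
apply: lerD.
  by rewrite normrM normrN; apply: ler_wpM2r => //; apply: le_trans (A_le _) _; rewrite lerDl.
apply: le_trans (ler_norm_sum _ _ _) _; rewrite mulr_sumr; apply: ler_sum => i _.
rewrite normrM; apply: ler_pM => //; first by apply: le_trans (B_le _) _; rewrite lerDr.
apply: le_trans (ler_normD _ _) _; rewrite lerD2r normrM.
have /andP[f0 fb] := cfield_itv c (in_edge y i); rewrite (ger0_norm f0).
by apply: ler_pM => //; exact: ler_normB.
Qed.

Lemma sum_src_kernel y : \sum_(e in S) src_kernel m y c e =
  G y + \sum_i G (y - stp h i) + \sum_i (in_edge y i \in S)%:R.
Proof.
rewrite /src_kernel !big_split /= [X in _ + X + _]exchange_big [X in _ + X]exchange_big /=.
congr (_ + _ + _); apply: eq_bigr => i _.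
rewrite big_mkcond (bigD1 (in_edge y i)) //= eqxx big1 ?addr0; first by case: ifP.
by move=> e /negPf ->; case: ifP.
Qed.

Lemma dual_src_diff_kernel y : ((1 + d%:R * be) * `|phi_reset_diff y|) ^+ 2 +
    (be * (\sum_i `|phi_reset_diff (y - stp h i)|)) ^+ 2 + (\sum_i `|field_defect (in_edge y i)|) ^+ 2 <=
  d%:R * (1 + d%:R * be) ^+ 2 * (be ^+ 2 * F * \sum_(e in S) src_kernel m y c e).
Proof.
set D2 := (1 + d%:R * be) ^+ 2; rewrite sum_src_kernel !(mulrDr (be ^+ 2 * F)) !(mulrDr (d%:R * D2)).
have d1 : 1 <= d%:R :> R by rewrite ler1n.
have D1 : 1 <= D2 by rewrite /D2 exprn_ege1 // lerDl mulr_ge0.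
have D0 : 0 <= D2 by exact: le_trans D1.
have beD : be ^+ 2 <= D2.
  by rewrite /D2 ler_pXn2r ?nnegrE ?addr_ge0 ?mulr_ge0 //; have := ler_wpM2r be_ge0 d1; lra.
have bF : 0 <= be ^+ 2 * F by rewrite mulr_ge0 ?sqr_ge0.
have bG x : 0 <= be ^+ 2 * F * G x by exact: mulr_ge0.
apply: lerD; first apply: lerD.
- rewrite exprMn real_normK ?num_real // -/D2.
  apply: ler_pM; rewrite ?sqr_ge0 ?phi_reset_diff_sqr //.
  exact: ler_peMl.
- rewrite exprMn [d%:R * D2]mulrC -[leRHS]mulrA; apply: le_trans (_ : D2 * (d%:R * \sum_i `|phi_reset_diff (y - stp h i)| ^+ 2) <= _).
    by apply: ler_pM; rewrite ?sqr_ge0 //; exact: sqr_sum_ord.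
  do 2![apply: ler_wpM2l => //]; rewrite mulr_sumr; apply: ler_sum => i _.
  by rewrite real_normK ?num_real // phi_reset_diff_sqr.
apply: le_trans (sqr_sum_ord _) _; rewrite -[leRHS]mulrA; apply: ler_wpM2l => //.
apply: le_trans (_ : be ^+ 2 * F * \sum_i (in_edge y i \in S)%:R <= _).
  by rewrite mulr_sumr; apply: ler_sum => i _; rewrite real_normK ?num_real // field_defect_sqr.
by apply: ler_peMl => //; apply: mulr_ge0 => //; nonneg.
Qed.

Lemma dual_src_reset y : (dual_src m A B c y - dual_src m A B c' y) ^+ 2 <=
  (XA + XB) ^+ 2 * ((\sum_(e in S) src_kernel m y c e) * \sum_(e in S) src_const * flux2 m c e).
Proof.
have kernel_ge0 : 0 <= \sum_(e in S) src_kernel m y c e by apply: sumr_ge0 => e _; exact: src_kernel_ge0.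
rewrite -[leLHS]real_normK ?num_real //.
set Z := (1 + d%:R * be) * `|phi_reset_diff y| + be * (\sum_i `|phi_reset_diff (y - stp h i)|) +
  \sum_i `|field_defect (in_edge y i)|.
apply: le_trans (_ : ((XA + XB) * Z) ^+ 2 <= _).
  by rewrite ler_pXn2r ?nnegrE ?dual_src_diff_le //; exact: le_trans (dual_src_diff_le y).
rewrite exprMn; apply: ler_wpM2l; first exact: sqr_ge0.
apply: le_trans (sqr3_le _ _ _) _.
apply: le_trans (ler_wpM2l (ler0n R 3) (dual_src_diff_kernel y)) _.
set k := \sum_(e in S) src_kernel m y c e in kernel_ge0 *.
have w0 : 0 <= 3 * be ^+ 2 * (d%:R * (1 + d%:R * be) ^+ 2) * k by nonneg.
rewrite -mulr_sumr /src_const; apply: le_trans (le_trans _ (ler_wpM2l w0 flux_reset_le)) _.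
  by apply: eq_leW; ring.
by apply: eq_leW; ring.
Qed.

End SourceReset.

End Sources.

End TorusVariance.

(** * Variance estimates in dimension at least three *)

Section HighDimension.
Variables (R : realFieldType) (d h : nat).
Hypotheses (d3 : (3 <= d)%N) (h_gt1 : (1 < h)%N).
Variables (J : finType) (rho : J -> R) (j0 : J).
Hypotheses (rho_ge0 : forall j, 0 <= rho j) (rho_sum : \sum_j rho j = 1).
Variables (al be : R) (al_gt0 : 0 < al) (al_be : al <= be).
Variables (vl : J -> R) (vl_itv : forall j, al <= vl j <= be).
Variables (zeta : 'I_d -> R) (zeta_le1 : forall i, `|zeta i| <= 1).
Local Notation T := (torus d h).
Local Notation E := (T * 'I_d)%type.
Local Notation cfg := {ffun E -> J}.
Local Notation Ex := (Ex (E := E) rho).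
Local Notation grd := (grd (@tsrc d h) (@ttgt d h)).
Local Notation phi := (phi vl zeta).
Local Notation flux := (flux vl zeta).
Local Notation flux2 := (flux2 vl zeta).
Local Notation dgreen := (dgreen vl).
Local Notation dual_src := (dual_src vl zeta).
Local Notation dual_term := (dual_term rho vl zeta).
Implicit Types (c : cfg) (e : E) (x y z : T) (m : R).

Let ExP := Ex_mean E rho_ge0 rho_sum.

Let d0 : (0 < d)%N. Proof. exact: leq_trans d3. Qed.

Let be_ge0 : 0 <= be. Proof. by rewrite ltW // (lt_le_trans al_gt0). Qed.

Variables (P s p : nat).
Hypotheses (P_large : 2 * 64 ^+ d <= growth_rate d al be ^+ P) (sp : (s.+1 * (2 * P.+1) = p.+1)%N).
Hypothesis p_small : part_ratio d al be p * scale_decay R d P ^+ 2 <= 1.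

Let mul2S : (2 * P).+2 = (2 * P.+1)%N. Proof. by rewrite mulnS. Qed.

Lemma growth_rate_mono q : (P <= q)%N -> 2 * 64 ^+ d <= growth_rate d al be ^+ q.
Proof.
move=> Pq; apply: le_trans P_large _; apply: ler_weXn2l => //.
exact: ltW (growth_rate_gt1 d3 al_gt0 al_be).
Qed.

Let P2_large : 2 * 64 ^+ d <= growth_rate d al be ^+ (2 * P).+1.
Proof. by apply: growth_rate_mono; rewrite mul2n -addnn -addnS leq_addr. Qed.

Let p_large : 2 * 64 ^+ d <= growth_rate d al be ^+ p.
Proof.
apply: growth_rate_mono; rewrite -ltnS -sp.
by apply: leq_trans (leq_pmull _ _); rewrite // leq_pmull.
Qed.

Definition flux_power_bound : R := flux_moment_const d al be (2 * P).+1.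

Definition phi_power_bound : R := phi_moment_const d al be P.

Variables (mu : R) (mu_gt0 : 0 < mu) (mu_large : 32 * d%:R <= mu * h%:R).

Let m_large m : mu <= m -> 32 * d%:R <= m * h%:R.
Proof. by move=> mm; apply: le_trans mu_large _; apply: ler_wpM2r. Qed.

Let m_pos m : mu <= m -> 0 < m. Proof. exact: lt_le_trans. Qed.

Lemma flux2_power_moment m e : mu <= m -> Ex (fun c => flux2 m c e ^+ (2 * P.+1)) <= flux_power_bound.
Proof.
move=> mm; have [_ H] := phi_flux_moments d3 h_gt1 j0 rho_ge0 rho_sum al_gt0 al_be vl_itv zeta_le1
  (m_pos mm) (m_large mm) P2_large.
by have := H e; rewrite mul2S.
Qed.

Lemma mean_le_power (f : cfg -> R) q (K : R) : (forall c, 0 <= f c) ->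
  Ex (fun c => f c ^+ q.+1) <= K -> Ex f <= 1 + K.
Proof.
move=> f0 fK; have := le_trans (mean_power ExP q.+1 f0) fK.
have x0 : 0 <= Ex f by apply: (mean_ge0 ExP).
move: (Ex f) x0 => x x0 xK; have K0 : 0 <= K by apply: le_trans xK; exact: exprn_ge0.
have [x1|x1] := lerP x 1; first by lra.
have : x <= x ^+ q.+1 by rewrite exprS ler_peMr // exprn_ege1 // ltW.
lra.
Qed.

Lemma flux_power_bound_ge0 : 0 <= flux_power_bound.
Proof. exact: flux_moment_const_ge0. Qed.

Lemma flux2_sqr_mean m e : mu <= m -> Ex (fun c => flux2 m c e ^+ 2) <= 1 + flux_power_bound.
Proof.
move=> mm; apply: (@mean_le_power _ P) => [c|]; first exact: sqr_ge0.
apply: le_trans (flux2_power_moment e mm).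
by apply: (mean_mono ExP) => c; rewrite -exprM.
Qed.

Lemma flux2_mean m e : mu <= m -> Ex (fun c => flux2 m c e) <= 1 + flux_power_bound.
Proof.
move=> mm; apply: (@mean_le_power _ (2 * P).+1) => [c|]; first exact: flux2_ge0.
by rewrite mul2S; exact: flux2_power_moment.
Qed.

Lemma phi_sqr_mean m y : mu <= m -> Ex (fun c => phi m c y ^+ 2) <= 1 + phi_power_bound.
Proof.
move=> mm; have [H _] := phi_flux_moments d3 h_gt1 j0 rho_ge0 rho_sum al_gt0 al_be vl_itv zeta_le1
  (m_pos mm) (m_large mm) P_large.
apply: (@mean_le_power _ P) => [c|]; first exact: sqr_ge0.
by apply: le_trans (H y); apply: (mean_mono ExP) => c; rewrite -exprM.
Qed.

Lemma green_moment m y (Y : cfg -> E -> R) M : mu <= m -> (forall c e, 0 <= Y c e) ->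
  (forall e, Ex (fun c => Y c e ^+ P.+1) <= M) ->
  Ex (fun c => (\sum_e dgreen m c y e * Y c e) ^+ P.+1) <= green_sum_const d al be P * M.
Proof.
move=> mm Y0 YM.
have := green_sum d3 h_gt1 rho_ge0 rho_sum al_gt0 al_be vl_itv (y := y) (j := 0) (Q := xpredT)
  (m_pos mm) (m_large mm) P_large Y0 YM (fun _ _ => leq0n _).
by rewrite mul0n expr0 mulr1.
Qed.

Definition green_flux_bound : R := 1 + green_sum_const d al be P * flux_power_bound.

Lemma green_flux m y : mu <= m -> Ex (fun c => \sum_e flux2 m c e ^+ 2 * dgreen m c y e) <= green_flux_bound.
Proof.
move=> mm; apply: (@mean_le_power _ P) => [c|].
  by apply: sumr_ge0 => e _; apply: mulr_ge0; [exact: sqr_ge0|exact: dgreen_ge0].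
apply: le_trans (green_moment (Y := fun c e => flux2 m c e ^+ 2) (M := flux_power_bound) y mm _ _).
- by apply: (mean_mono ExP) => c; rewrite (eq_bigr (fun e => dgreen m c y e * flux2 m c e ^+ 2)) // => e _; rewrite mulrC.
- by move=> c e; exact: sqr_ge0.
by move=> e; apply: le_trans (flux2_power_moment e mm); apply: (mean_mono ExP) => c; rewrite -exprM.
Qed.

Lemma power_sum_le (I : finType) (f : I -> R) q : (forall i, 0 <= f i) ->
  (\sum_i f i) ^+ q.+1 <= #|I|%:R ^+ q * \sum_i f i ^+ q.+1.
Proof.
move=> f0; have := @card_power R I xpredT f #|I|%:R q.
by apply=> //; rewrite sumr_const.
Qed.

Definition kernel_const : R := (d + d).+1%:R ^+ P * ((d.+1)%:R * green_sum_const d al be P + d%:R).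

Lemma kernel_const_ge0 : 0 <= kernel_const.
Proof. by have g := green_sum_const_ge0 d3 al_gt0 al_be P; rewrite /kernel_const; nonneg. Qed.

Lemma src_kernel_sum m y (Y : cfg -> E -> R) M : mu <= m -> (forall c e, 0 <= Y c e) ->
  (forall e, Ex (fun c => Y c e ^+ P.+1) <= M) ->
  Ex (fun c => (\sum_e src_kernel vl m y c e * Y c e) ^+ P.+1) <= kernel_const * M.
Proof.
move=> mm Y0 YM.
pose X c (o : option ('I_d + 'I_d)) : R := match o with
  | None => \sum_e dgreen m c y e * Y c e
  | Some (inl i) => \sum_e dgreen m c (y - stp h i) e * Y c e
  | Some (inr i) => Y c (in_edge y i) end.
have X0 c o : 0 <= X c o.
  by case: o => [[i|i]|] //=; apply: sumr_ge0 => e _; apply: mulr_ge0 => //; exact: dgreen_ge0.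
have sE (f : option ('I_d + 'I_d) -> R) : \sum_o f o = f None + (\sum_i f (Some (inl i)) + \sum_i f (Some (inr i))).
  rewrite (bigD1 None) //=; congr (_ + _).
  rewrite (reindex_omap (@Some _) id) /=; last by case.
  rewrite (eq_bigl xpredT); last by move=> i /=; rewrite eqxx.
  by rewrite big_sumType.
have kE c : \sum_e src_kernel vl m y c e * Y c e = \sum_o X c o.
  rewrite sE /=.
  under eq_bigr => e _ do rewrite /src_kernel 2!mulrDl.
  rewrite !big_split /= -addrA; congr (_ + (_ + _)).
    under eq_bigr => e _ do rewrite mulr_suml.
    by rewrite exchange_big.
  under eq_bigr => e _ do rewrite mulr_suml.
  rewrite exchange_big /=; apply: eq_bigr => i _.
  by rewrite (bigD1 (in_edge y i)) //= eqxx mul1r big1 ?addr0 // => e /negPf ->; rewrite mul0r.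
apply: le_trans (_ : Ex (fun c => (d + d).+1%:R ^+ P * \sum_o X c o ^+ P.+1) <= _).
  apply: (mean_mono ExP) => c; rewrite kE; apply: le_trans (power_sum_le _ (X0 c)) _.
  by rewrite card_option card_sum card_ord.
rewrite (meanZ ExP) /kernel_const -mulrA; apply: ler_wpM2l; first by nonneg.
rewrite (mean_sum ExP) sE /=.
have -> : (d.+1%:R * green_sum_const d al be P + d%:R) * M =
  green_sum_const d al be P * M + (d%:R * (green_sum_const d al be P * M) + d%:R * M) by rewrite -natr1; ring.
apply: lerD; first exact: green_moment.
apply: lerD.
  rewrite -sum_cst_ord; apply: ler_sum => i _; exact: green_moment.
by apply: le_trans (ler_sum _ (fun i _ => YM (in_edge y i))) _; rewrite sum_cst_ord.
Qed.

Variables (A : T -> R) (B : E -> R) (XA XB Ga : R) (Lam : {set T}).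
Hypotheses (A_le : forall x, `|A x| <= XA) (B_le : forall e, `|B e| <= XB).
Hypotheses (A_supp : forall x, x \notin Lam -> A x = 0)
  (B_supp : forall e, ttgt e \notin Lam -> B e = 0).

Definition dual_src_bound : R := 2 * (1 + phi_power_bound + be ^+ 2 * (d%:R * (d%:R * (1 + flux_power_bound)))).

Lemma dual_src_mean m y : mu <= m -> Ex (fun c => dual_src m A B c y ^+ 2) <= (XA + XB) ^+ 2 * dual_src_bound.
Proof.
move=> mm.
apply: le_trans (_ : Ex (fun c => 2 * (XA + XB) ^+ 2 * (phi m c y ^+ 2 +
    be ^+ 2 * (d%:R * \sum_i flux2 m c (in_edge y i)))) <= _).
  by apply: (mean_mono ExP) => c; exact: (dual_src_sqr al_gt0 al_be vl_itv zeta d0 A_le B_le).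
rewrite (meanZ ExP) (meanD ExP) !(meanZ ExP) (mean_sum ExP) [2 * _]mulrC -mulrA.
apply: ler_wpM2l; first exact: sqr_ge0.
apply: ler_wpM2l => //; apply: lerD; first exact: phi_sqr_mean.
apply: ler_wpM2l; first exact: sqr_ge0.
apply: ler_wpM2l => //; apply: le_trans (_ : \sum_(i < d) (1 + flux_power_bound) <= _).
  by apply: ler_sum => i _; exact: flux2_mean.
by rewrite sum_cst_ord.
Qed.

Lemma dual_energy_mean m m' : mu <= m -> mu <= m' -> 0 < Ga -> poincare (@tsrc d h) (@ttgt d h) Lam Ga m ->
  Ex (fun c => \sum_e grd (dual_sol vl m (dual_src m' A B) c) e ^+ 2) <=
  4 / ellmin al ^+ 2 * Ga * (#|Lam|%:R * ((XA + XB) ^+ 2 * dual_src_bound)).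
Proof.
move=> mm mm' Ga0 Ga_poincare; have m0 := m_pos mm.
have c0 : 0 < ellmin al by have [/andP[]] := ellmin_itv al_gt0.
apply: le_trans (_ : Ex (fun c => 4 / ellmin al ^+ 2 * Ga * \sum_(x in Lam) dual_src m' A B c x ^+ 2) <= _).
  apply: (mean_mono ExP) => c.
  have sv := dual_solP al_gt0 vl_itv m0 (dual_src m' A B) c.
  apply: le_trans (localized_energy al_gt0 m0 Ga0 Ga_poincare (cfield_elliptic vl_itv c) sv _).
    by rewrite lerDl; nonneg.
  by move=> x; exact: dual_src_supp.
rewrite (meanZ ExP) (Ex_sum_cond rho_ge0 rho_sum).
apply: ler_wpM2l; first by apply: mulr_ge0; [apply: divr_ge0; nonneg|exact: ltW].
apply: le_trans (ler_sum _ (fun x _ => dual_src_mean x mm')) _.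
by rewrite sumr_const -[leLHS]mulr_natl.
Qed.

Lemma src_weight_moment m e : mu <= m ->
  Ex (fun c => (src_const d al be * flux2 m c e) ^+ (2 * P.+1)) <= src_const d al be ^+ (2 * P.+1) * flux_power_bound.
Proof.
move=> mm; apply: le_trans (_ : Ex (fun c => src_const d al be ^+ (2 * P.+1) * flux2 m c e ^+ (2 * P.+1)) <= _).
  by apply: (mean_mono ExP) => c; rewrite [leLHS]exprMn.
rewrite (meanZ ExP); apply: ler_wpM2l; last exact: flux2_power_moment.
by apply: exprn_ge0; exact: src_const_ge0.
Qed.

Let decay_itv : 0 < decay_rate d al be < 1. Proof. exact: decay_rate_itv. Qed.

Let part_const_ge0 : 0 <= part_const d al be p.
Proof.
have /andP[t0 t1] := decay_itv; rewrite /part_const.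
apply: mulr_ge0; last by rewrite invr_ge0 exprn_ge0 // /flux_rate; lra.
by apply: mulr_ge0; [nonneg|apply: mulr_ge0 => //; exact: local_flux_const_ge0].
Qed.

Let part_ratio_ge0 : 0 <= part_ratio d al be p.
Proof.
have /andP[t0 t1] := decay_itv; rewrite /part_ratio.
by apply: divr_ge0; [apply: exprn_ge0; apply: divr_ge0; [exact: ltW|exact: sqr_ge0]|exact: ltW].
Qed.

Definition dual_weight_const : R := weighted_const d al be kernel_const (src_const d al be ^+ (2 * P.+1) * flux_power_bound) P
  (part_const d al be p) (flux_part_mean d al be) (2 / (1 - flux_rate d al be)).

Definition dual_term_const : R := dual_weight_const * (4 / ellmin al ^+ 2 * dual_src_bound + 1).

Lemma dual_term_le m m' : mu <= m -> mu <= m' -> 0 < Ga -> poincare (@tsrc d h) (@ttgt d h) Lam Ga m ->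
  dual_term m (dual_src m' A B) <= dual_term_const * (Ga * #|Lam|%:R * (XA + XB) ^+ 2).
Proof.
move=> mm mm' Ga0 Ga_poincare; have m0 := m_pos mm; have m0' := m_pos mm'.
have srcK := src_const_ge0 d al_gt0 al_be; have /andP[t0 t1] := decay_itv.
have weight0 : 0 <= src_const d al be ^+ (2 * P.+1) * flux_power_bound by have := flux_power_bound_ge0; nonneg.
have mean0 : 0 <= flux_part_mean d al be.
  by rewrite /flux_part_mean; apply: addr_ge0 => //; apply: divr_ge0 => //; exact: sqr_ge0.
have rate0 : 0 <= 2 / (1 - flux_rate d al be) by apply: divr_ge0 => //; rewrite /flux_rate; lra.
have := @weighted_energy R d h J rho j0 rho_ge0 rho_sum al be al_gt0 vl vl_itv m Ga m0 Ga0 Lam Ga_poincare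
  (dual_src m' A B) (dual_src_supp vl zeta A_supp B_supp m') d0
  (XA + XB) kernel_const (src_const d al be ^+ (2 * P.+1) * flux_power_bound) P
  (src_kernel vl m') (fun c e => src_const d al be * flux2 m' c e) (src_kernel_ge0 vl m')
  (fun c e => mulr_ge0 srcK (flux2_ge0 vl zeta m' c e)) kernel_const_ge0 weight0
  (fun S c y _ => dual_src_reset j0 al_gt0 al_be vl_itv zeta d0 A_le B_le m0' S c y)
  (fun y Y M _ => @src_kernel_sum m' y Y M mm') (fun e => src_weight_moment e mm')
  (fun j e c => flux_part rho al be vl zeta s m j e c) (part_const d al be p) (part_ratio d al be p)
  (flux_part_ge0 d3 rho al_gt0 al_be vl zeta s m) part_const_ge0 (flux_part_indep rho al be vl zeta s m)
  (fun j e => flux_part_moment d3 h_gt1 j0 rho_ge0 rho_sum al_gt0 al_be vl_itv zeta_le1 j e m0 (m_large mm) p_large sp)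
  (conj part_ratio_ge0 p_small) (flux2 m) (nshells d h) (flux_part_mean d al be) (2 / (1 - flux_rate d al be))
  mean0 rate0 (fun c e => flux2_decomp d3 rho_ge0 rho_sum al_gt0 al_be vl_itv zeta_le1 s c e m0).
have c0 : 0 < ellmin al by have [/andP[]] := ellmin_itv al_gt0.
have dual0 : 0 <= dual_weight_const.
  have b0 := box_size_ge0 R d 1; have k0 := kernel_const_ge0; have p0 := part_const_ge0.
  by rewrite /dual_weight_const /weighted_const /energy_const /source_const /reset_const /mixed_const; nonneg.
move/le_trans; apply; rewrite -/dual_weight_const /dual_term_const -mulrA; apply: ler_wpM2l => //.
apply: le_trans (lerD (dual_energy_mean mm mm' Ga0 Ga_poincare) (lexx _)) _.
by apply: eq_leW; ring.
Qed.

End HighDimension.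

(** * Variance estimates in the plane *)

Section PlaneVariance.
Variables (R : realFieldType) (h : nat) (J : finType) (rho : J -> R) (j0 : J).
Hypotheses (rho_ge0 : forall j, 0 <= rho j) (rho_sum : \sum_j rho j = 1).
Variables (al be : R) (al_gt0 : 0 < al) (al_be : al <= be).
Variables (vl : J -> R) (vl_itv : forall j, al <= vl j <= be).
Variables (zeta : 'I_2 -> R) (zeta_le1 : forall i, `|zeta i| <= 1).
Local Notation T := (torus 2 h).
Local Notation E := (T * 'I_2)%type.
Local Notation cfg := {ffun E -> J}.
Local Notation Ex := (Ex (E := E) rho).
Local Notation grd := (grd (@tsrc 2 h) (@ttgt 2 h)).
Local Notation phi := (phi vl zeta).
Local Notation flux2 := (flux2 vl zeta).
Local Notation dgreen := (dgreen vl).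
Local Notation dual_src := (dual_src vl zeta).
Local Notation dual_term := (dual_term rho vl zeta).
Local Notation sup_phi := (sup_phi vl zeta).
Implicit Types (c : cfg) (e : E) (x y z : T) (m : R).
Variables (r Ac n N : nat) (mu : R).
Hypotheses (r_half : hole_theta al be ^+ r <= 2^-1) (Ac_ge : feedback_const al be * 512 <= Ac%:R)
  (Ac_be : 4 * be <= Ac%:R) (Ac_gt0 : (0 < Ac)%N).
Hypotheses (nh : (2 ^ n <= (2 * h).+1)%N) (TN : (#|{: T}| <= 2 ^ N)%N) (nN : (n < N)%N).
Hypotheses (mu_gt0 : 0 < mu) (nmu : (4 ^+ n)^-1 <= mu).

Let ExP := Ex_mean E rho_ge0 rho_sum.

Let N_gt0 : (0 < N)%N. Proof. exact: leq_trans nN. Qed.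

Local Notation B := (sup_bound R r Ac N).

Let B_ge1 : 1 <= B. Proof. exact: sup_bound_ge1. Qed.

Definition sup_weight m c : R := 1 + sup_phi m c ^+ 2.

Lemma sup_weight_ge1 m c : 1 <= sup_weight m c.
Proof. by rewrite /sup_weight lerDl sqr_ge0. Qed.

Lemma flux2_le_sup_weight m c e : flux2 m c e <= 8 * sup_weight m c.
Proof.
rewrite /flux2 /flux /corr_flux /grd -/(phi m c).
have := phi_le_sup_phi vl zeta m c (ttgt e); have := phi_le_sup_phi vl zeta m c (tsrc e).
have := zeta_le1 e.2; have M0 := sup_phi_ge0 vl zeta m c.
rewrite !ler_norml /sup_weight => /andP[? ?] /andP[? ?] /andP[? ?].
set w := zeta e.2 + _.
have : `|w| <= 1 + 2 * sup_phi m c by rewrite ler_norml /w; apply/andP; split; lra.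
move: (sup_phi m c) M0 => M M0 wM.
have : w ^+ 2 <= (1 + 2 * M) ^+ 2.
  by rewrite -[w ^+ 2]real_normK ?num_real // ler_pXn2r ?nnegrE //; lra.
by have := sqr_ge0 (1 - 2 * M); nra.
Qed.

Lemma sup_weight_moment m : mu <= m -> Ex (fun c => sup_weight m c ^+ 2) <= 4 * B ^+ 2.
Proof.
move=> mm.
apply: le_trans (_ : Ex (fun c => 2 * 1 + 2 * (sup_phi m c ^+ 2) ^+ 2) <= _).
  apply: (mean_mono ExP) => c; rewrite /sup_weight.
  by apply: le_trans (sqrrD_le _ _) _; rewrite expr1n.
rewrite (meanD ExP) (mean_cst ExP) (meanZ ExP).
have := sup_phi_moment_low j0 rho_ge0 rho_sum al_gt0 al_be vl_itv zeta_le1 r_half Ac_ge Ac_be Ac_gt0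
  (lt_le_trans mu_gt0 mm) nh (le_trans nmu mm) TN nN (isT : (0 < 2)%N) (isT : (2 %| 8)%N).
have : 1 <= B ^+ 2 by rewrite exprn_ege1.
lra.
Qed.

Lemma plane_flux_sqr m e : mu <= m -> Ex (fun c => flux2 m c e ^+ 2) <= 256 * B ^+ 2.
Proof.
move=> mm; apply: le_trans (_ : Ex (fun c => 64 * sup_weight m c ^+ 2) <= _).
  apply: (mean_mono ExP) => c; have := flux2_le_sup_weight m c e; have f0 := flux2_ge0 vl zeta m c e.
  have -> : 64 * sup_weight m c ^+ 2 = (8 * sup_weight m c) ^+ 2 by ring.
  by move=> le8; rewrite ler_pXn2r ?nnegrE //; have := sup_weight_ge1 m c; lra.
by rewrite (meanZ ExP); have := sup_weight_moment mm; lra.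
Qed.

Lemma plane_green_flux m y : mu <= m ->
  Ex (fun c => \sum_e flux2 m c e ^+ 2 * dgreen m c y e) <= 256 * B ^+ 2 * plane_green al n.
Proof.
move=> mm; have m0 := lt_le_trans mu_gt0 mm; have g0 := plane_green_ge0 al_gt0 n.
apply: le_trans (_ : Ex (fun c => plane_green al n * 64 * sup_weight m c ^+ 2) <= _).
  apply: (mean_mono ExP) => c.
  apply: le_trans (_ : \sum_e (8 * sup_weight m c) ^+ 2 * dgreen m c y e <= _).
    apply: ler_sum => e _; apply: ler_wpM2r; first exact: dgreen_ge0.
    have := flux2_le_sup_weight m c e; have f0 := flux2_ge0 vl zeta m c e.
    by move=> le8; rewrite ler_pXn2r ?nnegrE //; have := sup_weight_ge1 m c; lra.
  rewrite -mulr_sumr -[leRHS]mulrA [leRHS]mulrC.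
  have -> : 64 * sup_weight m c ^+ 2 = (8 * sup_weight m c) ^+ 2 by ring.
  apply: ler_wpM2l; first exact: sqr_ge0.
  exact: (sum_dgreen_plane al_gt0 vl_itv c y m0 nh (le_trans nmu mm)).
rewrite (meanZ ExP) [leRHS]mulrC -[leLHS]mulrA; apply: ler_wpM2l => //.
by have := sup_weight_moment mm; lra.
Qed.

Lemma plane_gap m (Lam : {set T}) (D : R) : mu <= m -> #|Lam|%:R <= D \/ mu^-1 <= D ->
  poincare (@tsrc 2 h) (@ttgt 2 h) Lam (6 * n.+1%:R ^+ 2 * D) m.
Proof.
move=> mm LD u; have m0 := lt_le_trans mu_gt0 mm.
have g0 : 0 <= \sum_e grd u e ^+ 2 by nonneg.
have u0 : 0 <= \sum_x u x ^+ 2 by nonneg.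
case: LD => LD; last first.
  apply: le_trans (_ : \sum_x u x ^+ 2 <= _).
    by rewrite [leRHS](bigID (mem Lam)) /= lerDl; nonneg.
  have k1 : 1 <= 6 * n.+1%:R ^+ 2 * D * m.
    have d1 : 1 <= D * m.
      apply: le_trans (_ : mu^-1 * mu <= _); first by rewrite mulVf ?gt_eqF.
      by apply: ler_pM => //; rewrite ?invr_ge0; exact: ltW.
    have n1 : 1 <= n.+1%:R ^+ 2 :> R by rewrite exprn_ege1 // ler1n.
    by rewrite -!mulrA; nra.
  rewrite mulrDr; apply: le_trans (_ : 6 * n.+1%:R ^+ 2 * D * (m * \sum_x u x ^+ 2) <= _).
    by rewrite mulrA; apply: ler_peMl.
  rewrite lerDr; apply: mulr_ge0 => //; apply: mulr_ge0; first by nonneg.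
  by apply: le_trans LD; rewrite invr_ge0 ltW.
apply: le_trans (ler_sum _ (fun x _ => plane_sup u x nh (le_trans nmu mm))) _.
rewrite sumr_const -[leLHS]mulr_natl [6 * _ * D]mulrC -[leRHS]mulrA; apply: ler_wpM2r => //.
by nonneg.
Qed.

Variables (A : T -> R) (Bs : E -> R) (XA XB Ga : R) (Lam : {set T}).
Hypotheses (A_le : forall x, `|A x| <= XA) (B_le : forall e, `|Bs e| <= XB).
Hypotheses (A_supp : forall x, x \notin Lam -> A x = 0)
  (B_supp : forall e, ttgt e \notin Lam -> Bs e = 0).

Lemma plane_dual_src_sqr m c y :
  dual_src m A Bs c y ^+ 2 <= 2 * (1 + 32 * be ^+ 2) * (XA + XB) ^+ 2 * sup_weight m c.
Proof.
apply: le_trans (dual_src_sqr al_gt0 al_be vl_itv zeta (isT : (0 < 2)%N) A_le B_le m c y) _.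
have -> : 2 * (1 + 32 * be ^+ 2) * (XA + XB) ^+ 2 * sup_weight m c =
  2 * (XA + XB) ^+ 2 * (sup_weight m c + be ^+ 2 * (2 * (16 * sup_weight m c))) by ring.
apply: ler_wpM2l; first by nonneg.
apply: lerD.
  have : `|phi m c y| ^+ 2 <= sup_phi m c ^+ 2.
    by rewrite ler_pXn2r ?nnegrE ?phi_le_sup_phi //; exact: sup_phi_ge0.
  by rewrite real_normK ?num_real // /sup_weight; lra.
apply: ler_wpM2l; first exact: sqr_ge0.
apply: ler_wpM2l => //; apply: le_trans (ler_sum _ (fun i _ => flux2_le_sup_weight m c (in_edge y i))) _.
by rewrite sum_cst_ord; lra.
Qed.

Definition plane_dual_const : R := 256 / ellmin al ^+ 2 * (1 + 32 * be ^+ 2).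

Lemma plane_dual_term m m' : mu <= m -> mu <= m' -> 0 < Ga -> poincare (@tsrc 2 h) (@ttgt 2 h) Lam Ga m ->
  dual_term m (dual_src m' A Bs) <= plane_dual_const * B ^+ 2 * (Ga * #|Lam|%:R * (XA + XB) ^+ 2).
Proof.
move=> mm mm' Ga0 Ga_poincare.
have m0 := lt_le_trans mu_gt0 mm.
have c0 : 0 < ellmin al by have [/andP[]] := ellmin_itv al_gt0.
have e0 : 0 <= 4 / ellmin al ^+ 2 * Ga by apply: mulr_ge0; [apply: divr_ge0; nonneg|exact: ltW].
set K := 8 * (4 / ellmin al ^+ 2 * Ga * (#|Lam|%:R * (2 * (1 + 32 * be ^+ 2) * (XA + XB) ^+ 2))).
have K0 : 0 <= K by rewrite /K; nonneg.
apply: le_trans (_ : Ex (fun c => K / 2 * sup_weight m c ^+ 2 + K / 2 * sup_weight m' c ^+ 2) <= _).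
  apply: (mean_mono ExP) => c.
  have sv := dual_solP al_gt0 vl_itv m0 (dual_src m' A Bs) c.
  have energy_le := localized_energy al_gt0 m0 Ga0 Ga_poincare (cfield_elliptic vl_itv c) sv
    (dual_src_supp vl zeta A_supp B_supp m' c).
  set v := dual_sol _ _ _ _ in sv energy_le *.
  have w1 := sup_weight_ge1 m c.
  apply: le_trans (_ : 8 * sup_weight m c * (\sum_e grd v e ^+ 2) <= _).
    by rewrite mulr_sumr; apply: ler_sum => e _; apply: ler_wpM2r; [exact: sqr_ge0|exact: flux2_le_sup_weight].
  apply: le_trans (_ : K * (sup_weight m c * sup_weight m' c) <= _); last first.
    by have := mulr_ge0 K0 (sqr_ge0 (sup_weight m c - sup_weight m' c)); lra.
  have -> : K * (sup_weight m c * sup_weight m' c) = 8 * sup_weight m c * (4 / ellmin al ^+ 2 * Ga *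
     (#|Lam|%:R * (2 * (1 + 32 * be ^+ 2) * (XA + XB) ^+ 2 * sup_weight m' c))) by rewrite /K; ring.
  apply: ler_wpM2l; first by lra.
  apply: le_trans (le_trans _ energy_le) _; first by rewrite lerDl; nonneg.
  apply: ler_wpM2l => //; apply: le_trans (ler_sum _ (fun y _ => plane_dual_src_sqr m' c y)) _.
  by rewrite sumr_const -[leLHS]mulr_natl.
rewrite (meanD ExP) !(meanZ ExP).
apply: le_trans (_ : K / 2 * (4 * B ^+ 2) + K / 2 * (4 * B ^+ 2) <= _).
  by apply: lerD; apply: ler_wpM2l; rewrite ?divr_ge0 //; exact: sup_weight_moment.
by rewrite /K /plane_dual_const; apply: eq_leW; field; rewrite gt_eqF.
Qed.

End PlaneVariance.

(** * Variance estimates with constants depending only on the dimension and the ellipticity *)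

Lemma bernoulli_ineq (R : realFieldType) (t : R) n : 0 <= t -> 1 + n%:R * t <= (1 + t) ^+ n.
Proof.
move=> t0; elim: n => [|n IH]; first by rewrite mul0r addr0 expr0.
rewrite exprS; have t1 : 0 <= 1 + t by lra.
have := ler_wpM2l t1 IH; rewrite -natr1 => step.
by have : 0 <= n%:R * t ^+ 2 by [rewrite mulr_ge0 ?sqr_ge0]; nra.
Qed.

Lemma power_unbounded (R : archiRealFieldType) (g K : R) : 1 < g -> exists n, K <= g ^+ n.
Proof.
move=> g1; have g0 : 0 < g - 1 by lra.
exists (Num.bound (`|K| / (g - 1))); set n := Num.bound _.
have : `|K| / (g - 1) < n%:R by rewrite archi_boundP // divr_ge0 // ltW.
rewrite ltr_pdivrMr // => Kn; have := bernoulli_ineq n (ltW g0); rewrite [1 + (g - 1)]addrC subrK.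
by have := ler_norm K; lra.
Qed.

Lemma power_small (R : archiRealFieldType) (t e : R) : 0 < t < 1 -> 0 < e -> exists n, t ^+ n <= e.
Proof.
move=> /andP[t0 t1] e0.
have [n hn] : exists n, e^-1 <= t^-1 ^+ n by apply: power_unbounded; rewrite invf_gt1.
exists n; rewrite exprVn in hn.
by rewrite -[t ^+ n]invrK -[e]invrK lef_pV2 ?posrE ?invr_gt0 ?exprn_gt0.
Qed.

Lemma plane_size n : [/\ (n < 2 * n + 4)%N, (2 ^ n <= (2 * 2 ^ n).+1)%N &
  (#|{: torus 2 (2 ^ n)}| <= 2 ^ (2 * n + 4))%N].
Proof.
split; [lia|lia|]; rewrite card_ffun !card_ord.
have -> : (2 ^ (2 * n + 4) = (4 * 2 ^ n) ^ 2)%N by rewrite expnMn -expnM mulnC addnC expnD mulnC.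
by rewrite leq_exp2r //; have := expn_gt0 2 n; lia.
Qed.

Lemma plane_mass (R : realFieldType) (mu : R) n : 32 * 2%:R <= mu * 2 ^+ n -> (4 ^+ n)^-1 <= mu.
Proof.
move=> mu_large; have p2 : 1 <= 2 ^+ n :> R by rewrite exprn_ege1 // ler1n.
have p0 : 0 < 2 ^+ n :> R by lra.
have -> : 4 ^+ n = 2 ^+ n * 2 ^+ n :> R by rewrite -exprMn; congr (_ ^+ _); ring.
rewrite invfM; apply: le_trans (_ : (2 ^+ n)^-1 <= _).
  have i0 : 0 <= (2 ^+ n)^-1 :> R by rewrite invr_ge0 ltW.
  by apply: ler_piMr => //; rewrite invf_le1.
by rewrite -div1r ler_pdivrMr //; lra.
Qed.

Lemma expr_16 (R : realFieldType) (x : R) k : x ^+ (16 * k) = ((x ^+ (4 * k)) ^+ 2) ^+ 2.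
Proof. by rewrite -!exprM; congr (_ ^+ _); lia. Qed.

Section VarianceClosure.
Variables (R : realFieldType) (d h : nat) (J : finType) (rho : J -> R) (j0 : J).
Hypotheses (rho_ge0 : forall j, 0 <= rho j) (rho_sum : \sum_j rho j = 1).
Variables (al be : R) (al_gt0 : 0 < al) (al_be : al <= be).
Variables (vl : J -> R) (vl_itv : forall j, al <= vl j <= be) (zeta : 'I_d -> R).
Local Notation T := (torus d h).
Local Notation E := (T * 'I_d)%type.
Local Notation Ex := (Ex (E := E) rho).
Local Notation src := (@tsrc d h).
Local Notation tgt := (@ttgt d h).
Local Notation flux2 := (flux2 vl zeta).
Variables (mu X0 X1 D Ga k1 k2 K S k : R) (chi : T -> R) (Lam : {set T}).
Hypotheses (mu_gt0 : 0 < mu) (D_ge0 : 0 <= D) (Ga_ge0 : 0 <= Ga).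
Hypotheses (K_ge0 : 0 <= K) (S_ge0 : 0 <= S) (k_ge0 : 0 <= k).
Hypotheses (chi_le : forall x, `|chi x| <= X0) (grad_le : forall e, `|grd src tgt chi e| <= X1).
Hypotheses (chi_supp : forall x, x \notin Lam -> chi x = 0)
  (grad_supp : forall e, tgt e \notin Lam -> grd src tgt chi e = 0).
Hypothesis flux_sqr : forall m e, mu <= m -> Ex (fun c => flux2 m c e ^+ 2) <= k1.
Hypothesis green_flux : forall m y, mu <= m -> Ex (fun c => \sum_e flux2 m c e ^+ 2 * dgreen vl m c y e) <= k2.
Hypothesis dual_le : forall (A : T -> R) (B : E -> R) XA XB ma mb, mu <= ma -> mu <= mb ->
  (forall x, `|A x| <= XA) -> (forall e, `|B e| <= XB) ->
  (forall x, x \notin Lam -> A x = 0) -> (forall e, tgt e \notin Lam -> B e = 0) ->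
  dual_term rho vl zeta ma (dual_src vl zeta mb A B) <= S * (D * #|Lam|%:R * (XA + XB) ^+ 2).
Hypotheses (K_ge : d%:R * (k1 + 2 * k2) <= K) (k_ge : Ga * (2 * k2) <= k * D).

Let m_gt0 m : mu <= m -> 0 < m. Proof. exact: lt_le_trans. Qed.

Lemma energy_closure m : mu <= m -> Var rho (avg_energy vl zeta chi m) <=
  var_const al be * ((K + S * 2 + k) * (X0 ^+ 2 * #|Lam|%:R + D * #|Lam|%:R * (m * X0 + X1) ^+ 2)).
Proof.
move=> mm; have m0 := m_gt0 mm.
apply: le_trans (Var_energy j0 rho_ge0 rho_sum al_gt0 al_be vl_itv chi_le chi_supp m0
  (fun e => flux_sqr e mm) (fun y => green_flux y mm)) _.
apply: ler_wpM2l; first exact: var_const_ge0.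
have dual_part : dual_term rho vl zeta m (dual_src vl zeta m (fun x => m * chi x) (grd src tgt chi)) <=
    S * (D * #|Lam|%:R * (m * X0 + X1) ^+ 2).
  apply: dual_le => // x; first by rewrite normrM gtr0_norm // ler_pM2l.
  by move=> /chi_supp ->; rewrite mulr0.
have a0 : 0 <= X0 ^+ 2 * #|Lam|%:R by nonneg.
have local_part : X0 ^+ 2 * (d%:R * #|Lam|%:R * (k1 + 2 * k2)) <= K * (X0 ^+ 2 * #|Lam|%:R).
  by have := ler_wpM2l a0 K_ge; lra.
have b0 : 0 <= D * #|Lam|%:R * (m * X0 + X1) ^+ 2 by nonneg.
have := mulr_ge0 K_ge0 b0; have := mulr_ge0 S_ge0 a0; have := mulr_ge0 S_ge0 b0.
by have := mulr_ge0 k_ge0 a0; have := mulr_ge0 k_ge0 b0; lra.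
Qed.

Hypotheses (gap : forall m, mu <= m -> poincare src tgt Lam Ga m).

Lemma product_closure m1 m2 : mu <= m1 -> mu <= m2 -> Var rho (avg_product vl zeta chi m1 m2) <=
  var_const al be * ((K + S * 2 + k) * (D * #|Lam|%:R * X0 ^+ 2)).
Proof.
move=> mm1 mm2.
apply: le_trans (Var_product j0 rho_ge0 rho_sum al_gt0 al_be vl_itv chi_le chi_supp (m_gt0 mm1) (m_gt0 mm2)
  Ga_ge0 (gap mm1) (gap mm2) (fun y => green_flux y mm1) (fun y => green_flux y mm2)) _.
apply: ler_wpM2l; first exact: var_const_ge0.
have dual_part ma mb : mu <= ma -> mu <= mb ->
    dual_term rho vl zeta ma (dual_src vl zeta mb chi (fun=> 0)) <= S * (D * #|Lam|%:R * X0 ^+ 2).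
  move=> mma mmb; rewrite -[X0]addr0; apply: dual_le => // e.
  by rewrite normr0.
have gap_part : X0 ^+ 2 * Ga * (2 * (#|Lam|%:R * k2)) <= k * (D * #|Lam|%:R * X0 ^+ 2).
  have c0 : 0 <= X0 ^+ 2 * #|Lam|%:R by nonneg.
  by have := ler_wpM2l c0 k_ge; lra.
have b0 : 0 <= D * #|Lam|%:R * X0 ^+ 2 by nonneg.
have := mulr_ge0 K_ge0 b0; have := dual_part _ _ mm1 mm2; have := dual_part _ _ mm2 mm1.
lra.
Qed.

End VarianceClosure.

Section FiniteVariance.
Variables (R : archiRealFieldType) (al be : R) (al_gt0 : 0 < al) (al_be : al <= be).

(* [G n] is the loss on a torus of side [2 * 2 ^ n + 1], logarithmic in the side when
   [d = 2]; [D] is the constant of the Poincare or Hardy inequality on the support [Lam]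
   of the weight. *)
Definition torus_variance (d : nat) (C : R) (G : nat -> R) := forall (n : nat) (J : finType) (rho : J -> R) (j0 : J)
  (vl : J -> R) (zeta : 'I_d -> R) (mu m m1 m2 X0 X1 D : R) (chi : torus d (2 ^ n) -> R) (Lam : {set torus d (2 ^ n)}),
  (forall j, 0 <= rho j) -> \sum_j rho j = 1 -> (forall j, al <= vl j <= be) ->
  (forall i, `|zeta i| <= 1) -> 0 < mu -> (0 < n)%N -> 32 * d%:R <= mu * 2 ^+ n ->
  mu <= m -> mu <= m1 -> mu <= m2 ->
  (forall x, `|chi x| <= X0) -> (forall e, `|grd (@tsrc d (2 ^ n)) (@ttgt d (2 ^ n)) chi e| <= X1) ->
  (forall x, x \notin Lam -> chi x = 0) ->
  (forall e, ttgt e \notin Lam -> grd (@tsrc d (2 ^ n)) (@ttgt d (2 ^ n)) chi e = 0) ->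
  1 <= D -> ((2 < d)%N -> forall x, x \in Lam -> sqnorm R x <= D) -> (d = 2%N -> #|Lam|%:R <= D \/ mu^-1 <= D) ->
  Var rho (avg_energy vl zeta chi m) <=
    C * G n * (X0 ^+ 2 * #|Lam|%:R + D * #|Lam|%:R * (m * X0 + X1) ^+ 2) /\
  Var rho (avg_product vl zeta chi m1 m2) <= C * G n * (D * #|Lam|%:R * X0 ^+ 2).

Section HighDimensionBound.
Variable d : nat.
Hypothesis d3 : (3 <= d)%N.

Lemma decoupling_parameters : exists P s p, [/\ 2 * 64 ^+ d <= growth_rate d al be ^+ P,
  (s.+1 * (2 * P.+1))%N = p.+1 & part_ratio d al be p * scale_decay R d P ^+ 2 <= 1].
Proof.
have [P P_large] := power_unbounded (2 * 64 ^+ d) (growth_rate_gt1 d3 al_gt0 al_be).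
have /andP[tau0 tau1] := decay_rate_itv d3 al_gt0 al_be.
have rate0 : 0 < flux_rate d al be by rewrite /flux_rate; lra.
pose t := decay_rate d al be / flux_rate d al be ^+ 2.
have t01 : 0 < t < 1.
  rewrite /t divr_gt0 ?exprn_gt0 //= ltr_pdivrMr ?exprn_gt0 // mul1r /flux_rate.
  by have : 0 < (1 - decay_rate d al be) ^+ 2 by [rewrite exprn_gt0 // subr_gt0]; lra.
have w0 : 0 < scale_decay R d P ^+ 2 by rewrite /scale_decay /scale_growth !(exprn_gt0, mulr_gt0).
have [s hs] := power_small t01 (divr_gt0 tau0 w0).
pose p := (s.+1 * (2 * P.+1)).-1.
have sp : (s.+1 * (2 * P.+1) = p.+1)%N by rewrite /p prednK // !muln_gt0.
exists P, s, p; split=> //.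
have : t ^+ p.+1 <= decay_rate d al be / scale_decay R d P ^+ 2.
  apply: le_trans hs; case/andP: t01 => t0 t1.
  apply: ler_wiXn2l; rewrite ?ltW // -sp.
  by apply: leq_trans (leqnSn s) _; rewrite leq_pmulr.
rewrite ler_pdivlMr // /part_ratio -/t => t_small.
by rewrite mulrAC ler_pdivrMr // mul1r.
Qed.

Definition high_gap_const : R := 96 * d%:R * 17.

Lemma high_gap h (mu m D : R) (Lam : {set torus d h}) : (1 < h)%N -> 0 < mu ->
  32 * d%:R <= mu * h%:R -> mu <= m -> 1 <= D ->
  (forall x, x \in Lam -> sqnorm R x <= D) -> poincare (@tsrc d h) (@ttgt d h) Lam (high_gap_const * D) m.
Proof.
move=> h1 mu0 mu_large mm D1 LD u.
have D0 : 0 <= D + 16 by rewrite addr_ge0 // (le_trans ler01).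
have nz x : 0 < sqnorm R x + 16 by have := sqnorm_ge0 R x; lra.
apply: le_trans (_ : (D + 16) * \sum_x u x ^+ 2 * hweight R (x - 0) <= _).
  rewrite mulr_sumr [leLHS]big_mkcond; apply: ler_sum => x _.
  have weight0 : 0 <= hweight R (x - 0) by rewrite subr0 /hweight invr_ge0 ltW.
  case: ifPn => [xL|_]; last by apply: mulr_ge0 => //; apply: mulr_ge0 => //; exact: sqr_ge0.
  rewrite subr0 mulrCA; apply: ler_peMr; first exact: sqr_ge0.
  by rewrite /hweight ler_pdivlMr // mul1r lerD2r LD.
apply: le_trans (ler_wpM2l D0 (hardy_center d3 h1 0 u)) _.
have grad0 : 0 <= \sum_e grd (@tsrc d h) (@ttgt d h) u e ^+ 2 by nonneg.
have mass0 : 0 <= \sum_x u x ^+ 2 by nonneg.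
have d1 : 1 <= d%:R :> R by rewrite ler1n (leq_trans _ d3).
have scale : 32 * d%:R / h%:R <= 96 * d%:R * m.
  rewrite ler_pdivrMr ?ltr0n ?(ltn_trans _ h1) //; apply: le_trans mu_large _.
  by apply: ler_wpM2r => //; nra.
have DG : D + 16 <= 17 * D by lra.
have := ler_wpM2r mass0 scale => mass_le.
apply: le_trans (_ : (D + 16) * (96 * d%:R * (\sum_e grd (@tsrc d h) (@ttgt d h) u e ^+ 2 + m * \sum_x u x ^+ 2)) <= _).
  by apply: ler_wpM2l => //; lra.
have Q0 : 0 <= 96 * d%:R * (\sum_e grd (@tsrc d h) (@ttgt d h) u e ^+ 2 + m * \sum_x u x ^+ 2).
  by have m0 := le_trans (ltW mu0) mm; nonneg.
by apply: le_trans (ler_wpM2r Q0 DG) _; apply: eq_leW; rewrite /high_gap_const; ring.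
Qed.

Lemma torus_variance_high : exists2 C, 0 <= C & torus_variance d C (fun=> 1).
Proof.
have [P [s [p [P_large sp p_small]]]] := decoupling_parameters.
pose k1 : R := 1 + flux_power_bound d al be P; pose k2 := green_flux_bound d al be P.
have k1_ge0 : 0 <= k1 by rewrite addr_ge0 ?flux_power_bound_ge0.
have k2_ge0 : 0 <= k2.
  by rewrite addr_ge0 // mulr_ge0 ?flux_power_bound_ge0 // green_sum_const_ge0.
pose K := d%:R * (k1 + 2 * k2); pose S := `|dual_term_const d al be P p| * high_gap_const.
pose k := high_gap_const * (2 * k2).
have gap0 : 0 < high_gap_const by rewrite /high_gap_const !mulr_gt0 ?ltr0n // (ltn_trans _ d3).
have [K0 S0 k0] : [/\ 0 <= K, 0 <= S & 0 <= k].
  have k22 := mulr_ge0 (ler0n R 2) k2_ge0; have gap0' := ltW gap0.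
  by split; apply: mulr_ge0; rewrite // addr_ge0.
exists (var_const al be * (K + S * 2 + k)); first by have v0 := var_const_ge0 al_gt0 al_be; nonneg.
move=> n J rho j0 vl zeta mu m m1 m2 X0 X1 D chi Lam rho0 rho1 vlI z1 mu0 n0 mu_large mm mm1 mm2 cX cX1 cs gs D1 LD _.
have h1 : (1 < 2 ^ n)%N by rewrite -[1%N](expn0 2) ltn_exp2l.
rewrite -natrX in mu_large; have D0 := lt_le_trans ltr01 D1.
have gap m' mm' := high_gap (m := m') h1 mu0 mu_large mm' D1 (LD d3).
have flux_le m' e mm' : _ <= k1 :=
  @flux2_sqr_mean R d (2 ^ n) d3 h1 J rho j0 rho0 rho1 al be al_gt0 al_be vl vlI zeta z1 P P_large mu mu0 mu_large m' e mm'.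
have green_le m' y mm' : _ <= k2 :=
  @green_flux R d (2 ^ n) d3 h1 J rho j0 rho0 rho1 al be al_gt0 al_be vl vlI zeta z1 P P_large mu mu0 mu_large m' y mm'.
have dual_le A B XA XB ma mb : mu <= ma -> mu <= mb -> (forall x, `|A x| <= XA) -> (forall e, `|B e| <= XB) ->
    (forall x, x \notin Lam -> A x = 0) -> (forall e, ttgt e \notin Lam -> B e = 0) ->
    dual_term rho vl zeta ma (dual_src vl zeta mb A B) <= S * (D * #|Lam|%:R * (XA + XB) ^+ 2).
  move=> mma mmb hA hB sA sB.
  apply: le_trans (dual_term_le d3 h1 j0 rho0 rho1 al_gt0 al_be vlI z1 P_large sp p_small mu0 mu_large hA hB sA sB mma mmb
    (mulr_gt0 gap0 D0) (gap _ mma)) _.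
  have w0 : 0 <= high_gap_const * D * #|Lam|%:R * (XA + XB) ^+ 2 by nonneg.
  by apply: le_trans (ler_wpM2r w0 (ler_norm _)) _; apply: eq_leW; rewrite /S; ring.
have k_le : high_gap_const * D * (2 * k2) <= k * D by rewrite /k mulrAC.
have GD0 : 0 <= high_gap_const * D by rewrite mulr_ge0 ?ltW.
rewrite mulr1 -!(mulrA (var_const al be)); split.
  exact: (energy_closure j0 rho0 rho1 al_gt0 al_be vlI mu0 (ltW D0) K0 S0 k0 cX cX1 cs gs flux_le green_le dual_le (lexx _)).
exact: (product_closure j0 rho0 rho1 al_gt0 al_be vlI mu0 (ltW D0) GD0 K0 cX cs green_le dual_le k_le gap).
Qed.

End HighDimensionBound.

Section PlaneBound.
Variables r Ac : nat.
Hypotheses (r_half : hole_theta al be ^+ r <= 2^-1) (Ac_ge : feedback_const al be * 512 <= Ac%:R)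
  (Ac_be : 4 * be <= Ac%:R) (Ac_gt0 : (0 < Ac)%N).
Local Notation k := (8 * r + 2)%N.

Definition plane_sup_const : R := (4 * ((2 * Ac)%:R ^+ k) ^+ 2) ^+ 2.

Definition plane_green_const : R := 6 * coercivity al / al.

Definition plane_var_const : R := var_const al be * (plane_sup_const * (2 * (256 + 2 * (256 * plane_green_const)) +
  plane_dual_const al be * 6 * 2 + 12 * (256 * plane_green_const))).

Lemma plane_green_const_ge0 : 0 <= plane_green_const.
Proof.
rewrite /plane_green_const /coercivity; apply: divr_ge0; last exact: ltW.
by apply: mulr_ge0 => //; apply: addr_ge0; rewrite // invr_ge0 ltW.
Qed.

Lemma plane_dual_const_ge0 : 0 <= plane_dual_const al be.
Proof.
have c0 : 0 < ellmin al by have [/andP[]] := ellmin_itv al_gt0.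
by rewrite /plane_dual_const; apply: mulr_ge0; [apply: divr_ge0; nonneg|nonneg].
Qed.

Lemma plane_var_const_ge0 : 0 <= plane_var_const.
Proof.
have g0 := plane_green_const_ge0; have d0 := plane_dual_const_ge0; have v0 := var_const_ge0 al_gt0 al_be.
by rewrite /plane_var_const /plane_sup_const; nonneg.
Qed.

Local Notation bound n := (sup_bound R r Ac (2 * n + 4)).

Definition plane_loss n : R := bound n ^+ 2 * (2 * n + 4)%:R ^+ 4.

Lemma plane_lossE n : plane_loss n = plane_sup_const * (2 * n + 4)%:R ^+ (16 * k + 4).
Proof.
rewrite /plane_loss /sup_bound mulnA natrM natrX (exprD _ (16 * k)) /plane_sup_const.
move: ((2 * n + 4)%:R : R) => N.
rewrite [((2 * Ac)%:R * _) ^+ k]exprMn -[(N ^+ 4) ^+ k]exprM expr_16.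
by move: ((2 * Ac)%:R ^+ k) (N ^+ (4 * k)) => u w; ring.
Qed.

Lemma bound_le_loss n : [/\ bound n ^+ 2 <= plane_loss n, bound n ^+ 2 * n.+1%:R ^+ 2 <= plane_loss n &
  bound n ^+ 2 * n.+1%:R ^+ 2 * n.+1%:R ^+ 2 <= plane_loss n].
Proof.
have n1 : 1 <= n.+1%:R ^+ 2 :> R by rewrite exprn_ege1 // ler1n.
have nn : n.+1%:R ^+ 2 <= (2 * n + 4)%:R ^+ 2 :> R by rewrite ler_pXn2r ?nnegrE // ler_nat; lia.
have last_le : bound n ^+ 2 * n.+1%:R ^+ 2 * n.+1%:R ^+ 2 <= plane_loss n.
  rewrite /plane_loss (exprD _ 2 2) -mulrA; apply: ler_wpM2l; first exact: sqr_ge0.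
  by apply: ler_pM; rewrite ?sqr_ge0.
have b0 := sqr_ge0 (bound n).
have bn0 : 0 <= bound n ^+ 2 * n.+1%:R ^+ 2 by nonneg.
split=> //; apply: le_trans last_le; last by rewrite ler_peMr.
by rewrite -[leRHS]mulrA; apply: ler_peMr => //; exact: mulr_ege1.
Qed.

Lemma torus_variance_plane_at : torus_variance 2 plane_var_const (fun n => (2 * n + 4)%:R ^+ (16 * k + 4)).
Proof.
move=> n J rho j0 vl zeta mu m m1 m2 X0 X1 D chi Lam rho0 rho1 vlI z1 mu0 n0 mu_large mm mm1 mm2 cX cX1 cs gs D1 _ LD.
have {}LD := LD erefl; have D0 := lt_le_trans ltr01 D1.
have [nN nh TN] := plane_size n; have nmu : (4 ^+ n)^-1 <= mu by exact: plane_mass.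
have [bF bnF bnnF] := bound_le_loss n.
have F0 : 0 <= plane_loss n by exact: le_trans (sqr_ge0 _) bF.
have g0 := plane_green_const_ge0; have d0 := plane_dual_const_ge0.
pose k1 := 256 * bound n ^+ 2; pose k2 := k1 * plane_green al n.
have k2E : k2 = 256 * plane_green_const * (bound n ^+ 2 * n.+1%:R ^+ 2).
  by rewrite /k2 /k1 /plane_green /plane_green_const; ring.
have gap m' mm' : poincare _ _ Lam (6 * n.+1%:R ^+ 2 * D) m' := plane_gap (h := 2 ^ n) nh mu0 nmu mm' LD.
have flux_le m' e mm' : _ <= k1 := plane_flux_sqr j0 rho0 rho1 al_gt0 al_be vlI z1 r_half Ac_ge Ac_be Ac_gt0 nh TN nN
  mu0 nmu (m := m') e mm'.
have green_le m' y mm' : _ <= k2 := plane_green_flux j0 rho0 rho1 al_gt0 al_be vlI z1 r_half Ac_ge Ac_be Ac_gt0 nh TN nN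
  mu0 nmu (m := m') y mm'.
pose K := plane_loss n * (2 * (256 + 2 * (256 * plane_green_const))).
pose S := plane_loss n * (plane_dual_const al be * 6); pose kk := plane_loss n * (12 * (256 * plane_green_const)).
have [K0 S0 kk0] : [/\ 0 <= K, 0 <= S & 0 <= kk] by split; rewrite /K /S /kk; nonneg.
have Ga0 : 0 < 6 * n.+1%:R ^+ 2 * D by rewrite !mulr_gt0 ?exprn_gt0.
have dual_le A B XA XB ma mb : mu <= ma -> mu <= mb -> (forall x, `|A x| <= XA) -> (forall e, `|B e| <= XB) ->
    (forall x, x \notin Lam -> A x = 0) -> (forall e, ttgt e \notin Lam -> B e = 0) ->
    dual_term rho vl zeta ma (dual_src vl zeta mb A B) <= S * (D * #|Lam|%:R * (XA + XB) ^+ 2).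
  move=> mma mmb hA hB sA sB.
  apply: le_trans (plane_dual_term j0 rho0 rho1 al_gt0 al_be vlI z1 r_half Ac_ge Ac_be Ac_gt0 nh TN nN mu0 nmu
    hA hB sA sB mma mmb Ga0 (gap _ mma)) _.
  have w0 : 0 <= plane_dual_const al be * 6 * (D * #|Lam|%:R * (XA + XB) ^+ 2) by nonneg.
  by have := ler_wpM2l w0 bnF; rewrite /S; lra.
have K_le : 2%:R * (k1 + 2 * k2) <= K.
  by have := ler_wpM2l (mulr_ge0 (ler0n R 256) g0) bnF; rewrite k2E /k1 /K; lra.
have k_le : 6 * n.+1%:R ^+ 2 * D * (2 * k2) <= kk * D.
  have w0 : 0 <= 12 * D * (256 * plane_green_const) by nonneg.
  by have := ler_wpM2l w0 bnnF; rewrite k2E /kk; lra.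
have constE X : plane_var_const * (2 * n + 4)%:R ^+ (16 * k + 4) * X = var_const al be * ((K + S * 2 + kk) * X).
  by rewrite /K /S /kk plane_lossE /plane_var_const; ring.
rewrite !constE; split.
  exact: (energy_closure j0 rho0 rho1 al_gt0 al_be vlI mu0 (ltW D0) K0 S0 kk0 cX cX1 cs gs flux_le green_le dual_le K_le).
exact: (product_closure j0 rho0 rho1 al_gt0 al_be vlI mu0 (ltW D0) (ltW Ga0) K0 cX cs green_le dual_le k_le gap).
Qed.

End PlaneBound.

Lemma plane_parameters : exists r Ac, [/\ hole_theta al be ^+ r <= 2^-1, feedback_const al be * 512 <= Ac%:R,
  4 * be <= Ac%:R & (0 < Ac)%N].
Proof.
have [r hr] : exists r, hole_theta al be ^+ r <= 2^-1.
  by apply: power_small; [exact: hole_theta_itv|rewrite invr_gt0].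
have b0 : 0 < 4 * be by rewrite mulr_gt0 // (lt_le_trans al_gt0).
have f0 : 0 <= feedback_const al be * 512 by rewrite mulr_ge0 // feedback_const_ge0.
have bound := archi_boundP (addr_ge0 f0 (ltW b0)); set n := Num.bound _ in bound.
have bound1 : n%:R <= n.+1%:R :> R by rewrite ler_nat.
by exists r, n.+1; split=> //; lra.
Qed.

Lemma torus_variance_plane : exists q : nat, exists2 C, 0 <= C & torus_variance 2 C (fun n => (2 * n + 4)%:R ^+ q).
Proof.
have [r [Ac [r_half Ac_ge Ac_be Ac_gt0]]] := plane_parameters.
exists (16 * (8 * r + 2) + 4)%N, (plane_var_const r Ac); first exact: plane_var_const_ge0.
exact: torus_variance_plane_at.
Qed.

End FiniteVariance.

Require Import Defs.
From mathcomp Require Import all_classical all_reals all_analysis.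
From mathcomp Require Import measurable_realfun.

(** * The extrapolation coefficients are summable uniformly in [k] *)

#[local] Arguments coef_c : simpl never.

#[local] Arguments coef_a : simpl never.

#[local] Arguments coef_eta : simpl never.

#[local] Arguments coef_nu : simpl never.

Section Coefficients.
Variable R : realType.
Implicit Types (k i j : nat).

Definition coef_a_sum k : R := \sum_(i < k) `|coef_a R k i|.

Definition coef_sum k : R := \sum_(0 <= i < k) `|coef_eta R k i| +
  \sum_(0 <= i < k) \sum_(i.+1 <= j < k) `|coef_nu R k i j|.

Lemma coef_cE k : (0 < k)%N -> coef_c R k = (2 ^+ k - 1)^-1.
Proof.
case: k => // k _; elim: k => [|k IH]; first by rewrite expr1 (_ : 2 - 1 = 1) ?invr1 //; ring.
have -> : coef_c R k.+2 = (2 / coef_c R k.+1 + 1)^-1 by [].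
rewrite IH invrK; congr (_^-1); rewrite [2 ^+ k.+2]exprS; ring.
Qed.

Lemma coef_c_ge0 k : 0 <= coef_c R k.
Proof.
case: k => [|k] //; rewrite coef_cE // invr_ge0 subr_ge0 exprn_ege1 //; lra.
Qed.

Lemma coef_a_out k : (0 < k)%N -> coef_a R k k = 0.
Proof. by case: k => // -[|k] _ //; rewrite /coef_a -/(coef_a R) /=; rewrite ltnNge leqnSn /= (gtn_eqF (ltnSn _)). Qed.

Lemma pow2_sub k : (2 : R) ^ (1 - k.+1%:Z) = 2 ^- k.
Proof.
have -> : 1 - k.+1%:Z = - k%:Z by rewrite -addn1 PoszD; ring.
by rewrite -exprnN.
Qed.

Lemma coef_a_step k i : (i <= k.+1)%N -> `|coef_a R k.+2 i| <=
  coef_c R k.+1 * `|coef_a R k.+1 i| +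
  (if i is i'.+1 then 2 ^- k * coef_c R k.+1 * `|coef_a R k.+1 i'| else 0).
Proof.
move=> ik; have c0 := coef_c_ge0 k.+1.
have p0 : 0 <= 2 ^- k :> R by rewrite invr_ge0 exprn_ge0.
have -> : coef_a R k.+2 i = if i == 0%N then coef_c R k.+1 * coef_a R k.+1 0
    else if (i < k.+1)%N then
      coef_c R k.+1 * coef_a R k.+1 i
      - 2 ^ (1 - k.+1%:Z) * coef_c R k.+1 * coef_a R k.+1 i.-1
    else if i == k.+1 then
      - (2 ^ (1 - k.+1%:Z) * coef_c R k.+1 * coef_a R k.+1 k)
    else 0 by [].
rewrite pow2_sub; case: i ik => [|i] ik /=; first by rewrite addr0 normrM ger0_norm.
have t : `|2 ^- k * coef_c R k.+1 * coef_a R k.+1 i| = 2 ^- k * coef_c R k.+1 * `|coef_a R k.+1 i|.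
  by rewrite !normrM (ger0_norm p0) (ger0_norm c0).
have [ik'|ki] := ltnP i.+1 k.+1.
  by apply: le_trans (ler_normB _ _) _; rewrite t normrM (ger0_norm c0).
have ek : i = k by apply/eqP; rewrite eqn_leq -ltnS ik -ltnS ki.
rewrite ek eqxx normrN; rewrite ek in t; rewrite t lerDr; exact: mulr_ge0.
Qed.

Lemma coef_a_sum_step k : coef_a_sum k.+2 <= coef_c R k.+1 * (1 + 2 ^- k) * coef_a_sum k.+1.
Proof.
rewrite /coef_a_sum; apply: le_trans (ler_sum _ (fun (i : 'I_k.+2) _ => coef_a_step (ltn_ord i : (i <= k.+1)%N))) _.
rewrite big_split /= big_ord_recr /= coef_a_out // normr0 mulr0 addr0 -mulr_sumr.
rewrite [X in _ + X]big_ord_recl /= add0r -mulr_sumr -/(coef_a_sum k.+1).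
by rewrite mulrDr mulr1 mulrDl [coef_c R _ * 2 ^- k]mulrC.
Qed.

Lemma coef_a_sum_ge0 k : 0 <= coef_a_sum k. Proof. by apply: sumr_ge0. Qed.

Definition coef_potential k : R := 2 ^+ (k.+1 ^ 2) * coef_a_sum k.+2 ^+ 2.

Lemma coef_potential_step k : (3 <= k)%N -> coef_potential k.+1 <= 3 / 4 * coef_potential k.
Proof.
move=> k3; have s0 := coef_a_sum_ge0 k.+3; have s1 := coef_a_sum_ge0 k.+2.
set y : R := 2 ^+ k.+2.
have y16 : 16 <= y.
  have -> : (16 : R) = 2 ^+ 4 by ring.
  by rewrite /y ler_weXn2l ?ler1n // !ltnS ltnW.
have h1 : coef_a_sum k.+3 <= 6 / 5 / y * coef_a_sum k.+2.
  apply: le_trans (coef_a_sum_step k.+1) _; apply: ler_wpM2r => //.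
  rewrite coef_cE // -/y.
  have -> : 2 ^- k.+1 = 2 / y :> R by rewrite /y [2 ^+ k.+2]exprS; field; rewrite expf_neq0.
  rewrite mulrC ler_pdivrMr ?subr_gt0; last by lra.
  have -> : 6 / 5 / y * (y - 1) = 6 / 5 - 6 / 5 / y by field; lra.
  have yi : y^-1 <= 16^-1 by rewrite lef_pV2 ?posrE; lra.
  lra.
have h2 : coef_a_sum k.+3 ^+ 2 <= (6 / 5 / y) ^+ 2 * coef_a_sum k.+2 ^+ 2.
  rewrite -exprMn ler_pXn2r ?nnegrE //; apply: mulr_ge0 => //.
  by rewrite !divr_ge0 //; lra.
rewrite /coef_potential.
have e : (k.+2 ^ 2 = k.+1 ^ 2 + (2 * k.+1).+1)%N by rewrite -!mulnn; lia.
rewrite e exprD -mulrA [leRHS]mulrCA; apply: ler_wpM2l; first by rewrite exprn_ge0.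
have -> : 2 ^+ (2 * k.+1).+1 = y ^+ 2 / 2 :> R.
  by rewrite /y [2 ^+ k.+2]exprS exprS mulnC exprM; move: (2 ^+ k.+1 : R) => w; field.
apply: le_trans (ler_wpM2l _ h2) _; first by rewrite divr_ge0 // sqr_ge0.
have -> : y ^+ 2 / 2 * ((6 / 5 / y) ^+ 2 * coef_a_sum k.+2 ^+ 2) = 18 / 25 * coef_a_sum k.+2 ^+ 2 by field; lra.
by have := sqr_ge0 (coef_a_sum k.+2); lra.
Qed.

Lemma coef_eta_step k i : (i <= k.+1)%N -> `|coef_eta R k.+2 i| <=
  (if (i < k.+1)%N then `|coef_eta R k.+1 i| else 0) + 4 * 2 ^+ (k.+1 ^ 2) * `|coef_a R k.+2 i| ^+ 2.
Proof.
move=> ik; set z := 2 ^+ (k.+1 ^ 2) : R.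
have z0 : 0 <= z by rewrite exprn_ge0.
have -> : coef_eta R k.+2 i = if (i < k.+1)%N then coef_eta R k.+1 i
      + (2 ^+ (k.+1 * (k.+1 - 1) + i) - 2 ^+ (k.+1 ^ 2 + 1)) * coef_a R k.+2 i ^+ 2
    else if i == k.+1 then - (2 ^+ (k.+1 ^ 2) * coef_a R k.+2 k.+1 ^+ 2) else 0 by [].
rewrite real_normK ?num_real //.
have a0 := sqr_ge0 (coef_a R k.+2 i); have za := mulr_ge0 z0 a0.
case: ifP => ik'.
  apply: le_trans (ler_normD _ _) _; rewrite lerD2l normrM (ger0_norm a0).
  apply: ler_wpM2r => //.
  have h1 : 2 ^+ (k.+1 * (k.+1 - 1) + i) <= z.
    by rewrite /z ler_weXn2l ?ler1n // -mulnn; lia.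
  have h2 : 0 <= 2 ^+ (k.+1 * (k.+1 - 1) + i) :> R by rewrite exprn_ge0.
  rewrite [2 ^+ (_ + 1)]exprD expr1 -/z ler_norml; apply/andP; split; lra.
have [/eqP ->|_] := ifPn; last by rewrite normr0; lra.
rewrite normrN ger0_norm -/z; first by have := mulr_ge0 z0 (sqr_ge0 (coef_a R k.+2 k.+1)); lra.
by apply: mulr_ge0 => //; exact: sqr_ge0.
Qed.

Lemma coef_nu_step k i j : (i < j)%N -> (j <= k.+1)%N -> `|coef_nu R k.+2 i j| <=
  (if (j < k.+1)%N then `|coef_nu R k.+1 i j| else 0) +
  4 * 2 ^+ (k.+1 ^ 2) * (`|coef_a R k.+2 i| * `|coef_a R k.+2 j|).
Proof.
move=> ij jk; set z := 2 ^+ (k.+1 ^ 2) : R.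
have z0 : 0 <= z by rewrite exprn_ge0.
have -> : coef_nu R k.+2 i j = if (i < j < k.+1)%N then coef_nu R k.+1 i j
      + (2 ^+ (k.+1 * (k.+1 - 1)) * (2 ^+ i + 2 ^+ j) - 2 ^+ (k.+1 ^ 2 + 2))
        * coef_a R k.+2 i * coef_a R k.+2 j
    else if (i < k.+1)%N && (j == k.+1) then
      (2 ^+ (k.+1 * (k.+1 - 1) + i) - 3 * 2 ^+ (k.+1 ^ 2)) * coef_a R k.+2 i * coef_a R k.+2 k.+1
    else 0 by [].
rewrite ij /=.
have pw l : (l < k.+1)%N -> 0 <= (2 : R) ^+ (k.+1 * (k.+1 - 1)) * 2 ^+ l <= z / 2.
  move=> lk; rewrite -exprD exprn_ge0 //= ler_pdivlMr // -exprSr /z ler_weXn2l ?ler1n // -mulnn; lia.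
case: ifP => jk'.
  apply: le_trans (ler_normD _ _) _; rewrite lerD2l -mulrA normrM normrM.
  apply: ler_wpM2r; first exact: mulr_ge0.
  have /andP[? ?] := pw i (ltn_trans ij jk'); have /andP[? ?] := pw j jk'.
  rewrite mulrDr [2 ^+ (_ + 2)]exprD -/z ler_norml (_ : 2 ^+ 2 = 4 :> R); last by ring.
  by apply/andP; split; lra.
have ej : j = k.+1 by apply/eqP; rewrite eqn_leq jk leqNgt jk'.
rewrite ej eqxx andbT; have ik : (i < k.+1)%N by rewrite -ej.
rewrite ik add0r -mulrA normrM normrM; apply: ler_wpM2r; first exact: mulr_ge0.
have /andP[? ?] := pw i ik.
rewrite [2 ^+ (_ + i)]exprD -/z ler_norml; apply/andP; split; lra.
Qed.

Lemma coef_sum_step k : coef_sum k.+2 <= coef_sum k.+1 + 4 * coef_potential k.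
Proof.
set z := 4 * 2 ^+ (k.+1 ^ 2) : R.
have z0 : 0 <= z by rewrite /z mulr_ge0 // exprn_ge0.
pose a i := `|coef_a R k.+2 i|.
have a0 i : 0 <= a i by exact: normr_ge0.
have eta_part : \sum_(0 <= i < k.+2) `|coef_eta R k.+2 i| <=
   \sum_(0 <= i < k.+1) `|coef_eta R k.+1 i| + z * \sum_(0 <= i < k.+2) a i ^+ 2.
  apply: le_trans (_ : \sum_(0 <= i < k.+2) ((if (i < k.+1)%N then `|coef_eta R k.+1 i| else 0) + z * a i ^+ 2) <= _).
    rewrite big_nat_cond [leRHS]big_nat_cond; apply: ler_sum => i; rewrite andbT => /andP[_ ik].
    exact: coef_eta_step.
  rewrite big_split /= -mulr_sumr lerD2r big_nat_recr //= ltnn addr0.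
  rewrite big_nat_cond [leRHS]big_nat_cond; apply: ler_sum => i; rewrite andbT => /andP[_ ->].
  by [].
have nu_part : \sum_(0 <= i < k.+2) \sum_(i.+1 <= j < k.+2) `|coef_nu R k.+2 i j| <=
   \sum_(0 <= i < k.+1) \sum_(i.+1 <= j < k.+1) `|coef_nu R k.+1 i j| +
   z * \sum_(0 <= i < k.+2) \sum_(i.+1 <= j < k.+2) a i * a j.
  have outer_recr (F : nat -> nat -> R) : \sum_(0 <= i < k.+2) \sum_(i.+1 <= j < k.+2) F i j =
      \sum_(0 <= i < k.+1) \sum_(i.+1 <= j < k.+2) F i j.
    by rewrite big_nat_recr //= [X in _ + X]big_geq ?addr0.
  rewrite !outer_recr mulr_sumr -big_split /= big_nat_cond [leRHS]big_nat_cond.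
  apply: ler_sum => i; rewrite andbT => /andP[_ ik].
  apply: le_trans (_ : \sum_(i.+1 <= j < k.+2) ((if (j < k.+1)%N then `|coef_nu R k.+1 i j| else 0) + z * (a i * a j)) <= _).
    rewrite big_nat_cond [leRHS]big_nat_cond; apply: ler_sum => j; rewrite andbT => /andP[ij jk].
    exact: coef_nu_step.
  rewrite big_split /= -mulr_sumr lerD2r big_nat_recr //= ltnn addr0.
  rewrite big_nat_cond [leRHS]big_nat_cond; apply: ler_sum => j; rewrite andbT => /andP[_ ->].
  by [].
have sqr_part : \sum_(0 <= i < k.+2) a i ^+ 2 + \sum_(0 <= i < k.+2) \sum_(i.+1 <= j < k.+2) a i * a j <= coef_a_sum k.+2 ^+ 2.
  have -> : coef_a_sum k.+2 = \sum_(0 <= i < k.+2) a i by rewrite big_mkord.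
  rewrite expr2 mulr_suml -big_split /= big_nat_cond [leRHS]big_nat_cond.
  apply: ler_sum => i; rewrite andbT => /andP[_ ik].
  rewrite mulr_sumr (@big_cat_nat _ _ _ i 0 k.+2) //= 1?ltnW // (@big_ltn _ _ _ i k.+2) //=.
  rewrite -expr2 lerDr; apply: sumr_ge0 => j _; exact: mulr_ge0.
have := ler_wpM2l z0 sqr_part; rewrite mulrDr /coef_potential /coef_sum mulrA -/z; lra.
Qed.

Lemma coef_sum_bounded : exists2 C : R, 0 <= C & forall k, coef_sum k <= C.
Proof.
have c0 k : 0 <= coef_sum k.
  by apply: addr_ge0; apply: sumr_ge0 => i _ //; apply: sumr_ge0.
have p0 k : 0 <= coef_potential k by apply: mulr_ge0; [exact: exprn_ge0|exact: sqr_ge0].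
pose C := \sum_(i < 5) coef_sum i + 16 * coef_potential 3.
have big k : coef_sum (k + 5) + 16 * coef_potential (k + 3) <= coef_sum 5 + 16 * coef_potential 3.
  elim: k => [|k IH]; first by rewrite !add0n.
  rewrite !addSn; apply: le_trans IH.
  have := coef_sum_step (k + 4); have := @coef_potential_step (k + 3) (leq_addl _ _).
  have -> : (k + 4).+2 = (k + 5).+1 by lia.
  have -> : (k + 4).+1 = (k + 5)%N by lia.
  have -> : (k + 4 = (k + 3).+1)%N by lia.
  have := p0 (k + 3)%N; lra.
have s0 : 0 <= \sum_(i < 5) coef_sum i by apply: sumr_ge0.
exists (\sum_(i < 5) coef_sum i + (coef_sum 5 + 16 * coef_potential 3)).
  by have := p0 3%N; have := c0 5%N; lra.
move=> k; have [k5|k5] := ltnP k 5.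
  rewrite (bigD1 (Ordinal k5)) //=.
  have : 0 <= \sum_(i < 5 | i != Ordinal k5) coef_sum i by apply: sumr_ge0.
  by have := p0 3%N; have := c0 5%N; lra.
have := big (k - 5)%N; rewrite subnK // => h1.
by have := p0 (k - 5 + 3)%N; lra.
Qed.

End Coefficients.

(** * Comparison of solutions in a large box *)

Section ZLift.
Variable h : nat.

Definition zlift (t : 'I_(2 * h).+1) : int := if (t <= h)%N then t%:Z else t%:Z - (2 * h).+1%:Z.

Lemma zlift_inj : injective zlift.
Proof.
move=> s t; rewrite /zlift; have := ltn_ord s; have := ltn_ord t => ht hs e.
by apply: val_inj => /=; move: e; case: leqP => sh; case: leqP => th; lia.
Qed.

Lemma clift_zlift (R : realFieldType) t : clift R t = (zlift t)%:~R.
Proof. by rewrite /clift /zlift; case: leqP => // _; rewrite rmorphB. Qed.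

Lemma zlift_surj (z : int) : - h%:Z <= z <= h%:Z -> exists t, zlift t = z.
Proof.
move=> /andP[z1 z2].
have [z0|z0] := lerP 0 z.
  have lt : (`|z| < (2 * h).+1)%N by lia.
  by exists (Ordinal lt); rewrite /zlift /=; case: leqP; lia.
have lt : (`|(z + (2 * h).+1%:Z)%R| < (2 * h).+1)%N by lia.
by exists (Ordinal lt); rewrite /zlift /=; case: leqP; lia.
Qed.

Hypothesis h_gt0 : (0 < h)%N.

Lemma zliftS (t : 'I_(2 * h).+1) : zlift (t + inZp 1) = if zlift t == h%:Z then - h%:Z else zlift t + 1.
Proof.
have := @cliftS rat h h_gt0 t; rewrite !(clift_zlift rat) => e; apply: (@intr_inj rat); rewrite e.
by rewrite (_ : h%:R = h%:Z%:~R) // (inj_eq (@intr_inj rat)); case: ifP; rewrite ?rmorphN ?rmorphD.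
Qed.

Lemma zliftB (t : 'I_(2 * h).+1) : zlift (t - inZp 1) = if zlift t == - h%:Z then h%:Z else zlift t - 1.
Proof.
have := @cliftB rat h h_gt0 t; rewrite !(clift_zlift rat) => e; apply: (@intr_inj rat); rewrite e.
by rewrite (_ : h%:R = h%:Z%:~R) // -rmorphN (inj_eq (@intr_inj rat)); case: ifP; rewrite ?rmorphB.
Qed.

Lemma zlift_abs (t : 'I_(2 * h).+1) : (`|zlift (t + inZp 1)%R| <= `|zlift t|.+1)%N /\
  (`|zlift (t - inZp 1)%R| <= `|zlift t|.+1)%N.
Proof.
rewrite zliftS zliftB; move: (zlift t) => z.
by split; [have [->|_] := eqVneq z h%:Z|have [->|_] := eqVneq z (- h%:Z)]; lia.
Qed.

End ZLift.

Section Comparison.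
Variables (R : realFieldType) (d h : nat).
Local Notation T := (torus d h).
Local Notation E := (T * 'I_d)%type.
Implicit Types (x y : T) (i : 'I_d) (u v : T -> R).
Variables (be m : R) (a : E -> R).
Hypotheses (m_gt0 : 0 < m) (a_itv : forall e, 0 <= a e <= be).

Definition massive_op u x : R := m * u x - \sum_i (a (x, i) * (u (x + stp h i) - u x) -
  a (x - stp h i, i) * (u x - u (x - stp h i))).

Definition on_boundary x := [exists i, `|zlift (x i)|%N == h].

Lemma maximum_principle v : (forall x, ~~ on_boundary x -> 0 <= massive_op v x) -> (forall x, on_boundary x -> 0 <= v x) ->
  forall x, 0 <= v x.
Proof.
move=> inn bdr x.
case: (@arg_minP _ R T 0 xpredT v isT) => y _ ymin.
suff : 0 <= v y by move=> /le_trans; apply; exact: ymin.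
have m0 := m_gt0.
rewrite leNgt; apply/negP => vy; have ny : ~~ on_boundary y by apply/negP => /bdr; rewrite leNgt vy.
have := inn y ny; rewrite /massive_op leNgt => /negP; apply.
have : m * v y < 0 by rewrite pmulr_rlt0.
suff : 0 <= \sum_i (a (y, i) * (v (y + stp h i) - v y) - a (y - stp h i, i) * (v y - v (y - stp h i))) by lra.
apply: sumr_ge0 => i _.
have /andP[a0 _] := a_itv (y, i); have /andP[a1 _] := a_itv (y - stp h i, i).
have h1 : 0 <= a (y, i) * (v (y + stp h i) - v y) by rewrite mulr_ge0 // subr_ge0 ymin.
have h2 : 0 <= a (y - stp h i, i) * (v (y - stp h i) - v y) by rewrite mulr_ge0 // subr_ge0 ymin.
lra.
Qed.

(* [barrier] is a supersolution growing geometrically: it carries the influence of the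
   boundary values of the box. *)
Definition barrier_rate : R := 1 + m / (4 * be).

Definition barrier x : R := \sum_i barrier_rate ^+ `|zlift (x i)|%N.

Hypotheses (be_gt0 : 0 < be) (h_gt0 : (0 < h)%N).

Lemma barrier_rate_ge1 : 1 <= barrier_rate.
Proof. by rewrite /barrier_rate lerDl divr_ge0 // ?mulr_ge0 // ltW. Qed.

Lemma barrier_boundary x : on_boundary x -> barrier_rate ^+ h <= barrier x.
Proof.
move=> /existsP[i /eqP xi]; rewrite /barrier (bigD1 i) //= xi lerDl.
by apply: sumr_ge0 => j _; apply: exprn_ge0; exact: le_trans barrier_rate_ge1.
Qed.

Lemma barrier_step x i : barrier (x + stp h i) - barrier x <= (barrier_rate - 1) * barrier_rate ^+ `|zlift (x i)|%N /\
  barrier (x - stp h i) - barrier x <= (barrier_rate - 1) * barrier_rate ^+ `|zlift (x i)|%N.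
Proof.
have l1 := barrier_rate_ge1.
have neighbour_le (y : T) : (forall j, j != i -> y j = x j) -> (`|zlift (y i)| <= `|zlift (x i)|.+1)%N ->
    barrier y - barrier x <= (barrier_rate - 1) * barrier_rate ^+ `|zlift (x i)|%N.
  move=> yx yi; rewrite /barrier (bigD1 i) //= [X in _ - X](bigD1 i) //=.
  rewrite (eq_bigr (fun j => barrier_rate ^+ `|zlift (x j)|%N)); last by move=> j /yx ->.
  have : barrier_rate ^+ `|zlift (y i)|%N <= barrier_rate ^+ `|zlift (x i)|.+1 by apply: ler_weXn2l.
  by rewrite exprS; move: (\sum_(j | _) _) => s; lra.
split; apply: neighbour_le.
- by move=> j ji; rewrite !ffunE (negPf ji) addr0.
- by rewrite !ffunE eqxx; case: (zlift_abs h_gt0 (x i)).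
- by move=> j ji; rewrite !ffunE (negPf ji) subr0.
by rewrite !ffunE eqxx; case: (zlift_abs h_gt0 (x i)).
Qed.

Lemma massive_op_barrier x : 0 <= massive_op barrier x.
Proof.
have b0 := be_gt0; have m0 := m_gt0; have l1 := barrier_rate_ge1; rewrite /massive_op {1}/barrier mulr_sumr -sumrB; apply: sumr_ge0 => i _.
have [s1 s2] := barrier_step x i.
set g := barrier_rate ^+ _ in s1 s2 *.
have g0 : 0 <= g by apply: exprn_ge0; lra.
have /andP[a0 a0'] := a_itv (x, i); have /andP[a1 a1'] := a_itv (x - stp h i, i).
have lE : be * (barrier_rate - 1) = m / 4 by rewrite /barrier_rate; field; lra.
have q0 : 0 <= (barrier_rate - 1) * g by rewrite mulr_ge0 // subr_ge0.
have h1 : a (x, i) * (barrier (x + stp h i) - barrier x) <= be * ((barrier_rate - 1) * g).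
  apply: le_trans (ler_wpM2l a0 s1) _; exact: ler_wpM2r.
have h2 : a (x - stp h i, i) * (barrier (x - stp h i) - barrier x) <= be * ((barrier_rate - 1) * g).
  apply: le_trans (ler_wpM2l a1 s2) _; exact: ler_wpM2r.
have mg : 0 <= m * g by rewrite mulr_ge0 // ltW.
rewrite mulrA lE in h1 h2.
have -> : a (x - stp h i, i) * (barrier x - barrier (x - stp h i)) =
  - (a (x - stp h i, i) * (barrier (x - stp h i) - barrier x)) by ring.
lra.
Qed.

Lemma massive_opD u v x : massive_op (fun x => u x + v x) x = massive_op u x + massive_op v x.
Proof.
rewrite /massive_op (eq_bigr (fun i => (a (x, i) * (u (x + stp h i) - u x) - a (x - stp h i, i) * (u x - u (x - stp h i))) +
  (a (x, i) * (v (x + stp h i) - v x) - a (x - stp h i, i) * (v x - v (x - stp h i))))).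
  by rewrite big_split /=; ring.
by move=> i _; ring.
Qed.

Lemma massive_opZ (k : R) u x : massive_op (fun x => k * u x) x = k * massive_op u x.
Proof. by rewrite /massive_op mulrBr mulr_sumr mulrCA; congr (_ - _); apply: eq_bigr => i _; ring. Qed.

Lemma massive_op_cst (k : R) x : massive_op (fun=> k) x = m * k.
Proof. by rewrite /massive_op big1 ?subr0 // => i _; rewrite !subrr !mulr0 subrr. Qed.

Lemma torus_compare u (F U : R) : 0 <= F -> 0 <= U ->
  (forall x, ~~ on_boundary x -> `|massive_op u x| <= F) -> (forall x, on_boundary x -> `|u x| <= U) ->
  forall x, `|u x| <= F / m + U / barrier_rate ^+ h * barrier x.
Proof.
move=> F0 U0 inn bdr; have m0 := m_gt0.
have lh : 0 < barrier_rate ^+ h by apply: exprn_gt0; exact: lt_le_trans barrier_rate_ge1.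
have k0 : 0 <= U / barrier_rate ^+ h by rewrite divr_ge0 // ltW.
have Fm : 0 <= F / m by rewrite divr_ge0 // ltW.
have H (s : R) : `|s| = 1 -> forall x, 0 <= (F / m + U / barrier_rate ^+ h * barrier x) + s * u x.
  move=> s1; apply: maximum_principle => x xb.
    rewrite massive_opD massive_opD massive_op_cst !massive_opZ.
    have -> : m * (F / m) = F by field; lra.
    have := mulr_ge0 k0 (massive_op_barrier x).
    have : `|s * massive_op u x| <= F by rewrite normrM s1 mul1r inn.
    by rewrite ler_norml => /andP[? ?]; lra.
  have : U <= U / barrier_rate ^+ h * barrier x.
    rewrite -mulrA; apply: ler_peMr => //; rewrite mulrC ler_pdivlMr // mul1r; exact: barrier_boundary.
  have : `|s * u x| <= U by rewrite normrM s1 mul1r bdr.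
  by rewrite ler_norml => /andP[? ?]; lra.
move=> x; have := H 1 (normr1 _) x; have := H (-1) _ x; rewrite normrN normr1 => /(_ erefl).
by rewrite ler_norml => ? ?; apply/andP; split; lra.
Qed.

Lemma barrier_le x (r : nat) : (forall i, (`|zlift (x i)| <= r)%N) -> barrier x <= d%:R * barrier_rate ^+ r.
Proof.
move=> H; rewrite /barrier -sum_cst_ord; apply: ler_sum => i _.
by apply: ler_weXn2l => //; exact: barrier_rate_ge1.
Qed.

End Comparison.

Local Open Scope classical_set_scope.

(** * From the lattice to the torus *)

Section Unfolding.
Variables (R : realType) (d h : nat).
Local Notation T := (torus d h).
Local Notation E := (T * 'I_d)%type.
Implicit Types (x y : T) (i : 'I_d) (e : E).

Definition zpoint x : lattice d := \row_i zlift (x i).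

Definition zedge e : edge d := (zpoint e.1, e.2).

Lemma zpoint_inj : injective zpoint.
Proof.
move=> x y /rowP xy; apply/ffunP => i; apply: zlift_inj.
by have := xy i; rewrite !mxE.
Qed.

Lemma zedge_inj : injective zedge.
Proof. by move=> [x i] [y j] [/zpoint_inj -> ->]. Qed.

Lemma zpoint0 : zpoint 0 = 0.
Proof. by apply/rowP => i; rewrite !mxE ffunE /zlift. Qed.

Lemma zpoint_surj (z : lattice d) : (forall i, (`|z 0%R i| <= h)%N) -> exists x, zpoint x = z.
Proof.
move=> zh; have H i : exists t : 'I_(2 * h).+1, zlift t = z 0 i.
  by apply: zlift_surj; rewrite -ler_norml; have := zh i; rewrite -lez_nat abszE.
have [f hf] := choice H.
by exists [ffun i => f i]; apply/rowP => i; rewrite mxE ffunE.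
Qed.

Hypothesis h_gt0 : (0 < h)%N.

Lemma zpointD x i : zlift (x i) != h%:Z -> zpoint (x + stp h i) = zpoint x + basis_vec i.
Proof.
move=> xi; apply/rowP => j; rewrite !mxE !ffunE eqxx /=.
have [->|ji] := eqVneq j i; last by rewrite !addr0.
by rewrite zliftS // (negPf xi).
Qed.

Lemma zpointB x i : zlift (x i) != - h%:Z -> zpoint (x - stp h i) = zpoint x - basis_vec i.
Proof.
move=> xi; apply/rowP => j; rewrite !mxE !ffunE eqxx /=.
have [->|ji] := eqVneq j i; last by rewrite !subr0.
by rewrite zliftB // (negPf xi).
Qed.

Lemma interior_step x i : ~~ on_boundary x -> zpoint (x + stp h i) = zpoint x + basis_vec i /\
  zpoint (x - stp h i) = zpoint x - basis_vec i.
Proof.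
move=> /existsPn /(_ i) xi; split; [apply: zpointD|apply: zpointB]; apply: contra xi => /eqP ->.
  by rewrite absz_nat.
by rewrite abszN absz_nat.
Qed.

Variables (om : edge d -> R) (zeta : 'I_d -> R) (m : R).

Definition lattice_corrector (u : lattice d -> R) := forall z, m * u z = \sum_i
  (om (z, i) * (zeta i + (u (z + basis_vec i) - u z)) -
   om (z - basis_vec i, i) * (zeta i + (u z - u (z - basis_vec i)))).

Local Notation a := (fun e : E => om (zedge e)).

Lemma lattice_corrector_op u x : lattice_corrector u -> ~~ on_boundary x -> massive_op m a (u \o zpoint) x =
  \sum_i (om (zpoint x, i) - om (zpoint x - basis_vec i, i)) * zeta i.
Proof.
move=> uc xi; rewrite /massive_op /= uc -sumrB; apply: eq_bigr => i _.
by have [-> e] := interior_step i xi; rewrite /zedge /= !e; ring.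
Qed.

Variables (al be : R).
Hypotheses (al_gt0 : 0 < al) (al_be : al <= be) (om_itv : forall b, al <= om b <= be)
  (zeta_le1 : forall i, `|zeta i| <= 1) (m_gt0 : 0 < m) (d_gt0 : (0 < d)%N).

Let be_gt0 : 0 < be. Proof. exact: lt_le_trans al_be. Qed.

Let a_itv e : 0 <= a e <= be.
Proof. by have /andP[a0 ->] := om_itv (zedge e); rewrite andbT (le_trans _ a0) // ltW. Qed.

Lemma lattice_corrector_origin u U : lattice_corrector u -> 0 <= U -> (forall x, `|u (zpoint x)| <= U) ->
  `|u 0| <= d%:R * be / m + U / barrier_rate be m ^+ h * d%:R.
Proof.
move=> uc U0 uU.
have F0 : 0 <= d%:R * be by rewrite mulr_ge0 // ltW.
have b0 := be_gt0; have a0 := al_gt0.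
have := @torus_compare R d h be m a m_gt0 a_itv be_gt0 h_gt0 (u \o zpoint) (d%:R * be) U F0 U0 _ (fun x _ => uU x) 0.
rewrite /= zpoint0 /barrier; under eq_bigr => i _ do rewrite ffunE /zlift /= expr0.
rewrite sum_cst_ord mulr1; apply => x xi.
rewrite lattice_corrector_op // -sum_cst_ord; apply: le_trans (ler_norm_sum _ _ _) _; apply: ler_sum => i _.
rewrite normrM -[leRHS]mulr1; apply: ler_pM => //.
have /andP[? ?] := om_itv (zpoint x, i); have /andP[? ?] := om_itv (zpoint x - basis_vec i, i).
by rewrite ler_norml; apply/andP; split; lra.
Qed.

Variables (J : finType) (vl : J -> R) (c : {ffun E -> J}) (ep : R).
Hypotheses (vl_itv : forall j, al <= vl j <= be) (c_close : forall e, `|om (zedge e) - vl (c e)| <= ep).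

Lemma lattice_corrector_defect u y : lattice_corrector u -> ~~ on_boundary y ->
  massive_op m a (fun x => u (zpoint x) - phi vl zeta m c x) y =
  \sum_i ((om (zedge (y, i)) - cfield vl c (y, i)) * flux vl zeta m c (y, i) -
    (om (zedge (y - stp h i, i)) - cfield vl c (y - stp h i, i)) * flux vl zeta m c (y - stp h i, i)).
Proof.
move=> uc yi.
have -> : (fun x => u (zpoint x) - phi vl zeta m c x) = (fun x => (u \o zpoint) x + (-1) * phi vl zeta m c x).
  by apply: funext => z /=; ring.
rewrite massive_opD massive_opZ lattice_corrector_op // /massive_op (phi_point al_gt0 vl_itv) //.
rewrite mulN1r opprB addrC -addrA -sumrN -!big_split /=; apply: eq_bigr => i _.
have [_ e] := interior_step i yi; rewrite /zedge /= e /flux /corr_flux /grd /tsrc /ttgt /= subrK -/(phi vl zeta m c).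
ring.
Qed.

Lemma flux_defect_le M e : (forall x, `|phi vl zeta m c x| <= M) ->
  `|(om (zedge e) - cfield vl c e) * flux vl zeta m c e| <= ep * (1 + 2 * M).
Proof.
move=> pM; rewrite normrM; apply: ler_pM => //.
rewrite /flux /corr_flux /grd -/(phi vl zeta m c); have := zeta_le1 e.2.
have := pM (ttgt e); have := pM (tsrc e); rewrite !ler_norml => /andP[? ?] /andP[? ?] /andP[? ?].
by apply/andP; split; lra.
Qed.

Lemma lattice_corrector_compare u M r : lattice_corrector u -> (forall x, `|u (zpoint x)| <= M) ->
  be * (2 * d%:R) / m <= M -> (r <= h)%N ->
  forall x, (forall i, (`|zlift (x i)| <= r)%N) ->
  `|u (zpoint x) - phi vl zeta m c x| <= d%:R * (2 * (ep * (1 + 2 * M))) / m + 2 * M * d%:R / barrier_rate be m ^+ (h - r).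
Proof.
move=> uc uM Mb rh x xr.
have pM y : `|phi vl zeta m c y| <= M.
  by apply: le_trans (phi_sup al_gt0 al_be vl_itv zeta_le1 c y m_gt0) Mb.
have ep0 : 0 <= ep.
  by apply: le_trans (c_close (0, Ordinal d_gt0)); exact: normr_ge0.
have M0 : 0 <= M by apply: le_trans (pM 0); exact: normr_ge0.
have F0 : 0 <= d%:R * (2 * (ep * (1 + 2 * M))) by rewrite !mulr_ge0 // addr_ge0 // mulr_ge0.
have rate0 k : 0 < barrier_rate be m ^+ k.
  by apply: exprn_gt0; exact: lt_le_trans (barrier_rate_ge1 m_gt0 be_gt0).
have diffM y : `|u (zpoint y) - phi vl zeta m c y| <= 2 * M.
  by apply: le_trans (ler_normB _ _) _; have := uM y; have := pM y; lra.
apply: le_trans (torus_compare (U := 2 * M) m_gt0 a_itv be_gt0 h_gt0 F0 (mulr_ge0 (ler0n _ _) M0) _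
  (fun y _ => diffM y) x) _ => [y yi|].
  rewrite lattice_corrector_defect // -sum_cst_ord; apply: le_trans (ler_norm_sum _ _ _) _; apply: ler_sum => i _.
  apply: le_trans (ler_normB _ _) _.
  by have := flux_defect_le (y, i) pM; have := flux_defect_le (y - stp h i, i) pM; lra.
rewrite lerD2l -!mulrA ler_wpM2l // ler_wpM2l //.
apply: le_trans (ler_wpM2l _ (barrier_le m_gt0 be_gt0 xr)) _; first by rewrite invr_ge0 ltW.
by rewrite mulrCA ler_wpM2l // mulrC ler_pdivrMr // ler_pdivlMl // -exprD subnK.
Qed.

End Unfolding.

Section Functional.
Variables (R : realType) (d h : nat).
Local Notation T := (torus d h).
Local Notation E := (T * 'I_d)%type.

Definition lattice_energy (om : edge d -> R) (zeta : 'I_d -> R) (chi u : lattice d -> R) : R :=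
  \sum_(e : E) chi (zpoint e.1) * (om (zedge e) * (zeta e.2 + (u (zpoint e.1 + basis_vec e.2) - u (zpoint e.1))) ^+ 2).

Definition lattice_product (chi u v : lattice d -> R) : R := \sum_(x : T) chi (zpoint x) * (u (zpoint x) * v (zpoint x)).

Variable (chi : lattice d -> R).
Hypothesis chi_supp : forall (z : lattice d) i, (h < `|z 0%R i|)%N -> chi z = 0.

Lemma average_torus (H : lattice d -> R) : average chi H = \sum_(x : T) chi (zpoint x) * H (zpoint x).
Proof.
pose r := [seq zpoint x | x <- enum [set: T]%SET].
have ur : uniq r by rewrite map_inj_uniq ?enum_uniq //; exact: zpoint_inj.
rewrite /average; transitivity (\sum_(z \in [set` r]) H z * chi z).
  apply/esym; apply: fsbig_widen => // z [_ /= zr].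
  suff /existsNP[i /negP] : ~ (forall i, (`|z 0%R i| <= h)%N) by rewrite -ltnNge => /chi_supp ->; rewrite mulr0.
  move=> /zpoint_surj[x xz]; apply: zr; rewrite -xz; apply/mapP; exists x => //.
  by rewrite mem_enum inE.
rewrite -fsbig_seq // big_map big_enum /=; apply: eq_big => x; first by rewrite inE.
by move=> _; rewrite mulrC.
Qed.

Definition zbox r : {set T} := [set x : T | [forall i, (`|zlift (x i)| <= r)%N]].

Lemma zboxP r (x : T) : reflect (forall i, (`|zlift (x i)| <= r)%N) (x \in zbox r).
Proof. by rewrite inE; exact: forallP. Qed.

Section Closeness.
Variables (J : finType) (vl : J -> R) (c : {ffun E -> J}) (om : edge d -> R) (zeta : 'I_d -> R).
Variables (al be ep e1 M X0 : R) (r : nat).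
Hypotheses (om_itv : forall b, al <= om b <= be) (vl_itv : forall j, al <= vl j <= be) (al_gt0 : 0 < al)
  (zeta_le1 : forall i, `|zeta i| <= 1) (h_gt0 : (0 < h)%N) (rh : (r < h)%N).
Hypotheses (c_close : forall e, `|om (zedge e) - vl (c e)| <= ep) (chi_le : forall z, `|chi z| <= X0)
  (chi0 : forall x : T, x \notin zbox r -> chi (zpoint x) = 0).

Definition nearby (u : lattice d -> R) m := [/\ forall x : T, `|u (zpoint x)| <= M,
  forall x, `|phi vl zeta m c x| <= M & forall x, x \in zbox r.+1 -> `|u (zpoint x) - phi vl zeta m c x| <= e1].

Let X0_ge0 : 0 <= X0. Proof. by apply: le_trans (chi_le 0); exact: normr_ge0. Qed.

Lemma zboxS (x : T) : x \in zbox r -> x \in zbox r.+1.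
Proof. by move=> /zboxP xr; apply/zboxP => i; apply: leqW. Qed.

Lemma zbox_tgt (e : E) : e.1 \in zbox r -> ttgt e \in zbox r.+1.
Proof.
move=> /zboxP er; apply/zboxP => i; rewrite /ttgt !ffunE.
have [->|_] := eqVneq i e.2; last by rewrite addr0 leqW.
by have [h1 _] := zlift_abs h_gt0 (e.1 e.2); apply: leq_trans h1 _; rewrite ltnS.
Qed.

Lemma lattice_energy_close u m : nearby u m ->
  `|lattice_energy om zeta chi u - avg_energy vl zeta (chi \o @zpoint d h) m c| <=
  d%:R * #|zbox r|%:R * (X0 * (ep * (1 + 2 * M) ^+ 2 + 4 * (be * e1 * (1 + 2 * M)))).
Proof.
move=> [uM pM upe]; have a0 := al_gt0.
have M0 : 0 <= M by apply: le_trans (uM 0); exact: normr_ge0.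
rewrite /lattice_energy /avg_energy -sumrB -card_out_edges.
apply: le_trans (ler_norm_sum _ _ _) _; rewrite [leRHS]big_mkcond; apply: ler_sum => e _ /=.
case: ifPn => er; last by rewrite chi0 // !mul0r subrr normr0.
rewrite -mulrBr normrM; apply: ler_pM => //.
have -> : zpoint e.1 + basis_vec e.2 = zpoint (ttgt e).
  rewrite /ttgt zpointD //; have := zboxP _ _ er e.2; apply: contraL => /eqP ->.
  by rewrite absz_nat -ltnNge.
rewrite /flux2 /flux /corr_flux /grd -/(phi vl zeta m c) /cfield.
have := upe _ (zbox_tgt er); have := upe _ (zboxS er); have := uM (ttgt e); have := uM e.1.
have := pM (ttgt e); have := pM e.1; have := zeta_le1 e.2; have := c_close e.
have := vl_itv (c e); rewrite /tsrc.
move: (zeta e.2) (u _) (u _) (phi _ _ _ _ _) (phi _ _ _ _ _) (om _) (vl _) => z u1 u2 p1 p2 o v.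
move=> /andP[v1 v2] ov; rewrite !ler_norml => /andP[z1 z2] /andP[a1 a2] /andP[a3 a4] /andP[b1 b2].
move=> /andP[b3 b4] /andP[g1 g2] /andP[g3 g4].
have -> : o * (z + (u1 - u2)) ^+ 2 - v * (z + (p1 - p2)) ^+ 2 = (o - v) * (z + (u1 - u2)) ^+ 2 +
   v * (((u1 - p1) - (u2 - p2)) * ((z + (u1 - u2)) + (z + (p1 - p2)))) by ring.
rewrite -!ler_norml; apply: le_trans (ler_normD _ _) _; rewrite !normrM.
have A1 : `|z + (u1 - u2)| <= 1 + 2 * M by rewrite ler_norml; apply/andP; split; lra.
have A2 : `|z + (p1 - p2)| <= 1 + 2 * M by rewrite ler_norml; apply/andP; split; lra.
apply: lerD.
  by rewrite expr2; apply: ler_pM => //; exact: ler_pM.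
have -> : 4 * (be * e1 * (1 + 2 * M)) = be * ((2 * e1) * (2 * (1 + 2 * M))) by ring.
apply: ler_pM => //; [by rewrite ger0_norm //; lra|apply: ler_pM => //].
  by rewrite ler_norml; apply/andP; split; lra.
by apply: le_trans (ler_normD _ _) _; lra.
Qed.

Lemma lattice_product_close u v m1 m2 : nearby u m1 -> nearby v m2 ->
  `|lattice_product chi u v - avg_product vl zeta (chi \o @zpoint d h) m1 m2 c| <= #|zbox r|%:R * (X0 * (2 * (M * e1))).
Proof.
move=> [uM pM upe] [vM qM vqe]; rewrite /lattice_product /avg_product -sumrB.
apply: le_trans (ler_norm_sum _ _ _) _; rewrite mulr_natl -sumr_const [leRHS]big_mkcond; apply: ler_sum => x _ /=.
case: ifPn => xr; last by rewrite chi0 // !mul0r subrr normr0.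
rewrite -mulrBr normrM; apply: ler_pM => //.
have := upe _ (zboxS xr); have := vqe _ (zboxS xr); have := uM x; have := vM x; have := pM x; have := qM x.
move: (u _) (v _) (phi _ _ _ _ _) (phi _ _ _ _ _) => u1 v1 p q hq hp hv hu hvq hup.
have -> : u1 * v1 - p * q = (u1 - p) * v1 + p * (v1 - q) by ring.
apply: le_trans (ler_normD _ _) _; rewrite !normrM.
have h1 : `|u1 - p| * `|v1| <= e1 * M by apply: ler_pM.
have h2 : `|p| * `|v1 - q| <= M * e1 by apply: ler_pM.
lra.
Qed.

End Closeness.

Variables (al be : R) (ab : al <= be).

Lemma approx_quad_torus mu k (xi : 'cV[R]_d) (phi : R -> lattice d -> environment d ab -> R) w :
  approx_quad mu k chi xi phi w =
  lattice_energy (fun e => @itv_val R al be ab (w e)) (fun i => xi i 0) chi (phi mu ^~ w) +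
  mu * (\sum_(0 <= i < k) coef_eta R k i * lattice_product chi (phi (2 ^+ i * mu) ^~ w) (phi (2 ^+ i * mu) ^~ w)) +
  mu * (\sum_(0 <= i < k) \sum_(i.+1 <= j < k)
    coef_nu R k i j * lattice_product chi (phi (2 ^+ i * mu) ^~ w) (phi (2 ^+ j * mu) ^~ w)).
Proof.
rewrite /approx_quad; congr (_ + mu * _ + mu * _).
- rewrite average_torus /lattice_energy sum_edges exchange_big /=; apply: eq_bigr => x _.
  rewrite /dot mulr_sumr; apply: eq_bigr => i _.
  by rewrite mul_diag_mx /grad !mxE; congr (_ * _); rewrite mulrCA expr2.
- apply: eq_bigr => i _; rewrite average_torus; congr (_ * _).
apply: eq_bigr => i _; apply: eq_bigr => j _; rewrite average_torus; congr (_ * _).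
Qed.

End Functional.

(** * Random variables *)

Section Expectations.
Local Open Scope ereal_scope.
Context (dd : measure_display) (T : measurableType dd) (R : realType) (P : probability T R).

Lemma finite_law (I : finType) (f : T -> I) (G : I -> R) :
  (forall i, measurable [set w | f w = i]) -> (forall i, (0 <= G i)%R) ->
  \int[P]_w (G (f w))%:E = \sum_i (G i)%:E * P [set w | f w = i].
Proof.
move=> mf G0.
rewrite (eq_integral (fun w => \sum_i (G i)%:E * (\1_[set w | f w = i] w)%:E)); last first.
  move=> w _; rewrite (bigD1 (f w)) //= indicE mem_set // mule1 big1 ?adde0 // => i fi.
  by rewrite indicE memNset ?mule0 //= => fwi; rewrite fwi eqxx in fi.
rewrite ge0_integral_sum //; last 2 first.
- by move=> i; apply: measurable_funeM; apply/measurable_EFinP; exact: measurable_indic.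
- by move=> i w _; rewrite mule_ge0 // lee_fin.
apply: eq_bigr => i _; rewrite ge0_integralZl_EFin //.
- by rewrite integral_indic // setIT.
- by apply/measurable_EFinP; exact: measurable_indic.
Qed.

Lemma finite_law_total (I : finType) (f : T -> I) :
  (forall i, measurable [set w | f w = i]) -> (\sum_i fine (P [set w | f w = i]) = 1)%R.
Proof.
move=> mf; apply: EFin_inj; rewrite -sumEFin.
have e := finite_law mf (fun=> ler01); rewrite integral_cst // mul1e in e.
rewrite -(probability_setT P); apply: etrans (esym e).
by apply: eq_bigr => i _; rewrite fineK ?fin_num_measure // mul1e.
Qed.

Lemma variance_le_sqr (X : T -> R) (k V : R) : measurable_fun [set: T] X ->
  \int[P]_w ((X w - k) ^+ 2)%:E <= V%:E -> 'V_P[X] <= V%:E.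
Proof.
move=> mX XV.
pose Y : T -> R := (X \- cst k)%R.
have mY : measurable_fun [set: T] Y by apply: measurable_funB.
have Y2 : Y \in Lfun P 2%:E.
  rewrite inE; apply/andP; split; rewrite inE //=.
  rewrite /finite_norm unlock; apply: poweR_lty; apply: le_lt_trans (ltry V).
  apply: le_trans XV; apply: eq_leW; apply: eq_integral => w _ /=.
  by rewrite powR_mulrn // real_normK ?num_real.
have -> : 'V_P[X] = 'V_P[Y].
  have -> : Y = (X \- cst k)%R by [].
  rewrite varianceB_cst_r //.
  have -> : X = (Y \+ cst k)%R by apply: funext => w; rewrite /Y /= subrK.
  have k2 : cst k \in Lfun P 2%:E by exact: Lfun_cst.
  by rewrite rpredD // lee1n.
rewrite varianceE //; apply: le_trans (_ : 'E_P[(Y ^+ 2)%R] <= _).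
  by rewrite -[leRHS]adde0 leeD2l // oppe_le0 sqre_ge0.
by rewrite unlock.
Qed.

End Expectations.

Lemma box_decay (R : realType) d (t c v : R) : 0 < t -> 0 <= c -> 0 < v ->
  exists2 h, (0 < h)%N & c * (2 * h).+1%:R ^+ d / (1 + t) ^+ h < v.
Proof.
move=> t0 c0 v0.
pose K := c * (3 * d.+1)%:R ^+ d / t ^+ d.+1.
have K0 : 0 <= K by rewrite divr_ge0 ?mulr_ge0 ?exprn_ge0 // ltW.
pose s := (Num.bound (K / v)).+1.
exists (s * d.+1)%N => //.
have s0 : 0 < s%:R :> R by rewrite ltr0n.
have Ks : K / v < s%:R.
  by apply: lt_trans (archi_boundP (divr_ge0 K0 (ltW v0))) _; rewrite ltr_nat.
rewrite ltr_pdivrMr // mulrC -ltr_pdivrMr // in Ks.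
apply: le_lt_trans Ks.
have st : 0 < (s%:R * t) ^+ d.+1 by rewrite exprn_gt0 // mulr_gt0.
have p1 : (s%:R * t) ^+ d.+1 <= (1 + t) ^+ (s * d.+1).
  have t0' := ltW t0; have t1 : 0 <= 1 + t by lra.
  rewrite exprM; apply: (@lerXn2r R d.+1 (s%:R * t) ((1 + t) ^+ s)); rewrite ?nnegrE;
    [exact: mulr_ge0|exact: exprn_ge0|by apply: le_trans (bernoulli_ineq s t0'); rewrite lerDr].
have p2 : (2 * (s * d.+1)).+1%:R ^+ d <= ((3 * d.+1)%:R * s%:R) ^+ d :> R.
  apply: lerXn2r; rewrite ?nnegrE ?mulr_ge0 // -natrM ler_nat.
  by have : (0 < s * d.+1)%N by []; lia.
apply: le_trans (_ : c * ((3 * d.+1)%:R * s%:R) ^+ d / (s%:R * t) ^+ d.+1 <= _).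
  apply: ler_pM; rewrite ?mulr_ge0 ?exprn_ge0 ?invr_ge0 //; first by rewrite exprn_ge0 // addr_ge0 // ltW.
    exact: ler_wpM2l.
  by rewrite lef_pV2 // posrE //; apply: lt_le_trans p1.
rewrite /K; apply: eq_leW; rewrite !exprMn !exprS.
by field; rewrite !expf_neq0 ?lt0r_neq0.
Qed.

Section Environment.
Variables (R : realType) (d : nat) (al be : R) (ab : al <= be).
Variables (nu : probability (conductance ab) R) (P : probability (environment d ab) R).
Hypothesis prodP : is_product_measure nu P.
Local Notation env := (environment d ab).

Lemma measurable_coord e : measurable_fun [set: env] (fun w : env => (w e : conductance ab)).
Proof. by move=> _ B mB; rewrite setTI; apply: sub_sigma_algebra; exists e, B. Qed.

Lemma measurable_itv_val : measurable_fun [set: conductance ab] (@itv_val R al be ab : conductance ab -> R).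
Proof. by move=> _ B mB; exists B. Qed.

Lemma measurable_conductance e : measurable_fun [set: env] (fun w : env => @itv_val R al be ab (w e)).
Proof. exact: (measurableT_comp measurable_itv_val (measurable_coord e)). Qed.

Lemma measurable_shift z : measurable_fun [set: env] (@Defs.shift d R al be ab z).
Proof.
apply: (@measurability _ _ env env setT _ (@cylinders d R al be ab)) => // _ [_ [e [B [mB ->]]] <-].
by rewrite setTI; apply: sub_sigma_algebra; exists (e.1 + z, e.2), B.
Qed.

Definition cylinder (s : seq (edge d)) (B : edge d -> set (conductance ab)) : set env :=
  [set w | forall e, e \in s -> B e (w e)].

Lemma measurable_cylinder s B : (forall e, measurable (B e)) -> measurable (cylinder s B).
Proof.
move=> mB; have -> : cylinder s B = \bigcap_(e in [set` s]) [set w : env | B e (w e)].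
  by apply/seteqP; split => w /= H e; exact: H.
apply: fin_bigcap_measurable => // e _.
by have := measurable_coord e measurableT (mB e); rewrite setTI.
Qed.

Lemma shift_invariant z A : measurable A -> P (@Defs.shift d R al be ab z @^-1` A) = P A.
Proof.
pose X : {RV P >-> env} := mfun_Sub (mem_set (measurable_shift z)).
pose G := [set A : set env | exists s B, [/\ uniq s, forall e, measurable (B e) & A = cylinder s B]].
pose m1 : {measure set env -> \bar R} := distribution P X.
rewrite -[LHS]/(m1 A); apply: (measure_unique G (fun=> [set: env])) => //.
- apply/seteqP; split.
    apply: smallest_sub; first exact: smallest_sigma_algebra.
    move=> _ [e [B [mB ->]]]; apply: sub_sigma_algebra; exists [:: e], (fun=> B); split => //.
    by apply/seteqP; split => w /= H; [move=> e'; rewrite inE => /eqP ->|apply: H; rewrite inE].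
  apply: smallest_sub; first exact: sigma_algebra_measurable.
  by move=> _ [s [B [_ mB ->]]]; exact: measurable_cylinder.
- move=> _ _ [s [B [us mB ->]]] [t [C [ut mC ->]]].
  exists (undup (s ++ t)), (fun e => (if e \in s then B e else setT) `&` (if e \in t then C e else setT)).
  split; [exact: undup_uniq|by move=> e; apply: measurableI; case: ifP|].
  apply/seteqP; split => [w [/= H1 H2] e|w /= H].
    by rewrite mem_undup mem_cat => _; split; case: ifP => // ?; [exact: H1|exact: H2].
  by split => e es; have := H e; rewrite mem_undup mem_cat es ?orbT => /(_ isT) [].
- by move=> _; exists [::], (fun=> setT); split => //; apply/seteqP; split => w.
- by rewrite bigcup_const.
- move=> _ [s [B [us mB ->]]].
  pose sg (e : edge d) : edge d := (e.1 + z, e.2).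
  pose sg' (e : edge d) : edge d := (e.1 - z, e.2).
  have sK : cancel sg sg' by move=> [x i]; rewrite /sg' /sg /= addrK.
  have -> : m1 (cylinder s B) = P (cylinder (map sg s) (fun e => B (sg' e))).
    congr (P _); apply/seteqP; split => w /= H e.
      by move=> /mapP[e' e's ->]; rewrite sK; exact: (H e').
    by move=> es; have := H (sg e); rewrite sK map_f // => /(_ isT).
  apply: etrans (esym (prodP us mB)); rewrite prodP //; last by rewrite map_inj_uniq //; exact: can_inj sK.
  by rewrite big_map; congr EFin; apply: eq_bigr => e _; rewrite sK.
by move=> _; rewrite /= probability_setT ltry.
Qed.

Lemma stationary_norm (u : lattice d -> env -> R) z : stationary P u -> (forall x, measurable_fun [set: env] (u x)) ->
  (\int[P]_w `|u z w|%:E = \int[P]_w `|u 0%R w|%:E)%E.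
Proof.
move=> su mu.
pose X : {RV P >-> env} := mfun_Sub (mem_set (measurable_shift z)).
have mn x : measurable_fun [set: env] (fun w => `|u x w|%:E).
  by apply/measurable_EFinP; apply: measurableT_comp.
transitivity (\int[P]_w `|u 0%R (Defs.shift z w)|%:E)%E.
  apply: ge0_ae_eq_integral => //.
    by apply: (measurableT_comp (mn 0)); exact: measurable_shift.
  have := su 0 z; apply: filterS => w /=; rewrite add0r => -> _ //.
have /= <- // := @ge0_integral_distribution _ _ _ _ _ P X (fun w => `|u 0 w|%:E) (mn 0).
apply: eq_measure_integral => A mA _; exact: shift_invariant.
Qed.

Lemma corrector_lattice (xi : 'cV[R]_d) m (u : lattice d -> env -> R) w :
  (forall x, m * u x w - bdiv (fun y => diffusion w y *m (xi + grad (u ^~ w) y)) x = 0) ->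
  lattice_corrector (fun e => @itv_val R al be ab (w e)) (fun i => xi i 0) m (u ^~ w).
Proof.
move=> H z; have /eqP := H z; rewrite subr_eq0 => /eqP ->; apply: eq_bigr => i _.
by rewrite !mul_diag_mx /grad !mxE subrK.
Qed.

Lemma itv_val_itv (v : conductance ab) : al <= @itv_val R al be ab v <= be.
Proof. exact: (svalP v). Qed.

Lemma corrector_measurable (xi : 'cV[R]_d) m (u : lattice d -> env -> R) x :
  is_modified_corrector P xi m u -> measurable_fun [set: env] (u x).
Proof. by move=> [/(_ x)]; rewrite inE => /andP[/[!inE]]. Qed.

Lemma stationary_ae_le (u : lattice d -> env -> R) z (M : R) : stationary P u ->
  (forall x, measurable_fun [set: env] (u x)) ->
  (\forall w \ae P, `|u 0 w| <= M) -> \forall w \ae P, `|u z w| <= M.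
Proof.
move=> su mu uM; pose A := [set w : env | M < `|u 0 w|].
have mA : measurable A.
  have -> : A = [set: env] `&` (fun w => `|u 0 w|) @^-1` `]M, +oo[.
    by rewrite setTI; apply/seteqP; split => w /=; rewrite in_itv /= andbT.
  by apply: (measurableT_comp _ (mu 0)) => //; exact: measurable_itv.
have PA : P A = 0%E.
  by apply/(negligibleP P mA); apply: negligibleS uM => w /= Aw; apply/negP; rewrite -ltNge.
have mS : measurable (@Defs.shift d R al be ab z @^-1` A).
  by have := measurable_shift z measurableT mA; rewrite setTI.
have shift_le : \forall w \ae P, ~ A (Defs.shift z w).
  have PS : P (@Defs.shift d R al be ab z @^-1` A) = 0%E by rewrite shift_invariant.
  have shift0 : P.-negligible (@Defs.shift d R al be ab z @^-1` A) by apply/negligibleP.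
  by apply: negligibleS shift0 => w /= /contrapT.
have := su 0 z; rewrite add0r => uz.
by apply: filterS2 uz shift_le => w -> /negP; rewrite -leNgt.
Qed.

Lemma stationary_torus_sum h (u : lattice d -> env -> R) (k I : R) : stationary P u ->
  (forall x, measurable_fun [set: env] (u x)) -> 0 <= k -> (\int[P]_w `|u 0%R w|%:E = I%:E)%E ->
  (\int[P]_w (\sum_(x : torus d h) k%:E * `|u (zpoint x) w|%:E) = (k * ((2 * h).+1%:R ^+ d * I))%:E)%E.
Proof.
move=> su mu k0 IE; have mN x : measurable_fun [set: env] (fun w => `|u x w|%:E).
  by apply/measurable_EFinP; apply: measurableT_comp.
rewrite ge0_integral_sum //; last 2 first.
- by move=> x; exact: measurable_funeM.
- by move=> x w _; rewrite mule_ge0 // lee_fin.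
under eq_bigr => x _ do rewrite ge0_integralZl_EFin // stationary_norm // IE -EFinM.
rewrite sumEFin sumr_const -[X in X%:E]mulr_natl mulrCA.
by have -> : #|{: torus d h}|%:R = (2 * h).+1%:R ^+ d :> R by rewrite card_ffun !card_ord natrX.
Qed.

Section CorrectorBound.
Variables (xi : 'cV[R]_d) (m : R) (u : lattice d -> env -> R).
Hypotheses (al_gt0 : 0 < al) (xi_le1 : forall i, `|xi i 0| <= 1) (m_gt0 : 0 < m)
  (uc : is_modified_corrector P xi m u).
Local Notation bound := (d%:R * be / m).

Definition corrector_excess w : R := Num.max (`|u 0 w| - bound) 0.

Let be_gt0 : 0 < be. Proof. exact: lt_le_trans ab. Qed.

Let mu x : measurable_fun [set: env] (u x). Proof. exact: corrector_measurable uc. Qed.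

Let excess_ge0 w : (0 <= (corrector_excess w)%:E)%E.
Proof. by rewrite lee_fin /corrector_excess le_max lexx orbT. Qed.

Let measurable_excess : measurable_fun [set: env] (fun w => (corrector_excess w)%:E).
Proof.
apply/measurable_EFinP; apply: measurable_maxr => //; apply: measurable_funB => //.
exact: measurableT_comp.
Qed.

Lemma corrector_excess_le h : (0 < h)%N -> \forall w \ae P,
  corrector_excess w <= d%:R / barrier_rate be m ^+ h * \sum_(x : torus d h) `|u (zpoint x) w|.
Proof.
move=> h0; case: uc => _ _; apply: filterS => w /corrector_lattice wc.
have rate0 : 0 < barrier_rate be m ^+ h by apply: exprn_gt0; exact: lt_le_trans (barrier_rate_ge1 m_gt0 be_gt0).
rewrite /corrector_excess ge_max; set U := \sum_x _; have U0 : 0 <= U by apply: sumr_ge0.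
rewrite mulr_ge0 ?divr_ge0 ?(ltW rate0) // andbT lerBlDl.
have := lattice_corrector_origin h0 al_gt0 ab (fun b => itv_val_itv (w b)) xi_le1 m_gt0 wc U0 _.
move=> H; apply: le_trans (H _) _; last by rewrite lerD2l; lra.
by move=> x; rewrite /U (bigD1 x) //= lerDl sumr_ge0.
Qed.

Lemma integral_corrector_excess : (\int[P]_w (corrector_excess w)%:E = 0)%E.
Proof.
case: (uc) => uL us _.
have mean_lty : (\int[P]_w `|u 0%R w|%:E < +oo)%E.
  have : u 0 \in Lfun P 1 by apply: Lfun_subset12 (uL 0); rewrite fin_num_measure.
  by move=> /Lfun1_integrable /integrableP[_].
have [I [I0 IE]] : exists I : R, 0 <= I /\ (\int[P]_w `|u 0%R w|%:E = I%:E)%E.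
  have : (0 <= \int[P]_w `|u 0%R w|%:E)%E by apply: integral_ge0.
  by case: (X in (0 <= X)%E -> _) mean_lty => [r _ r0| |] //; exists r.
have excess_le h : (0 < h)%N -> (\int[P]_w (corrector_excess w)%:E <=
    (d%:R / barrier_rate be m ^+ h * ((2 * h).+1%:R ^+ d * I))%:E)%E.
  move=> h0; have k0 : 0 <= d%:R / barrier_rate be m ^+ h.
    by rewrite divr_ge0 // exprn_ge0 // (le_trans ler01) // barrier_rate_ge1.
  rewrite -(stationary_torus_sum h us mu k0 IE); apply: ae_ge0_le_integral => //.
  - by move=> w _; apply: sume_ge0 => x _; rewrite mule_ge0 // lee_fin.
  - by apply: emeasurable_sum => x; apply: measurable_funeM; apply/measurable_EFinP; exact: measurableT_comp.
  apply: filterS (corrector_excess_le h0) => w le_w _.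
  by under eq_bigr do rewrite -EFinM; rewrite sumEFin lee_fin -mulr_sumr.
have v0 : (0 <= \int[P]_w (corrector_excess w)%:E)%E by apply: integral_ge0.
apply/eqP; rewrite eq_le v0 andbT leNgt; apply/negP => v1.
have [v [vp vE]] : exists v : R, 0 < v /\ (\int[P]_w (corrector_excess w)%:E = v%:E)%E.
  have := excess_le 1%N isT; case: (X in (X <= _)%E -> _) v1 => [v| |] //; by rewrite lte_fin; exists v.
have t0 : 0 < m / (4 * be) by rewrite divr_gt0 // mulr_gt0.
have [h h0] := @box_decay R d _ (d%:R * I) v t0 (mulr_ge0 (ler0n _ _) I0) vp.
rewrite ltNge => /negP; apply; have := excess_le h h0; rewrite vE lee_fin => /le_trans; apply.
by apply: eq_leW; rewrite /barrier_rate; ring.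
Qed.

Lemma corrector_bound z : \forall w \ae P, `|u z w| <= bound.
Proof.
case: (uc) => _ us _; apply: stationary_ae_le => //.
have : (\int[P]_w `|(corrector_excess w)%:E| = 0)%E.
  by rewrite -integral_corrector_excess; apply: eq_integral => w _; rewrite gee0_abs.
move=> /(ae_eq_integral_abs P measurableT measurable_excess); apply: filterS => w /(_ I)[].
by rewrite /corrector_excess => /max_idPr; rewrite subr_le0.
Qed.

End CorrectorBound.

End Environment.

(** * Discretisation of the environment *)

Section CombinationVariance.
Variables (R : realFieldType) (d h : nat) (J : finType) (rho : J -> R).
Hypotheses (rho_ge0 : forall j, 0 <= rho j) (rho_sum : \sum_j rho j = 1).
Local Notation E := (torus d h * 'I_d)%type.
Local Notation cfg := {ffun E -> J}.

Lemma Var_combination (I : eqType) (s : seq I) (a : I -> R) (f0 : cfg -> R) (f : I -> cfg -> R) (b S V : R) :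
  0 <= V -> {in s, forall i, Var rho (f i) <= V} -> \sum_(i <- s) `|a i| <= S ->
  Var rho (fun c => f0 c + b * \sum_(i <- s) a i * f i c) <= 2 * Var rho f0 + 2 * (b ^+ 2 * S ^+ 2 * V).
Proof.
move=> V0 fV aS; have ExP := Ex_mean E rho_ge0 rho_sum.
have a0 : 0 <= \sum_(i <- s) `|a i| by apply: sumr_ge0.
pose g i c := f i c - Ex rho (f i).
have e1 : Ex rho (fun c => f0 c + b * \sum_(i <- s) a i * f i c) =
    Ex rho f0 + b * \sum_(i <- s) a i * Ex rho (f i).
  rewrite (meanD ExP) (meanZ ExP) (mean_sum ExP); congr (_ + b * _); apply: eq_bigr => i _.
  exact: (meanZ ExP).
apply: le_trans (_ : Ex rho (fun c => 2 * (f0 c - Ex rho f0) ^+ 2 +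
   2 * (b ^+ 2 * (S * \sum_(i <- s) `|a i| * g i c ^+ 2))) <= _).
  apply: (mean_mono ExP) => c; rewrite e1.
  have -> : f0 c + b * (\sum_(i <- s) a i * f i c) - (Ex rho f0 + b * (\sum_(i <- s) a i * Ex rho (f i))) =
    (f0 c - Ex rho f0) + b * \sum_(i <- s) a i * g i c.
    have -> : \sum_(i <- s) a i * g i c = \sum_(i <- s) a i * f i c - \sum_(i <- s) a i * Ex rho (f i).
      by rewrite -sumrB; apply: eq_bigr => i _; rewrite mulrBr.
    ring.
  apply: le_trans (sqrrD_le _ _) _; rewrite lerD2l ler_wpM2l // exprMn ler_wpM2l ?sqr_ge0 //.
  have cs := @cauchy_schwarz_seq R I s xpredT (fun i => `|a i|) (fun i => Num.sg (a i)) (g^~ c) (fun i => normr_ge0 _).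
  rewrite (eq_bigr (fun i => a i * g i c)) in cs; last by move=> i _; rewrite [`|_| * _]mulrC -numEsg.
  apply: le_trans cs _; apply: ler_wpM2r; first by apply: sumr_ge0 => i _; rewrite mulr_ge0 ?sqr_ge0.
  apply: le_trans aS; apply: ler_sum => i _; rewrite sqr_sg.
  by case: (a i != 0); rewrite ?mulr1 ?mulr0.
rewrite (meanD ExP) (meanZ ExP) lerD2l (meanZ ExP) (meanZ ExP) ler_wpM2l // -mulrA ler_wpM2l ?sqr_ge0 //.
rewrite (meanZ ExP) (mean_sum ExP) expr2 -mulrA ler_wpM2l //; first exact: le_trans aS.
apply: le_trans (_ : \sum_(i <- s) `|a i| * V <= _).
  by rewrite !big_seq; apply: ler_sum => i si; rewrite (meanZ ExP) ler_wpM2l //; exact: fV.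
by rewrite -mulr_suml ler_wpM2r.
Qed.

End CombinationVariance.

Section Rounding.
Variables (R : realType) (d : nat) (al be : R) (ab : al <= be) (g : R) (g_gt0 : 0 < g).
Variables (nu : probability (conductance ab) R) (P : probability (environment d ab) R).
Hypothesis prodP : is_product_measure nu P.
Local Notation env := (environment d ab).

Definition grid_size : nat := Num.truncn ((be - al) * g).

Local Notation J := 'I_grid_size.+1.

Definition grid (j : J) : R := al + j%:R / g.

Definition grid_round (v : conductance ab) : J := inord (Num.truncn ((@itv_val R al be ab v - al) * g)).

Definition grid_law (j : J) : R := fine (nu [set v | grid_round v = j]).

Lemma grid_round_val v : grid_round v = Num.truncn ((@itv_val R al be ab v - al) * g) :> nat.
Proof.
rewrite /grid_round inordK // ltnS; apply: le_truncn; rewrite ler_wpM2r ?(ltW g_gt0) // lerD2r.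
by have /andP[] := itv_val_itv v.
Qed.

Lemma grid_itv j : al <= grid j <= be.
Proof.
rewrite /grid lerDl divr_ge0 ?(ltW g_gt0) //= -lerBrDl ler_pdivrMr //.
apply: le_trans (_ : grid_size%:R <= _); first by rewrite ler_nat -ltnS.
by rewrite truncn_le mulr_ge0 ?(ltW g_gt0) // subr_ge0.
Qed.

Lemma grid_round_itv v j : (grid_round v = j) <-> (al + j%:R / g <= @itv_val R al be ab v < al + j.+1%:R / g).
Proof.
have /andP[v0 _] := itv_val_itv v.
rewrite -lerBrDl -ltrBlDl ler_pdivrMr // ltr_pdivlMr //.
rewrite -truncn_eq ?mulr_ge0 ?subr_ge0 ?(ltW g_gt0) // -grid_round_val.
by split => [->|/eqP/val_inj].
Qed.

Lemma grid_round_close v : `|@itv_val R al be ab v - grid (grid_round v)| <= g^-1.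
Proof.
have /andP[] := (grid_round_itv v (grid_round v)).1 erefl; rewrite /grid -natr1 mulrDl mul1r => h1 h2.
by rewrite ler_norml; apply/andP; split; have := invr_gt0 g; rewrite g_gt0; lra.
Qed.

Lemma measurable_grid_round j : measurable [set v | grid_round v = j].
Proof.
have -> : [set v | grid_round v = j] = [set: conductance ab] `&` (@itv_val R al be ab) @^-1` `[al + j%:R / g, al + j.+1%:R / g[.
  by rewrite setTI; apply/seteqP; split => v /=; rewrite in_itv /= => /grid_round_itv.
by apply: measurable_itv_val => //; exact: measurable_itv.
Qed.

Lemma grid_law_ge0 j : 0 <= grid_law j.
Proof. by rewrite /grid_law fine_ge0. Qed.

Lemma grid_law_sum : \sum_j grid_law j = 1.
Proof. exact: finite_law_total measurable_grid_round. Qed.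

Variable h : nat.
Local Notation T := (torus d h).
Local Notation E := (T * 'I_d)%type.

Definition grid_config (w : env) : {ffun E -> J} := [ffun e => grid_round (w (zedge e))].

Lemma grid_config_close w e : `|@itv_val R al be ab (w (zedge e)) - grid (grid_config w e)| <= g^-1.
Proof. by rewrite ffunE; exact: grid_round_close. Qed.

Lemma grid_config_law c : measurable [set w | grid_config w = c] /\ P [set w | grid_config w = c] = (weight grid_law c)%:E.
Proof.
pose s := map (@zedge d h) (enum {: E}).
pose B b := if [pick e | zedge e == b] is Some e then [set v | grid_round v = c e] else setT.
have BE e : B (zedge e) = [set v | grid_round v = c e].
  by rewrite /B; case: pickP => [e' /eqP /zedge_inj -> //|/(_ e)]; rewrite eqxx.
have mB b : measurable (B b) by rewrite /B; case: pickP => [e _|_ //]; exact: measurable_grid_round.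
have -> : [set w | grid_config w = c] = cylinder s B.
  apply/seteqP; split => w /=.
    by move=> /ffunP wc _ /mapP[e _ ->]; rewrite BE /=; have := wc e; rewrite ffunE.
  move=> H; apply/ffunP => e; rewrite ffunE.
  by have := H (zedge e); rewrite BE; apply; rewrite map_f // mem_enum.
split; first exact: measurable_cylinder.
rewrite prodP //; last by rewrite map_inj_uniq ?enum_uniq //; exact: zedge_inj.
rewrite big_map big_enum /=; congr EFin; apply: eq_bigr => e _.
by rewrite BE.
Qed.

Lemma grid_config_expectation (G : {ffun E -> J} -> R) : (forall c, 0 <= G c) ->
  (\int[P]_w (G (grid_config w))%:E = (Ex grid_law G)%:E)%E.
Proof.
move=> G0; rewrite (finite_law P (fun c => (grid_config_law c).1) G0) /Ex -sumEFin; apply: eq_bigr => c _.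
by rewrite (grid_config_law c).2 -EFinM mulrC.
Qed.

Lemma variance_discretised (X : env -> R) (F : {ffun E -> J} -> R) (de : R) : measurable_fun [set: env] X ->
  (\forall w \ae P, `|X w - F (grid_config w)| <= de) ->
  ('V_P[X] <= (2 * de ^+ 2 + 2 * Var grid_law F)%:E)%E.
Proof.
move=> mX Xd; apply: (@variance_le_sqr _ _ _ _ _ (Ex grid_law F)) => //.
pose G c := 2 * de ^+ 2 + 2 * (F c - Ex grid_law F) ^+ 2.
have G0 c : 0 <= G c by rewrite addr_ge0 // mulr_ge0 // sqr_ge0.
have ExP := Ex_mean E grid_law_ge0 grid_law_sum.
have -> : 2 * de ^+ 2 + 2 * Var grid_law F = Ex grid_law G by rewrite (meanD ExP) (mean_cst ExP) (meanZ ExP).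
rewrite -grid_config_expectation //; apply: ae_ge0_le_integral => //.
- by move=> w _; rewrite lee_fin sqr_ge0.
- by apply/measurable_EFinP; apply: measurable_funX; apply: measurable_funB.
- by move=> w _; rewrite lee_fin.
- apply/measurable_EFinP => _ Y mY; rewrite setTI.
  have -> : (fun w => G (grid_config w)) @^-1` Y = \bigcup_(c in [set c | Y (G c)]) [set w | grid_config w = c].
    by apply/seteqP; split => [w /= Yw|w /= [c Yc ->] //]; exists (grid_config w).
  apply: fin_bigcup_measurable; first exact: finite_finset.
  by move=> c _; exact: (grid_config_law c).1.
apply: filterS Xd => w Xw _; rewrite lee_fin /G.
have -> : X w - Ex grid_law F = (X w - F (grid_config w)) + (F (grid_config w) - Ex grid_law F) by ring.
apply: le_trans (sqrrD_le _ _) _; rewrite lerD2r ler_wpM2l //.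
rewrite -[X in X <= _]real_normK ?num_real //; apply: lerXn2r; rewrite ?nnegrE //.
by apply: le_trans Xw.
Qed.

End Rounding.

(** * Variance in terms of the size of the box *)

Section Terms.
Variables (R : realType) (mu : R) (k : nat).

Definition coef_terms : seq (R * (nat * nat)) :=
  [seq (coef_eta R k i, (i, i)) | i <- index_iota 0 k] ++
  [seq (coef_nu R k i j, (i, j)) | i <- index_iota 0 k, j <- index_iota i.+1 k].

Lemma sum_coef_terms (F : nat -> nat -> R -> R) :
  \sum_(t <- coef_terms) F t.2.1 t.2.2 t.1 = \sum_(0 <= i < k) F i i (coef_eta R k i) +
    \sum_(0 <= i < k) \sum_(i.+1 <= j < k) F i j (coef_nu R k i j).
Proof. by rewrite big_cat /= big_map big_allpairs_dep. Qed.

Lemma coef_sum_terms : \sum_(t <- coef_terms) `|t.1| = coef_sum R k.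
Proof. exact: (sum_coef_terms (fun _ _ x => `|x|)). Qed.

End Terms.

Section ErrorTerms.
Variables (R : realFieldType) (d : nat) (be mu S : R).

Definition corr_bound : R := 2 * d%:R * be / mu.

Definition boundary_err N : R := 2 * corr_bound * d%:R / barrier_rate be mu ^+ N.

Definition err_factor : R := 4 * d%:R * be * (1 + 2 * corr_bound) + 2 * mu * corr_bound * S.

Hypotheses (be_gt0 : 0 < be) (mu_gt0 : 0 < mu) (S_ge0 : 0 <= S).

Lemma corr_bound_ge0 : 0 <= corr_bound.
Proof. by rewrite divr_ge0 ?mulr_ge0 // ltW. Qed.

Lemma boundary_err_ge0 N : 0 <= boundary_err N.
Proof.
have M0 := corr_bound_ge0; have rate1 := barrier_rate_ge1 mu_gt0 be_gt0.
by rewrite divr_ge0 ?exprn_ge0 ?(le_trans ler01 rate1) // mulr_ge0 // mulr_ge0.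
Qed.

Lemma err_factor_ge0 : 0 <= err_factor.
Proof.
have M0 := corr_bound_ge0; have b0 := ltW be_gt0; have m0 := ltW mu_gt0.
by rewrite /err_factor; nonneg.
Qed.

End ErrorTerms.

Section BoxVariance.
Variables (R : realType) (d : nat) (al be : R) (ab : al <= be).
Variables (nu : probability (conductance ab) R) (P : probability (environment d ab) R).
Hypothesis prodP : is_product_measure nu P.
Local Notation env := (environment d ab).
Hypotheses (al_gt0 : 0 < al) (d_gt0 : (0 < d)%N).
Variables (C : R) (G : nat -> R).
Hypothesis fv : torus_variance al be d C G.
Variables (n r k : nat) (mu X0 X1 D S : R) (chi : lattice d -> R) (xi : 'cV[R]_d)
  (phi : R -> lattice d -> env -> R).
Local Notation h := (2 ^ n)%N.
Hypotheses (mu_gt0 : 0 < mu) (n_gt0 : (0 < n)%N) (rh : (r.+1 < h)%N) (muh : 32 * d%:R <= mu * 2 ^+ n)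
  (xi_le1 : forall i, `|xi i 0| <= 1) (phiP : forall m, 0 < m -> is_modified_corrector P xi m (phi m))
  (chi_supp : forall (z : lattice d) i, (r < `|z 0%R i|)%N -> chi z = 0) (chi_le : forall z, `|chi z| <= X0)
  (chi_grad : forall z i, `|chi (z + basis_vec i) - chi z| <= X1)
  (kS : coef_sum R k <= S) (D1 : 1 <= D) (C0 : 0 <= C * G n).
Local Notation Lam := (zbox d h r.+1).
Local Notation Ln := (#|Lam|%:R : R).
Hypotheses (D_high : (2 < d)%N -> d%:R * r.+1%:R ^+ 2 <= D) (D_plane : d = 2%N -> Ln <= D \/ mu^-1 <= D).

Local Notation M := (corr_bound d be mu).
Local Notation e0 := (boundary_err d be mu (h - r.+1)).
Local Notation conductances w := (fun e => @itv_val R al be ab ((w : env) e)).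
Local Notation xic := (fun i => xi i 0).
Local Notation chiT := (chi \o @zpoint d h).
Local Notation rounding g := (grid (al := al) (be := be) (g := g)).

Let h_gt0 : (0 < h)%N. Proof. by rewrite expn_gt0. Qed.

Let be_gt0 : 0 < be. Proof. exact: lt_le_trans ab. Qed.

Let M_ge0 : 0 <= M. Proof. exact: corr_bound_ge0. Qed.

Let S_ge0 : 0 <= S. Proof. by apply: le_trans kS; rewrite -coef_sum_terms sumr_ge0. Qed.

Let e0_ge0 : 0 <= e0. Proof. exact: boundary_err_ge0. Qed.

Let X0_ge0 : 0 <= X0. Proof. exact: le_trans (chi_le 0). Qed.

Let X1_ge0 : 0 <= X1. Proof. exact: le_trans (chi_grad 0 (Ordinal d_gt0)). Qed.

Let chi0 r' (x : torus d h) : (r <= r')%N -> x \notin zbox d h r' -> chi (zpoint x) = 0.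
Proof.
move=> rr; rewrite inE negb_forall => /existsP[i]; rewrite -ltnNge => rx.
by apply: (chi_supp (i := i)); rewrite mxE; exact: leq_ltn_trans rx.
Qed.

Let chi_gradT e : `|grd (@tsrc d h) (@ttgt d h) chiT e| <= X1.
Proof.
rewrite /grd /=; have [e2|e2] := eqVneq (zlift (e.1 e.2)) h%:Z; last by rewrite /ttgt zpointD.
rewrite (chi_supp (i := e.2)) ?(chi_supp (z := zpoint (tsrc e)) (i := e.2)) ?subrr ?normr0 //.
  by rewrite mxE /tsrc e2 absz_nat; apply: leq_trans rh.
by rewrite mxE /ttgt !ffunE eqxx zliftS // e2 eqxx abszN absz_nat; apply: leq_trans rh.
Qed.

Let chi_grad0 e : ttgt e \notin Lam -> grd (@tsrc d h) (@ttgt d h) chiT e = 0.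
Proof.
move=> te; rewrite /grd /= (chi0 _ te) // (chi0 (leqnn r)) ?subrr //.
apply: contra te => er; exact: zbox_tgt.
Qed.

Let sqnorm_le : (2 < d)%N -> forall x, x \in Lam -> sqnorm R x <= D.
Proof.
move=> d2 x /zboxP xr; apply: le_trans (D_high d2); rewrite /sqnorm -sum_cst_ord; apply: ler_sum => i _.
rewrite /ccoord clift_zlift -[leLHS]real_normK ?num_real //; apply: lerXn2r; rewrite ?nnegrE //.
by rewrite -intr_norm -abszE -pmulrn ler_nat.
Qed.

Let torus_bounds m1 m2 (J : finType) (rho vl : J -> R) (j0 : J) :
  (forall j, 0 <= rho j) -> \sum_j rho j = 1 -> (forall j, al <= vl j <= be) -> mu <= m1 -> mu <= m2 ->
  Var rho (avg_energy vl xic chiT mu) <=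
    C * G n * (X0 ^+ 2 * Ln + D * Ln * (mu * X0 + X1) ^+ 2) /\
  Var rho (avg_product vl xic chiT m1 m2) <= C * G n * (D * Ln * X0 ^+ 2).
Proof.
move=> r0 r1 vli mm1 mm2.
apply: (@fv n J rho j0 vl xic mu mu m1 m2 X0 X1 D chiT Lam) => //.
- by move=> x; exact: chi_le.
- by move=> x; exact: (@chi0 r.+1 x (leqnSn r)).
Qed.

Definition torus_quad (J : finType) (vl : J -> R) c := avg_energy vl xic chiT mu c +
  mu * \sum_(t <- coef_terms R k) t.1 * avg_product vl xic chiT (2 ^+ t.2.1 * mu) (2 ^+ t.2.2 * mu) c.

Let mu_pow i : mu <= 2 ^+ i * mu.
Proof. by apply: ler_peMl; [exact: ltW|rewrite exprn_ege1 // ler1n]. Qed.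

Let mu_pow_gt0 i : 0 < 2 ^+ i * mu.
Proof. exact: lt_le_trans (mu_pow i). Qed.

Lemma torus_quad_Var (J : finType) (rho vl : J -> R) (j0 : J) :
  (forall j, 0 <= rho j) -> \sum_j rho j = 1 -> (forall j, al <= vl j <= be) ->
  Var rho (torus_quad vl) <= 2 * (C * G n * (X0 ^+ 2 * Ln + D * Ln * (mu * X0 + X1) ^+ 2)) +
    2 * (mu ^+ 2 * S ^+ 2 * (C * G n * (D * Ln * X0 ^+ 2))).
Proof.
move=> r0 r1 vli.
apply: le_trans (_ : 2 * Var rho (avg_energy vl xic chiT mu) +
   2 * (mu ^+ 2 * S ^+ 2 * (C * G n * (D * Ln * X0 ^+ 2))) <= _).
  apply: Var_combination => //; last by rewrite coef_sum_terms.
    by rewrite mulr_ge0 // mulr_ge0 ?sqr_ge0 // mulr_ge0 // (le_trans ler01).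
  move=> t _ /=; exact: (torus_bounds j0 r0 r1 vli (mu_pow t.2.1) (mu_pow t.2.2)).2.
by rewrite lerD2r ler_wpM2l //; exact: (torus_bounds j0 r0 r1 vli (lexx mu) (lexx mu)).1.
Qed.

Definition corrector_event (w : env) : Prop :=
  (forall i, lattice_corrector (conductances w) xic (2 ^+ i * mu) (phi (2 ^+ i * mu) ^~ w)) /\
  (forall i (x : torus d h), `|phi (2 ^+ i * mu) (zpoint x) w| <= M).

Lemma corrector_event_ae : \forall w \ae P, corrector_event w.
Proof.
have equation : \forall w \ae P, forall i,
    lattice_corrector (conductances w) xic (2 ^+ i * mu) (phi (2 ^+ i * mu) ^~ w).
  apply/ae_foralln => i; have [_ _ H] := phiP (mu_pow_gt0 i).
  by apply: filterS H => w; exact: corrector_lattice.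
suff sup_le : \forall w \ae P, forall i (x : torus d h), `|phi (2 ^+ i * mu) (zpoint x) w| <= M.
  by apply: filterS2 equation sup_le => w; split.
apply/ae_foralln => i; apply: filter_forall => x.
have := corrector_bound prodP al_gt0 xi_le1 (mu_pow_gt0 i) (phiP (mu_pow_gt0 i)) (zpoint x).
apply: filterS => w /le_trans; apply.
apply: ler_pM; rewrite ?mulr_ge0 ?invr_ge0 ?(ltW (mu_pow_gt0 i)) ?(ltW be_gt0) //.
  by rewrite ler_wpM2r ?(ltW be_gt0) // ler_peMl // ler1n.
by rewrite lef_pV2 ?posrE.
Qed.

Section Discretised.
Variables (g : R) (w : env) (g_gt0 : 0 < g) (wP : corrector_event w).

Definition corrector_err : R := d%:R * (2 * (g^-1 * (1 + 2 * M))) / mu + e0.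

Definition quad_err : R :=
  d%:R * Ln * (X0 * (g^-1 * (1 + 2 * M) ^+ 2 + 4 * (be * corrector_err * (1 + 2 * M)))) +
  mu * (S * (Ln * (X0 * (2 * (M * corrector_err))))).

Let gV_ge0 : 0 <= g^-1. Proof. by rewrite invr_ge0 ltW. Qed.

Let M1_ge0 : 0 <= 1 + 2 * M. Proof. by rewrite addr_ge0 // mulr_ge0. Qed.

Lemma corrector_err_ge0 : 0 <= corrector_err.
Proof. by rewrite addr_ge0 // divr_ge0 ?(ltW mu_gt0) // !mulr_ge0. Qed.

Lemma quad_err_ge0 : 0 <= quad_err.
Proof. by have c0 := corrector_err_ge0; have b0 := ltW be_gt0; rewrite /quad_err; nonneg. Qed.

Lemma corrector_nearby i :
  nearby (rounding g) (grid_config g h w) xic corrector_err M r (phi (2 ^+ i * mu) ^~ w) (2 ^+ i * mu).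
Proof.
have m0 := mu_pow_gt0 i; have mm := mu_pow i; case: wP => equation sup_le.
have sup_M : be * (2 * d%:R) / (2 ^+ i * mu) <= M.
  rewrite /corr_bound [2 * _]mulrC mulrC [2 * _ * be]mulrC mulrC [d%:R * 2]mulrC.
  by rewrite ler_wpM2l ?mulr_ge0 ?(ltW be_gt0) // lef_pV2 ?posrE.
split => [x|x|x /zboxP xr]; first exact: sup_le.
  by apply: le_trans (phi_sup al_gt0 ab (grid_itv ab g_gt0) xi_le1 _ _ m0) sup_M.
apply: le_trans (lattice_corrector_compare h_gt0 al_gt0 ab (fun b => itv_val_itv (w b)) xi_le1 m0 d_gt0
  (grid_itv ab g_gt0) (grid_config_close g_gt0 w) (equation i) (sup_le i) sup_M (ltnW rh) xr) _.
apply: lerD; first by rewrite ler_wpM2l ?lef_pV2 ?posrE // !mulr_ge0.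
have q0 : 0 <= 2 * M * d%:R by rewrite mulr_ge0 // mulr_ge0.
rewrite /boundary_err (ler_wpM2l q0) // lef_pV2 ?posrE ?exprn_gt0 ?(lt_le_trans ltr01 (barrier_rate_ge1 _ _)) //.
apply: lerXn2r; rewrite ?nnegrE ?(le_trans ler01 (barrier_rate_ge1 _ _)) // /barrier_rate lerD2l ler_wpM2r //.
by rewrite invr_ge0 mulr_ge0 // ltW.
Qed.

Let inner_card_le : #|zbox d h r|%:R <= Ln :> R.
Proof. by rewrite ler_nat; apply: subset_leq_card; apply/fintype.subsetP => x; exact: zboxS. Qed.

Lemma approx_energy_close :
  `|lattice_energy h (conductances w) xic chi (phi mu ^~ w) - avg_energy (rounding g) xic chiT mu (grid_config g h w)| <=
  d%:R * Ln * (X0 * (g^-1 * (1 + 2 * M) ^+ 2 + 4 * (be * corrector_err * (1 + 2 * M)))).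
Proof.
have := lattice_energy_close (om := conductances w) (grid_itv ab g_gt0) al_gt0 xi_le1 h_gt0
  (ltnW rh) (grid_config_close g_gt0 w) chi_le (fun x => @chi0 r x (leqnn r)) (corrector_nearby 0).
rewrite expr0 mul1r => /le_trans; apply.
rewrite ler_wpM2r ?ler_wpM2l // mulr_ge0 // addr_ge0 ?mulr_ge0 ?sqr_ge0 ?corrector_err_ge0 //.
exact: ltW.
Qed.

Let product_err_ge0 : 0 <= X0 * (2 * (M * corrector_err)).
Proof. by rewrite mulr_ge0 // mulr_ge0 // mulr_ge0 // corrector_err_ge0. Qed.

Lemma approx_product_close i j : `|lattice_product h chi (phi (2 ^+ i * mu) ^~ w) (phi (2 ^+ j * mu) ^~ w) -
    avg_product (rounding g) xic chiT (2 ^+ i * mu) (2 ^+ j * mu) (grid_config g h w)| <=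
  Ln * (X0 * (2 * (M * corrector_err))).
Proof.
apply: le_trans (lattice_product_close chi_le (fun x => @chi0 r x (leqnn r)) (corrector_nearby i) (corrector_nearby j)) _.
by rewrite ler_wpM2r.
Qed.

Let chi_supp_h (z : lattice d) i : (h < `|z 0%R i|)%N -> chi z = 0.
Proof. by move=> hz; apply: (chi_supp (i := i)); apply: leq_ltn_trans hz; apply: ltnW; exact: ltnW. Qed.

Lemma torus_quad_close : `|approx_quad mu k chi xi phi w - torus_quad (rounding g) (grid_config g h w)| <= quad_err.
Proof.
rewrite (@approx_quad_torus R d h chi chi_supp_h al be ab) /torus_quad.
rewrite -[X in `|X - _|]addrA -[X in `|_ + X - _|]mulrDr.
rewrite -(sum_coef_terms k (fun i j x => x * lattice_product h chi (phi (2 ^+ i * mu) ^~ w) (phi (2 ^+ j * mu) ^~ w))).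
rewrite opprD addrACA -mulrBr; apply: le_trans (ler_normD _ _) _; apply: lerD; first exact: approx_energy_close.
rewrite -sumrB normrM (gtr0_norm mu_gt0) ler_wpM2l ?(ltW mu_gt0) //; apply: le_trans (ler_norm_sum _ _ _) _.
apply: le_trans (_ : \sum_(t <- coef_terms R k) `|t.1| * (Ln * (X0 * (2 * (M * corrector_err)))) <= _).
  by apply: ler_sum => t _; rewrite -mulrBr normrM ler_wpM2l // approx_product_close.
by rewrite -mulr_suml coef_sum_terms ler_wpM2r // mulr_ge0.
Qed.

End Discretised.

Lemma approx_measurable : measurable_fun [set: env] (approx_quad mu k chi xi phi).
Proof.
have supp_h (z : lattice d) i : (h < `|z 0%R i|)%N -> chi z = 0.
  by move=> hz; apply: (chi_supp (i := i)); apply: leq_ltn_trans hz; apply: ltnW; exact: ltnW.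
have mphi m x : 0 < m -> measurable_fun [set: env] (phi m x).
  by move=> m0; exact: (corrector_measurable x (phiP m0)).
have mproduct i j : measurable_fun [set: env] (fun w => lattice_product h chi (phi (2 ^+ i * mu) ^~ w) (phi (2 ^+ j * mu) ^~ w)).
  apply: measurable_sum => x; apply: measurable_funM => //; apply: measurable_funM; exact: mphi.
rewrite (funext (@approx_quad_torus R d h chi supp_h al be ab mu k xi phi)).
apply: measurable_funD; first apply: measurable_funD.
- apply: measurable_sum => e; apply: measurable_funM => //; apply: measurable_funM.
    exact: measurable_conductance.
  apply: measurable_funX; apply: measurable_funD => //; apply: measurable_funB; exact: mphi.
- apply: measurable_funM => //; apply: measurable_sum => i; exact: measurable_funM.
apply: measurable_funM => //; apply: measurable_sum => i; apply: measurable_sum => j; exact: measurable_funM.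
Qed.

Lemma quad_err_limit eta : 0 < eta ->
  exists2 g, 0 < g & quad_err g <= Ln * X0 * (e0 * err_factor d be mu S) + eta.
Proof.
move=> eta0; pose a := d%:R * (2 * (1 + 2 * M)) / mu.
pose B := d%:R * Ln * (X0 * ((1 + 2 * M) ^+ 2 + 4 * (be * a * (1 + 2 * M)))) + mu * (S * (Ln * (X0 * (2 * (M * a))))).
have mu0 := ltW mu_gt0; have b0 := ltW be_gt0.
have a0 : 0 <= a by rewrite !(mulr_ge0, addr_ge0, invr_ge0).
have B0 : 0 <= B by rewrite /B addr_ge0 // !(mulr_ge0, addr_ge0, sqr_ge0, invr_ge0).
have g0 : 0 < (B + 1) / eta by rewrite divr_gt0 //; lra.
exists ((B + 1) / eta) => //; set g := (B + 1) / eta.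
have gB : g^-1 * B <= eta.
  rewrite /g invf_div mulrAC ler_pdivrMr; last by lra.
  by rewrite ler_wpM2l ?(ltW eta0) //; lra.
apply: le_trans (_ : Ln * X0 * (e0 * err_factor d be mu S) + g^-1 * B <= _); last by rewrite lerD2l.
by apply: eq_leW; rewrite /quad_err /corrector_err /err_factor /B /a; ring.
Qed.

Lemma box_variance eta : 0 < eta -> ('V_P[approx_quad mu k chi xi phi] <=
  (2 * (Ln * X0 * (e0 * err_factor d be mu S) + eta) ^+ 2 +
   2 * (2 * (C * G n * (X0 ^+ 2 * Ln + D * Ln * (mu * X0 + X1) ^+ 2)) +
    2 * (mu ^+ 2 * S ^+ 2 * (C * G n * (D * Ln * X0 ^+ 2)))))%:E)%E.
Proof.
move=> eta0; have [g g0 err_le] := quad_err_limit eta0.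
have j0 : 'I_(grid_size al be g).+1 := ord0.
apply: le_trans (variance_discretised (h := h) (F := torus_quad (rounding g)) (de := quad_err g) g0 prodP
  approx_measurable _) _.
  by apply: filterS corrector_event_ae => w; exact: torus_quad_close.
rewrite lee_fin; apply: lerD; last first.
  rewrite ler_wpM2l //; apply: torus_quad_Var => //; [exact: grid_law_ge0|exact: grid_law_sum|exact: grid_itv].
have err0 := quad_err_ge0 g0.
by rewrite ler_wpM2l //; apply: lerXn2r; rewrite ?nnegrE // (le_trans err0).
Qed.

End BoxVariance.

(** * Choice of the parameters *)

Lemma card_zbox d h r : (#|zbox d h r| <= (2 * r.+1) ^ d)%N.
Proof.
pose A := [pred t : 'I_(2 * h).+1 | (clift rat t ^+ 2 < r.+1%:R ^+ 2)%R].
apply: leq_trans (_ : #|ffun_on A| <= _)%N.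
  apply: subset_leq_card; apply/fintype.subsetP => x /zboxP xr; apply/ffun_onP => i; rewrite inE clift_zlift.
  rewrite -[X in (X < _)%R]real_normK ?num_real // ltr_pXn2r ?nnegrE //.
  by rewrite -intr_norm -abszE -pmulrn ltr_nat ltnS.
have mono (p q k : nat) : (p <= q -> p ^ k <= q ^ k)%N by case: k => // k; rewrite leq_exp2r.
rewrite card_ffun_on card_ord; apply: mono; exact: card_clift.
Qed.

Lemma far_point (t : int) n : (`|t| <= n)%N -> (n < `|(t + (2 * n).+1%:Z)%R|)%N.
Proof. by lia. Qed.

Section AveragingBounds.
Variables (R : realType) (d : nat) (K L : R) (chi : lattice d -> R).
Hypotheses (d_gt0 : (0 < d)%N) (K_gt0 : 0 < K) (L_gt0 : 0 < L) (chiP : averaging_function K L chi).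
Local Notation L1 := (Num.max L 1).
Local Notation r := (Num.truncn L1).

Lemma dot_coord (v : 'cV[R]_d) i : `|v i 0| <= enorm v.
Proof.
rewrite /enorm -sqrtr_sqr ler_wsqrtr // /dot (bigD1 i) //= -expr2 lerDl.
by apply: sumr_ge0 => j _; rewrite -expr2 sqr_ge0.
Qed.

Lemma averaging_support (z : lattice d) i : (r < `|z 0%R i|)%N -> chi z = 0.
Proof.
move=> rz; apply/eqP; apply: contraTT rz => cz; case: chiP => /(_ z cz i) zL _ _.
rewrite -leqNgt truncn_ge_nat; last by rewrite le_max ler01 orbT.
have -> : `|z 0 i|%:R = `|(z 0 i)%:~R| :> R by rewrite -intr_norm -abszE -pmulrn.
apply: le_trans (_ : L <= _); last by rewrite le_max lexx.
by rewrite ler_norml; case/andP: zL => ? ?; apply/andP; split; apply: ltW.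
Qed.

Lemma radius_le : r%:R <= L1.
Proof. by rewrite truncn_le le_max ler01 orbT. Qed.

Lemma averaging_small : L < 1 -> forall z, chi z = (z == 0)%:R.
Proof.
move=> Ls; have z0 z : chi z != 0 -> z = 0.
  case: chiP => H _ _ /H zL; apply/rowP => i; rewrite mxE.
  have /andP[h1 h2] := zL i; have : -1 < z 0 i < 1.
    have h3 : (-1 : int)%:~R < (z 0 i)%:~R :> R by rewrite mulrN1z; lra.
    have h4 : (z 0 i)%:~R < (1 : int)%:~R :> R by rewrite mulr1z; lra.
    by rewrite ltr_int in h3; rewrite ltr_int in h4; rewrite h3 h4.
  by move: (z 0 i) => t; lia.
have c1 : chi 0 = 1.
  case: chiP => _ <- _; rewrite -(@fsbig_widen _ _ _ _ [set 0]) ?fsbig_set1 // => z [_ /= zn].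
  by apply/eqP/negPn/negP => /z0.
move=> z; have [->|zn] := eqVneq z 0; first exact: c1.
by apply/eqP/negPn/negP => /z0 /eqP; rewrite (negPf zn).
Qed.

Lemma averaging_gradient z i : `|chi (z + basis_vec i) - chi z| <= (1 + 3 * K) / L1 ^+ d.+1.
Proof.
have [L1'|L1'] := ltrP L 1.
  have k0 := K_gt0; rewrite expr1n divr1 !averaging_small //.
  by case: eqP; case: eqP => _ _; rewrite ?subrr ?subr0 ?sub0r ?normrN ?normr1 ?normr0; lra.
have k0 := K_gt0; case: chiP => _ _ /(_ z) H; have := dot_coord (grad chi z) i; rewrite mxE => /le_trans; apply.
apply: le_trans H _; rewrite ler_wpM2r ?invr_ge0 ?exprn_ge0 ?(ltW L_gt0) //; lra.
Qed.

Lemma averaging_sup z : `|chi z| <= (1 + 3 * K) / L1 ^+ d.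
Proof.
have [L1'|L1'] := ltrP L 1.
  by have k0 := K_gt0; rewrite expr1n divr1 averaging_small //; case: eqP => _; rewrite ?normr1 ?normr0; lra.
have k0 := K_gt0; pose i0 := Ordinal d_gt0; pose e := @basis_vec d i0.
have Lm : L1 = L by apply/max_idPl.
have g0 y : `|chi (y + e) - chi y| <= K * L ^- d.+1.
  by case: chiP => _ _ /(_ y); apply: le_trans; have := dot_coord (grad chi y) i0; rewrite mxE.
have walk j y : `|chi y| <= `|chi (y + e *+ j)| + j%:R * (K * L ^- d.+1).
  elim: j => [|j IH]; first by rewrite mulr0n addr0 mul0r addr0.
  apply: le_trans IH _; rewrite mulrSr addrA.
  have := g0 (y + e *+ j); rewrite distrC; have := ler_normD (chi (y + e *+ j) - chi (y + e *+ j + e)) (chi (y + e *+ j + e)).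
  by rewrite subrK -natr1; lra.
have Kl : 0 <= K * L ^- d.+1 by rewrite mulr_ge0 ?invr_ge0 ?exprn_ge0 // ltW.
have b0 : 0 <= (1 + 3 * K) / L ^+ d by rewrite divr_ge0 ?exprn_ge0 ?(ltW L_gt0) //; lra.
have [rz|rz] := ltnP r `|z 0%R i0|; first by rewrite (averaging_support rz) normr0.
apply: le_trans (walk (2 * r).+1 z) _.
rewrite (averaging_support (i := i0)); last first.
  have -> : (z + e *+ (2 * r).+1) 0 i0 = z 0 i0 + (2 * r).+1%:Z.
    rewrite mxE; congr (_ + _); transitivity ((1 : int) *+ (2 * r).+1); last exact: natz.
    by rewrite mulmxnE mxE !eqxx.
  exact: far_point.
rewrite normr0 add0r.
have := radius_le; rewrite Lm => rL.
apply: le_trans (_ : 3 * L * (K * L ^- d.+1) <= _).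
  by rewrite ler_wpM2r // -natr1 natrM; lra.
have -> : 3 * L * (K * L ^- d.+1) = 3 * K / L ^+ d.
  by rewrite exprS; field; rewrite expf_neq0 ?andbT lt0r_neq0.
by rewrite ler_wpM2r ?invr_ge0 ?exprn_ge0 ?(ltW L_gt0) //; lra.
Qed.

End AveragingBounds.

Lemma dyadic_above (R : realType) (Y : R) : 1 <= Y -> exists2 n, (0 < n)%N & Y <= 2 ^+ n <= 2 * Y.
Proof.
move=> Y1.
have ex : exists n, Y <= 2 ^+ n.+1.
  have [n hn] := power_unbounded Y (ltr1n R 2); exists n; apply: le_trans hn _.
  by rewrite exprS ler_peMl ?exprn_ge0 // ler1n.
case: (ex_minnP ex) => n nY nmin; exists n.+1 => //; rewrite nY /=.
case: n nY nmin => [|n] nY nmin; first by rewrite expr1; lra.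
rewrite exprS ler_wpM2l //; have := nmin n; rewrite ltnn => H.
by rewrite leNgt; apply/negP => lt; have := H (ltW lt).
Qed.

Lemma log_power (R : realType) (s : R) q : 1 <= s -> (0 < q)%N -> (1 + ln s) ^+ q <= q%:R ^+ q * s.
Proof.
move=> s1 q0; have s0 : 0 < s by lra.
have qR : 0 < q%:R :> R by rewrite ltr0n.
have l0 : 0 <= ln s by exact: ln_ge0.
have -> : q%:R ^+ q * s = (q%:R * expR (ln s / q%:R)) ^+ q.
  by rewrite exprMn -expRM_natr divfK ?lt0r_neq0 // lnK // posrE.
apply: lerXn2r; rewrite ?nnegrE ?mulr_ge0 ?expR_ge0 //; first by lra.
apply: le_trans (_ : q%:R * (1 + ln s / q%:R) <= _); last by rewrite ler_wpM2l // expR_ge1Dx.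
by rewrite mulrDr mulr1 mulrCA divff ?lt0r_neq0 // mulr1 lerD2r ler1n.
Qed.

Section Arithmetic.
Variables (R : realFieldType) (d : nat) (be mu A L S : R).
Hypotheses (be_gt0 : 0 < be) (mu_gt0 : 0 < mu) (A_ge1 : 1 <= A) (A_mu : mu^-1 <= A) (L_ge1 : 1 <= L) (S_ge0 : 0 <= S).

Let be_ge0 := ltW be_gt0.

Let A_ge0 : 0 <= A. Proof. exact: le_trans A_ge1. Qed.

Definition decay_const : R := 64 * d%:R ^+ 3 * be ^+ 3 * (1 + 4 * d%:R * be + S).

Lemma decay_const_ge0 : 0 <= decay_const.
Proof. by rewrite /decay_const; nonneg. Qed.

Lemma boundary_err_le N : (0 < N)%N -> boundary_err d be mu N <= 16 * d%:R ^+ 2 * be ^+ 2 * A ^+ 2 / N%:R.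
Proof.
move=> N_gt0; have N0 : 0 < N%:R :> R by rewrite ltr0n.
have t0 : 0 < mu / (4 * be) by rewrite divr_gt0 // mulr_gt0.
have rate_ge : (barrier_rate be mu ^+ N)^-1 <= 4 * be * mu^-1 / N%:R.
  have -> : 4 * be * mu^-1 / N%:R = (N%:R * (mu / (4 * be)))^-1 by field; rewrite !lt0r_neq0.
  have rate0 : 0 < barrier_rate be mu by exact: lt_le_trans ltr01 (barrier_rate_ge1 mu_gt0 be_gt0).
  rewrite lef_pV2 ?posrE ?exprn_gt0 ?(mulr_gt0 N0 t0) //.
  by apply: le_trans (bernoulli_ineq N (ltW t0)); rewrite lerDr.
have M0 := corr_bound_ge0 d be_gt0 mu_gt0.
rewrite /boundary_err; apply: le_trans (ler_wpM2l _ rate_ge) _; first by nonneg.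
have -> : 2 * corr_bound d be mu * d%:R * (4 * be * mu^-1 / N%:R) =
  (16 * d%:R ^+ 2 * be ^+ 2 / N%:R) * mu^-1 ^+ 2 by rewrite /corr_bound; ring.
have -> : 16 * d%:R ^+ 2 * be ^+ 2 * A ^+ 2 / N%:R = (16 * d%:R ^+ 2 * be ^+ 2 / N%:R) * A ^+ 2 by ring.
apply: ler_wpM2l; first by nonneg.
by apply: lerXn2r; rewrite ?nnegrE ?invr_ge0 // ltW.
Qed.

Lemma err_factor_le : err_factor d be mu S <= 4 * d%:R * be * ((1 + 4 * d%:R * be + S) * A).
Proof.
have -> : err_factor d be mu S = 4 * d%:R * be * (1 + 4 * d%:R * be * mu^-1 + S).
  by rewrite /err_factor /corr_bound; field; rewrite lt0r_neq0.
have x0 : 0 <= 4 * d%:R * be by nonneg.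
by apply: ler_wpM2l => //; have := ler_wpM2l x0 A_mu; have := ler_wpM2l S_ge0 A_ge1; have := A_ge1; lra.
Qed.

Lemma boundary_decay N : A ^+ 3 * L ^+ d <= N%:R -> boundary_err d be mu N * err_factor d be mu S <= decay_const * L ^- d.
Proof.
move=> NA; have Ld : 0 < L ^+ d by rewrite exprn_gt0 // (lt_le_trans ltr01).
have A0 : 0 < A by rewrite (lt_le_trans ltr01).
have N0 : 0 < N%:R :> R by apply: lt_le_trans NA; rewrite mulr_gt0 // exprn_gt0.
have N_gt0 : (0 < N)%N by rewrite -(ltr0n R).
apply: le_trans (ler_pM (boundary_err_ge0 d be_gt0 mu_gt0 N) (err_factor_ge0 d be_gt0 mu_gt0 S_ge0)
  (boundary_err_le N_gt0) err_factor_le) _.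
have -> : 16 * d%:R ^+ 2 * be ^+ 2 * A ^+ 2 / N%:R * (4 * d%:R * be * ((1 + 4 * d%:R * be + S) * A)) =
  decay_const * (A ^+ 3 / N%:R) by rewrite /decay_const; ring.
apply: ler_wpM2l; first exact: decay_const_ge0.
by rewrite ler_pdivrMr // mulrC ler_pdivlMr.
Qed.

Definition spread (D : R) : R := L ^- d + D * L ^- (d + 2) + D * mu ^+ 2 * L ^- d.

Lemma spread_ge D : 0 <= D -> 0 <= L ^- d <= spread D.
Proof.
move=> D0; have L0 := le_trans ler01 L_ge1.
rewrite invr_ge0 exprn_ge0 //= /spread -addrA lerDl.
by apply: addr_ge0; rewrite mulr_ge0 ?invr_ge0 ?exprn_ge0 // mulr_ge0 ?sqr_ge0.
Qed.

Lemma torus_bounds_le_spread (c B Ln D : R) : 0 <= c -> 0 <= D -> 0 <= Ln -> Ln <= B * L ^+ d ->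
  forall X0 X1, X0 = c / L ^+ d -> X1 = c / L ^+ d.+1 ->
  X0 ^+ 2 * Ln + D * Ln * (mu * X0 + X1) ^+ 2 + mu ^+ 2 * S ^+ 2 * (D * Ln * X0 ^+ 2) <=
  c ^+ 2 * B * (2 + S ^+ 2) * spread D.
Proof.
move=> c0 D0 n0 LB X0 X1 -> ->; have L0 : 0 < L by rewrite (lt_le_trans ltr01).
pose p := (L ^+ d)^-1; pose l := L^-1.
have pp : 0 <= p by rewrite invr_ge0 exprn_ge0 // ltW.
have -> : c / L ^+ d.+1 = c * p * l by rewrite exprSr /p /l; field; rewrite !lt0r_neq0 // exprn_gt0.
have np : Ln * p <= B by rewrite ler_pdivrMr // exprn_gt0.
have -> : (c / L ^+ d) ^+ 2 * Ln + D * Ln * (mu * (c / L ^+ d) + c * p * l) ^+ 2 +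
    mu ^+ 2 * S ^+ 2 * (D * Ln * (c / L ^+ d) ^+ 2) =
  (c ^+ 2 * p * (1 + D * (mu + l) ^+ 2 + D * mu ^+ 2 * S ^+ 2)) * (Ln * p) by rewrite /p; ring.
have -> : c ^+ 2 * B * (2 + S ^+ 2) * spread D =
  (c ^+ 2 * p * ((2 + S ^+ 2) * (1 + D * l ^+ 2 + D * mu ^+ 2))) * B.
  by rewrite /spread exprD /p /l; field; rewrite !lt0r_neq0 // exprn_gt0.
have cp : 0 <= c ^+ 2 * p by rewrite mulr_ge0 ?sqr_ge0.
apply: ler_pM; [by nonneg|by nonneg| |exact: np].
apply: ler_wpM2l => //.
have square_le : D * (mu + l) ^+ 2 <= D * (2 * mu ^+ 2 + 2 * l ^+ 2) by rewrite ler_wpM2l // sqrrD_le.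
have Dl : 0 <= D * l ^+ 2 by nonneg.
have Dm : 0 <= D * mu ^+ 2 by nonneg.
by have s0 := sqr_ge0 S; have := mulr_ge0 s0 Dl; rewrite mulrDl mulrDr mulrDr; lra.
Qed.

End Arithmetic.

Lemma scaled_sum_le (R : realFieldType) (t k C g a1 a2 q W : R) : 0 <= C -> 0 <= g -> 0 <= q -> 0 <= W ->
  t ^+ 2 <= k ^+ 2 * W -> a1 + a2 <= q * W ->
  2 * t ^+ 2 + 2 * (2 * (C * g * a1) + 2 * (C * g * a2)) <= (2 * k ^+ 2 + 4 * C * q) * (1 + g) * W.
Proof.
move=> C0 g0 q0 W0 tk aq.
have := ler_wpM2l (mulr_ge0 C0 g0) aq.
have : 0 <= k ^+ 2 * g * W by nonneg.
have : 0 <= C * q * W by nonneg.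
have -> : (2 * k ^+ 2 + 4 * C * q) * (1 + g) * W =
  2 * (k ^+ 2 * W) + 2 * (k ^+ 2 * g * W) + 4 * (C * q * W) + 4 * (C * g * (q * W)) by ring.
lra.
Qed.

Definition approx_variance_le (R : realType) (al be : R) (ab : al <= be) (d : nat) (K mu L V : R) : Prop :=
  forall (nu : probability (conductance ab) R) (P : probability (environment d ab) R), is_product_measure nu P ->
  forall (k : nat) (chi : lattice d -> R) (xi : 'cV[R]_d) (phi : R -> lattice d -> environment d ab -> R),
    averaging_function K L chi -> enorm xi = 1 ->
    (forall m : R, 0 < m -> is_modified_corrector P xi m (phi m)) ->
  ('V_P[approx_quad mu k chi xi phi] <= V%:E)%E.

Section ScaledVariance.
Variables (R : realType) (al be : R) (ab : al <= be) (d : nat) (C : R) (G : nat -> R).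
Hypotheses (al_gt0 : 0 < al) (d_gt0 : (0 < d)%N) (C_ge0 : 0 <= C) (G_ge0 : forall n, 0 <= G n).
Hypothesis fv : torus_variance al be d C G.
Variables (K S : R).
Hypotheses (K_gt0 : 0 < K) (S_ge0 : 0 <= S) (S_ge : forall k, coef_sum R k <= S).
Local Notation c := (1 + 3 * K).
Local Notation B := (6 ^+ d : R).

Let be_gt0 : 0 < be. Proof. exact: lt_le_trans ab. Qed.

Let c_ge0 : 0 <= c. Proof. by have := ltW K_gt0 => K0; nonneg. Qed.

Definition scaled_const : R := 2 * (B * c * decay_const d be S + 1) ^+ 2 + 4 * C * (c ^+ 2 * B * (2 + S ^+ 2)).

Lemma scaled_const_ge0 : 0 <= scaled_const.
Proof. by rewrite /scaled_const; nonneg. Qed.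

Variables (mu L D : R).
Local Notation L1 := (Num.max L 1).
Local Notation A := (Num.max 1 mu^-1).
Local Notation r := (Num.truncn L1).
Hypotheses (mu_gt0 : 0 < mu) (L_gt0 : 0 < L) (D_ge1 : 1 <= D).
Hypotheses (D_high : (2 < d)%N -> 4 * d%:R * L1 ^+ 2 <= D) (D_plane : d = 2%N -> (6 * L1) ^+ d <= D \/ mu^-1 <= D).

Let L1_ge1 : 1 <= L1. Proof. by rewrite le_max lexx orbT. Qed.

Let L1_gt0 : 0 < L1. Proof. exact: lt_le_trans L1_ge1. Qed.

Let A_ge1 : 1 <= A. Proof. by rewrite le_max lexx. Qed.

Let A_mu : mu^-1 <= A. Proof. by rewrite le_max lexx orbT. Qed.

Lemma torus_size : exists n, [/\ (0 < n)%N, (r.+1 < 2 ^ n)%N, 32 * d%:R <= mu * 2 ^+ n,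
  A ^+ 3 * L1 ^+ d <= (2 ^ n - r.+1)%:R & 2 ^+ n <= 2 * ((4 + 32 * d%:R) * (A ^+ 3 * L1 ^+ d))].
Proof.
have A0 := le_trans ler01 A_ge1; have r_le := radius_le L.
have L1_le : L1 <= L1 ^+ d by rewrite -{1}[L1]expr1; apply: ler_weXn2l.
have A_le : A <= A ^+ 3 by rewrite -{1}[A]expr1; apply: ler_weXn2l.
pose Z := A ^+ 3 * L1 ^+ d.
have L1Z : L1 <= Z by apply: le_trans L1_le _; rewrite /Z ler_peMl ?exprn_ege1 // exprn_ge0 // ltW.
have AZ : A <= Z by apply: le_trans A_le (ler_peMr _ _); rewrite ?exprn_ge0 ?exprn_ege1.
have dA : 32 * d%:R * A <= 32 * d%:R * Z by rewrite ler_wpM2l // mulr_ge0.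
have dA0 : 0 <= 32 * d%:R * A by nonneg.
pose Y := Z + L1 + 2 + 32 * d%:R * A.
have [n n0 /andP[]] : exists2 n, (0 < n)%N & Y <= 2 ^+ n <= 2 * Y.
  by apply: dyadic_above; have := L1_ge1; rewrite /Y; lra.
have l1 := L1_ge1; rewrite /Y => Yn nY.
have rn : (r.+1 < 2 ^ n)%N by rewrite -(ltr_nat R) natrX -natr1; apply: lt_le_trans Yn; lra.
exists n; split=> //.
- apply: le_trans (_ : mu * (32 * d%:R * A) <= _); last by rewrite ler_wpM2l ?(ltW mu_gt0) //; lra.
  by rewrite mulrCA -[leLHS]mulr1 ler_wpM2l // -ler_pdivrMl // mulr1.
- by rewrite natrB ?(ltnW rn) // natrX -natr1 -/Z; lra.
by apply: le_trans nY _; rewrite -/Z mulrDl; lra.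
Qed.

Lemma card_zbox_radius h : #|zbox d h r.+1|%:R <= B * L1 ^+ d.
Proof.
rewrite -exprMn; apply: le_trans (_ : ((2 * r.+2) ^ d)%:R <= _); first by rewrite ler_nat card_zbox.
rewrite natrX; apply: lerXn2r; rewrite ?nnegrE // ?mulr_ge0 ?(ltW L1_gt0) //.
by have := radius_le L; have := L1_ge1; rewrite natrM -!natr1; lra.
Qed.

Lemma boundary_sum_le (Ln e U : R) : 0 <= Ln -> Ln <= B * L1 ^+ d -> 0 <= e * U -> e * U <= decay_const d be S * L1 ^- d ->
  (Ln * (c / L1 ^+ d) * (e * U) + L1 ^- d) ^+ 2 <= (B * c * decay_const d be S + 1) ^+ 2 * L1 ^- d.
Proof.
move=> Ln0 LnB eU0 eU_le; have p0 : 0 < L1 ^+ d by rewrite exprn_gt0.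
have pV0 : 0 <= L1 ^- d by rewrite invr_ge0 ltW.
have Q0 := decay_const_ge0 d be_gt0 S_ge0.
have X_le : Ln * (c / L1 ^+ d) <= B * c by rewrite mulrCA -[B * c]mulrC ler_wpM2l // ler_pdivrMr.
have X0 : 0 <= Ln * (c / L1 ^+ d) by rewrite mulr_ge0 // divr_ge0 // ltW.
have sum_le : Ln * (c / L1 ^+ d) * (e * U) + L1 ^- d <= (B * c * decay_const d be S + 1) * L1 ^- d.
  by rewrite [leRHS]mulrDl [1 * _]mul1r lerD2r -[leRHS]mulrA; exact: ler_pM.
have sqr_le : (L1 ^- d) ^+ 2 <= L1 ^- d by rewrite expr2 ler_piMl // invf_le1 // exprn_ege1.
have sum0 : 0 <= Ln * (c / L1 ^+ d) * (e * U) + L1 ^- d by rewrite addr_ge0 // mulr_ge0.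
apply: le_trans (_ : ((B * c * decay_const d be S + 1) * L1 ^- d) ^+ 2 <= _).
  by rewrite lerXn2r // nnegrE // (le_trans sum0).
by rewrite [leLHS]exprMn ler_wpM2l ?sqr_ge0.
Qed.

Lemma scaled_variance : exists2 n, 2 ^+ n <= 2 * ((4 + 32 * d%:R) * (A ^+ 3 * L1 ^+ d)) &
  approx_variance_le ab d K mu L (scaled_const * (1 + G n) * spread d mu L1 D).
Proof.
have [n [n0 rn mun An n_le]] := torus_size; exists n => // nu P prodP k chi xi phi chiP xi1 phiP.
have LnB := card_zbox_radius (2 ^ n); have D0 := le_trans ler01 D_ge1.
have /andP[p0 pW] := spread_ge d mu L1_ge1 D0.
have p_gt0 : 0 < L1 ^- d by rewrite invr_gt0 exprn_gt0.
apply: le_trans (box_variance prodP al_gt0 d_gt0 fv (r := r) (X0 := c / L1 ^+ d) (X1 := c / L1 ^+ d.+1) (D := D) (S := S)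
  mu_gt0 n0 rn mun _ phiP _ _ _ (S_ge k) D_ge1 (mulr_ge0 C_ge0 (G_ge0 n)) _ _ p_gt0) _.
- by move=> i; rewrite -xi1; exact: dot_coord.
- by move=> z i; exact: (averaging_support chiP).
- by move=> z; exact: (averaging_sup d_gt0 K_gt0 L_gt0 chiP).
- by move=> z i; exact: (averaging_gradient d_gt0 K_gt0 L_gt0 chiP).
- move=> d2; apply: le_trans (D_high d2); rewrite [4 * _]mulrC -mulrA ler_wpM2l //.
  have -> : 4 * L1 ^+ 2 = (2 * L1) ^+ 2 by ring.
  apply: lerXn2r; rewrite ?nnegrE ?mulr_ge0 ?(ltW L1_gt0) // -natr1.
  by have := radius_le L; have := L1_ge1; lra.
- move=> d2; case: (D_plane d2) => hD; [left|by right].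
  by apply: le_trans LnB _; rewrite -exprMn.
rewrite lee_fin [mu ^+ 2 * S ^+ 2 * (C * G n * _)]mulrCA.
apply: scaled_sum_le => //; [by nonneg|exact: le_trans pW| |exact: torus_bounds_le_spread].
apply: le_trans (boundary_sum_le _ LnB _ (boundary_decay be_gt0 mu_gt0 A_ge1 A_mu L1_ge1 S_ge0 An)) _ => //.
  by rewrite mulr_ge0 ?boundary_err_ge0 ?err_factor_ge0.
by rewrite ler_wpM2l ?sqr_ge0.
Qed.

End ScaledVariance.

Lemma inv_power_max (R : realType) (L : R) j : 0 < L -> Num.max L 1 ^- j <= L ^- j.
Proof.
move=> L0; have m0 : 0 < Num.max L 1 by rewrite lt_max L0.
rewrite lef_pV2 ?posrE ?exprn_gt0 //; apply: lerXn2r; rewrite ?nnegrE ?(ltW L0) ?(ltW m0) //.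
by rewrite le_max lexx.
Qed.

Lemma spread_high (R : realType) (d : nat) (Q mu L : R) : (3 <= d)%N -> 0 <= Q -> 0 < L ->
  Q * (1 + 1) * spread d mu (Num.max L 1) (4 * d%:R * Num.max L 1 ^+ 2) <=
  (2 * Q * (1 + 4 * d%:R) + 1) * (L ^- d + mu ^+ 2 * L ^ (2 - d%:Z)).
Proof.
move=> d3 Q0 L0; have L10 : 0 < Num.max L 1 by rewrite lt_max L0.
have [j dj] : exists j, d = j.+2 by case: d d3 => [|[|j]] // _; exists j.
have -> : L ^ (2 - d%:Z) = L ^- j.
  by rewrite dj (_ : 2 - j.+2%:Z = - j%:Z) ?exprnN //; lia.
have dj2 : d = (j + 2)%N by rewrite addn2.
have := inv_power_max d L0; have := inv_power_max j L0; move: (Num.max L 1) L10 => L1 L10.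
have -> : Q * (1 + 1) * spread d mu L1 (4 * d%:R * L1 ^+ 2) = 2 * Q * (L1 ^- d + 4 * d%:R * L1 ^- d + 4 * d%:R * mu ^+ 2 * L1 ^- j).
  have dE : L1 ^+ 2 * L1 ^- (d + 2) = L1 ^- d by rewrite exprD; field; rewrite !expf_neq0 ?lt0r_neq0.
  have jE : L1 ^+ 2 * L1 ^- d = L1 ^- j by rewrite dj2 exprD; field; rewrite !expf_neq0 ?lt0r_neq0.
  have -> : spread d mu L1 (4 * d%:R * L1 ^+ 2) =
    L1 ^- d + 4 * d%:R * (L1 ^+ 2 * L1 ^- (d + 2)) + 4 * d%:R * mu ^+ 2 * (L1 ^+ 2 * L1 ^- d) by rewrite /spread; ring.
  by rewrite dE jE; ring.
have a0 : 0 <= L1 ^- d by rewrite invr_ge0 exprn_ge0 // ltW.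
have b0 : 0 <= L1 ^- j by rewrite invr_ge0 exprn_ge0 // ltW.
move: (L1 ^- d) (L1 ^- j) (L ^- d) (L ^- j) a0 b0 => a b p q a0 b0 bq ap.
have x0 : 0 <= d%:R :> R by []; have m0 := sqr_ge0 mu.
have mq : mu ^+ 2 * b <= mu ^+ 2 * q by rewrite ler_wpM2l.
have mb : 0 <= mu ^+ 2 * b by rewrite mulr_ge0.
have da := ler_wpM2l x0 ap; have dmq := ler_wpM2l x0 mq.
have Q2 : 0 <= 2 * Q by lra.
rewrite [leRHS]mulrDl [1 * _]mul1r; apply: le_trans (_ : 2 * Q * (1 + 4 * d%:R) * (p + mu ^+ 2 * q) <= _); last by lra.
by rewrite -[leRHS]mulrA; apply: ler_wpM2l => //; have := mulr_ge0 x0 a0; lra.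
Qed.

Lemma high_variance (R : realType) (al be : R) (ab : al <= be) (d : nat) (K : R) : 0 < al -> (3 <= d)%N -> 0 < K ->
  exists2 C, 0 < C & forall mu L, 0 < mu -> 0 < L ->
    approx_variance_le ab d K mu L (C * (L ^- d + mu ^+ 2 * L ^ (2 - d%:Z))).
Proof.
move=> al0 d3 K0; have [C C0 tv] := torus_variance_high al0 ab d3; have [S S0 S_ge] := coef_sum_bounded R.
have d0 : (0 < d)%N by exact: ltn_trans d3.
have d_neq2 : d <> 2%N by move=> d2; rewrite d2 in d3.
have Q0 := scaled_const_ge0 be d C0 K S; set Q := scaled_const be d C K S in Q0.
exists (2 * Q * (1 + 4 * d%:R) + 1); first by rewrite ltr_wpDl // !mulr_ge0 // addr_ge0 // mulr_ge0.
move=> mu L mu0 L0.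
have D1 : 1 <= 4 * d%:R * Num.max L 1 ^+ 2.
  by rewrite !mulr_ege1 ?ler1n ?exprn_ege1 // le_max lexx orbT.
have [n _ H] := scaled_variance ab al0 d0 C0 (fun=> ler01) tv K0 S0 S_ge mu0 L0 D1 (fun _ => lexx _)
  (fun d2 => False_ind _ (d_neq2 d2)).
move=> nu P prodP k chi xi phi chiP xi1 phiP; apply: le_trans (H nu P prodP k chi xi phi chiP xi1 phiP) _.
by rewrite lee_fin; exact: spread_high.
Qed.

Section PlaneRate.
Variable R : realType.

Definition log_const : R := 4 + 2 * (ln 136 + 5) / ln 2.

Let ln136_ge0 : 0 <= ln 136 :> R. Proof. by rewrite ln_ge0 // ler1n. Qed.

Let ln2_gt0 : 0 < ln 2 :> R. Proof. by rewrite ln_gt0 // ltr1n. Qed.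

Lemma log_const_ge0 : 0 <= log_const.
Proof. by rewrite addr_ge0 // divr_ge0 ?(ltW ln2_gt0) // mulr_ge0 // addr_ge0. Qed.

Variables (mu L : R).
Hypotheses (mu_gt0 : 0 < mu) (L_gt0 : 0 < L).
Local Notation L1 := (Num.max L 1).
Local Notation A := (Num.max 1 mu^-1).
Local Notation lp := (ln_plus mu^-1).

Let L1_ge1 : 1 <= L1. Proof. by rewrite le_max lexx orbT. Qed.

Let L1_gt0 : 0 < L1. Proof. exact: lt_le_trans L1_ge1. Qed.

Let A_ge1 : 1 <= A. Proof. by rewrite le_max lexx. Qed.

Let A_gt0 : 0 < A. Proof. exact: lt_le_trans A_ge1. Qed.

Let lp_ge1 : 1 <= lp. Proof. by rewrite le_max lexx orbT. Qed.

Let lp_ge0 : 0 <= lp. Proof. exact: le_trans lp_ge1. Qed.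

Let ln_A_le : ln A <= lp.
Proof.
have l1 := lp_ge1.
by case: (lerP 1 mu^-1) => _; [rewrite le_max lexx|rewrite ln1; lra].
Qed.

Lemma log_size n : 2 ^+ n <= 2 * ((4 + 32 * 2%:R) * (A ^+ 3 * L1 ^+ 2)) ->
  (2 * n + 4)%:R <= log_const * (1 + ln A + ln L1).
Proof.
move=> n_le; have lA := ln_ge0 A_ge1; have lL := ln_ge0 L1_ge1; have l136 := ln136_ge0.
have : ln (2 ^+ n : R) <= ln (136 * (A ^+ 3 * L1 ^+ 2)).
  rewrite ler_ln ?posrE ?mulr_gt0 ?exprn_gt0 //; apply: le_trans n_le _.
  by rewrite mulrA; have -> : 2 * (4 + 32 * 2%:R) = 136 :> R by ring.
rewrite lnXn // lnM ?posrE ?mulr_gt0 ?exprn_gt0 // [ln (A ^+ 3 * _)]lnM ?posrE ?exprn_gt0 //.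
rewrite [ln (A ^+ 3)]lnXn // [ln (L1 ^+ 2)]lnXn // => ln_le.
have : n%:R <= (ln 136 + 5) * (1 + ln A + ln L1) / ln 2.
  rewrite ler_pdivlMr //; apply: le_trans (_ : ln 136 + 3 * ln A + 2 * ln L1 <= _).
    by rewrite mulr_natl; move: ln_le; rewrite -[_ *+ 3]mulr_natl -[_ *+ 2]mulr_natl; lra.
  by have := mulr_ge0 l136 lA; have := mulr_ge0 l136 lL; lra.
rewrite natrD natrM /log_const.
have -> : (4 + 2 * (ln 136 + 5) / ln 2) * (1 + ln A + ln L1) =
  4 * (1 + ln A + ln L1) + 2 * ((ln 136 + 5) * (1 + ln A + ln L1) / ln 2) by ring.
lra.
Qed.

Variables (q : nat) (x Q : R).
Hypotheses (x_ge0 : 0 <= x) (Q_ge0 : 0 <= Q) (x_le : x <= log_const * (1 + ln A + ln L1)).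

Definition small_box_const : R := 1 + (3 * log_const) ^+ q.

Definition large_box_const : R := 1 + (3 * log_const) ^+ q.+1 * q.+1%:R ^+ q.+1 + 1.

Let log3_ge0 : 0 <= 3 * log_const. Proof. by rewrite mulr_ge0 // log_const_ge0. Qed.

Lemma small_box_const_ge0 : 0 <= small_box_const.
Proof. by rewrite addr_ge0 // exprn_ge0. Qed.

Lemma large_box_const_ge0 : 0 <= large_box_const.
Proof. by rewrite addr_ge0 // addr_ge0 // mulr_ge0 // exprn_ge0. Qed.

Lemma small_box_loss : L1 <= A -> 1 + x ^+ q <= small_box_const * lp ^+ q.+1.
Proof.
move=> LA; have ln_L1_le : ln L1 <= lp by apply: le_trans ln_A_le; rewrite ler_ln ?posrE.
have l1 := lp_ge1; have x_lp : x <= 3 * log_const * lp.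
  by apply: le_trans x_le _; rewrite -mulrA mulrCA ler_wpM2l ?log_const_ge0 //; have := ln_A_le; lra.
rewrite [leRHS]mulrDl mul1r; apply: lerD; first exact: exprn_ege1.
apply: le_trans (_ : (3 * log_const * lp) ^+ q <= _); first by apply: lerXn2r; rewrite ?nnegrE // mulr_ge0.
by rewrite [leLHS]exprMn ler_wpM2l ?exprn_ge0 // ler_weXn2l.
Qed.

Lemma large_box_loss : A <= L1 -> 1 + x ^+ q <= large_box_const * lp ^+ q.+1 * (L1 / A).
Proof.
move=> AL; pose s := L1 / A; have s1 : 1 <= s by rewrite ler_pdivlMr // mul1r.
have s0 : 0 < s by exact: lt_le_trans s1.
have lnE : ln L1 = ln A + ln s by rewrite -lnM ?posrE // /s mulrC divfK // lt0r_neq0.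
have ls := ln_ge0 s1; have l1 := lp_ge1; have lA := ln_A_le.
pose y := 3 * log_const * lp * (1 + ln s).
have xy : x <= y.
  apply: le_trans x_le _; rewrite lnE /y -!mulrA mulrCA ler_wpM2l ?log_const_ge0 //.
  by have lpls : ln s <= lp * ln s by [rewrite ler_peMl]; lra.
have power_le : x ^+ q.+1 <= (3 * log_const) ^+ q.+1 * q.+1%:R ^+ q.+1 * lp ^+ q.+1 * s.
  apply: le_trans (_ : y ^+ q.+1 <= _); first by apply: lerXn2r; rewrite ?nnegrE // (le_trans x_ge0).
  rewrite /y [leLHS]exprMn [(_ * lp) ^+ _]exprMn -!mulrA ler_wpM2l ?exprn_ge0 // mulrCA ler_wpM2l ?exprn_ge0 //.
  exact: log_power.
have power_mono : x ^+ q <= 1 + x ^+ q.+1.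
  have [x1|x1] := lerP x 1; first by have := exprn_ile1 q x_ge0 x1; have := exprn_ge0 q.+1 x_ge0; lra.
  by have := ler_weXn2l (ltW x1) (leqnSn q); lra.
have one_le : 1 <= lp ^+ q.+1 * s by rewrite mulr_ege1 // exprn_ege1.
rewrite -/s -mulrA /large_box_const mulrDl mulrDl !mul1r; rewrite -!mulrA in power_le *; lra.
Qed.

Let mul_loss_le (g c l b k s : R) : 0 <= g -> g <= c * l -> 0 <= b <= k * s -> Q * g * b <= k * Q * c * (s * l).
Proof. by move=> g0 gc /andP[b0 bk]; have := ler_wpM2l Q_ge0 (ler_pM g0 b0 gc bk); lra. Qed.

Let loss_ge0 : 0 <= 1 + x ^+ q. Proof. by rewrite addr_ge0 // exprn_ge0. Qed.

Local Notation rate := ((L ^- 2 + mu ^+ 2) * lp ^+ q.+1).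

Lemma small_box_spread : L1 <= A -> Q * (1 + x ^+ q) * spread 2 mu L1 (36 * L1 ^+ 2) <= 37 * Q * small_box_const * rate.
Proof.
move=> LA; apply: mul_loss_le => //; first exact: small_box_loss.
have -> : spread 2 mu L1 (36 * L1 ^+ 2) = 37 * L1 ^- 2 + 36 * mu ^+ 2.
  by rewrite /spread exprD; field; rewrite lt0r_neq0.
have i0 : 0 <= L1 ^- 2 by rewrite invr_ge0 exprn_ge0 // ltW.
have i_le := inv_power_max 2 L_gt0; have m0 := sqr_ge0 mu.
by apply/andP; split; lra.
Qed.

Lemma large_box_bracket : A < L1 -> 0 <= L1 / A * spread 2 mu L1 A <= 3 * mu ^+ 2.
Proof.
move=> AL.
have -> : L1 / A * spread 2 mu L1 A = A^-1 * L1^-1 + L1^-1 ^+ 3 + mu ^+ 2 * L1^-1.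
  by rewrite /spread exprD; field; rewrite !lt0r_neq0.
have Am : A^-1 ^+ 2 <= mu ^+ 2.
  apply: lerXn2r; rewrite ?nnegrE ?invr_ge0 ?(ltW A_gt0) ?(ltW mu_gt0) //.
  by rewrite -[leRHS]invrK lef_pV2 ?posrE ?invr_gt0 // le_max lexx orbT.
have LA : L1^-1 <= A^-1 by rewrite lef_pV2 ?posrE // ltW.
have A1 : A^-1 <= 1 by rewrite invf_le1.
have l0 : 0 <= L1^-1 by rewrite invr_ge0 ltW.
have b0 : 0 <= A^-1 by rewrite invr_ge0 ltW.
have m0 := sqr_ge0 mu; move: (L1^-1) (A^-1) LA A1 l0 b0 Am => l b lb b1 l0 b0 bm.
have mixed_le : b * l <= b ^+ 2 by rewrite expr2 ler_wpM2l.
have cube_le : l ^+ 3 <= b ^+ 2.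
  apply: le_trans (_ : l ^+ 2 <= _); last by apply: lerXn2r; rewrite ?nnegrE.
  by apply: ler_wiXn2l => //; lra.
have last_le : mu ^+ 2 * l <= mu ^+ 2 by rewrite ler_piMr //; lra.
have := mulr_ge0 b0 l0; have := exprn_ge0 3 l0; have := mulr_ge0 m0 l0.
by move=> ? ? ?; apply/andP; split; lra.
Qed.

Lemma large_box_spread : A < L1 -> Q * (1 + x ^+ q) * spread 2 mu L1 A <= 3 * Q * large_box_const * rate.
Proof.
move=> AL; apply: le_trans (_ : 3 * Q * large_box_const * (mu ^+ 2 * lp ^+ q.+1) <= _); last first.
  rewrite ler_wpM2l ?mulr_ge0 ?large_box_const_ge0 // ler_wpM2r ?exprn_ge0 // lerDr.
  by rewrite invr_ge0 exprn_ge0 // ltW.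
have -> : Q * (1 + x ^+ q) * spread 2 mu L1 A = Q * ((1 + x ^+ q) * (A / L1)) * (L1 / A * spread 2 mu L1 A).
  by field; rewrite !lt0r_neq0.
have A_L1 : 0 <= A / L1 by rewrite divr_ge0 // ltW.
apply: mul_loss_le; [exact: mulr_ge0| |exact: large_box_bracket].
apply: le_trans (ler_wpM2r A_L1 (large_box_loss (ltW AL))) _.
by apply: eq_leW; field; rewrite !lt0r_neq0.
Qed.

End PlaneRate.

Lemma plane_variance (R : realType) (al be : R) (ab : al <= be) : 0 < al -> exists q, forall K, 0 < K ->
  exists2 C, 0 < C & forall mu L, 0 < mu -> 0 < L ->
    approx_variance_le ab 2 K mu L (C * ((L ^- 2 + mu ^+ 2) * ln_plus mu^-1 ^+ q.+1)).
Proof.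
move=> al0; have [q [C C0 tv]] := torus_variance_plane al0 ab; have [S S0 S_ge] := coef_sum_bounded R.
exists q => K K0.
have Q0 := scaled_const_ge0 be 2 C0 K S; set Q := scaled_const be 2 C K S in Q0.
have small0 := small_box_const_ge0 R q; have large0 := large_box_const_ge0 R q.
exists (37 * Q * small_box_const R q + 3 * Q * large_box_const R q + 1).
  by rewrite ltr_wpDl // addr_ge0 // !mulr_ge0.
move=> mu L mu0 L0 nu P prodP k chi xi phi chiP xi1 phiP.
pose L1 := Num.max L 1; pose A := Num.max 1 mu^-1.
have G0 n : 0 <= (2 * n + 4)%:R ^+ q :> R by exact: exprn_ge0.
have A1 : 1 <= A by rewrite le_max lexx.
have L2 : 1 <= 36 * L1 ^+ 2 by rewrite mulr_ege1 ?ler1n // exprn_ege1 // le_max lexx orbT.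
have lp0 : 0 <= ln_plus mu^-1 by rewrite le_max ler01 orbT.
have rate0 : 0 <= (L ^- 2 + mu ^+ 2) * ln_plus mu^-1 ^+ q.+1.
  by rewrite mulr_ge0 ?exprn_ge0 // addr_ge0 ?sqr_ge0 // invr_ge0 exprn_ge0 // ltW.
have bound D : 1 <= D -> (6 * L1) ^+ 2 <= D \/ mu^-1 <= D -> exists2 n,
    2 ^+ n <= 2 * ((4 + 32 * 2%:R) * (A ^+ 3 * L1 ^+ 2)) &
    approx_variance_le ab 2 K mu L (Q * (1 + (2 * n + 4)%:R ^+ q) * spread 2 mu L1 D).
  move=> D1 hD; exact: (scaled_variance ab al0 (isT : (0 < 2)%N) C0 G0 tv K0 S0 S_ge mu0 L0 D1
    (fun e => False_ind _ (notF e)) (fun _ => hD)).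
have [LA|AL] := leP L1 A.
  have [|n n_le H] := bound _ L2; first by left; rewrite exprMn; have -> : 6 ^+ 2 = 36 :> R by ring.
  apply: le_trans (H nu P prodP k chi xi phi chiP xi1 phiP) _; rewrite lee_fin.
  apply: le_trans (small_box_spread L0 q (ler0n _ _) Q0 (log_size n_le) LA) _.
  by rewrite ler_wpM2r //; have := mulr_ge0 Q0 large0; lra.
have [|n n_le H] := bound _ A1; first by right; rewrite le_max lexx orbT.
apply: le_trans (H nu P prodP k chi xi phi chiP xi1 phiP) _; rewrite lee_fin.
apply: le_trans (large_box_spread mu0 L0 q (ler0n _ _) Q0 (log_size n_le) AL) _.
by rewrite ler_wpM2r //; have := mulr_ge0 Q0 small0; lra.
Qed.

Theorem theorem6 (R : realType) (alpha beta : R)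
    (alpha_gt0 : 0 < alpha) (ab : alpha <= beta) :
  exists2 q : R, 0 < q &
  forall d : nat, (2 <= d)%N ->
  forall K : R, 0 < K ->
  exists2 C : R, 0 < C &
  forall (nu : probability (conductance ab) R)
         (P : probability (environment d ab) R),
    is_product_measure nu P ->
  forall (k : nat) (mu L : R) (chi : lattice d -> R) (xi : 'cV[R]_d)
         (phi : R -> lattice d -> environment d ab -> R),
    (1 <= k)%N -> 0 < mu -> 0 < L ->
    averaging_function K L chi ->
    enorm xi = 1 ->
    (forall m : R, 0 < m -> is_modified_corrector P xi m (phi m)) ->
    ('V_P[approx_quad mu k chi xi phi] <=
      (C * (if d == 2%N
            then (L ^- 2 + mu ^+ 2) * ln_plus mu^-1 `^ q
            else L ^- d + mu ^+ 2 * L ^ (2 - d%:Z)))%:E)%E.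
Proof.
have [q plane] := plane_variance ab alpha_gt0.
exists q.+1%:R; first by rewrite ltr0n.
move=> d d_ge2 K K0; have [->|d_neq2] := eqVneq d 2%N.
  have [C C0 variance_le] := plane K K0; exists C => //.
  move=> nu P prodP k mu L chi xi phi _ mu0 L0 chiP xi1 phiP.
  rewrite /= powR_mulrn; last by rewrite le_max ler01 orbT.
  exact: (variance_le mu L mu0 L0 nu P prodP k chi xi phi).
have d_ge3 : (3 <= d)%N by rewrite ltn_neqAle eq_sym d_neq2.
have [C C0 variance_le] := high_variance ab alpha_gt0 d_ge3 K0; exists C => //.
move=> nu P prodP k mu L chi xi phi _ mu0 L0 chiP xi1 phiP.
exact: (variance_le mu L mu0 L0 nu P prodP k chi xi phi).
Qed.
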